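(* Let $V=\mathbb{R}^{2n}$, let $N$ be a closed connected manifold of dimension $d$ with universal cover $\widetilde{N}$ and $\Gamma=\pi_1(N)$, and let $\rho:\Gamma\to\mathrm{SL}(V)$ be a representation. Let $u:\widetilde{N}\to \mathrm{Gr}_d^{(n,n)}(\mathcal{Q})$ be a continuous $\rho$-equivariant map that admits a $\rho$-equivariant fitting flow $\Phi$. Then $\rho$ is $\{n\}$-Anosov, and for any $q\in \mathbb{S} u^*\mathcal{E}$, if $\zeta\in \partial \Gamma$ denotes the limit as $t\to+\infty$ of the flow line $(\Phi_t(q))$, the value $\xi^n_\rho(\zeta)\in \mathrm{Gr}_n(\mathbb{R}^{2n})$ of the limit map of $\rho$ corresponds to the projective subspace $$\mathbb{P}(\xi^n_\rho(\zeta))=\bigcap_{t\geq 0} \{ \pi(\Phi_t(q))\leq 0\}\subset\mathbb{P}(V).$$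
   Context: $\mathcal{Q}=S^2V^*$ is the space of symmetric bilinear forms on $V$, with the natural action of $\mathrm{SL}(V)$; ''positive'' means positive definite. $\mathrm{Gr}_d(\mathcal{Q})$ is the Grassmannian of $d$-dimensional subspaces (pencils) of $\mathcal{Q}$, and $\mathrm{Gr}_d^{(n,n)}(\mathcal{Q})$ is the set of pencils all of whose non-zero elements have signature $(n,n)$. For a continuous map $u:M\to\mathrm{Gr}_d(\mathcal{Q})$ let $u^*\mathcal{E}=\{(x,q):x\in M,\ q\in u(x)\}$, let $\pi(x,q)=q$, and let $\mathbb{S}u^*\mathcal{E}$ be the sphere bundle over $M$ obtained by removing the zero section and quotienting by positive scalars; for $[q]\in\mathbb{S}u^*\mathcal{E}$, $\pi([q])$ is defined up to positive scalar. A fitting flow for $u$ is a continuous flow $(\Phi_t)_{t\in\mathbb{R}}$ on $\mathbb{S}u^*\mathcal{E}$ such that for all $(x,[q])$ and all $t>0$, writing $\Phi_t(x,[q])=(x',[q'])$, one can choose representatives with $q'-q$ positive. It is $\rho$-equivariant if it commutes with $\gamma\cdot(x,[q])=(\gamma x,[\rho(\gamma)\cdot q])$. For $q\in \mathcal{Q}$, $\{q\le0\}\subset\mathbb{P}(V)$ is the set of lines on which $q(v,v)\le0$. $\rho$ is $\{n\}$-Anosov if for a word metric $|\cdot|$ there are $A,B>0$ with $\sigma_n(\rho(\gamma))/\sigma_{n+1}(\rho(\gamma))\ge e^{A|\gamma|-B}$ for all $\gamma\in\Gamma$, where $\sigma_1\ge\dots\ge\sigma_{2n}$ are the singular values. Then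 $\Gamma$ is Gromov hyperbolic with boundary $\partial\Gamma$, and $\xi^n_\rho:\partial\Gamma\to\mathrm{Gr}_n(\mathbb{R}^{2n})$ is the unique continuous $\rho$-equivariant map that is transverse ($\xi^n_\rho(x)\oplus\xi^n_\rho(y)=\mathbb{R}^{2n}$ for $x\ne y$) and dynamics preserving ($\xi^n_\rho(\gamma^+)$ is the attracting fixed point of $\rho(\gamma)$ on $\mathrm{Gr}_n(\mathbb{R}^{2n})$ whenever $\gamma$ has an attracting fixed point $\gamma^+\in\partial\Gamma$). The projections to $\widetilde{N}$ of the flow lines of an equivariant fitting flow are quasi-geodesics, so they have well-defined limits in $\partial\Gamma\simeq\partial\widetilde{N}$. *)

(* Defs.v *)
From HB Require Import structures.
From mathcomp Require Import all_boot all_order all_algebra.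
From mathcomp Require Import all_classical all_reals all_analysis.

Set Implicit Arguments.
Unset Strict Implicit.
Unset Printing Implicit Defensive.

Import Order.TTheory GRing.Theory Num.Theory.
Import numFieldNormedType.Exports.

Local Open Scope classical_set_scope.
Local Open Scope ring_scope.

(** * Topological manifolds and universal covers *)

Section Manifolds.
Context {R : realType}.

Definition locally_euclidean (d : nat) (N : topologicalType) : Prop :=
  forall x : N, exists (U : set N) (W : set 'rV[R]_d)
      (f : N -> 'rV[R]_d) (g : 'rV[R]_d -> N),
    [/\ open U, U x & open W] /\
    [/\ {within U, continuous f}, {within W, continuous g},
        f @` U = W, {in U, cancel f g} & {in W, cancel g f}].

Definition closed_connected_manifold (d : nat) (N : topologicalType) : Prop :=
  [/\ hausdorff_space N, @second_countable N, locally_euclidean d N,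
      compact [set: N] & connected [set: N]].

Definition path_connected (M : topologicalType) : Prop :=
  forall x y : M, exists f : R -> M,
    [/\ {within `[0, 1]%classic, continuous f}, f 0 = x & f 1 = y].

Definition null_homotopic_loops (M : topologicalType) : Prop :=
  forall f : R -> M, {within `[0, 1]%classic, continuous f} -> f 0 = f 1 ->
  exists H : R * R -> M,
    {within `[0, 1]%classic `*` `[0, 1]%classic, continuous H} /\
    forall s, s \in `[0, 1] ->
      [/\ H (s, 0) = f s, H (s, 1) = f 0, H (0, s) = f 0 & H (1, s) = f 0].

Definition simply_connected (M : topologicalType) : Prop :=
  path_connected M /\ null_homotopic_loops M.

(* [P] is the family of sheets over [U]; a sheet maps homeomorphically onto [U]
   because [p] is continuous, and injective and open on the sheet. *)
Definition evenly_covered (M N : topologicalType) (p : M -> N) (U : set N) :=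
  exists P : set (set M),
    [/\ trivIset P id, \bigcup_(O in P) O = p @^-1` U &
        forall O, P O -> [/\ open O, set_inj O p, p @` O = U &
          forall O', open O' -> O' `<=` O -> open (p @` O')]].

Definition covering_map (M N : topologicalType) (p : M -> N) : Prop :=
  [/\ continuous p, range p = setT &
      forall y : N, exists U : set N, [/\ open U, U y & evenly_covered p U]].

Definition universal_cover (M N : topologicalType) (p : M -> N) : Prop :=
  simply_connected M /\ covering_map p.

End Manifolds.
Arguments closed_connected_manifold R d N : clear implicits.
Arguments simply_connected R M : clear implicits.
Arguments universal_cover R {M N} p.

Definition is_action (G : groupType) (M : Type) (act : G -> M -> M) : Prop :=
  (forall x, act 1%g x = x) /\
  (forall g h x, act (g * h)%g x = act g (act h x)).

Definition deck_transformation (M N : topologicalType) (p : M -> N)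
    (f : M -> M) : Prop :=
  [/\ continuous f, p \o f = p &
      exists f' : M -> M, [/\ continuous f', cancel f f' & cancel f' f]].

(* When [p] is a universal cover this says that [G], acting through [act], is
   the fundamental group of the base acting by deck transformations. *)
Definition is_deck_group (M N : topologicalType) (p : M -> N)
    (G : groupType) (act : G -> M -> M) : Prop :=
  [/\ is_action act, injective act &
      forall f : M -> M, deck_transformation p f <-> exists g, act g = f].

(** * Grassmannians *)

(* [Gr R d a b] is the Grassmannian of d-dimensional subspaces of the space of
   a x b matrices: the space V of column vectors of length m is
   'M_(m, 1), and the space Q of symmetric bilinear forms on V is the space of
   symmetric m x m matrices in 'M_(m, m). *)
Section Grassmannian.
Variables (R : realType) (d a b : nat).

Record Gr := MkGr {
  gr_val : {vspace 'M[R]_(a, b)};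
  gr_dim : \dim gr_val = d }.

HB.instance Definition _ := gen_eqMixin Gr.
HB.instance Definition _ := gen_choiceMixin Gr.

Definition is_frame (B : {ptws 'I_d -> 'M[R]_(a, b)}) (U : Gr) : Prop :=
  gr_val U = <<[seq B i | i <- enum 'I_d]>>%VS.

(* The quotient topology from the space of frames (linearly independent
   d-tuples), itself a subspace of the space of all d-tuples. *)
Definition gr_open (A : set Gr) : Prop :=
  forall (U : Gr) (B : {ptws 'I_d -> 'M[R]_(a, b)}),
    is_frame B U -> A U ->
    \forall B' \near nbhs B, forall U', is_frame B' U' -> A U'.

Lemma gr_openT : gr_open setT.
Proof. by move=> U B _ _; apply: nearW. Qed.

Lemma gr_openI : setI_closed gr_open.
Proof.
move=> A1 A2 o1 o2 U B fB [a1 a2].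
near=> B' => U' fB'; split.
  by move: U' fB'; near: B'; exact: (o1 U).
by move: U' fB'; near: B'; exact: (o2 U).
Unshelve. all: by end_near. Qed.

Lemma gr_open_bigU (I : Type) (f : I -> set Gr) :
  (forall i, gr_open (f i)) -> gr_open (\bigcup_i f i).
Proof.
move=> of_ U B fB [i _ fiU].
near=> B' => U' fB'; exists i => //.
by move: U' fB'; near: B'; exact: (of_ i U).
Unshelve. all: by end_near. Qed.

HB.instance Definition _ :=
  isOpenTopological.Build Gr gr_openT gr_openI gr_open_bigU.

(* [linfun f] is [f] itself as soon as [f] is linear. *)
Definition gr_image (f : 'M[R]_(a, b) -> 'M[R]_(a, b)) (U U' : Gr) : Prop :=
  gr_val U' = (linfun f @: gr_val U)%VS.

End Grassmannian.
Arguments Gr R d a b : clear implicits.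

(* The projective space of lines in R^m. *)
Notation PV R m := (Gr R 1 m 1).

(** * Symmetric bilinear forms, with q(v, w) = v^T q w *)

Section Forms.
Context {R : realType}.

Definition symmetric_form m (q : 'M[R]_m) : Prop := q^T = q.

Definition form_eval m (q : 'M[R]_m) (v w : 'cV[R]_m) : R :=
  (v^T *m q *m w) 0 0.

Definition positive_form m (q : 'M[R]_m) : Prop :=
  symmetric_form q /\ forall v : 'cV[R]_m, v != 0 -> 0 < form_eval q v v.

(* The action (g . q)(v, w) = q(g^-1 v, g^-1 w). *)
Definition form_act m (g : 'M[R]_m) (q : 'M[R]_m) : 'M[R]_m :=
  (invmx g)^T *m q *m invmx g.

(* Sylvester normal form with n signs +1 and n signs -1. *)
Definition signature_nn n (q : 'M[R]_(n + n)) : Prop :=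
  exists2 P : 'M[R]_(n + n), P \in unitmx &
    P^T *m q *m P = block_mx 1%:M 0 0 (- 1%:M).

Definition pencil_nn d n (U : Gr R d (n + n) (n + n)) : Prop :=
  forall q, q \in gr_val U ->
    symmetric_form q /\ (q != 0 -> signature_nn q).

Definition positive_ray m (q : 'M[R]_m) : set 'M[R]_m :=
  [set c *: q | c in [set c : R | 0 < c]].

(* {q <= 0} in P(V), for the class [ray] of a form up to positive scalars. *)
Definition nonpos_locus m (ray : set 'M[R]_m) : set (PV R m) :=
  [set l | forall q v, ray q -> v \in gr_val l -> form_eval q v v <= 0].

Definition proj_subspace d m (U : Gr R d m 1) : set (PV R m) :=
  [set l | (gr_val l <= gr_val U)%VS].

End Forms.

(** * The sphere bundle of the pulled back tautological bundle *)

Section SphereBundle.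
Context {R : realType} {d m : nat} {M : topologicalType}.
Variable u : M -> Gr R d m m.

Record sphere_bundle := MkSphereBundle {
  sb_pt : M;
  sb_ray : set 'M[R]_m;
  sb_rayP : exists q,
    [/\ q \in gr_val (u sb_pt), q != 0 & sb_ray = positive_ray q] }.

HB.instance Definition _ := gen_eqMixin sphere_bundle.
HB.instance Definition _ := gen_choiceMixin sphere_bundle.

(* The quotient topology from the complement of the zero section in u^*E, which
   is itself a subspace of M * 'M_m: a pair z is in this complement iff
   there is s' such that sb_pt s' = z.1 and sb_ray s' z.2, and s' is then the
   class of z. *)
Definition sb_open (A : set sphere_bundle) : Prop :=
  forall (s : sphere_bundle) (q : 'M[R]_m), sb_ray s q -> A s ->
    \forall z \near nbhs (sb_pt s, q),
      forall s', sb_pt s' = z.1 -> sb_ray s' z.2 -> A s'.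

Lemma sb_openT : sb_open setT.
Proof. by move=> s q _ _; apply: nearW. Qed.

Lemma sb_openI : setI_closed sb_open.
Proof.
move=> A1 A2 o1 o2 s q sq [a1 a2].
apply: filterS2 (o1 s q sq a1) (o2 s q sq a2) => z h1 h2 s' e1 e2.
by split; [exact: h1 | exact: h2].
Qed.

Lemma sb_open_bigU (I : Type) (f : I -> set sphere_bundle) :
  (forall i, sb_open (f i)) -> sb_open (\bigcup_i f i).
Proof.
move=> of_ s q sq [i _ fis].
apply: filterS (of_ i s q sq fis) => z h s' e1 e2.
by exists i => //; exact: h.
Qed.

HB.instance Definition _ :=
  isOpenTopological.Build sphere_bundle sb_openT sb_openI sb_open_bigU.

Definition continuous_flow (Phi : R -> sphere_bundle -> sphere_bundle) : Prop :=
  [/\ forall s, Phi 0 s = s,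
      forall t1 t2 s, Phi (t1 + t2) s = Phi t1 (Phi t2 s) &
      continuous (fun z : R * sphere_bundle => Phi z.1 z.2)].

Definition fitting_flow (Phi : R -> sphere_bundle -> sphere_bundle) : Prop :=
  continuous_flow Phi /\
  forall (s : sphere_bundle) (t : R), 0 < t ->
    exists q q', [/\ sb_ray s q, sb_ray (Phi t s) q' & positive_form (q' - q)].

Section Equivariance.
Variables (G : groupType) (act : G -> M -> M) (rho : G -> 'M[R]_m).

Definition equivariant_pencil_map : Prop :=
  forall g x, gr_image (form_act (rho g)) (u x) (u (act g x)).

(* s' = g . s *)
Definition sb_translate (g : G) (s s' : sphere_bundle) : Prop :=
  sb_pt s' = act g (sb_pt s) /\ sb_ray s' = form_act (rho g) @` sb_ray s.

Definition equivariant_flow (Phi : R -> sphere_bundle -> sphere_bundle) :=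
  forall g s s', sb_translate g s s' ->
    forall t, sb_translate g (Phi t s) (Phi t s').

End Equivariance.
End SphereBundle.

(** * Word metrics and the Gromov boundary *)

Section WordMetric.
Variable G : groupType.

Definition is_word_for (S : seq G) (g : G) (k : nat) : Prop :=
  exists w : seq G, [/\ size w = k,
    all (fun x => (x \in S) || (x^-1%g \in S)) w & (\prod_(x <- w) x)%g = g].

Record finite_generating_set := MkFGS {
  fgs_seq : seq G;
  fgs_gen : forall g, exists k, `[< is_word_for fgs_seq g k >] }.

Variable S : finite_generating_set.

Definition word_length (g : G) : nat := ex_minn (fgs_gen S g).

(* Twice the Gromov product based at 1, i.e. d(1,x) + d(1,y) - d(x,y) for the
   left-invariant word metric d; the truncated subtraction is exact by the
   triangle inequality. *)
Definition gromov_product2 (x y : G) : nat :=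
  (word_length x + word_length y - word_length (x^-1 * y)%g)%N.

Definition gromov_equiv (s s' : nat -> G) : Prop :=
  forall r : nat, exists K : nat, forall i j,
    (K <= i)%N -> (K <= j)%N -> (r <= gromov_product2 (s i) (s' j))%N.

Definition converges_at_infinity (s : nat -> G) : Prop := gromov_equiv s s.

(* A boundary point is a class of sequences converging at infinity. *)
Record gromov_boundary := MkBoundary {
  bd_seqs : set (nat -> G);
  bd_seqsP : exists2 s, converges_at_infinity s &
    bd_seqs = [set s' | converges_at_infinity s' /\ gromov_equiv s s'] }.

HB.instance Definition _ := gen_eqMixin gromov_boundary.
HB.instance Definition _ := gen_choiceMixin gromov_boundary.

(* The standard neighbourhoods of a boundary point: those eta such that
   liminf of twice the Gromov product of s i and s' j is at least r, for some
   s representing zeta and s' representing eta. *)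
Definition bd_shadow (zeta : gromov_boundary) (r : nat) : set gromov_boundary :=
  [set eta | exists s s' K, [/\ bd_seqs zeta s, bd_seqs eta s' &
     forall i j, (K <= i)%N -> (K <= j)%N ->
       (r <= gromov_product2 (s i) (s' j))%N]].

Definition bd_open (A : set gromov_boundary) : Prop :=
  forall zeta, A zeta -> exists r, bd_shadow zeta r `<=` A.

Lemma bd_openT : bd_open setT.
Proof. by move=> zeta _; exists 0%N. Qed.

Lemma bd_shadow_le zeta r r' : (r <= r')%N ->
  bd_shadow zeta r' `<=` bd_shadow zeta r.
Proof.
move=> le_r eta [s [s' [K [zs es' h]]]]; exists s, s', K; split=> // i j Ki Kj.
exact: leq_trans le_r (h i j Ki Kj).
Qed.

Lemma bd_openI : setI_closed bd_open.
Proof.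
move=> A1 A2 o1 o2 zeta [/o1[r1 h1] /o2[r2 h2]].
exists (maxn r1 r2) => eta heta; split.
  by apply: h1; apply: bd_shadow_le heta; exact: leq_maxl.
by apply: h2; apply: bd_shadow_le heta; exact: leq_maxr.
Qed.

Lemma bd_open_bigU (I : Type) (f : I -> set gromov_boundary) :
  (forall i, bd_open (f i)) -> bd_open (\bigcup_i f i).
Proof.
move=> of_ zeta [i _ /of_[r h]]; exists r => eta /h fi.
by exists i.
Qed.

HB.instance Definition _ :=
  isOpenTopological.Build gromov_boundary bd_openT bd_openI bd_open_bigU.

(* zeta' = g . zeta *)
Definition bd_translate (g : G) (zeta zeta' : gromov_boundary) : Prop :=
  bd_seqs zeta' = [set (fun k => g * s k)%g | s in bd_seqs zeta].

(* zeta is the attracting fixed point of g in the compactification of G by its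
   boundary, i.e. the limit of the powers of g.  (Attraction inside the boundary
   alone would not determine it when the boundary has isolated points.) *)
Definition bd_attracting (g : G) (zeta : gromov_boundary) : Prop :=
  bd_seqs zeta (fun k => (g ^+ k)%g).

(* The path c has limit zeta as t -> +oo, the boundary of the space M being
   identified with that of G through the orbit maps of a cocompact action. *)
Definition path_limit {R : realType} {M : topologicalType} (act : G -> M -> M)
    (c : R -> M) (zeta : gromov_boundary) : Prop :=
  exists K : set M, [/\ compact K, \bigcup_g (act g @` K) = setT &
    forall (t : nat -> R) (g : nat -> G), t @ \oo --> +oo ->
      (forall k, (act (g k) @` K) (c (t k))) -> bd_seqs zeta g].

End WordMetric.

(** * Anosov representations and their limit maps *)

Section Anosov.
Context {R : realType}.

Definition SL_representation (G : groupType) m (rho : G -> 'M[R]_m) : Prop :=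
  (forall g, \det (rho g) = 1) /\
  (forall g h, rho (g * h)%g = rho g *m rho h).

Definition is_singular_values m (g : 'M[R]_m) (s : seq R) : Prop :=
  [/\ sorted >=%R s, all (fun x => 0 <= x) s &
      char_poly (g^T *m g) = \prod_(x <- s) ('X - (x ^+ 2)%:P)].

Definition singular_values m (g : 'M[R]_m) : seq R :=
  xget [::] [set s | is_singular_values g s].

(* The k-th singular value, for 1 <= k <= m. *)
Definition sigma m (k : nat) (g : 'M[R]_m) : R := (singular_values g)`_k.-1.

Definition anosov (G : groupType) n (rho : G -> 'M[R]_(n + n)) : Prop :=
  exists (S : finite_generating_set G) (A B : R), [/\ 0 < A, 0 < B &
    forall g, expR (A * (word_length S g)%:R - B) <=
              sigma n (rho g) / sigma n.+1 (rho g)].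

Definition gr_attracting d m (g : 'M[R]_m) (E : Gr R d m 1) : Prop :=
  gr_image (mulmx g) E E /\
  exists2 O : set (Gr R d m 1), nbhs E O &
    forall W : set (Gr R d m 1), nbhs E W ->
      \forall k \near \oo, forall U U',
        O U -> gr_image (mulmx (g ^+ k)) U U' -> W U'.

Definition transverse m d (E F : Gr R d m 1) : Prop :=
  directv (gr_val E + gr_val F)%VS /\ (gr_val E + gr_val F)%VS = fullv.

Definition is_limit_map (G : groupType) (S : finite_generating_set G) n
    (rho : G -> 'M[R]_(n + n)) (xi : gromov_boundary S -> Gr R n (n + n) 1) :=
  [/\ continuous xi,
      forall g zeta zeta', bd_translate g zeta zeta' ->
        gr_image (mulmx (rho g)) (xi zeta) (xi zeta'),
      forall x y, x <> y -> transverse (xi x) (xi y) &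
      forall g zeta, bd_attracting g zeta -> gr_attracting (rho g) (xi zeta)].

End Anosov.

(* Main.v *)
(** Along a flow line the forms increase, so that a vector v has c_k |rho(e_k)^-1 v|^2
    contracted exponentially while the form is nonpositive at v and expanded
    exponentially while it is nonnegative, where e_k follows the flow line in Gamma.
    Since the forms have signature (n, n), both behaviours occur on n-dimensional
    subspaces, and this yields a gap between the n-th and (n+1)-st singular values
    that is exponential in k.  It becomes exponential in the word length because any
    two points of the universal cover are joined by a flow line: the flow is proper,
    and if z were missed by the flow lines from y, one could deform the map of a d-ball
    that they define off y.  By a degree argument on the ball this contradicts the
    existence of a nonzero positive semidefinite form orthogonal to the pencil u(y),
    whose pairing with the flow lines is positive.

    For the limit map, the singular value gap implies that flow lines stay close to
    word geodesics (the projectors on the contracted subspaces converge exponentially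
    away from a geodesic, while those at the two ends of a flow line stay apart).
    A flow line comes back near itself in the quotient, hence shadows elements g with
    a periodic chain of increasing forms.  The attracting subspace of rho(g) is then
    nonpositive for these forms, and letting g^+ tend to zeta gives one inclusion;
    the other one follows by counting dimensions, because the vectors on which all the
    forms are nonpositive are contracted and hence lie in a subspace of dimension <= n. *)

Require Import Defs.
From HB Require Import structures.
From mathcomp Require Import all_boot all_order all_algebra.
From mathcomp Require Import all_classical all_reals all_analysis.
From mathcomp Require Import ring lra zify.

Set Implicit Arguments.
Unset Strict Implicit.
Unset Printing Implicit Defensive.

Import Order.TTheory GRing.Theory Num.Theory.
Import numFieldNormedType.Exports.

Local Open Scope classical_set_scope.
Local Open Scope ring_scope.

(** * Limits and compactness in matrix spaces *)

(** Forms are known only up to positive factors, so the scalars [c k] are not controlled. They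
    cancel because only the ratio of [sigma n] to [sigma n.+1] is estimated, one from the positive
    n-plane of the first form, the other from the negative n-plane of the last one. No metric on the
    cover is given to compare with word length; joining points by flow lines replaces it and also
    yields finite generation. The degree argument rests on the equality of the dimensions of N and
    of the pencils: along the ball, both the forms and a functional on the pencils become fields
    with values in the R^d that contains the ball, and Poincare-Miranda replaces the degree. The
    obstacle is that the functional must stay without zeros during the deformation; hence frames and
    functionals are deformed along with the map, and a small generic perturbation takes the place of
    transversality. The values of the limit map are described directly only at attracting fixed
    points, whereas a flow line need not be periodic; closing it up costs half of the growth
    constant [D], and continuity of [xi] does the rest. *)

Section MatrixLimits.
Context {R : realType}.

Lemma mx_entry_norm m n (A : 'M[R]_(m, n)) i j : `|A i j| <= `|A|.
Proof.
rewrite [leRHS]/Num.norm /= mx_normrE; apply/bigmax_geP; right => /=.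
by exists (i, j).
Qed.

Lemma mx_norm_le m n (A : 'M[R]_(m, n)) e : 0 <= e ->
  (forall i j, `|A i j| <= e) -> `|A| <= e.
Proof.
move=> e0 Ae; rewrite [leLHS]/Num.norm /= mx_normrE.
by apply/bigmax_leP; split=> // -[i j] _ /=.
Qed.

Lemma mx_norm_mul m n p (A : 'M[R]_(m, n)) (B : 'M[R]_(n, p)) :
  `|A *m B| <= n%:R * `|A| * `|B|.
Proof.
apply: mx_norm_le => [|i j]; first by rewrite !mulr_ge0.
rewrite mxE (le_trans (ler_norm_sum _ _ _)) //.
have -> : n%:R * `|A| * `|B| = \sum_(k < n) (`|A| * `|B|).
  by rewrite sumr_const card_ord -mulrA mulr_natl.
by apply: ler_sum => k _; rewrite normrM ler_pM // mx_entry_norm.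
Qed.

Lemma mx_norm_tr m n (A : 'M[R]_(m, n)) : `|A^T| = `|A|.
Proof.
apply/eqP; rewrite eq_le; apply/andP; split; apply: mx_norm_le => // i j.
  by rewrite mxE mx_entry_norm.
by have := mx_entry_norm A^T j i; rewrite mxE.
Qed.

Context {T : Type} {F : set_system T} {FF : Filter F}.

Lemma cvg_mxP m n (f : T -> 'M[R]_(m, n)) (A : 'M[R]_(m, n)) :
  (f @ F --> A) <-> forall i j, (fun t => f t i j) @ F --> A i j.
Proof.
split=> [fA i j|fA].
  apply/cvgrPdist_lt => e e0; move/cvgrPdist_lt : fA => /(_ e e0).
  apply: filterS => t; apply: le_lt_trans.
  by have := mx_entry_norm (A - f t) i j; rewrite !mxE.
apply/cvgrPdist_le => e e0.
have H : forall i : 'I_m, \forall t \near F, forall j : 'I_n, `|A i j - f t i j| <= e.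
  move=> i; apply: (filter_forall FF) => j.
  by move/cvgrPdist_le : (fA i j) => /(_ e e0).
have := filter_forall FF H; apply: filterS => t He; apply: mx_norm_le (ltW e0) _ => i j.
by rewrite !mxE.
Qed.

Lemma cvg_sum_fin (I : finType) (P : pred I) (f : I -> T -> R) (a : I -> R) :
  (forall i, f i @ F --> a i) ->
  (fun t => \sum_(i | P i) f i t) @ F --> \sum_(i | P i) a i.
Proof.
move=> fa; rewrite (_ : (fun t => _) = \sum_(i | P i) f i); last first.
  by apply/funext => t; rewrite fct_sumE.
elim/big_ind2: _ => [|x y z w xy zw|i _]; [exact: cvg_cst | exact: cvgD | exact: fa].
Qed.

Lemma cvg_prod_fin (I : finType) (P : pred I) (f : I -> T -> R) (a : I -> R) :
  (forall i, f i @ F --> a i) ->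
  (fun t => \prod_(i | P i) f i t) @ F --> \prod_(i | P i) a i.
Proof.
move=> fa; rewrite (_ : (fun t => _) = \prod_(i | P i) f i); last first.
  by apply/funext => t; elim/big_ind2: _ => // x x' y y' -> ->.
elim/big_ind2: _ => [|x y z w xy zw|i _]; [exact: cvg_cst | exact: cvgM | exact: fa].
Qed.

Lemma cvg_mulmx m n p (f : T -> 'M[R]_(m, n)) (g : T -> 'M[R]_(n, p))
    (A : 'M[R]_(m, n)) (B : 'M[R]_(n, p)) :
  f @ F --> A -> g @ F --> B -> (fun t => f t *m g t) @ F --> A *m B.
Proof.
move=> /cvg_mxP fA /cvg_mxP gB; apply/cvg_mxP => i j; rewrite mxE.
under eq_fun do rewrite mxE.
by apply: cvg_sum_fin => k; exact: cvgM.
Qed.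

Lemma cvg_trmx m n (f : T -> 'M[R]_(m, n)) (A : 'M[R]_(m, n)) :
  f @ F --> A -> (fun t => (f t)^T) @ F --> A^T.
Proof.
move=> /cvg_mxP fA; apply/cvg_mxP => i j; rewrite mxE.
under eq_fun do rewrite mxE.
exact: fA.
Qed.

Lemma cvg_det n (f : T -> 'M[R]_n) (A : 'M[R]_n) :
  f @ F --> A -> (fun t => \det (f t)) @ F --> \det A.
Proof.
move=> /cvg_mxP fA; rewrite /determinant; apply: cvg_sum_fin => s; apply: cvgM; first exact: cvg_cst.
by apply: cvg_prod_fin => i; exact: fA.
Qed.

Lemma cvg_invmx n (f : T -> 'M[R]_n) (A : 'M[R]_n) : A \in unitmx ->
  f @ F --> A -> (fun t => invmx (f t)) @ F --> invmx A.
Proof.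
move=> uA fA; have dA : \det A != 0 by rewrite -unitfE -unitmxE.
have dA0 : \forall t \near F, \det (f t) != 0.
  by have h := cvg_det fA; apply: cvgr_neq0 h dA.
have adjA : (fun t => \adj (f t)) @ F --> \adj A.
  apply/cvg_mxP => i j; rewrite mxE; under eq_fun do rewrite mxE.
  apply: cvgM; first exact: cvg_cst.
  apply: cvg_det; apply/cvg_mxP => k l; rewrite !mxE.
  under eq_fun do rewrite !mxE.
  by move/cvg_mxP : fA; exact.
have -> : invmx A = (\det A)^-1 *: \adj A by rewrite /invmx uA.
apply: (@cvg_trans _ ((fun t => (\det (f t))^-1 *: \adj (f t)) @ F)).
  apply: near_eq_cvg; near=> t; rewrite /invmx unitmxE unitfE ifT //; near: t.
  exact: dA0.
by apply: cvgZ => //; apply: cvgV => //; exact: cvg_det.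
Unshelve. all: by end_near. Qed.

End MatrixLimits.

Lemma trmxZ (R : realType) m n (a : R) (A : 'M[R]_(m, n)) : (a *: A)^T = a *: A^T.
Proof. exact: linearZ. Qed.

Lemma mxvec_norm (R : realType) m n (A : 'M[R]_(m, n)) : `|mxvec A| = `|A|.
Proof.
apply/eqP; rewrite eq_le; apply/andP; split; apply: mx_norm_le => // i j.
  by rewrite ord1; case/mxvec_indexP: j => k l; rewrite mxvecE mx_entry_norm.
by rewrite -(mxvecE A) mx_entry_norm.
Qed.

Section CvgMxvec.
Context {R : realType} {T : Type} {F : set_system T} {FF : Filter F}.

Lemma cvg_mxvec m n (f : T -> 'M[R]_(m, n)) (A : 'M[R]_(m, n)) :
  f @ F --> A -> (fun t => mxvec (f t)) @ F --> mxvec A.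
Proof.
move=> /cvg_mxP fA; apply/cvg_mxP => i j; rewrite ord1.
case/mxvec_indexP: j => k l; rewrite mxvecE.
under eq_fun do rewrite mxvecE.
exact: fA.
Qed.

Lemma cvg_vec_mx m n (f : T -> 'rV[R]_(m * n)) (A : 'rV[R]_(m * n)) :
  f @ F --> A -> (fun t => vec_mx (f t)) @ F --> vec_mx A.
Proof.
move=> /cvg_mxP fA; apply/cvg_mxP => i j; rewrite mxE.
under eq_fun do rewrite mxE.
exact: fA.
Qed.

End CvgMxvec.

(** Heine-Borel for matrices, carried over from row vectors by the isometry [mxvec]. *)
Lemma bounded_closed_compact_mx (R : realType) m n (A : set 'M[R]_(m, n)) :
  (exists M, forall B, A B -> `|B| <= M) -> closed A -> compact A.
Proof.
move=> [M AM] cA.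
have cvec : continuous (fun v : 'rV[R]_(m * n) => vec_mx v : 'M[R]_(m, n)).
  by move=> v; apply: (cvg_vec_mx (F := nbhs v) (f := id)) => X.
pose A' := [set v : 'rV[R]_(m * n) | A (vec_mx v)].
have cA' : compact A'.
  apply: bounded_closed_compact.
    exists M; split; first by rewrite num_real.
    move=> x Mx v /AM; rewrite -mxvec_norm vec_mxK => vM /=.
    exact: le_trans vM (ltW Mx).
  by move/continuous_closedP : cvec => /(_ _ cA).
have -> : A = (fun v : 'rV[R]_(m * n) => vec_mx v : 'M[R]_(m, n)) @` A'.
  rewrite eqEsubset; split=> [B AB|_ [v Av <-]//].
  by exists (mxvec B); rewrite /A' /= ?mxvecK.
by apply: continuous_compact => //; exact: continuous_subspaceT.
Qed.

Lemma nbhs_mxP (R : realType) m n (y : 'M[R]_(m, n)) (A : set 'M[R]_(m, n)) :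
  nbhs y A <-> exists2 e : R, 0 < e & forall z, `|y - z| < e -> A z.
Proof.
split=> [/nbhs_ballP[e /= e0 eA]|[e e0 eA]].
  by exists e => // z yz; apply: eA; rewrite mx_norm_ball.
by apply/nbhs_ballP; exists e => //= z; rewrite mx_norm_ball; exact: eA.
Qed.

Section ClosedSets.
Context {R : realType} {T : topologicalType} (f : T -> R) (cf : continuous f).

Lemma closed_fun_le c : closed [set x | f x <= c].
Proof. by move/continuous_closedP : cf => /(_ _ (@closed_le R c)). Qed.

Lemma closed_fun_eq c : closed [set x | f x = c].
Proof.
have h : closed [set x : R | x = c] by exact: (@closed_eq R c).
by move/continuous_closedP : cf => /(_ _ h).
Qed.

Lemma open_fun_lt c : open [set x | f x < c].
Proof. by move/continuousP : cf => /(_ _ (@open_lt R c)). Qed.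

End ClosedSets.

Lemma continuous_entry (R : realType) (T : topologicalType) m n
    (f : T -> 'M[R]_(m, n)) i j : continuous f -> continuous (fun x => f x i j).
Proof. by move=> cf x; have /cvg_mxP/(_ i j) := cf x. Qed.

Lemma continuous_mulmx (R : realType) (T : topologicalType) m n p
    (f : T -> 'M[R]_(m, n)) (g : T -> 'M[R]_(n, p)) :
  continuous f -> continuous g -> continuous (fun x => f x *m g x).
Proof. by move=> cf cg x; apply: cvg_mulmx; [exact: cf|exact: cg]. Qed.

Lemma continuous_trmx (R : realType) (T : topologicalType) m n
    (f : T -> 'M[R]_(m, n)) : continuous f -> continuous (fun x => (f x)^T).
Proof. by move=> cf x; apply: cvg_trmx; exact: cf. Qed.

Lemma closed_fun_mx0 (R : realType) (T : topologicalType) m n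
    (f : T -> 'M[R]_(m, n)) : continuous f -> closed [set x | f x = 0].
Proof.
move=> cf; have -> : [set x | f x = 0] = [set x | `|f x| = 0].
  by apply/seteqP; split=> x /= => [->|/eqP]; rewrite ?normr0 // normr_eq0 => /eqP.
by apply: closed_fun_eq => x; apply: continuous_comp (cf x) _; exact: norm_continuous.
Qed.

Lemma continuous_self (T : topologicalType) : continuous (fun x : T => x).
Proof. by move=> x A. Qed.

Lemma continuous_const (T U : topologicalType) (c : U) : continuous (fun _ : T => c).
Proof. by move=> x; exact: cvg_cst. Qed.

Lemma continuous_pair (X A B : topologicalType) (f : X -> A) (g : X -> B) :
  continuous f -> continuous g -> continuous (fun x => (f x, g x)).
Proof.
move=> cf cg x; apply: (cvg_pair (F := nbhs x) (G := nbhs (f x)) (H := nbhs (g x))).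
  exact: cf.
exact: cg.
Qed.

Lemma continuous_compose (X A B : topologicalType) (f : X -> A) (g : A -> B) :
  continuous f -> continuous g -> continuous (fun x => g (f x)).
Proof. by move=> cf cg x; apply: continuous_comp; [exact: cf|exact: cg]. Qed.

Lemma continuous_fst (X Y : topologicalType) : continuous (fun z : X * Y => z.1).
Proof. by move=> z; exact: cvg_fst. Qed.

Lemma continuous_snd (X Y : topologicalType) : continuous (fun z : X * Y => z.2).
Proof. by move=> z; exact: cvg_snd. Qed.

(** * The Poincare-Miranda theorem *)

Section Sperner.
Variables (d N : nat).
Local Notation point := {ffun 'I_d -> nat}.
Implicit Types (v w : point) (S : {set 'I_d}) (F G : seq point -> bool).
Local Open Scope nat_scope.

Definition shift_pt v (i : 'I_d) : point := [ffun j => v j + (j == i)].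
Definition set_pt v (i : 'I_d) a : point := [ffun j => if j == i then a else v j].

(* The sum mod 2 of F over the simplices of Kuhn's triangulation of the cube at
   v in the directions S, each given by its increasing list of vertices. *)
Fixpoint kuhn_sum k S v F : bool :=
  if k is k'.+1 then
    \big[addb/false]_(i in S)
      kuhn_sum k' (S :\ i) (shift_pt v i) (fun l => F (v :: l))
  else F [:: v].

(** The dual of the mod 2 boundary operator: F is summed over the lists obtained by dropping one
    vertex of l. *)
Fixpoint facet_sum (F : seq point -> bool) (l : seq point) : bool :=
  if l is x :: l' then F l' (+) facet_sum (fun l1 => F (x :: l1)) l' else false.

Lemma eq_facet_sum F G l : F =1 G -> facet_sum F l = facet_sum G l.
Proof.
elim: l F G => //= x l IH F G FG; rewrite FG; congr (_ (+) _).
by apply: IH => l1; rewrite FG.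
Qed.

Lemma kuhn_sum_eq k S v F G :
  (forall l, size l = k.+1 ->
     (forall w, w \in l -> forall j, v j <= w j <= v j + (j \in S)) ->
     F l = G l) ->
  kuhn_sum k S v F = kuhn_sum k S v G.
Proof.
elim: k S v F G => [|k IH] S v F G FG /=.
  by apply: FG => // w; rewrite inE => /eqP-> j; rewrite leqnn leq_addr.
apply: eq_bigr => i iS; apply: IH => l sl lP; apply: FG; first by rewrite /= sl.
move=> w; rewrite inE => /orP[/eqP->|/lP wP] j; first by rewrite leqnn leq_addr.
move: (wP j); rewrite !inE ffunE; case: eqP => [->|_] /=; first by rewrite iS; lia.
by rewrite addn0.
Qed.

Lemma kuhn_sumD k S v F G :
  kuhn_sum k S v (fun l => F l (+) G l) = kuhn_sum k S v F (+) kuhn_sum k S v G.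
Proof.
elim: k S v F G => [|k IH] S v F G //=.
by rewrite -big_split /=; apply: eq_bigr => i _; rewrite IH.
Qed.

Lemma kuhn_sum0 k S v : kuhn_sum k S v (fun=> false) = false.
Proof. by elim: k S v => [|k IH] S v //=; rewrite big1. Qed.

Lemma shift_ptC v i j : shift_pt (shift_pt v i) j = shift_pt (shift_pt v j) i.
Proof. by apply/ffunP => l; rewrite !ffunE addnAC. Qed.

(** Each unordered pair of distinct directions is counted twice, hence cancels mod 2. In the
    triangulation: a facet obtained by dropping an inner vertex lies in two simplices, which differ
    by the order of two consecutive directions. *)
Lemma addb_sym_sum S (h : 'I_d -> 'I_d -> bool) :
  (forall i j, h i j = h j i) ->
  \big[addb/false]_(i in S) \big[addb/false]_(j in S :\ i) h i j = false.
Proof.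
move=> hC.
rewrite (eq_bigr (fun i : 'I_d => (\big[addb/false]_(j in S | (j < i)%N) h i j) (+)
     (\big[addb/false]_(j in S | (i < j)%N) h i j))); last first.
  move=> i iS; rewrite (bigID (fun j : 'I_d => (j < i)%N)) /=; congr (_ (+) _).
    apply: eq_bigl => j; rewrite !inE.
    by case: (eqVneq j i) => [->|_] //=; rewrite ltnn andbF.
  apply: eq_bigl => j; rewrite !inE -leqNgt ltn_neqAle eq_sym.
  by rewrite (inj_eq val_inj) andbCA andbA.
rewrite big_split /=.
rewrite [X in _ (+) X](exchange_big_dep (fun j => j \in S)) /=; last first.
  by move=> i j _ /andP[].
rewrite (eq_bigr (fun i : 'I_d =>
    \big[addb/false]_(j | (j \in S) && ((j \in S) && (j < i)%N)) h i j)).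
  rewrite [X in _ (+) X](eq_bigr (fun i : 'I_d =>
    \big[addb/false]_(j | (j \in S) && ((j \in S) && (j < i)%N)) h i j)).
    exact: addbb.
  move=> i iS; apply: eq_big => [j|j _]; last exact: hC.
  by rewrite iS /=; case: (j \in S).
by move=> i iS; apply: eq_bigl => j; case: (j \in S).
Qed.

(** Facets with an inner vertex dropped cancel in pairs by [addb_sym_sum]. There remain the facets
    with the first vertex dropped, on the far face at [shift_pt v i] with i the first direction, and
    those with the last vertex dropped, on the face at v with i the last direction. *)
Lemma kuhn_sum_facets k S v F : #|S| = k.+1 ->
  kuhn_sum k.+1 S v (facet_sum F) =
  \big[addb/false]_(i in S)
    (kuhn_sum k (S :\ i) (shift_pt v i) F (+) kuhn_sum k (S :\ i) v F).
Proof.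
elim: k S v F => [|k IH] S v F cS.
  by apply: eq_bigr => i _ /=; rewrite addbF.
have cSi i : i \in S -> #|S :\ i| = k.+1.
  by move=> iS; move: cS; rewrite (cardsD1 i S) iS add1n => -[].
(* In the expansion of the tail, the first inner sum drops the second vertex and is symmetric in i
   and j; the second one drops the last vertex. *)
transitivity (\big[addb/false]_(i in S)
    (kuhn_sum k.+1 (S :\ i) (shift_pt v i) F (+)
     ((\big[addb/false]_(j in S :\ i)
        kuhn_sum k (S :\ i :\ j) (shift_pt (shift_pt v i) j) (fun l1 => F (v :: l1)))
     (+) (\big[addb/false]_(j in S :\ i)
        kuhn_sum k (S :\ i :\ j) (shift_pt v i) (fun l1 => F (v :: l1)))))).
  apply: eq_bigr => i iS; etransitivity.
    exact: (kuhn_sumD k.+1 (S :\ i) (shift_pt v i) F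
              (facet_sum (fun l1 => F (v :: l1)))).
  by rewrite IH ?cSi // big_split.
rewrite !big_split (_ : \big[addb/false]_(i in S) \big[addb/false]_(j in S :\ i)
    kuhn_sum k (S :\ i :\ j) (shift_pt (shift_pt v i) j)
      (fun l1 => F (v :: l1)) = false); last first.
  apply: addb_sym_sum => i j; rewrite shift_ptC; congr kuhn_sum.
  by apply/setP => l; rewrite !inE andbCA.
rewrite Monoid.mul1m; congr (ssrbool_addb__canonical__Monoid_ComLaw _ _); rewrite /=.
rewrite (exchange_big_dep (fun j => j \in S)) /=; last first.
  by move=> i j _; rewrite inE => /andP[].
apply: eq_bigr => j jS; apply: eq_big => [i|i _].
  by rewrite !inE jS andbT [RHS]andbC eq_sym.
by congr kuhn_sum; apply/setP => l; rewrite !inE andbCA.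
Qed.

Fixpoint box_sum (s : seq 'I_d) (G : point -> bool) v : bool :=
  if s is i :: s' then
    \big[addb/false]_(a < N) box_sum s' G (set_pt v i a)
  else G v.

Lemma set_ptC v i j a b : i != j ->
  set_pt (set_pt v i a) j b = set_pt (set_pt v j b) i a.
Proof.
move=> ij; apply/ffunP => l; rewrite !ffunE.
by case: (eqVneq l j) => // ->; rewrite eq_sym (negPf ij).
Qed.

Lemma box_sum_pull i s (G : point -> bool) v : uniq s -> i \in s ->
  box_sum s G v = \big[addb/false]_(a < N) box_sum (rem i s) G (set_pt v i a).
Proof.
elim: s v => //= j s IH v /andP[js us]; rewrite inE.
case: (eqVneq i j) => [->|ij] //= iS.
under eq_bigr do rewrite IH //.
rewrite exchange_big /=; apply: eq_bigr => a _.
by apply: eq_bigr => b _; rewrite set_ptC // eq_sym.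
Qed.

Lemma box_sum_eq s (G H : point -> bool) v : uniq s ->
  (forall w, (forall j, j \in s -> w j < N) -> (forall j, j \notin s -> w j = v j) ->
     G w = H w) ->
  box_sum s G v = box_sum s H v.
Proof.
elim: s v => /= [|i s IH] v us GH; first by apply: GH.
case/andP: us => is_ us; apply: eq_bigr => a _; apply: IH => // w w1 w2.
apply: GH => j; rewrite inE.
  case: (eqVneq j i) => [->|_] /= => [_|]; last exact: w1.
  by rewrite w2 // ffunE eqxx.
by rewrite negb_or => /andP[ji js]; rewrite w2 // ffunE (negPf ji).
Qed.

Lemma box_sumD s (G H : point -> bool) v :
  box_sum s (fun w => G w (+) H w) v = box_sum s G v (+) box_sum s H v.
Proof.
by elim: s v => //= i s IH v; under eq_bigr do rewrite IH; rewrite big_split.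
Qed.

Lemma box_sum0 s v : box_sum s (fun=> false) v = false.
Proof. by elim: s v => //= i s IH v; rewrite big1. Qed.

Lemma box_sum_big s (I : finType) (P : pred I) (G : I -> point -> bool) v :
  box_sum s (fun w => \big[addb/false]_(i | P i) G i w) v =
  \big[addb/false]_(i | P i) box_sum s (G i) v.
Proof.
elim: s v => //= i s IH v; under eq_bigr do rewrite IH.
by rewrite exchange_big.
Qed.

Lemma box_sum_shift i s (G : point -> bool) v : i \notin s ->
  box_sum s (fun w => G (shift_pt w i)) v = box_sum s G (shift_pt v i).
Proof.
elim: s v => //= j s IH v; rewrite inE negb_or => /andP[ij is_].
apply: eq_bigr => a _; rewrite IH //; congr box_sum; apply/ffunP => l.
rewrite !ffunE; case: (eqVneq l j) => // ->.
by rewrite eq_sym (negPf ij) addn0.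
Qed.

Lemma addb_telescope (h : nat -> bool) n :
  \big[addb/false]_(a < n) (h a.+1 (+) h a) = h n (+) h 0.
Proof.
elim: n => [|n IH]; first by rewrite big_ord0 addbb.
by rewrite big_ord_recr /= IH; case: (h n) (h 0) (h n.+1) => [] [] [].
Qed.

(** A face between two neighbouring grid cubes is counted twice, so only the two outer faces in the
    direction i survive. *)
Lemma box_sum_telescope i s (G : point -> bool) v : uniq s -> i \in s ->
  box_sum s (fun w => G (shift_pt w i) (+) G w) v =
  box_sum (rem i s) G (set_pt v i N) (+) box_sum (rem i s) G (set_pt v i 0).
Proof.
move=> us is_; rewrite (box_sum_pull _ _ us is_).
rewrite -(addb_telescope (fun a => box_sum (rem i s) G (set_pt v i a))).
apply: eq_bigr => a _; rewrite box_sumD box_sum_shift ?mem_rem_uniq ?inE ?eqxx //.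
congr (box_sum _ _ _ (+) _); apply/ffunP => l; rewrite !ffunE.
by case: eqP; rewrite ?addn1 ?addn0.
Qed.

Variable lab : point -> nat.
Hypothesis lab_le : forall w, lab w <= d.
Hypothesis lab_0 : forall w i, w i = 0 -> lab w <> 0.
Hypothesis lab_N : forall w i, w i = N -> lab w <> i.+1.

Definition full_labels k (l : seq point) := perm_eq (map lab l) (iota 0 k.+1).

(** Dropping a vertex labelled x leaves the labels t exactly when all the labels together are x ::
    t, up to order. The prefix p carries the vertices already passed in the induction. *)
Lemma facet_sum_perm (t : seq nat) (p l : seq point) :
  facet_sum (fun l' => perm_eq (map lab (p ++ l')) t) l =
  odd (count (fun x => perm_eq (map lab (p ++ l)) (x :: t)) (map lab l)).
Proof.
elim: l p => //= x l IH p.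
have -> : facet_sum (fun l1 => perm_eq (map lab (p ++ x :: l1)) t) l =
    facet_sum (fun l1 => perm_eq (map lab (rcons p x ++ l1)) t) l.
  by apply: eq_facet_sum => l1; rewrite cat_rcons.
rewrite IH cat_rcons oddD; congr (_ (+) _).
by rewrite oddb !map_cat /= -cat1s perm_catCA perm_cons.
Qed.

(** Parity of the doors of a room: a simplex that misses only the label k+1 has one label on two
    vertices, hence two full facets; a fully labelled one has a single full facet; the others have
    none. *)
Lemma facet_sum_full k l : all (fun w => lab w <= k.+1) l ->
  facet_sum (full_labels k) l = full_labels k.+1 l.
Proof.
move=> lk; have := facet_sum_perm (iota 0 k.+1) [::] l; rewrite /= => ->.
set s := map lab l; have sk : all (fun x => x <= k.+1) s by rewrite all_map.
have fullE : full_labels k.+1 l = perm_eq s (k.+1 :: iota 0 k.+1).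
  have iotaS : iota 0 k.+2 = rcons (iota 0 k.+1) k.+1.
    by rewrite -cats1 -[k.+2]addn1 iotaD.
  by rewrite /full_labels iotaS perm_sym perm_rcons perm_sym.
rewrite fullE; case: (boolP (has (fun x => perm_eq s (x :: iota 0 k.+1)) s)).
  move=> /hasP[x xs px].
  have -> : count (fun y => perm_eq s (y :: iota 0 k.+1)) s = count_mem x s.
    apply: eq_count => y; rewrite (permPl px) /=.
    apply/idP/eqP => [|->]; last exact: perm_refl.
    move=> pq; have := permP pq (pred1 y); rewrite /= eqxx.
    by case: eqP => // _; lia.
  have -> : count_mem x s = (x < k.+1).+1.
    have -> : count_mem x s = (x == x) + count_mem x (iota 0 k.+1).
      exact: (permP px).
    by rewrite eqxx count_uniq_mem ?iota_uniq // mem_iota.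
  rewrite [odd _]/= oddb; have := allP sk x xs.
  rewrite leq_eqVlt => /orP[/eqP xk|xk].
    by move: px; rewrite xk ltnn => ->.
  rewrite xk; symmetry; apply/negbTE/negP => pk.
  move: px; rewrite (permPl pk) => pq; have := permP pq (pred1 k.+1).
  by rewrite /= eqxx; case: eqP => [e|_]; [move: xk; rewrite e ltnn|lia].
move=> nh; have /eqP -> : count (fun y => perm_eq s (y :: iota 0 k.+1)) s == 0.
  by rewrite -leqn0 leqNgt -has_count.
apply/esym; apply: contraNF nh => pk; apply/hasP; exists k.+1 => //.
by rewrite (perm_mem pk) inE eqxx.
Qed.

Definition first_coords k : {set 'I_d} := [set i : 'I_d | (i < k)%N].
Definition top_pt : point := [ffun=> N].

(** Induction on the dimension, over the face of the grid where the coordinates from k on equal N.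
    Fully labelled simplices have the parity of the full facets on the boundary: the faces at 0 miss
    the label 0, the face at N in a direction i below the last one misses the label i+1, and the
    face at N in the last direction is the previous case. *)
Lemma full_labels_boxsum k : k <= d ->
  box_sum [seq i <- enum 'I_d | i \in first_coords k]
    (fun v => kuhn_sum k (first_coords k) v (full_labels k)) top_pt.
Proof.
elim: k => [_|k IH kd].
  have -> : [seq i <- enum 'I_d | i \in first_coords 0] = [::].
    by apply/eqP; rewrite -size_eq0 size_filter -leqn0 leqNgt -has_count; apply/hasPn => i; rewrite inE.
  (* All coordinates of [top_pt] equal N, which excludes every label but 0. *)
  rewrite /= /full_labels /=; case: (posnP (lab top_pt)) => [->//|l0].
  have ld : (lab top_pt).-1 < d by rewrite prednK.
  by case: (@lab_N top_pt (Ordinal ld)); rewrite ?ffunE //= prednK.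
set S := first_coords k.+1; set s := [seq i <- enum 'I_d | i \in S].
have us : uniq s by rewrite filter_uniq ?enum_uniq.
have sS i : (i \in s) = (i \in S) by rewrite mem_filter mem_enum andbT.
have cS : #|S| = k.+1.
  have -> : S = [set widen_ord kd i | i : 'I_k.+1]%SET.
    apply/setP => i; rewrite inE; apply/idP/imsetP => [ik|[j _ ->]] /=; last first.
      exact: ltn_ord.
    by exists (Ordinal ik) => //; apply: val_inj.
  by rewrite card_imset ?card_ord // => i j /(congr1 val) /= /val_inj.
rewrite (_ : box_sum _ _ _ = \big[addb/false]_(i in S)
    (box_sum (rem i s) (fun w => kuhn_sum k (S :\ i) w (full_labels k))
       (set_pt top_pt i N)
     (+) box_sum (rem i s) (fun w => kuhn_sum k (S :\ i) w (full_labels k))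
       (set_pt top_pt i 0))); last first.
  transitivity (box_sum s (fun v => \big[addb/false]_(i in S)
     (kuhn_sum k (S :\ i) (shift_pt v i) (full_labels k)
      (+) kuhn_sum k (S :\ i) v (full_labels k))) top_pt).
    (* Labels above k+1 do not occur, since the coordinates outside S stay equal to N. *)
    apply: box_sum_eq => // v v1 v2; rewrite -kuhn_sum_facets //.
    apply: kuhn_sum_eq => l _ lP; apply/esym/facet_sum_full/allP => w /lP wP.
    rewrite leqNgt; apply/negP => kl.
    have ld : (lab w).-1 < d by rewrite prednK ?(leq_trans _ kl).
    have lS : Ordinal ld \notin S by rewrite inE -leqNgt /=; lia.
    apply: (@lab_N w (Ordinal ld)); last by rewrite /= prednK // (leq_trans _ kl).
    have := wP (Ordinal ld); rewrite (negPf lS) addn0 -eqn_leq => /eqP <-.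
    by rewrite v2 ?sS // ffunE.
  rewrite box_sum_big; apply: eq_bigr => i iS.
  by rewrite -box_sum_telescope // sS.
have kS : Ordinal kd \in S by rewrite inE /=.
have vanish i x : i \in S -> (x = 0) \/ (x = N /\ i != Ordinal kd) ->
    box_sum (rem i s) (fun w => kuhn_sum k (S :\ i) w (full_labels k))
       (set_pt top_pt i x) = false.
  move=> iS xP; rewrite -(box_sum0 (rem i s) (set_pt top_pt i x)).
  apply: box_sum_eq; rewrite ?rem_uniq // => v _ v2.
  rewrite -(kuhn_sum0 k (S :\ i) v); apply: kuhn_sum_eq => l _ lP.
  apply/negP => fl.
  have wix w : w \in l -> w i = x.
    move=> /lP/(_ i); rewrite !inE eqxx addn0 -eqn_leq => /eqP <-.
    by rewrite v2 ?ffunE ?eqxx // mem_rem_uniq // inE eqxx.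
  have labP c : c <= k -> exists2 w, w \in l & lab w = c.
    move=> ck; have : c \in map lab l by rewrite (perm_mem fl) mem_iota.
    by move=> /mapP[w wl ->]; exists w.
  case: xP => [x0|[xN ik]].
    have [w wl w0] := labP 0 isT.
    by apply: (@lab_0 w i) => //; rewrite wix.
  have ik' : i < k.
    move: iS; rewrite inE ltnS leq_eqVlt => /orP[/eqP e|//].
    by case/eqP: ik; apply: val_inj.
  have [w wl wi] := labP i.+1 ik'.
  by apply: (@lab_N w i) => //; rewrite wix.
rewrite (bigD1 (Ordinal kd)) //= big1 ?addbF; last first.
  by move=> i /andP[iS ik]; rewrite !vanish //; [left|right].
rewrite (vanish _ 0) ?addbF //; last by left.
have -> : set_pt top_pt (Ordinal kd) N = top_pt.
  by apply/ffunP => j; rewrite !ffunE; case: eqP.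
have Sk : S :\ Ordinal kd = first_coords k.
  by apply/setP => j; rewrite !inE ltnS [j <= k]leq_eqVlt -(inj_eq val_inj) /=;
     case: (ltngtP j k).
have -> : rem (Ordinal kd) s = [seq i <- enum 'I_d | i \in first_coords k].
  rewrite rem_filter // -filter_predI; apply: eq_filter => j.
  by rewrite -Sk !inE.
by rewrite Sk IH // ltnW.
Qed.

Lemma sperner_cube : exists v, (forall i, v i < N) /\
  forall c, c <= d -> exists2 w, lab w = c & forall i, v i <= w i <= (v i).+1.
Proof.
apply: contrapT => nex; have := full_labels_boxsum (leqnn d).
rewrite (_ : first_coords d = [set: 'I_d]%SET); last by apply/setP => i; rewrite !inE ltn_ord.
rewrite (_ : [seq i <- _ | _] = enum 'I_d); last by apply/all_filterP/allP => i; rewrite inE.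
rewrite (@box_sum_eq _ _ (fun=> false)) ?box_sum0 ?enum_uniq // => v v1 _.
rewrite -(kuhn_sum0 d [set: 'I_d]%SET v); apply: kuhn_sum_eq => l _ lP.
apply/negP => fl; apply: nex; exists v; split=> [i|c cd].
  by apply: v1; rewrite mem_enum.
have : c \in map lab l by rewrite (perm_mem fl) mem_iota.
move=> /mapP[w wl ->]; exists w => // i.
by have := lP w wl i; rewrite inE addn1.
Qed.

End Sperner.

Lemma within_compact_unif_continuous (R : realType) (U V : normedModType R)
    (K : set U) (f : U -> V) : compact K -> {within K, continuous f} ->
  forall e, 0 < e -> exists2 r, 0 < r &
    forall x y, K x -> K y -> `|x - y| < r -> `|f x - f y| < e.
Proof.
move=> cK /subspace_continuousP cf e e0.
have /compact_near_coveringP/near_covering_withinP H := cK.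
have := H R (0^'+) (fun r x => forall y, K y -> `|x - y| < r -> `|f x - f y| < e) _ _.
case=> [x Kx|r /= r0 rP]; last first.
  exists (r / 2); first by rewrite divr_gt0.
  have r2 : ball 0 r (r / 2).
    by rewrite /ball /= sub0r normrN gtr0_norm ?divr_gt0 // ltr_pdivrMr // ltr_pMr // ltr1n.
  by move=> x y Kx Ky xy; apply: (rP _ r2 _ x Kx y Ky xy); rewrite /= divr_gt0.
have /cvgrPdist_lt/(_ (e / 2)) := cf x Kx; rewrite divr_gt0 // => /(_ isT).
rewrite near_withinE => /nbhs_normP[r /= r0 rP].
have r20 : 0 < r / 2 by rewrite divr_gt0.
exists ([set x' | `|x - x'| < r / 2], [set s : R | s < r / 2]) => /=.
  split; first by apply/nbhs_normP; exists (r / 2).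
  near=> s; near: s; exact: nbhs_right_lt.
move=> [x' s] /= [xx' sr] Kx' y Ky x'y.
have xy : `|x - y| < r.
  rewrite -(subrK x' x) -addrA (le_lt_trans (ler_normD _ _)) //.
  by rewrite (splitr r) ltrD // (lt_trans x'y).
rewrite -(subrK (f x) (f x')) -addrA (le_lt_trans (ler_normD _ _)) //.
rewrite (splitr e) ltrD //; last exact: rP.
by rewrite distrC; apply: rP => //=; rewrite (lt_trans xx') // ltr_pdivrMr // ltr_pMr // ltr1n.
Unshelve. all: by end_near. Qed.

Section Miranda.
Variable R : realType.

Lemma cube_compact d r : compact [set x : 'rV[R]_d | `|x| <= r].
Proof.
apply: bounded_closed_compact_mx; first by exists r.
apply: (@closed_comp _ _ (fun x : 'rV[R]_d => `|x|) [set y | y <= r]); last exact: closed_le.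
by move=> x _; exact: norm_continuous.
Qed.

(** Sperner labels on a fine grid: 0 where all coordinates of f are nonnegative, otherwise i+1 for
    some negative coordinate i. The signs of f on the faces are the boundary conditions of
    [sperner_cube]. *)
Theorem poincare_miranda d (f : 'rV[R]_d -> 'rV[R]_d) :
  {within [set x : 'rV[R]_d | `|x| <= 1], continuous f} ->
  (forall (x : 'rV[R]_d) i, `|x| <= 1 -> x 0 i = 1 -> 0 < f x 0 i) ->
  (forall (x : 'rV[R]_d) i, `|x| <= 1 -> x 0 i = - 1 -> f x 0 i < 0) ->
  exists2 x : 'rV[R]_d, `|x| <= 1 & f x = 0.
Proof.
move=> cf fpos fneg; apply: contrapT => nex.
have fn0 (x : 'rV[R]_d) : `|x| <= 1 -> 0 < `|f x|.
  by move=> x1; rewrite normr_gt0; apply/eqP => fx0; apply: nex; exists x.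
have c1 : [set x : 'rV[R]_d | `|x| <= 1] !=set0 by exists 0; rewrite /= normr0.
have cnf : {within [set x : 'rV[R]_d | `|x| <= 1], continuous (fun x => `|f x|)}.
  move=> x; apply: continuous_comp (cf x) _; exact: norm_continuous.
have [x0] := compact_EVT_min c1 (@cube_compact d 1) cnf.
rewrite inE /= => x01 x0min; set e := `|f x0|.
have e0 : 0 < e by exact: fn0.
have [r r0 rP] := within_compact_unif_continuous (@cube_compact d 1) cf
  (divr_gt0 e0 (ltr0n R 2)).
(* The mesh 2/N.+1 is below the modulus of uniform continuity for half the minimum e of the norm of
   f. *)
have [N Nr] : exists N : nat, 2 / r < N.+1%:R.
  exists (Num.truncn (2 / r)); exact: truncnS_gt.
pose pt (v : {ffun 'I_d -> nat}) : 'rV[R]_d :=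
  \row_i (2 * (minn (v i) N.+1)%:R / N.+1%:R - 1).
have N0 : 0 < N.+1%:R :> R by [].
have pt1 v : `|pt v| <= 1.
  apply: mx_norm_le => // i j; rewrite mxE ler_norml; apply/andP; split.
    by rewrite -subr_ge0 opprK subrK divr_ge0 // mulr_ge0.
  rewrite lerBlDr ler_pdivrMr // [1 + 1](_ : _ = 2) // ler_pM2l //.
  by rewrite ler_nat geq_minr.
pose lab (v : {ffun 'I_d -> nat}) :=
  if [pick i | f (pt v) 0 i < 0] is Some i then (nat_of_ord i).+1 else 0%N.
have labP v : (lab v = 0%N /\ forall i, 0 <= f (pt v) 0 i) \/
    exists2 i : 'I_d, lab v = i.+1 & f (pt v) 0 i < 0.
  rewrite /lab; case: pickP => [i fi|fP]; first by right; exists i.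
  by left; split=> // i; rewrite leNgt fP.
have [|v i vi|v i vi|v [vN vP]] := @sperner_cube d N.+1 lab.
- by move=> v; have [[-> _]//|[i -> _]] := labP v; exact: ltn_ord.
- have [[_ /(_ i)]|[j -> //]] := labP v.
  by rewrite leNgt fneg // mxE vi min0n mulr0 mul0r sub0r.
- have [[-> _]//|[j -> fj]] := labP v; case=> /val_inj ji.
  move: fj; rewrite ltNge ltW // ji fpos // mxE vi minnn mulfK ?gt_eqF //.
  by rewrite (_ : 2 = 1 + 1) // addrK.
(* At [w0] all coordinates of f are nonnegative, while each of them is negative at some nearby
   vertex; hence all are at most e/2, below the minimum e. *)
have [w0 lw0 w0P] := vP 0%N isT.
have [[_ fw0]|[i]] := labP w0; last by rewrite lw0.
have : `|f (pt w0)| <= e / 2.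
  apply: mx_norm_le => [|i j]; first by rewrite divr_ge0 // ltW.
  rewrite ord1; have [w lw wP] := vP j.+1 (ltn_ord j).
  have [[]|[j' lj' fw]] := labP w; first by rewrite lw.
  have jj : j' = j by apply: val_inj; move: lw; rewrite lj' => -[].
  rewrite {}jj in fw.
  have close : `|pt w0 - pt w| < r.
    apply: (@le_lt_trans _ _ (2 / N.+1%:R)); last first.
      by rewrite ltr_pdivrMr // mulrC -ltr_pdivrMr.
    apply: mx_norm_le => [|k l]; first by rewrite divr_ge0.
    rewrite !mxE opprB addrA subrK -mulrBl -mulrBr !normrM normfV.
    rewrite (ger0_norm (ltW N0)) ler_pM2r ?invr_gt0 // ger0_norm //.
    rewrite -[leRHS]mulr1 ler_pM2l //.
    have := w0P l; have := wP l; have := vN l.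
    move: (w l) (w0 l) (v l) => a b c ? ? ?.
    have -> : minn b N.+1 = b by lia.
    have -> : minn a N.+1 = a by lia.
    by rewrite ler_distlC lerBlDr -!(natrD _ _ 1) !ler_nat; lia.
  have := rP _ _ (pt1 w0) (pt1 w) close.
  move=> /(le_lt_trans (mx_entry_norm _ 0 j)); rewrite !mxE => h.
  rewrite ger0_norm //; apply: ltW; apply: le_lt_trans h.
  rewrite ger0_norm; first by rewrite lerDl oppr_ge0 ltW.
  by rewrite subr_ge0 ltW // (lt_le_trans fw).
have := x0min (pt w0); rewrite inE /= => /(_ (pt1 w0)) h1 h2.
have := le_trans h1 h2; rewrite -/e leNgt ltr_pdivrMr // ltr_pMr //.
by rewrite ltr1n.
Qed.

End Miranda.

(** * Generic perturbations on spheres *)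

Section LipschitzPerturbation.
Variable R : realType.

(* The approximation is the inf-convolution of g with L times the norm. *)
Lemma lipschitz_approx d (K : set 'rV[R]_d) (g : 'rV[R]_d -> R) e :
  compact K -> K !=set0 -> {within K, continuous g} -> 0 < e ->
  exists L (h : 'rV[R]_d -> R), [/\ 0 <= L,
    forall x y, `|h x - h y| <= L * `|x - y| &
    forall x, K x -> `|h x - g x| <= e].
Proof.
move=> cK K0 cg e0.
have cng : {within K, continuous (fun x => `|g x|)}.
  by move=> x; apply: continuous_comp (cg x) _; exact: norm_continuous.
have [x0 _ x0max] := compact_EVT_max K0 cK cng.
have {}x0max x : K x -> `|g x| <= `|g x0| by move=> Kx; apply: x0max; rewrite inE.
move: (`|g x0|) x0max (normr_ge0 (g x0)) => M gM M0.
have [r r0 rP] := within_compact_unif_continuous cK cg e0.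
(* Beyond the distance r the penalty is at least 2M, which bounds every variation of g; below r, g
   varies by less than e. *)
pose L := 2 * M / r.
have L0 : 0 <= L by rewrite divr_ge0 ?mulr_ge0 // ltW.
pose A x := [set g y + L * `|x - y| | y in K].
have Alb x : lbound (A x) (- M).
  move=> _ [y Ky <-]; have := gM y Ky; rewrite ler_norml => /andP[h _].
  by apply: (le_trans h); rewrite lerDl mulr_ge0.
have A0 x : A x !=set0 by have [y Ky] := K0; exists (g y + L * `|x - y|), y.
have iA x : has_inf (A x) by split => //; exists (- M).
have hle x y : K y -> inf (A x) <= g y + L * `|x - y|.
  by move=> Ky; apply: (ge_inf (ex_intro _ _ (Alb x))); exists y.
exists L, (fun x => inf (A x)); split => // [x y|x Kx].
  have H a b : inf (A a) - inf (A b) <= L * `|a - b|.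
    rewrite lerBlDr addrC -lerBlDr; apply: lb_le_inf => // _ [z Kz <-].
    rewrite lerBlDr (le_trans (hle a z Kz)) // -addrA lerD2l -mulrDr ler_wpM2l //.
    by rewrite [leRHS]addrC ler_distD.
  by rewrite ler_norml; apply/andP; split; [rewrite lerNl opprB distrC|]; exact: H.
rewrite ler_norml; apply/andP; split.
  have : g x - e <= inf (A x); last by lra.
  apply: lb_le_inf => // _ [y Ky <-].
  have [xy|xy] := ltP `|x - y| r.
    have := rP x y Kx Ky xy; rewrite ltr_norml => /andP[_ h].
    have : 0 <= L * `|x - y| by rewrite mulr_ge0.
    by lra.
  have : L * r <= L * `|x - y| by rewrite ler_wpM2l.
  rewrite {1}/L divfK ?gt_eqF //; have := gM x Kx; have := gM y Ky.
  by rewrite !ler_norml => /andP[+ _] /andP[_ +]; lra.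
have := hle x x Kx; rewrite subrr normr0 mulr0 addr0 => h.
by rewrite lerBlDr (le_trans h) // lerDr ltW.
Qed.

(** Pigeonhole in place of a measure argument: the sphere is cut into cells, of the order of K^d
    many, whose images have diameter below eta/K; they are too few for the K^(d+1) points of a grid
    of mesh eta/K. *)
Lemma sphere_lipschitz_image d (h : 'rV[R]_d.+1 -> 'rV[R]_d.+1) L c r eta :
  0 <= L -> (forall x y, `|h x - h y| <= L * `|x - y|) -> 0 < r -> 0 < eta ->
  exists2 v : 'rV[R]_d.+1, `|v| <= eta & forall x, `|x - c| = r -> h x <> v.
Proof.
move=> L0 hL r0 eta0; apply: contrapT => nex.
(* Makes the image of a cell of side 2r/(CK) have diameter less than eta/K. *)
pose C := (Num.truncn (2 * r * L / eta)).+1.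
have CP : 2 * r * L / eta < C%:R by exact: truncnS_gt.
(* Makes the number 2(d+1)(CK+1)^d of cells at most (K-1)K^d. *)
pose K := (2 * d.+1 * (2 * C) ^ d).+1.
pose v (j : {ffun 'I_d.+1 -> 'I_K}) : 'rV[R]_d.+1 :=
  \row_i (eta * (j i)%:R / K%:R).
have K0 : 0 < K%:R :> R by [].
have vle j : `|v j| <= eta.
  apply: mx_norm_le => [|a i]; first exact: ltW.
  rewrite mxE ger0_norm; last by rewrite divr_ge0 ?mulr_ge0 // ltW.
  rewrite ler_pdivrMr // ler_pM2l //.
  by rewrite ler_nat ltnW.
have hit j : exists x, `|x - c| = r /\ h x = v j.
  apply: contrapT => nj; apply: nex; exists (v j) => // x xr hx.
  by apply: nj; exists x.
pose x j := xget 0 [set x | `|x - c| = r /\ h x = v j].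
have xP j : `|x j - c| = r /\ h (x j) = v j.
  exact: (xgetPex 0 (hit j)).
have side j : exists i, `|(x j - c) 0 i| = r.
  apply: contrapT => ns; have [xr _] := xP j.
  have lt i : `|(x j - c) 0 i| < r.
    rewrite lt_neqAle -{2}xr mx_entry_norm andbT; apply/eqP => e.
    by apply: ns; exists i.
  suff: `|x j - c| < r by rewrite xr ltxx.
  rewrite [ltLHS]/Num.norm /= mx_normrE; apply/bigmax_ltP; split=> // -[a i] _ /=.
  by rewrite ord1.
pose s j := xget ord0 [set i | `|(x j - c) 0 i| = r].
have sP j : `|(x j - c) 0 (s j)| = r.
  exact: (xgetPex ord0 (side j)).
pose t j i := ((x j - c) 0 i + r) / (2 * r) * (C * K)%:R.
have xb j i : - r <= (x j - c) 0 i <= r.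
  by rewrite -ler_norml; have [<- _] := xP j; exact: mx_entry_norm.
have r20 : 0 < 2 * r by rewrite mulr_gt0.
have t0 j i : 0 <= t j i.
  have /andP[hr _] := xb j i.
  by rewrite mulr_ge0 // divr_ge0 ?(ltW r20) //; lra.
have tle j i : t j i <= (C * K)%:R.
  rewrite -[leRHS]mul1r ler_wpM2r // ler_pdivrMr // mul1r mulr_natl mulr2n lerD2r.
  by have /andP[_ hr] := xb j i.
have CK0 : 0 < (C * K)%:R :> R by rewrite ltr0n muln_gt0.
(* The face of the sphere for the sup norm, given by a coordinate of absolute value r and its sign,
   and the integer position of the other d coordinates. *)
pose cell j := (s j, 0 <= (x j - c) 0 (s j),
  [ffun k : 'I_d => inord (Num.truncn (t j (lift (s j) k))) : 'I_(C * K).+1]).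
have cell_inj : injective cell.
  move=> j j' [ss sgn tt]; rewrite -ss in sgn tt.
  have close : `|x j - x j'| <= 2 * r / (C * K)%:R.
    apply: mx_norm_le => [|a i]; first by rewrite divr_ge0 ?mulr_ge0 // ltW.
    rewrite ord1; case: (unliftP (s j) i) => [k ->|->]; last first.
      suff -> : (x j - x j') 0 (s j) = 0.
        by rewrite normr0 divr_ge0 ?mulr_ge0 // ltW.
      have : (x j - c) 0 (s j) = (x j' - c) 0 (s j).
        have := sP j; have := sP j'; rewrite -ss.
        case: (leP 0 ((x j - c) 0 (s j))) sgn => [p|p] /esym q; rewrite ?q.
          by rewrite !ger0_norm // => -> ->.
        by rewrite !ltr0_norm // ?ltNge ?q // => <- /eqP; rewrite eqr_opp => /eqP.
      by rewrite !mxE => /addIr ->; rewrite subrr.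
    have := congr1 (fun f : {ffun _} => nat_of_ord (f k)) tt; rewrite !ffunE.
    rewrite !inordK ?ltnS; last 2 first.
    - by rewrite -(ler_nat R) (le_trans _ (tle j' (lift (s j) k))) // truncn_le.
    - by rewrite -(ler_nat R) (le_trans _ (tle j (lift (s j) k))) // truncn_le.
    move=> trE.
    have /andP[a1 a2] := truncn_itv (t0 j (lift (s j) k)).
    have /andP[b1 b2] := truncn_itv (t0 j' (lift (s j) k)).
    rewrite trE in a1 a2.
    have tl : `|t j (lift (s j) k) - t j' (lift (s j) k)| <= 1.
      by rewrite ler_norml; move: a1 a2 b1 b2; rewrite -!natr1; lra.
    have -> : (x j - x j') 0 (lift (s j) k) =
        2 * r / (C * K)%:R * (t j (lift (s j) k) - t j' (lift (s j) k)).
      rewrite /t -mulrBl -mulrBl !mxE; field.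
      by rewrite !gt_eqF // -?natr1 ?ltr0n //; rewrite -?natrM ?natr1 ?ltr0n.
    rewrite normrM ger0_norm ?divr_ge0 ?mulr_ge0 ?(ltW r0) //.
    by rewrite ler_piMr // divr_ge0 ?mulr_ge0 // ltW.
  have : `|v j - v j'| < eta / K%:R.
    have [_ <-] := xP j; have [_ <-] := xP j'.
    rewrite (le_lt_trans (hL _ _)) // (le_lt_trans (ler_wpM2l L0 close)) //.
    have -> : L * (2 * r / (C * K)%:R) = 2 * r * L / C%:R / K%:R.
      by rewrite natrM; field; rewrite !pnatr_eq0.
    rewrite ltr_pM2r ?invr_gt0 // ltr_pdivrMr ?ltr0n // [ltRHS]mulrC.
    by rewrite -ltr_pdivrMr.
  move=> vv; apply/ffunP => i; apply: val_inj; apply/eqP; apply: contraT => ne.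
  move: vv; rewrite ltNge => /negP[].
  apply: le_trans (mx_entry_norm _ 0 i); rewrite !mxE -mulrBl -mulrBr !normrM normfV.
  rewrite (gtr0_norm K0) (gtr0_norm eta0) ler_pM2r ?invr_gt0 //.
  rewrite -[leLHS]mulr1 ler_pM2l //.
  move: ne; rewrite neq_ltn => /orP[] lt; rewrite ler_normr.
    by apply/orP; right; rewrite opprB lerBrDr -(natrD _ 1) ler_nat.
  by apply/orP; left; rewrite lerBrDr -(natrD _ 1) ler_nat.
have := leq_card cell cell_inj.
rewrite card_ffun !card_prod card_ffun !card_ord card_bool.
have : (d.+1 * 2 * (C * K).+1 ^ d <= K.-1 * K ^ d)%N.
  have -> : K.-1 = (2 * d.+1 * (2 * C) ^ d)%N by [].
  rewrite -[leqRHS]mulnA -expnMn [(d.+1 * 2)%N]mulnC leq_mul2l; apply/orP; right.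
  case: (d) => // d'; rewrite leq_exp2r // -mulnA mul2n -addnn -addn1 leq_add2l.
  by rewrite muln_gt0.
move=> h1 h2; have := leq_trans h2 h1; rewrite expnS leq_mul2r expn_eq0 /=.
by rewrite ltnn.
Qed.

(** Substitute for Sard's lemma: with H a Lipschitz approximation of g and v a small value that H
    misses on the sphere, g + f is H - v. *)
Lemma sphere_perturbation d (K : set 'rV[R]_d.+1) (g : 'rV[R]_d.+1 -> 'rV[R]_d.+1)
    c r e : compact K -> {within K, continuous g} -> 0 < r -> 0 < e ->
  exists f : 'rV[R]_d.+1 -> 'rV[R]_d.+1, [/\ {within K, continuous f},
    forall x, K x -> `|f x| <= e &
    forall x, K x -> `|x - c| = r -> g x + f x <> 0].
Proof.
move=> cK cg r0 e0.
have [->|K0] := eqVneq K set0.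
  exists (fun=> 0); split => // x; exact: cvg_cst.
have {}K0 : K !=set0 by exact/set0P.
have e20 : 0 < e / 2 by rewrite divr_gt0.
have /choice[L /choice[h hP]] : forall i : 'I_d.+1, exists L (h : 'rV[R]_d.+1 -> R),
    [/\ 0 <= L, forall x y, `|h x - h y| <= L * `|x - y| &
      forall x, K x -> `|h x - g x 0 i| <= e / 2].
  move=> i; apply: lipschitz_approx => //.
  apply/subspace_continuousP => x Kx; move/subspace_continuousP : cg => /(_ x Kx).
  by move=> /cvg_mxP; exact.
pose H x : 'rV[R]_d.+1 := \row_i h i x.
have L0 : 0 <= \sum_i L i by rewrite sumr_ge0 // => i _; have [] := hP i.
have HL x y : `|H x - H y| <= (\sum_i L i) * `|x - y|.
  apply: mx_norm_le => [|a i]; first by rewrite mulr_ge0.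
  rewrite !mxE; have [_ hi _] := hP i; rewrite (le_trans (hi x y)) // ler_wpM2r //.
  by rewrite (bigD1 i) //= lerDl sumr_ge0 // => j _; have [] := hP j.
have [v ve vP] := sphere_lipschitz_image c L0 HL r0 e20.
exists (fun x => H x - v - g x); split=> [|x Kx|x Kx xr]; last first.
- by rewrite addrC subrK => /eqP; rewrite subr_eq0 => /eqP; exact: vP.
- apply: mx_norm_le => [|a i]; first exact: ltW.
  rewrite ord1 !mxE; have [_ _ /(_ x Kx) hx] := hP i.
  have := le_trans (mx_entry_norm v 0 i) ve; move: hx.
  by rewrite !ler_norml => /andP[? ?] /andP[? ?]; apply/andP; split; lra.
move=> x; apply: cvgB; last exact: cg.
apply: cvgB; last exact: cvg_cst.
suff : continuous H by move=> cH; exact: (continuous_subspaceT cH).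
move=> y; apply/(@cvgrPdist_lt _ _ _ (nbhs y) (nbhs_filter y)) => eta eta0.
have L1 : 0 < \sum_i L i + 1 by rewrite ltr_pwDr.
apply/nbhs_mxP; exists (eta / (\sum_i L i + 1)) => /=; first by rewrite divr_gt0.
move=> z /= yz; apply: le_lt_trans (HL y z) _.
apply: (@le_lt_trans _ _ ((\sum_i L i + 1) * `|y - z|)).
  by rewrite ler_wpM2r // lerDl.
by rewrite mulrC -ltr_pdivlMr.
Qed.

End LipschitzPerturbation.

(** * Quadratic forms and singular values *)

Section Euclidean.
Context {R : realType}.

Definition nsq m (v : 'cV[R]_m) : R := (v^T *m v) 0 0.

Lemma nsqE m (v : 'cV[R]_m) : nsq v = \sum_i v i 0 ^+ 2.
Proof. by rewrite /nsq mxE; apply: eq_bigr => i _; rewrite mxE expr2. Qed.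

Lemma nsq_ge0 m (v : 'cV[R]_m) : 0 <= nsq v.
Proof. by rewrite nsqE sumr_ge0 // => i _; rewrite sqr_ge0. Qed.

Lemma nsq_eq0 m (v : 'cV[R]_m) : (nsq v == 0) = (v == 0).
Proof.
apply/eqP/eqP => [|->]; last by rewrite /nsq mulmx0 mxE.
rewrite nsqE => /eqP; rewrite psumr_eq0 => [/allP v0|i _]; last exact: sqr_ge0.
apply/matrixP => i j; rewrite ord1 mxE; apply/eqP.
by have := v0 i; rewrite mem_index_enum sqrf_eq0 => /(_ isT).
Qed.

Lemma nsq_gt0 m (v : 'cV[R]_m) : (0 < nsq v) = (v != 0).
Proof. by rewrite lt_def nsq_ge0 andbT nsq_eq0. Qed.

Lemma nsqZ m a (v : 'cV[R]_m) : nsq (a *: v) = a ^+ 2 * nsq v.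
Proof. by rewrite /nsq trmxZ -scalemxAl -scalemxAr scalerA mxE expr2. Qed.

Lemma nsqD_le m (v w : 'cV[R]_m) : nsq (v + w) <= 2 * nsq v + 2 * nsq w.
Proof.
rewrite !nsqE !mulr_sumr -big_split /= ler_sum // => i _; rewrite !mxE.
have := sqr_ge0 (v i 0 - w i 0); nra.
Qed.

Lemma nsq_norm m (v : 'cV[R]_m) : nsq v <= m%:R * `|v| ^+ 2.
Proof.
rewrite nsqE; have -> : m%:R * `|v| ^+ 2 = \sum_(i < m) `|v| ^+ 2.
  by rewrite sumr_const card_ord mulr_natl.
by apply: ler_sum => i _; rewrite -[leLHS]real_normK ?num_real // lerXn2r ?nnegrE ?mx_entry_norm.
Qed.

Lemma norm_nsq m (v : 'cV[R]_m) : `|v| ^+ 2 <= nsq v.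
Proof.
suff h : `|v| <= Num.sqrt (nsq v).
  by rewrite -(sqr_sqrtr (nsq_ge0 v)) lerXn2r ?nnegrE ?sqrtr_ge0.
apply: mx_norm_le => [|i j]; first exact: sqrtr_ge0.
rewrite -sqrtr_sqr ler_sqrt ?nsq_ge0 // nsqE ord1 (bigD1 i) //= lerDl.
by rewrite sumr_ge0 // => k _; rewrite sqr_ge0.
Qed.

(** A crude bound for the square of the operator norm; the summand 1 makes it positive. *)
Definition opbound m (A : 'M[R]_m) : R := m%:R ^+ 3 * `|A| ^+ 2 + 1.

Lemma opbound_gt0 m (A : 'M[R]_m) : 0 < opbound A.
Proof. by rewrite ltr_wpDl // mulr_ge0 ?exprn_ge0. Qed.

Lemma nsq_mul_le m (A : 'M[R]_m) v : nsq (A *m v) <= opbound A * nsq v.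
Proof.
apply: (@le_trans _ _ (m%:R ^+ 3 * `|A| ^+ 2 * nsq v)); last first.
  by rewrite ler_wpM2r ?nsq_ge0 // lerDl.
rewrite (le_trans (nsq_norm _)) //.
apply: (@le_trans _ _ (m%:R * (m%:R * `|A| * `|v|) ^+ 2)).
  by rewrite ler_wpM2l // lerXn2r ?nnegrE ?mulr_ge0 // mx_norm_mul.
have -> : m%:R * (m%:R * `|A| * `|v|) ^+ 2 = m%:R ^+ 3 * `|A| ^+ 2 * `|v| ^+ 2 by ring.
by rewrite ler_wpM2l ?mulr_ge0 ?exprn_ge0 // norm_nsq.
Qed.

Lemma form_eval_norm m (q : 'M[R]_m) v :
  `|form_eval q v v| <= m%:R ^+ 2 * `|q| * nsq v.
Proof.
rewrite /form_eval -mulmxA.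
rewrite (le_trans (mx_entry_norm _ 0 0)) // (le_trans (mx_norm_mul _ _)) //.
rewrite mx_norm_tr (@le_trans _ _ (m%:R * `|v| * (m%:R * `|q| * `|v|))) //.
  by rewrite ler_wpM2l ?mulr_ge0 // mx_norm_mul.
have -> : m%:R * `|v| * (m%:R * `|q| * `|v|) = m%:R ^+ 2 * `|q| * `|v| ^+ 2 by ring.
by rewrite ler_wpM2l ?mulr_ge0 ?exprn_ge0 // norm_nsq.
Qed.

Lemma form_evalD m (p q : 'M[R]_m) v : form_eval (p + q) v v = form_eval p v v + form_eval q v v.
Proof. by rewrite /form_eval mulmxDr mulmxDl mxE. Qed.

Lemma form_evalZ m a (q : 'M[R]_m) v : form_eval (a *: q) v v = a * form_eval q v v.
Proof. by rewrite /form_eval -scalemxAr -scalemxAl mxE. Qed.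

Lemma form_evalB m (p q : 'M[R]_m) v : form_eval (p - q) v v = form_eval p v v - form_eval q v v.
Proof. by rewrite form_evalD -scaleN1r form_evalZ mulN1r. Qed.

Lemma form_evalvZ m (q : 'M[R]_m) a v : form_eval q (a *: v) (a *: v) = a ^+ 2 * form_eval q v v.
Proof.
by rewrite /form_eval trmxZ -!scalemxAl -scalemxAr scalerA mxE expr2.
Qed.

Lemma form_eval1 m (v : 'cV[R]_m) : form_eval 1%:M v v = nsq v.
Proof. by rewrite /form_eval mulmx1. Qed.

Lemma form_eval_act m (g q : 'M[R]_m) v :
  form_eval (form_act g q) v v = form_eval q (invmx g *m v) (invmx g *m v).
Proof. by rewrite /form_eval /form_act trmx_mul !mulmxA. Qed.

Lemma form_eval_mul m (q A : 'M[R]_m) v :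
  form_eval (A^T *m q *m A) v v = form_eval q (A *m v) (A *m v).
Proof. by rewrite /form_eval trmx_mul !mulmxA. Qed.

Lemma row_nsq m (v : 'rV[R]_m) : (v *m v^T) 0 0 = nsq v^T.
Proof. by rewrite /nsq trmxK. Qed.

Lemma quad_lin_eq0 (a b : R) : (forall t, 0 <= t * a + t ^+ 2 * b) -> a = 0.
Proof.
move=> H; apply/eqP; apply: contraT => a0.
pose c := `|b| + 1; have c0 : 0 < c by rewrite ltr_wpDl.
have bc : b < c by rewrite (le_lt_trans (ler_norm b)) // ltrDl.
have := H (- a / c).
have -> : - a / c * a + (- a / c) ^+ 2 * b = (a ^+ 2 / c) * (b / c - 1).
  by field; rewrite gt_eqF.
rewrite leNgt pmulr_rlt0 ?divr_gt0 ?exprn_even_gt0 //.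
by rewrite subr_lt0 ltr_pdivrMr // mul1r bc.
Qed.

Lemma mx11_form m (u v : 'rV[R]_m) (S : 'M[R]_m) : S^T = S ->
  (u *m S *m v^T) 0 0 = (v *m S *m u^T) 0 0.
Proof.
move=> sS; have -> : u *m S *m v^T = (v *m S *m u^T)^T.
  by rewrite !trmx_mul trmxK sS mulmxA.
by rewrite mxE.
Qed.

(** Eigenvectors are found one at a time as maximum points of the quadratic form on the unit vectors
    orthogonal to the rows of [Ob]. The last clause bounds the form on that complement and keeps the
    eigenvalues in decreasing order. *)
Lemma spectral_partial m (S : 'M[R]_m) : S^T = S -> forall k, (k <= m)%N ->
  exists (Ob : 'M[R]_(k, m)) (D : 'rV[R]_k), [/\ Ob *m Ob^T = 1%:M,
    Ob *m S = diag_mx D *m Ob, forall i j : 'I_k, (i <= j)%N -> D 0 j <= D 0 i &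
    forall v : 'rV_m, v *m Ob^T = 0 -> forall i, (v *m S *m v^T) 0 0 <= D 0 i * (v *m v^T) 0 0].
Proof.
move=> sS; elim=> [_|k IH km].
  exists 0, 0; split; [by rewrite flatmx0 [RHS]flatmx0|by rewrite flatmx0 [RHS]flatmx0| |].
    by case.
  by move=> v _ [].
have [Ob [D [OO OS sD Dmax]]] := IH (ltnW km).
pose W := [set v : 'rV[R]_m | v *m Ob^T = 0 /\ (v *m v^T) 0 0 = 1].
have cW : compact W.
  apply: bounded_closed_compact_mx.
    exists 1 => v [_ v1]; have := norm_nsq v^T; rewrite -row_nsq v1 mx_norm_tr.
    by move=> h; rewrite -(@ler_pXn2r _ 2) ?nnegrE // expr1n.
  have -> : W = [set v | v *m Ob^T = 0] `&` [set v | (v *m v^T) 0 0 = 1] by [].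
  apply: closedI.
    by apply: closed_fun_mx0; apply: continuous_mulmx; [exact: continuous_self|exact: continuous_const].
  apply: closed_fun_eq; apply: continuous_entry; apply: continuous_mulmx.
    exact: continuous_self.
  by apply: continuous_trmx; exact: continuous_self.
have [w0 w0O w0n] : exists2 w : 'rV[R]_m, w *m Ob^T = 0 & w != 0.
  have : (kermx Ob^T != 0)%MS.
    by rewrite -mxrank_eq0 mxrank_ker subn_eq0 -ltnNge (leq_ltn_trans (rank_leq_col _)).
  by move=> /rowV0Pn[w /sub_kermxP wO w0]; exists w.
have homog (v : 'rV[R]_m) : v != 0 -> exists2 c : R, 0 < c & ((c *: v) *m (c *: v)^T) 0 0 = 1.
  move=> v0; have n0 : 0 < nsq v^T.
    by rewrite nsq_gt0; apply: contraNneq v0 => /(congr1 trmx); rewrite trmxK trmx0 => ->.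
  exists (Num.sqrt (nsq v^T))^-1; first by rewrite invr_gt0 sqrtr_gt0.
  rewrite row_nsq trmxZ nsqZ exprVn sqr_sqrtr ?nsq_ge0 // mulVf //.
  by rewrite gt_eqF.
have W0 : W !=set0.
  have [c c0 cv] := homog _ w0n; exists (c *: w0); split => //.
  by rewrite -scalemxAl w0O scaler0.
have cS : {within W, continuous (fun v : 'rV[R]_m => (v *m S *m v^T) 0 0)}.
  apply: continuous_subspaceT; apply: continuous_entry.
  apply: continuous_mulmx; last by apply: continuous_trmx; exact: continuous_self.
  by apply: continuous_mulmx; [exact: continuous_self|exact: continuous_const].
have [v1 v1W vmax] := compact_EVT_max W0 cW cS.
move: v1W; rewrite inE => -[v1O v11]; set l := (v1 *m S *m v1^T) 0 0.
have lP (v : 'rV[R]_m) : v *m Ob^T = 0 -> (v *m S *m v^T) 0 0 <= l * (v *m v^T) 0 0.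
  move=> vO; have [->|v0] := eqVneq v 0; first by rewrite !mul0mx mxE mulr0.
  have [c c0 cv] := homog _ v0.
  have Wcv : c *: v \in W by rewrite inE; split => //; rewrite -scalemxAl vO scaler0.
  have := vmax _ Wcv.
  have E (A : 'M[R]_1) a : (a *: A) 0 0 = a * A 0 0 by rewrite mxE.
  move: cv; rewrite trmxZ -!scalemxAl -!scalemxAr !scalerA !E -/l => cv h.
  by rewrite -(ler_pM2l (mulr_gt0 c0 c0)) (le_trans h) // mulrCA cv mulr1.
have v1S : v1 *m S = l *: v1.
  (* Up to a factor, w is the gradient of the form along the sphere at the maximum point. It is
     orthogonal to the rows of [Ob], so the variation in its direction is allowed and vanishes at
     first order. *)
  pose w := v1 *m S - l *: v1.
  have wO : w *m Ob^T = 0.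
    rewrite mulmxBl -scalemxAl v1O scaler0 subr0 -mulmxA -{1}sS -trmx_mul OS.
    by rewrite trmx_mul mulmxA v1O mul0mx.
  have wS : (w *m S *m v1^T) 0 0 - l * (w *m v1^T) 0 0 = nsq w^T.
    have E (A B : 'M[R]_1) : (A - l *: B) 0 0 = A 0 0 - l * B 0 0 by rewrite !mxE.
    by rewrite -row_nsq {3}/w linearB /= trmxZ trmx_mul sS mulmxBr -scalemxAr mulmxA E.
  have wE : w = v1 *m S - l *: v1 by [].
  clearbody w; have : - (2 * nsq w^T) = 0.
    apply: (@quad_lin_eq0 _ (l * (w *m w^T) 0 0 - (w *m S *m w^T) 0 0)) => t.
    have tO : (v1 + t *: w) *m Ob^T = 0 by rewrite mulmxDl v1O -scalemxAl wO scaler0 addr0.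
    have := lP _ tO; rewrite -subr_ge0 -wS.
    have := mx11_form v1 w sS; have := mx11_form v1 w (trmx1 R m).
    have -> : (v1 + t *: w)^T = v1^T + t *: w^T by rewrite linearD /= trmxZ.
    rewrite !mulmx1 !mulmxDl !mulmxDr -!scalemxAl -!scalemxAr !scalerA.
    have E (A B C F : 'M[R]_1) a b c :
      (A + a *: B + (b *: C + c *: F)) 0 0 = A 0 0 + a * B 0 0 + (b * C 0 0 + c * F 0 0).
      by rewrite !mxE.
    rewrite !E -/l v11 => -> -> h; apply: le_trans h _; rewrite le_eqVlt; apply/orP; left.
    apply/eqP; ring.
  move/eqP; rewrite oppr_eq0 mulf_eq0 pnatr_eq0 /= nsq_eq0 => /eqP/(congr1 trmx).
  by rewrite trmxK trmx0 wE => /eqP; rewrite subr_eq0 => /eqP.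
rewrite -addn1; exists (col_mx Ob v1), (row_mx D l%:M); split.
- rewrite tr_col_mx mul_col_row OO v1O (_ : v1 *m v1^T = 1%:M); last first.
    by apply/matrixP => i j; rewrite !ord1 v11 mxE.
  rewrite (_ : Ob *m v1^T = 0) -?scalar_mx_block //.
  by rewrite -[LHS]trmxK trmx_mul trmxK v1O trmx0.
- rewrite mul_col_mx OS v1S diag_mx_row mul_block_col !mul0mx addr0 add0r.
  congr col_mx; rewrite -mul_scalar_mx; congr (_ *m _).
  by apply/matrixP => i j; rewrite !ord1 !mxE.
- move=> i j; rewrite !mxE; case: (splitP j) => j' ej; case: (splitP i) => i' ei; rewrite ej ei.
  + exact: sD.
  + by rewrite leqNgt (leq_trans (ltn_ord j')) // leq_addr.
  + by rewrite ord1 mxE eqxx => _; have := Dmax _ v1O i'; rewrite v11 mulr1.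
  + by rewrite !ord1.
move=> v; rewrite tr_col_mx mul_mx_row -row_mx0 => /eq_row_mx[vO _] i.
rewrite [row_mx _ _ _ _]mxE; case: (splitP i) => i' _; first exact: Dmax.
by rewrite ord1 [l%:M _ _]mxE eqxx mulr1n; exact: lP.
Qed.

Theorem spectral_symmetric m (S : 'M[R]_m) : S^T = S ->
  exists (Ob : 'M[R]_m) (D : 'rV[R]_m), [/\ Ob *m Ob^T = 1%:M, Ob^T *m Ob = 1%:M,
    S = Ob^T *m diag_mx D *m Ob & forall i j : 'I_m, (i <= j)%N -> D 0 j <= D 0 i].
Proof.
move=> sS; have [Ob [D [OO OS sD _]]] := spectral_partial sS (leqnn m).
have OO' := mulmx1C OO; exists Ob, D; split => //.
by rewrite -mulmxA -OS mulmxA OO' mul1mx.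
Qed.

End Euclidean.

(** * Singular values and the minimax principle *)

Section SingularValues.
Context {R : realType}.

Lemma orth_nsq m (Ob : 'M[R]_m) v : Ob^T *m Ob = 1%:M -> nsq (Ob *m v) = nsq v.
Proof. by move=> OO; rewrite /nsq trmx_mul mulmxA -(mulmxA _ _ Ob) OO mulmx1. Qed.

Lemma spectral_form m (S Ob : 'M[R]_m) (D : 'rV[R]_m) v :
  S = Ob^T *m diag_mx D *m Ob ->
  form_eval S v v = \sum_i D 0 i * (Ob *m v) i 0 ^+ 2.
Proof.
move=> ->; rewrite form_eval_mul /form_eval -mulmxA mul_diag_mx mxE.
by apply: eq_bigr => i _; rewrite !mxE mulrCA expr2.
Qed.

Lemma char_poly_spectral m (Ob : 'M[R]_m) (D : 'rV[R]_m) :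
  Ob *m Ob^T = 1%:M ->
  char_poly (Ob^T *m diag_mx D *m Ob) = \prod_i ('X - (D 0 i)%:P).
Proof.
move=> OO; have OO' := mulmx1C OO.
have -> : char_poly (Ob^T *m diag_mx D *m Ob) = char_poly (diag_mx D).
  rewrite /char_poly /char_poly_mx.
  have -> : 'X%:M - map_mx polyC (Ob^T *m diag_mx D *m Ob) =
     map_mx polyC Ob^T *m ('X%:M - map_mx polyC (diag_mx D)) *m map_mx polyC Ob.
    rewrite mulmxBr mulmxBl !map_mxM; congr (_ - _).
    by rewrite mul_mx_scalar -scalemxAl -map_mxM OO' map_mx1 scalemx1.
  rewrite !det_mulmx mulrAC -det_mulmx -map_mxM OO' map_mx1 det1 mul1r //.
rewrite char_poly_trig ?diag_mx_is_trig //.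
by apply: eq_bigr => i _; rewrite mxE eqxx.
Qed.

Lemma gram_form m (B : 'M[R]_m) v : form_eval (B^T *m B) v v = nsq (B *m v).
Proof. by rewrite -[B^T]mulmx1 form_eval_mul form_eval1. Qed.

(** [singular_values] is chosen by [xget]; the square roots of the eigenvalues of B^T B show that a
    choice exists, and the characteristic polynomial together with the ordering identifies the
    chosen list with them. *)
Lemma singular_values_spectral m (B : 'M[R]_m) :
  exists (Ob : 'M[R]_m) (D : 'rV[R]_m), [/\ Ob *m Ob^T = 1%:M, Ob^T *m Ob = 1%:M,
    forall v, nsq (B *m v) = \sum_i D 0 i * (Ob *m v) i 0 ^+ 2,
    forall i j : 'I_m, (i <= j)%N -> D 0 j <= D 0 i &
    forall i : 'I_m, 0 <= (singular_values B)`_i /\ (singular_values B)`_i ^+ 2 = D 0 i].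
Proof.
have sS : (B^T *m B)^T = B^T *m B by rewrite trmx_mul trmxK.
have [Ob [D [OO OO' SE sD]]] := spectral_symmetric sS.
have nE v : nsq (B *m v) = \sum_i D 0 i * (Ob *m v) i 0 ^+ 2.
  by rewrite -gram_form (spectral_form v SE).
exists Ob, D; split => //.
have D0 i : 0 <= D 0 i.
  have := nsq_ge0 (B *m (Ob^T *m delta_mx i 0)); rewrite nE.
  rewrite (bigD1 i) //= big1 ?addr0 => [|j ji]; rewrite mulmxA OO mul1mx !mxE !eqxx.
    by rewrite expr1n mulr1.
  by rewrite (negPf ji) expr0n mulr0.
pose s0 := [seq Num.sqrt (D 0 i) | i <- enum 'I_m].
have sorted_of (s : seq R) : size s = m ->
    (forall i j : 'I_m, (i <= j)%N -> s`_j <= s`_i) -> sorted >=%R s.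
  move=> ss H; apply/(sortedP 0) => i; rewrite ss => im.
  exact: (H (Ordinal (ltnW im)) (Ordinal im) (leqnSn i)).
have nths0 (i : 'I_m) : s0`_i = Num.sqrt (D 0 i).
  by rewrite (nth_map i) ?size_enum_ord // nth_ord_enum.
have s0P : is_singular_values B s0.
  split.
  - apply: sorted_of => [|i j ij]; first by rewrite size_map size_enum_ord.
    by rewrite !nths0 ler_wsqrtr // sD.
  - by apply/allP => _ /mapP[i _ ->]; exact: sqrtr_ge0.
  - rewrite SE char_poly_spectral // big_map big_enum /=.
    by apply: eq_bigr => i _; rewrite sqr_sqrtr.
have : is_singular_values B (singular_values B).
  by apply: (xgetPex [::]); exists s0.
move: (singular_values B) => s [ss sge sch] i.
pose s2 := [seq x ^+ 2 | x <- s].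
have pe : perm_eq s2 [seq D 0 i | i <- enum 'I_m].
  apply: prod_XsubC_eq; rewrite [LHS]big_map [RHS]big_map -sch SE.
  by rewrite char_poly_spectral // [RHS]big_enum.
have nthD (j : 'I_m) : [seq D 0 i | i <- enum 'I_m]`_j = D 0 j.
  by rewrite (nth_map i) ?size_enum_ord // nth_ord_enum.
have sE : s2 = [seq D 0 i | i <- enum 'I_m].
  apply: (@sorted_eq _ >=%R) pe.
  - by move=> x y z xy yz; exact: le_trans yz xy.
  - by move=> x y; rewrite andbC; exact: le_anti.
  - rewrite sorted_map; apply: (@sub_in_sorted _ (fun x => 0 <= x)) ss => // x y x0 y0 /=.
    by move=> yx; rewrite lerXn2r ?nnegrE.
  - apply: sorted_of => [|j k jk]; first by rewrite size_map size_enum_ord.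
    by rewrite !nthD sD.
have sm : size s = m by rewrite -(size_map (fun x => x ^+ 2)) -/s2 sE size_map size_enum_ord.
split; first by apply: (allP sge); rewrite mem_nth // sm.
have := congr1 (fun t : seq R => t`_i) sE.
by rewrite /= nthD (nth_map 0) ?sm.
Qed.

Variable n : nat.
Hypothesis n_gt0 : (0 < n)%N.
Implicit Types B : 'M[R]_(n + n).

Lemma sigma_ge0 B : 0 <= sigma n B /\ 0 <= sigma n.+1 B.
Proof.
have [Ob [D [_ _ _ _ H]]] := singular_values_spectral B.
have i1 : (n.-1 < n + n)%N by lia.
have i2 : (n < n + n)%N by lia.
by split; [have [] := H (Ordinal i1)|have [] := H (Ordinal i2)].
Qed.

(** These are n-1 linear conditions on n unknowns: the row [i0] is replaced by zero, which kills the
    determinant. *)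
Lemma exists_kernel_vector (C : 'M[R]_n) (i0 : 'I_n) :
  exists2 w : 'cV[R]_n, w != 0 & forall i, i != i0 -> (C *m w) i 0 = 0.
Proof.
pose C' : 'M[R]_n := \matrix_(i, j) if i == i0 then 0 else C i j.
have : \det C'^T == 0.
  rewrite det_tr (expand_det_row _ i0) big1 // => j _.
  by rewrite mxE eqxx mul0r.
move=> /det0P[v v0 vC]; exists v^T.
  by apply: contraNneq v0 => /(congr1 trmx); rewrite trmxK trmx0 => ->.
move=> i ii0; have := congr1 (fun M : 'rV_n => M 0 i) vC; rewrite !mxE => vC0.
by rewrite -[RHS]vC0; apply: eq_bigr => j _; rewrite !mxE (negPf ii0) mulrC.
Qed.

(** Courant-Fischer: the n-dimensional image of N contains a nonzero vector of the span of the first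
    n+1 right singular vectors, since only n-1 coordinates have to vanish. *)
Lemma sigma_minimax_le B (N : 'M[R]_(n + n, n)) a :
  (forall w : 'cV_n, N *m w = 0 -> w = 0) ->
  (forall w : 'cV_n, nsq (B *m (N *m w)) <= a * nsq (N *m w)) ->
  sigma n.+1 B ^+ 2 <= a.
Proof.
move=> Ninj NB; have [Ob [D [OO OO' BE sD sv]]] := singular_values_spectral B.
have i2 : (n < n + n)%N by lia.
have [_] := sv (Ordinal i2); rewrite /sigma /= => ->; set l := D _ _.
have [w w0 wP] := exists_kernel_vector (dsubmx (Ob *m N)) (Ordinal n_gt0).
set v := N *m w.
have v0 : 0 < nsq v by rewrite nsq_gt0; apply: contraNneq w0 => /Ninj ->.
rewrite -(ler_pM2r v0) (le_trans _ (NB w)) // BE -(orth_nsq v OO') nsqE mulr_sumr.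
apply: ler_sum => i _; case: (leqP i n) => [ni|ni].
  by rewrite ler_wpM2r ?sqr_ge0 // sD.
have [k ik] : exists k, i = rshift n k.
  have kn : (i - n < n)%N by have := ltn_ord i; lia.
  by exists (Ordinal kn); apply: val_inj; rewrite /= subnKC // ltnW.
have k0 : k != Ordinal n_gt0.
  by apply/eqP => k0; move: ni; rewrite ik k0 /= addn0 ltnn.
suff -> : (Ob *m v) i 0 = 0 by rewrite expr0n !mulr0.
by rewrite /v mulmxA ik -(wP k k0) !mxE; apply: eq_bigr => j _; rewrite [in RHS]mxE.
Qed.

(** Dual to [sigma_minimax_le]: some nonzero vector of the image of N lies in the span of the right
    singular vectors from the n-th on. *)
Lemma sigma_minimax_ge B (N : 'M[R]_(n + n, n)) a :
  (forall w : 'cV_n, N *m w = 0 -> w = 0) ->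
  (forall w : 'cV_n, a * nsq (N *m w) <= nsq (B *m (N *m w))) ->
  a <= sigma n B ^+ 2.
Proof.
move=> Ninj NB; have [Ob [D [OO OO' BE sD sv]]] := singular_values_spectral B.
have i1 : (n.-1 < n + n)%N by lia.
have [_] := sv (Ordinal i1); rewrite /sigma /= => ->; set l := D _ _.
have kn : (n.-1 < n)%N by lia.
have [w w0 wP] := exists_kernel_vector (usubmx (Ob *m N)) (Ordinal kn).
set v := N *m w.
have v0 : 0 < nsq v by rewrite nsq_gt0; apply: contraNneq w0 => /Ninj ->.
rewrite -(ler_pM2r v0) (le_trans (NB w)) // BE -(orth_nsq v OO') nsqE mulr_sumr.
apply: ler_sum => i _; case: (leqP n.-1 i) => [ni|ni].
  by rewrite ler_wpM2r ?sqr_ge0 // sD.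
have [k ik] : exists k, i = lshift n k.
  have kn' : (i < n)%N by lia.
  by exists (Ordinal kn'); apply: val_inj.
have k0 : k != Ordinal kn.
  by apply/eqP => k0; move: ni; rewrite ik k0 /= ltnn.
suff -> : (Ob *m v) i 0 = 0 by rewrite expr0n !mulr0.
by rewrite /v mulmxA ik -(wP k k0) !mxE; apply: eq_bigr => j _; rewrite [in RHS]mxE.
Qed.

(* The orthogonal projector onto the span of the last n right singular
   vectors, together with a frame of its image. *)
Lemma small_projector B : exists (P : 'M[R]_(n + n)) (U : 'M[R]_(n + n, n)),
  [/\ P^T = P, P *m P = P, P *m U = U,
    (forall w : 'cV_n, U *m w = 0 -> w = 0) &
    [/\ forall v, nsq (B *m (P *m v)) <= sigma n.+1 B ^+ 2 * nsq (P *m v),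
    forall v, sigma n B ^+ 2 * nsq (v - P *m v) <= nsq (B *m v) &
    forall v, nsq v = nsq (P *m v) + nsq (v - P *m v)]].
Proof.
have [Ob [D [OO OO' BE sD sv]]] := singular_values_spectral B.
have i1 : (n.-1 < n + n)%N by lia.
have i2 : (n < n + n)%N by lia.
have [_] := sv (Ordinal i1); rewrite /sigma /= => ->; set l1 := D _ _.
have [l20] := sv (Ordinal i2); move=> /= e2; set l2 := D _ _ in e2.
pose E : 'M[R]_(n + n) := block_mx 0 0 0 1%:M.
pose P := Ob^T *m E *m Ob.
have Ee (v : 'cV[R]_(n + n)) i : (E *m v) i 0 = if (n <= i)%N then v i 0 else 0.
  rewrite /E -[v]vsubmxK mul_block_col !mul0mx mul1mx !add0r.
  case: (splitP i) => k ik.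
    have -> : i = lshift n k by exact: val_inj.
    by rewrite !col_mxEu mxE /= leqNgt ltn_ord.
  have -> : i = rshift n k by exact: val_inj.
  by rewrite !col_mxEd /= leq_addr.
have EE : E *m E = E.
  by rewrite /E mulmx_block !mul0mx !mulmx0 mul1mx !addr0 add0r.
have OP v : Ob *m (P *m v) = E *m (Ob *m v) by rewrite /P 2!mulmxA !mulmxA OO mul1mx -!mulmxA.
have PE v : nsq (P *m v) = \sum_(i < n + n) (if (n <= i)%N then (Ob *m v) i 0 ^+ 2 else 0).
  rewrite -(orth_nsq _ OO') OP nsqE; apply: eq_bigr => i _; rewrite Ee.
  by case: ifP => // _; rewrite expr0n.
have PcE v : nsq (v - P *m v) = \sum_(i < n + n) (if (n <= i)%N then 0 else (Ob *m v) i 0 ^+ 2).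
  rewrite -(orth_nsq _ OO') mulmxBr OP nsqE; apply: eq_bigr => i _.
  have E2 (a b : 'cV[R]_(n + n)) : (a - b) i 0 = a i 0 - b i 0 by rewrite !mxE.
  by rewrite E2 Ee; case: ifP => _; rewrite ?subrr ?subr0 // expr0n.
have ET : E^T = E by rewrite /E tr_block_mx !trmx0 trmx1.
exists P, (Ob^T *m col_mx 0 1%:M); split.
- by rewrite /P !trmx_mul trmxK ET mulmxA.
- by rewrite /P !mulmxA -[_ *m Ob *m Ob^T]mulmxA OO mulmx1 -[_ *m E *m E]mulmxA EE.
- rewrite /P !mulmxA -[_ *m Ob *m Ob^T]mulmxA OO mulmx1 -mulmxA /E mul_block_col.
  by rewrite !mul0mx mul1mx !add0r.
- move=> w; rewrite -mulmxA => /(congr1 (mulmx Ob)); rewrite mulmxA OO mul1mx mulmx0.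
  rewrite mul_col_mx mul1mx mul0mx -col_mx0 => /eq_col_mx[_ ->] //.
- split=> v.
  + rewrite BE PE OP mulr_sumr; apply: ler_sum => i _; rewrite Ee.
    case: leqP => ni; last by rewrite expr0n !mulr0.
    by rewrite e2 ler_wpM2r ?sqr_ge0 // sD.
  + rewrite BE PcE mulr_sumr; apply: ler_sum => i _; case: leqP => ni.
      rewrite mulr0 mulr_ge0 ?sqr_ge0 //.
      by have [_ <-] := sv i; rewrite sqr_ge0.
    by rewrite ler_wpM2r ?sqr_ge0 // sD //=; lia.
  + rewrite PE PcE -(orth_nsq v OO') nsqE -big_split /=; apply: eq_bigr => i _.
    by case: ifP; rewrite ?addr0 ?add0r.
Qed.

End SingularValues.

(** * The trace pairing and positive semidefinite forms *)

Section PositiveForms.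
Context {R : realType}.
Variable m : nat.
Implicit Types (b q : 'M[R]_m) (P : 'M[R]_(m * m)).

(** The trace pairing, written with [mxvec] because the projectors on pencils act on vectorised
    matrices. *)
Definition mxdot b q : R := (mxvec b *m (mxvec q)^T) 0 0.

Lemma mxdotE b q : mxdot b q = \tr (b^T *m q).
Proof.
rewrite /mxdot mxE /mxtrace.
rewrite (reindex _ (curry_mxvec_bij m m)) /=.
rewrite (eq_bigr (fun ij : 'I_m * 'I_m => b ij.1 ij.2 * q ij.1 ij.2)); last first.
  by case=> i j _; rewrite mxE !mxvecE.
rewrite -(pair_bigA _ (fun i j => b i j * q i j)) exchange_big /=.
by apply: eq_bigr => j _; rewrite mxE; apply: eq_bigr => i _; rewrite mxE.
Qed.

Lemma psd_gram b : b^T = b -> (forall v, 0 <= form_eval b v v) ->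
  exists C : 'M[R]_m, b = C^T *m C.
Proof.
move=> sb b0; have [Ob [D [OO OO' bE _]]] := spectral_symmetric sb.
have D0 i : 0 <= D 0 i.
  have := b0 (Ob^T *m delta_mx i 0); rewrite (spectral_form _ bE).
  rewrite (bigD1 i) //= big1 ?addr0 => [|j ji]; rewrite mulmxA OO mul1mx !mxE !eqxx.
    by rewrite expr1n mulr1.
  by rewrite (negPf ji) expr0n mulr0.
exists (diag_mx (\row_i Num.sqrt (D 0 i)) *m Ob).
rewrite trmx_mul tr_diag_mx mulmxA -[_ *m diag_mx _ *m diag_mx _]mulmxA mulmx_diag bE.
congr (_ *m diag_mx _ *m _); apply/rowP => i; rewrite !mxE -expr2 sqr_sqrtr //.
Qed.

(** With b = C^T C, the pairing is the sum of the values of q at the rows of C. *)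
Lemma mxdot_psd_pos b q : b^T = b -> (forall v, 0 <= form_eval b v v) -> b != 0 ->
  positive_form q -> 0 < mxdot b q.
Proof.
move=> sb b0 bn0 [sq q0]; have [C bE] := psd_gram sb b0.
have qe i : (C *m q *m C^T) i i = form_eval q (row i C)^T (row i C)^T.
  by rewrite /form_eval trmxK -row_mul !mxE; apply: eq_bigr => j _; rewrite !mxE.
have qge i : 0 <= form_eval q (row i C)^T (row i C)^T.
  have [->|/q0/ltW//] := eqVneq (row i C)^T 0.
  by rewrite /form_eval mulmx0 mxE.
have -> : mxdot b q = \sum_i form_eval q (row i C)^T (row i C)^T.
  rewrite mxdotE sb bE -mulmxA mxtrace_mulC.
  by apply: eq_bigr.
rewrite lt_def sumr_ge0 ?andbT //; apply: contraNneq bn0 => s0.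
have C0 : C = 0.
  apply/row_matrixP => i; rewrite row0; apply: trmx_inj; rewrite trmx0; apply/eqP.
  apply: contraT => /q0; rewrite lt_def => /andP[/negP[]].
  by move/eqP: s0; rewrite psumr_eq0 // => /allP/(_ i (mem_index_enum i)).
by rewrite bE C0 mulmx0.
Qed.

End PositiveForms.

Section OrthogonalPSD.
Context {R : realType}.
Variable m : nat.
Implicit Types (b q : 'M[R]_m) (P : 'M[R]_(m * m)).

Lemma mxdotDl b b' q : mxdot (b + b') q = mxdot b q + mxdot b' q.
Proof. by rewrite /mxdot linearD mulmxDl mxE. Qed.

Lemma mxdotZl a b q : mxdot (a *: b) q = a * mxdot b q.
Proof. by rewrite /mxdot linearZ -scalemxAl mxE. Qed.

Lemma mxdotC b q : mxdot b q = mxdot q b.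
Proof. by rewrite !mxdotE -mxtrace_tr trmx_mul trmxK. Qed.

Lemma mxdotDr b q q' : mxdot b (q + q') = mxdot b q + mxdot b q'.
Proof. by rewrite mxdotC mxdotDl !(mxdotC b). Qed.

Lemma mxdotZr a b q : mxdot b (a *: q) = a * mxdot b q.
Proof. by rewrite mxdotC mxdotZl (mxdotC b). Qed.

Lemma mxdotBl b b' q : mxdot (b - b') q = mxdot b q - mxdot b' q.
Proof. by rewrite mxdotDl -scaleN1r mxdotZl mulN1r. Qed.

Lemma mxdot_ge0 b : 0 <= mxdot b b.
Proof. by rewrite /mxdot row_nsq nsq_ge0. Qed.

Lemma mxdot_norm b : `|b| ^+ 2 <= mxdot b b.
Proof. by rewrite /mxdot row_nsq -mxvec_norm -mx_norm_tr norm_nsq. Qed.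

Lemma mxdot_rank1 q (v : 'cV[R]_m) : q^T = q -> mxdot q (v *m v^T) = form_eval q v v.
Proof.
move=> sq; rewrite mxdotE sq mulmxA mxtrace_mulC mulmxA /form_eval.
by rewrite /mxtrace big_ord1.
Qed.

Definition psd_simplex : set 'M[R]_m :=
  [set b | [/\ b^T = b, forall v, 0 <= form_eval b v v & \tr b = 1]].

Lemma psd_simplex_compact : compact psd_simplex.
Proof.
apply: bounded_closed_compact_mx.
  exists m%:R => b [sb b0 tb]; have [C bE] := psd_gram sb b0.
  have C1 : `|C| <= 1.
    by rewrite -(@ler_pXn2r _ 2) ?nnegrE // expr1n -tb bE -mxdotE mxdot_norm.
  rewrite bE (le_trans (mx_norm_mul _ _)) // mx_norm_tr.
  by rewrite -mulrA -[leRHS]mulr1 ler_wpM2l // mulr_ile1.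
have -> : psd_simplex = [set b | b^T - b = 0] `&`
    (\bigcap_(v in [set: 'cV[R]_m]) [set b | (- form_eval b v v <= 0)%R]) `&` [set b | \tr b = 1].
  apply/seteqP; split=> b /=.
    case=> sb b0 tb; split; [split => //|by []]; first by rewrite sb subrr.
    by move=> v _ /=; rewrite oppr_le0.
  case=> -[/eqP sb b0] tb; split => //; first by apply/eqP; rewrite -subr_eq0.
  by move=> v; have := b0 v I; rewrite /= oppr_le0.
apply: closedI; first apply: closedI.
- have cT : continuous (fun b : 'M[R]_m => b^T).
    by apply: continuous_trmx; exact: continuous_self.
  apply: closed_fun_mx0 => b.
  exact: (cvgB (F := nbhs b) (cT b) (@continuous_self _ b)).
- apply: closed_bigI => v _; apply: closed_fun_le => b; apply: (cvgN (F := nbhs b)); move: b.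
  apply: continuous_entry; apply: continuous_mulmx; last exact: continuous_const.
  by apply: continuous_mulmx; [exact: continuous_const|exact: continuous_self].
- apply: closed_fun_eq => b; apply: (cvg_sum_fin (F := nbhs b)) => i; move: b.
  by apply: continuous_entry; exact: continuous_self.
Qed.

(* The point of the simplex whose projection to the pencil is smallest: were this
   projection q0 nonzero, minimality would give q0(v, v) >= |q0|^2 for every unit
   vector v, so that q0 would be a positive element of the pencil. *)
Lemma psd_orthogonal P : (0 < m)%N -> P^T = P -> P *m P = P ->
  (forall q, mxvec q *m P = mxvec q -> q^T = q /\ ~ positive_form q) ->
  exists b, [/\ b^T = b, forall v, 0 <= form_eval b v v, b != 0 & mxvec b *m P = 0].
Proof.
move=> m0 sP PP Pq.
pose pr b : 'M[R]_m := vec_mx (mxvec b *m P).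
have prE b c : mxdot (pr b) c = mxdot (pr b) (pr c).
  rewrite /mxdot /pr !vec_mxK trmx_mul sP mulmxA -[_ *m P *m P]mulmxA PP //.
have prD b c : pr (b + c) = pr b + pr c by rewrite /pr linearD mulmxDl linearD.
have prZ a b : pr (a *: b) = a *: pr b by rewrite /pr linearZ -scalemxAl linearZ.
have S0 : psd_simplex !=set0.
  exists (m%:R^-1 *: 1%:M); split.
  - by rewrite trmxZ trmx1.
  - by move=> v; rewrite form_evalZ form_eval1 mulr_ge0 ?invr_ge0 ?nsq_ge0.
  - by rewrite mxtraceZ mxtrace1 mulVf // pnatr_eq0 -lt0n.
have cpr : continuous pr.
  move=> b; apply: (cvg_vec_mx (F := nbhs b)); apply: (cvg_mulmx (F := nbhs b)).
    by apply: (cvg_mxvec (F := nbhs b)); exact: continuous_self.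
  exact: cvg_cst.
have cphi : {within psd_simplex, continuous (fun b => mxdot (pr b) (pr b))}.
  apply: continuous_subspaceT; apply: continuous_entry; apply: continuous_mulmx.
    by move=> b; apply: (cvg_mxvec (F := nbhs b)); exact: cpr.
  by apply: continuous_trmx => b /=; apply: (cvg_mxvec (F := nbhs b)); exact: cpr.
have [b0 b0S bmin] := compact_EVT_min S0 psd_simplex_compact cphi.
move: b0S; rewrite inE => -[sb b0p tb]; exists b0; split => //.
  by apply: contraPneq tb => ->; rewrite mxtrace0 => /eqP; rewrite eq_sym oner_eq0.
have [q0sym q0np] : (pr b0)^T = pr b0 /\ ~ positive_form (pr b0).
  by apply: Pq; rewrite /pr vec_mxK -mulmxA PP.
have : mxdot (pr b0) (pr b0) <= 0; last first.
  move=> h; have := le_trans (mxdot_norm (pr b0)) h.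
  rewrite exprn_even_le0 //= normr_eq0 => /eqP.
  by rewrite /pr => /(congr1 mxvec); rewrite vec_mxK linear0.
rewrite leNgt; apply/negP => phi0; apply: q0np; split => // v v0.
have n0 : 0 < nsq v by rewrite nsq_gt0.
pose c := (nsq v)^-1 *: (v *m v^T) - b0.
have step t : 0 <= t <= 1 -> psd_simplex (b0 + t *: c).
  move=> /andP[t0 t1].
  have -> : b0 + t *: c = (1 - t) *: b0 + (t / nsq v) *: (v *m v^T).
    by rewrite /c scalerBr scalerA scalerBl scale1r addrCA addrC.
  split.
  - by rewrite linearD /= !trmxZ sb trmx_mul trmxK.
  - move=> w; rewrite form_evalD !form_evalZ addr_ge0 // mulr_ge0 ?subr_ge0 ?divr_ge0 ?nsq_ge0 //.
    rewrite /form_eval mulmxA -mulmxA mxE big_ord1.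
    by rewrite -[v^T *m w]trmxK trmx_mul trmxK [X in _ * X]mxE -expr2 sqr_ge0.
  - rewrite mxtraceD !mxtraceZ tb mxtrace_mulC /mxtrace big_ord1 -/(nsq v).
    by rewrite divfK ?gt_eqF // mulr1 subrK.
have key : 0 <= mxdot (pr b0) c.
  rewrite leNgt; apply/negP => neg.
  pose N := mxdot (pr c) (pr c); have N0 : 0 <= N := mxdot_ge0 _.
  (* This t satisfies t N <= - [mxdot (pr b0) c], so the second order term cannot make up for the
     first order decrease. *)
  pose t := - mxdot (pr b0) c / (N + - mxdot (pr b0) c).
  have den : 0 < N + - mxdot (pr b0) c by rewrite ltr_wpDl // oppr_gt0.
  have t0 : 0 < t by rewrite divr_gt0 // oppr_gt0.
  have t1 : t <= 1 by rewrite ler_pdivrMr // mul1r lerDr.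
  have tS : b0 + t *: c \in psd_simplex by rewrite inE; apply: step; rewrite ltW.
  have := bmin _ tS; rewrite prD prZ mxdotDl !mxdotDr !mxdotZl !mxdotZr -/N.
  rewrite (mxdotC (pr c)) -prE -addrA lerDl -!mulrDr pmulr_rge0 // => h.
  have : t * N <= - mxdot (pr b0) c.
    have nx : 0 <= - mxdot (pr b0) c by rewrite oppr_ge0 (ltW neg).
    by rewrite /t mulrAC ler_pdivrMr // ler_wpM2l // lerDl.
  by move: h neg; rewrite -prE; lra.
move: key; rewrite /c mxdotC mxdotBl mxdotZl mxdotC mxdot_rank1 //.
rewrite [X in _ - X]mxdotC prE subr_ge0 => key.
rewrite -(pmulr_rgt0 _ (_ : 0 < (nsq v)^-1)) ?invr_gt0 //.
exact: lt_le_trans phi0 key.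
Qed.

End OrthogonalPSD.

(** * Path lifting and deck transformations *)

(** Connectedness, in the form in which uniqueness of lifts uses it. *)
Definition locally_constant_constant (X : topologicalType) :=
  forall Pr : X -> Prop, (forall x, \forall x' \near x, Pr x' <-> Pr x) ->
  forall x y, Pr x -> Pr y.

Lemma paste_continuous (R : realType) (X Y : topologicalType) (f g : X -> Y)
    (phi : X -> R) a : continuous f -> continuous g -> continuous phi ->
  (forall x, phi x = a -> f x = g x) ->
  continuous (fun x => if phi x <= a then f x else g x).
Proof.
move=> cf cg cphi fg x B /=; case: (ltgtP (phi x) a) => xa nB.
- have h : \forall y \near x, phi y < a.
    by exact: (cphi x _ (open_nbhs_nbhs (conj (@open_lt R a) xa))).
  by apply: filterS2 h (cf x B nB) => y ya By; rewrite /= ltW.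
- have h : \forall y \near x, a < phi y.
    by exact: (cphi x _ (open_nbhs_nbhs (conj (@open_gt R a) xa))).
  by apply: filterS2 h (cg x B nB) => y ya By; rewrite /= leNgt ya.
- have nB' : nbhs (g x) B by rewrite -fg.
  have h1 : \forall y \near x, B (f y) by exact: cf.
  have h2 : \forall y \near x, B (g y) by exact: cg.
  by apply: filterS2 h1 h2 => y By By' /=; case: ifP.
Qed.

Section Clamp.
Context {R : realType}.

(** Composition with [clamp a b] extends maps from an interval to all of R, so that paths and
    homotopies can be handled with plain continuity. *)
Definition clamp (a b s : R) : R := Num.min (Num.max s a) b.

Lemma clamp_continuous a b : continuous (clamp a b).
Proof.
move=> s; have h1 : {for s, continuous ((fun s : R => s) \max (fun=> a))}.
  by apply: continuous_max; [exact: continuous_self|exact: cvg_cst].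
have h2 : {for s, continuous (((fun s : R => s) \max (fun=> a)) \min (fun=> b))}.
  by apply: continuous_min => //; exact: cvg_cst.
exact: h2.
Qed.

Lemma clamp_itv a b s : a <= b -> a <= clamp a b s <= b.
Proof. by move=> ab; rewrite /clamp le_min ab le_max lexx orbT ge_min lexx orbT. Qed.

Lemma clamp_id a b s : a <= s <= b -> clamp a b s = s.
Proof. by move=> /andP[as_ sb]; rewrite /clamp max_l // min_l. Qed.

Lemma clamp_ge a b s : a <= b -> b <= s -> clamp a b s = b.
Proof. by move=> ab bs; rewrite /clamp max_l ?(le_trans ab) // min_r. Qed.

Lemma clamp_le a b s : a <= b -> s <= a -> clamp a b s = a.
Proof. by move=> ab sa; rewrite /clamp max_r // min_l. Qed.

Lemma clamp_lip a b s s' : a <= b -> `|clamp a b s - clamp a b s'| <= `|s - s'|.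
Proof.
move=> ab; have := ler_norm (s - s'); have := ler_norm (s' - s).
rewrite [X in _ <= X]distrC => h1 h2; rewrite ler_norml /clamp /Order.max /Order.min.
by apply/andP; split; case: (ltP s a) => ?; case: (ltP s' a) => ?;
  case: (ltP a b) => ?; case: (ltP s b) => ?; case: (ltP s' b) => ?; lra.
Qed.

Lemma locally_constant_real : locally_constant_constant R.
Proof.
move=> Pr loc x y Px.
have cR : connected [set: R] by apply/connected_intervalP.
have oP : open [set z | Pr z].
  rewrite openE => z Pz; have := loc z; rewrite /interior; apply: filterS => z' [_]; exact.
have oPc : open (~` [set z | Pr z]).
  rewrite openE => z Pz; have := loc z; rewrite /interior; apply: filterS => z' [h _].
  by move=> Pz'; apply: Pz; apply: h.
suff : [set z | Pr z] = setT by move=> e; rewrite -[Pr y]/([set z | Pr z] y) e.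
apply: cR; first by exists x.
- by exists [set z | Pr z] => //; rewrite setTI.
- by exists [set z | Pr z]; rewrite ?setTI // -[X in closed X]setCK; exact: open_closedC.
Qed.

Lemma path_connected_path (M : topologicalType) (x y : M) :
  @path_connected R M -> exists f : R -> M, [/\ continuous f, f 0 = x & f 1 = y].
Proof.
move=> /(_ x y)[f [cf f0 f1]]; exists (f \o clamp 0 1); split.
- move=> s; have s01 := clamp_itv s (ler01 : 0 <= 1 :> R).
  move/subspace_continuousP : cf => /(_ (clamp 0 1 s)).
  rewrite /= in_itv /= s01 => /(_ isT) cf A /cf nA.
  have h : \forall s' \near s, `[0, 1]%classic (clamp 0 1 s') -> A (f (clamp 0 1 s')).
    exact: (@clamp_continuous 0 1 s _ nA).
  by apply: filterS h => s'; apply; rewrite /= in_itv /= clamp_itv.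
- by rewrite /= clamp_id // lexx ler01.
- by rewrite /= clamp_id // lexx ler01.
Qed.

Lemma locally_constant_path (M : topologicalType) :
  @path_connected R M -> locally_constant_constant M.
Proof.
move=> pM Pr loc x y Px; have [f [cf f0 f1]] := path_connected_path x y pM.
rewrite -f1; apply: (@locally_constant_real (Pr \o f) _ 0 1).
  by move=> s; exact: (cf s _ (loc (f s))).
by rewrite /= f0.
Qed.

End Clamp.

Section Lifting.
Context {R : realType} {M N : topologicalType}.
Variable p : M -> N.
Hypothesis cov : covering_map p.

Let cp : continuous p. Proof. by case: cov. Qed.

(* [s a] is the section of p over U through a; its image is the sheet of a. *)
Definition trivializing (U : set N) (s : M -> N -> M) : Prop :=
  [/\ open U, forall a, U (p a) -> s a (p a) = a,
      forall a y, U (p a) -> U y -> p (s a y) = y /\ {for y, continuous (s a)},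
      forall a, U (p a) -> open (s a @` U) &
      forall a y y', U (p a) -> U y -> U y' -> s (s a y) y' = s a y'].

Lemma trivializing_subset U V s : trivializing U s -> open V -> V `<=` U ->
  trivializing V s.
Proof.
move=> [oU s1 s2 s3 s4] oV VU; split => //.
- by move=> a /VU; exact: s1.
- by move=> a y /VU Ua /VU; exact: s2.
- move=> a /VU Ua; have -> : s a @` V = s a @` U `&` p @^-1` V.
    apply/seteqP; split=> [_ [y Vy <-]|_ [[y Uy <-]]] /=.
      by split; [exists y => //; exact: VU|rewrite (s2 a y Ua (VU _ Vy)).1].
    by rewrite (s2 a y Ua Uy).1 => Vy; exists y.
  by apply: openI; [exact: s3|move/continuousP : cp; exact].
- by move=> a y y' /VU Ua /VU Uy /VU Uy'; exact: s4.
Qed.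

Lemma trivializing_at y : exists U s, U y /\ trivializing U s.
Proof.
have [_ _ /(_ y)[U [oU Uy [P [tP PU PP]]]]] := cov.
(* The sheet through a; the default [set0] is never met when p a lies in U. *)
pose sh a := xget set0 [set Q | P Q /\ Q a].
have shP a : U (p a) -> P (sh a) /\ sh a a.
  move=> Ua; have : (\bigcup_(Q in P) Q) a by rewrite PU.
  by case=> Q PQ Qa; exact: (xgetPex set0 (ex_intro (fun Q => P Q /\ Q a) Q (conj PQ Qa))).
have shE a Q : U (p a) -> P Q -> Q a -> sh a = Q.
  move=> Ua PQ Qa; have [Psh sha] := shP a Ua.
  by apply: tP => //; exists a.
have Uof Q b : P Q -> Q b -> U (p b).
  by move=> PQ Qb; have [_ _ <- _] := PP Q PQ; exists b.
pose s a z := xget a [set b | sh a b /\ p b = z].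
have sP a z : U (p a) -> U z -> sh a (s a z) /\ p (s a z) = z.
  move=> Ua Uz; have [Psh sha] := shP a Ua; have [_ _ im _] := PP _ Psh.
  by apply: (@xgetPex _ a [set b | sh a b /\ p b = z]); move: Uz; rewrite -im => -[b ? ?]; exists b.
have sE a b : U (p a) -> sh a b -> s a (p b) = b.
  move=> Ua sb; have [Psh sha] := shP a Ua; have [_ inj _ _] := PP _ Psh.
  have Ub : U (p b) by exact: (Uof (sh a)).
  by have [h1 h2] := sP a (p b) Ua Ub; apply: inj; rewrite ?inE.
have shs a z : U (p a) -> U z -> sh (s a z) = sh a.
  move=> Ua Uz; have [h1 h2] := sP a z Ua Uz; apply: shE => //; first by rewrite h2.
  by have [] := shP a Ua.
exists U, s; split => //; split => //.
- by move=> a Ua; apply: sE => //; have [] := shP a Ua.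
- move=> a z Ua Uz; have [h1 h2] := sP a z Ua Uz; split => //.
  have [Psh sha] := shP a Ua; have [osh inj im pop] := PP _ Psh.
  move=> A; rewrite nbhsE => -[B [oB Bz] BA].
  have oBs : open (B `&` sh a) by exact: openI.
  have : open (p @` (B `&` sh a)) by apply: pop => // t [].
  move=> oI; have Iz : (p @` (B `&` sh a)) z by exists (s a z).
  apply: filterS (open_nbhs_nbhs (conj oI Iz)) => _ [b [Bb sb] <-] /=.
  by apply: BA; rewrite sE.
- move=> a Ua; have [Psh sha] := shP a Ua; have [osh inj im pop] := PP _ Psh.
  suff -> : s a @` U = sh a by [].
  apply/seteqP; split=> [_ [z Uz <-]|b sb]; first by have [] := sP a z Ua Uz.
  by exists (p b); [exact: (Uof (sh a))|exact: sE].
- move=> a z z' Ua Uz Uz'; have [h1 h2] := sP a z Ua Uz.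
  have Us : U (p (s a z)) by rewrite h2.
  have [h3 h4] := sP (s a z) z' Us Uz'; have [h5 h6] := sP a z' Ua Uz'.
  rewrite shs // in h3; have [Psh sha] := shP a Ua; have [_ inj _ _] := PP _ Psh.
  by apply: inj; rewrite ?inE // h4 h6.
Qed.

Lemma sheet_nbhs U s a : trivializing U s -> U (p a) ->
  \forall b \near a, U (p b) /\ s a (p b) = b.
Proof.
move=> [oU s1 s2 s3 s4] Ua.
have sa : (s a @` U) a by exists (p a) => //; exact: s1.
apply: filterS (open_nbhs_nbhs (conj (s3 a Ua) sa)) => _ [y Uy <-].
by have [-> _] := s2 a y Ua Uy; split.
Qed.

Lemma lift_unique (X : topologicalType) (f g : X -> M) x0 :
  locally_constant_constant X -> continuous f -> continuous g ->
  (forall x, p (f x) = p (g x)) -> f x0 = g x0 -> forall x, f x = g x.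
Proof.
move=> LX cf cg fg fg0 x; apply: (LX (fun x => f x = g x)) fg0 => {x0}x0.
have [U [s [Ux tU]]] := trivializing_at (p (f x0)).
have Ux' : U (p (g x0)) by rewrite -fg.
have [oU s1 s2 s3 s4] := tU.
have h1 : \forall x \near x0, U (p (f x)) /\ s (f x0) (p (f x)) = f x.
  exact: (cf x0 _ (sheet_nbhs tU Ux)).
have h2 : \forall x \near x0, U (p (g x)) /\ s (g x0) (p (g x)) = g x.
  exact: (cg x0 _ (sheet_nbhs tU Ux')).
apply: filterS2 h1 h2 => x' [Uf sf] [Ug sg]; split => [e|e]; last first.
  by rewrite -sf -sg fg e.
rewrite -(s1 _ Ux) -(s1 _ Ux') fg.
by rewrite -(s4 _ (p (f x')) _ Ux Uf Ux') -(s4 _ (p (g x')) _ Ux' Ug Ux') sf sg e.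
Qed.

Let c01 := @clamp R 0 1.

(** Lebesgue number of the compact segment at height [t0]: one size e serves all abscissas. *)
Lemma strip_uniform (h : R * R -> N) t0 : continuous h ->
  exists2 e : R, 0 < e & forall a, exists U s, trivializing U s /\
    forall s' t', `|s' - a| <= e -> `|t' - t0| <= e -> U (h (c01 s', t')).
Proof.
move=> ch.
have := @segment_compact R 0 1; rewrite compact_near_coveringP => H.
have := H R (0^'+) (fun e a => exists U s, trivializing U s /\
  forall s' t', `|s' - a| <= e -> `|t' - t0| <= e -> U (h (s', t'))) _ _.
case=> [a _|e /= e0 eP]; last first.
  exists (e / 2); first by rewrite divr_gt0.
  move=> a; have [|||U [s [tU UP]]] := eP (e / 2) _ _ (c01 a).
  - by rewrite /ball /= sub0r normrN gtr0_norm ?divr_gt0 // ltr_pdivrMr // ltr_pMr // ltr1n.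
  - by rewrite /= divr_gt0.
  - by rewrite /= in_itv /= clamp_itv.
  exists U, s; split => // s' t' sa tt; apply: UP => //; apply: le_trans sa.
  exact: clamp_lip.
have [U [s [Ua tU]]] := trivializing_at (h (a, t0)).
have [oU _ _ _ _] := tU.
have := ch (a, t0) U (open_nbhs_nbhs (conj oU Ua)) => -[[A B] /= [nA nB] AB].
move: nA nB => /nbhs_ballP[r1 /= r10 r1P] /nbhs_ballP[r2 /= r20 r2P].
exists (ball a (r1 / 2), [set e | e < Num.min (r1 / 2) r2]) => /=.
  split; first by apply: nbhsx_ballx; rewrite divr_gt0.
  by apply: nbhs_right_lt; rewrite lt_min r20 divr_gt0.
move=> [a' e] /= [aa' er]; exists U, s; split => // s' t' sa tt.
move: er; rewrite lt_min => /andP[er1 er2].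
apply: (AB (s', t')); split => /=.
  apply: r1P; rewrite /ball /= (splitr r1) (le_lt_trans (ler_distD a' _ _)) // ltrD //.
  by rewrite distrC (le_lt_trans sa).
by apply: r2P; rewrite /ball /= distrC (le_lt_trans tt).
Qed.

(** The lift is continued over successive intervals of length e by the section through K (a, t0).
    The strip may have to be narrowed at each of the finitely many steps. *)
Lemma strip_lift (h : R * R -> N) t0 x1 : continuous h ->
  (forall t, h (0, t) = p x1) ->
  exists2 e : R, 0 < e & exists K : R * R -> M, [/\ continuous K,
    forall s t, p (K (s, t)) = h (c01 s, clamp (t0 - e) (t0 + e) t) &
    forall t, K (0, t) = x1].
Proof.
move=> ch h0; have [e e0 eP] := strip_uniform t0 ch.
have ind : forall k, exists e', [/\ 0 < e', e' <= e & exists K : R * R -> M, [/\ continuous K,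
    forall s t, p (K (s, t)) = h (c01 (clamp 0 (k%:R * e) s), clamp (t0 - e') (t0 + e') t) &
    forall t, K (0, t) = x1]].
  elim=> [|k [e' [e'0 e'e [K [cK pK K0]]]]].
    exists e; split => //; exists (fun=> x1); split => //; first exact: continuous_const.
    move=> s t; rewrite mul0r.
    have -> : clamp 0 0 s = 0 :> R by have := clamp_itv s (lexx (0:R)); case/andP; lra.
    by rewrite /c01 clamp_id ?h0 // lexx ler01.
  set a := k%:R * e in pK *.
  have a0 : 0 <= a by rewrite mulr_ge0 // ltW.
  have [U [s [tU UP]]] := eP a.
  have [oU s1 s2 s3 s4] := tU.
  set c := K (a, t0).
  have aa : clamp 0 a a = a by rewrite clamp_id // a0 lexx.
  have tt : clamp (t0 - e') (t0 + e') t0 = t0 by rewrite clamp_id //; apply/andP; split; lra.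
  have Uc : U (p c).
    by rewrite pK aa tt; apply: UP; rewrite subrr normr0 ltW.
  have cKa : continuous (fun t => K (a, t)).
    apply: (continuous_compose (f := fun t => (a, t))) cK.
    by apply: continuous_pair; [exact: continuous_const|exact: continuous_self].
  have : \forall t \near t0, U (p (K (a, t))) /\ s c (p (K (a, t))) = K (a, t).
    exact: (cKa t0 _ (sheet_nbhs tU Uc)).
  move=> /nbhs_ballP[r /= r0 rP].
  (* Within this height K (a, t) stays in the sheet of c, so the old lift and the new section agree
     on the line s = a. *)
  pose e2 := Num.min e' (r / 2).
  have e20 : 0 < e2 by rewrite lt_min e'0 divr_gt0.
  have e2e' : e2 <= e' by rewrite ge_min lexx.
  have e2r : e2 < r by rewrite gt_min; apply/orP; right; rewrite ltr_pdivrMr // ltr_pMr // ltr1n.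
  pose ct := clamp (t0 - e2) (t0 + e2).
  have ctP t : t0 - e2 <= ct t <= t0 + e2 by apply: clamp_itv; lra.
  have ctt t : clamp (t0 - e') (t0 + e') (ct t) = ct t.
    by have /andP[? ?] := ctP t; rewrite clamp_id //; apply/andP; split; lra.
  have ctn t : `|ct t - t0| <= e2.
    by have /andP[? ?] := ctP t; rewrite ler_norml; apply/andP; split; lra.
  pose b := k.+1%:R * e; have ab : b = a + e by rewrite /b -natr1 mulrDl mul1r.
  have abP s' : a <= clamp a b s' <= b by apply: clamp_itv; rewrite ab; lra.
  pose G1 (z : R * R) := K (clamp 0 a z.1, ct z.2).
  pose G2 (z : R * R) := s c (h (c01 (clamp a b z.1), ct z.2)).
  have UG z : U (h (c01 (clamp a b z.1), ct z.2)).
    apply: UP; last by rewrite (le_trans (ctn _)) // (le_trans e2e').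
    by have := abP z.1; rewrite ab ler_norml => /andP[? ?]; apply/andP; split; lra.
  exists e2; split => //; first exact: le_trans e2e' e'e.
  exists (fun z => if z.1 <= a then G1 z else G2 z); split.
  - apply: paste_continuous.
    + apply: continuous_compose cK; apply: continuous_pair.
        by apply: continuous_compose (@clamp_continuous _ _ _); exact: continuous_fst.
      by apply: continuous_compose (@clamp_continuous _ _ _); exact: continuous_snd.
    + have ch2 : continuous (fun z : R * R => h (c01 (clamp a b z.1), ct z.2)).
        apply: continuous_compose ch; apply: continuous_pair.
          apply: continuous_compose (@clamp_continuous _ _ _).
          by apply: continuous_compose (@clamp_continuous _ _ _); exact: continuous_fst.
        by apply: continuous_compose (@clamp_continuous _ _ _); exact: continuous_snd.
      move=> z; apply: (continuous_comp (ch2 z)).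
      by have [] := s2 c _ Uc (UG z).
    + exact: continuous_fst.
    + move=> [s' t] /= ->; rewrite /G1 /G2 /= aa clamp_id; last by rewrite ab lexx lerDl ltW.
      have [Ut <-] : U (p (K (a, ct t))) /\ s c (p (K (a, ct t))) = K (a, ct t).
        by apply: rP; rewrite /ball /= distrC (le_lt_trans (ctn t)).
      by rewrite pK aa ctt.
  - move=> s' t /=; case: ifP => sa.
      rewrite /G1 /= pK ctt; congr (h (c01 _, _)); have [s0|s0] := leP 0 s'.
        rewrite (clamp_id (s := s')) ?s0 // clamp_id ?s0 //.
        by rewrite clamp_id // s0 /= -/b ab (le_trans sa) // lerDl ltW.
      rewrite !(@clamp_le _ _ _ s') // ?(ltW s0) //; last by rewrite -/b ab addr_ge0 // ltW.
      by rewrite clamp_id // lexx.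
    have as' : a < s' by rewrite ltNge sa.
    rewrite /G2 /=; have [-> _] := s2 c _ Uc (UG (s', t)); congr (h (c01 _, _)).
    rewrite -/b /clamp !max_l //; first exact: le_trans (ltW as').
    exact: ltW.
  - move=> t /=; rewrite a0 /G1 /=.
    by rewrite clamp_le.
have [k ke] : exists k : nat, 1 < k%:R * e.
  exists (Num.truncn e^-1).+1; rewrite -ltr_pdivrMr // div1r; exact: truncnS_gt.
have [e' [e'0 e'e [K [cK pK K0]]]] := ind k.
exists e' => //; exists (fun z => K (c01 z.1, z.2)); split => [z|s t|t] /=.
- move: z; apply: continuous_compose cK.
  apply: continuous_pair; last exact: continuous_snd.
  by apply: continuous_compose (@clamp_continuous _ _ _); exact: continuous_fst.
- rewrite pK; congr (h (_, _)); have /andP[s0 s1] := clamp_itv s (ler01 : 0 <= 1 :> R).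
  rewrite (@clamp_id _ 0 (k%:R * e)) ?s0 ?(le_trans s1 (ltW ke)) // /c01.
  by rewrite [LHS]clamp_id // s0 s1.
- by rewrite /c01 clamp_le.
Qed.

End Lifting.

(** * Deck transformations act transitively on the fibres *)

Section DeckTransitivity.
Context {R : realType} {M N : topologicalType}.
Variable p : M -> N.
Hypothesis uc : universal_cover R p.

Let pM : @path_connected R M. Proof. by case: uc => -[]. Qed.
Let cov : covering_map p. Proof. by case: uc. Qed.
Let cp : continuous p. Proof. by case: cov. Qed.
Let c01 := @clamp R 0 1.

Let c0 : c01 0 = 0. Proof. by rewrite /c01 clamp_id // lexx ler01. Qed.
Let c1 : c01 1 = 1. Proof. by rewrite /c01 clamp_id // lexx ler01. Qed.
Let cc01 : continuous c01. Proof. exact: clamp_continuous. Qed.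
Let c01I s : 0 <= c01 s <= 1. Proof. exact: clamp_itv. Qed.
Let c01K s : 0 <= s <= 1 -> c01 s = s. Proof. exact: clamp_id. Qed.

Lemma path_lift (al : R -> N) x1 : continuous al -> al 0 = p x1 ->
  exists be : R -> M, [/\ continuous be, be 0 = x1 & forall s, p (be s) = al (c01 s)].
Proof.
move=> cal al0; have [|//|e _ [K [cK pK K0]]] := @strip_lift R M N p cov (fun z => al z.1) 0 x1.
  by apply: continuous_compose cal; exact: continuous_fst.
exists (fun s => K (s, 0)); split; [|exact: K0|by move=> s; rewrite pK].
apply: continuous_compose cK.
by apply: continuous_pair; [exact: continuous_self|exact: continuous_const].
Qed.

Lemma path_lift_unique (be be' : R -> M) : continuous be -> continuous be' ->
  (forall s, p (be (c01 s)) = p (be' (c01 s))) -> be 0 = be' 0 ->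
  forall s, 0 <= s <= 1 -> be s = be' s.
Proof.
move=> cb cb' pb b0 s s01; rewrite -(c01K s01).
apply: (@lift_unique _ _ _ cov _ (be \o c01) (be' \o c01) 0) => //=.
- exact: locally_constant_real.
- exact: continuous_compose cb.
- exact: continuous_compose cb'.
- by rewrite c0.
Qed.

(** Simple connectedness enters here: the loop made of [al] and the reverse of [al'] contracts in M,
    so its image under p contracts in N. Along a homotopy of loops with fixed base point, the
    property of lifting to a closed path is locally constant in the parameter. *)
Lemma lift_endpoint (al al' be be' : R -> M) :
  continuous al -> continuous al' -> continuous be -> continuous be' ->
  al 0 = al' 0 -> al 1 = al' 1 -> be 0 = be' 0 ->
  (forall s, p (be (c01 s)) = p (al (c01 s))) ->
  (forall s, p (be' (c01 s)) = p (al' (c01 s))) -> be 1 = be' 1.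
Proof.
move=> ca ca' cb cb' a0 a1 b0 pb pb'.
have claff (a b : R) : continuous (fun s : R => a * s + b).
  move=> s; apply: cvgD; last exact: cvg_cst.
  by apply: cvgM; [exact: cvg_cst|exact: continuous_self].
pose l s := if s <= 1 / 2 then al (c01 (2 * s + 0)) else al' (c01 (- 2 * s + 2)).
have cl : continuous l.
  apply: paste_continuous.
  - by apply: (continuous_compose _ ca); apply: (continuous_compose _ cc01).
  - by apply: (continuous_compose _ ca'); apply: (continuous_compose _ cc01).
  - exact: continuous_self.
  - move=> s ->; have -> : 2 * (1 / 2) + 0 = 1 :> R by lra.
    have -> : - 2 * (1 / 2) + 2 = 1 :> R by lra.
  by rewrite c1.
have l0 : l 0 = al 0.
  by rewrite /l divr_ge0 // mulr0 addr0 c0.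
have l1 : l 1 = al 0.
  rewrite /l ifF; last by apply/negbTE; rewrite -ltNge; lra.
  have -> : - 2 * 1 + 2 = 0 :> R by lra.
  by rewrite c0 a0.
have [H [cH HP]] : exists H : R * R -> M,
    {within `[0, 1]%classic `*` `[0, 1]%classic, continuous H} /\
    forall s, s \in `[0, 1] ->
      [/\ H (s, 0) = l s, H (s, 1) = l 0, H (0, s) = l 0 & H (1, s) = l 0].
  have [[_ nl] _] := uc; apply: nl; first exact: continuous_subspaceT.
  by rewrite l0 l1.
pose h (z : R * R) := p (H (c01 z.1, c01 z.2)).
have in01 s : c01 s \in `[0, 1]%R by rewrite in_itv /= c01I.
have ch : continuous h.
  apply: (continuous_compose (f := fun z => H (c01 z.1, c01 z.2))) cp.
  pose q (z : R * R) := (c01 z.1, c01 z.2).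
  have cq : continuous q.
    apply: continuous_pair; apply: continuous_compose cc01.
      exact: continuous_fst.
    exact: continuous_snd.
  move=> z A nA; move/subspace_continuousP : cH => /(_ (q z)).
  move=> /(_ (conj (in01 z.1) (in01 z.2))) cH.
  have h1 : \forall w \near z, (`[0, 1] `*` `[0, 1])%classic (q w) -> A (H (q w)).
    exact: (cq z _ (cH A nA)).
  apply: filterS h1 => w; apply; split; exact: in01.
have h0t t : h (0, t) = p (al 0).
  by rewrite /h /= c0; have [_ _ -> _] := HP _ (in01 t); rewrite l0.
have h1t t : h (1, t) = p (al 0).
  by rewrite /h /= c1; have [_ _ _ ->] := HP _ (in01 t); rewrite l0.
have hs0 s : h (s, 0) = p (l (c01 s)).
  by rewrite /h /= c0; have [-> _ _ _] := HP _ (in01 s).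
have hs1 s : h (s, 1) = p (al 0).
  by rewrite /h /= c1; have [_ -> _ _] := HP _ (in01 s); rewrite l0.
set x1 := be 0 in b0 *.
have px1 : p x1 = p (al 0) by have := pb 0; rewrite c0.
(* The lift from [x1] of the loop at stage t is closed: clear for the constant loop at t = 1, wanted
   at t = 0. *)
pose good t := forall ga : R -> M, continuous ga -> ga 0 = x1 ->
  (forall s, p (ga (c01 s)) = h (c01 s, t)) -> ga 1 = x1.
have good1 : good 1.
  move=> ga cg g0 pg; have := @path_lift_unique ga (fun=> x1) cg (@continuous_const R M x1) _ g0.
  by move=> -> //; [move=> s; rewrite pg hs1 px1|rewrite ler01 lexx].
have good0 : good 0.
  apply: (@locally_constant_real R good _ 1 0 good1) => t0.
  have [|e e0 [K [cK pK K0]]] := @strip_lift R M N p cov h t0 x1 ch.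
    by move=> t; rewrite h0t px1.
  have K1 t : K (1, t) = K (1, t0).
    apply: (@lift_unique _ _ _ cov _ (fun t => K (1, t)) (fun=> K (1, t0)) t0) => //.
    + exact: locally_constant_real.
    + apply: (continuous_compose _ cK).
      by apply: continuous_pair; [exact: continuous_const|exact: continuous_self].
    + exact: continuous_const.
    + by move=> t'; rewrite !pK -/c01 c1 !h1t.
  have cKs t : continuous (fun s => K (s, t)).
    apply: (continuous_compose _ cK).
    by apply: continuous_pair; [exact: continuous_self|exact: continuous_const].
  have goodE t : `|t - t0| < e -> good t <-> K (1, t0) = x1.
    move=> tt; have ct : clamp (t0 - e) (t0 + e) t = t.
      by move: tt; rewrite ltr_norml => /andP[? ?]; rewrite clamp_id //; apply/andP; split; lra.
    have cKt s : p (K (c01 s, t)) = h (c01 s, t) by rewrite pK ct -/c01 (c01K (c01I s)).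
    split=> [gt|K1x ga cg g0 pg].
      by rewrite -(K1 t); apply: (gt (fun s => K (s, t))).
    rewrite (@path_lift_unique ga (fun s => K (s, t))) ?K1 ?g0 ?K0 ?ler01 ?lexx //.
    by move=> s; rewrite pg cKt.
  apply/nbhs_ballP; exists e => //= t; rewrite /ball /= distrC => tt.
  rewrite (goodE t tt) goodE //; by rewrite subrr normr0.
(* The lift of the whole loop: its first half is [be], and its second half is [be'] run
   backwards. *)
have [L [cL L0 pL]] : exists L : R -> M, [/\ continuous L, L 0 = x1 &
    forall s, p (L s) = (p \o l) (c01 s)].
  apply: path_lift; first exact: (continuous_compose cl).
  by rewrite /= l0 px1.
have L1 : L 1 = x1.
  by apply: good0 => // s; rewrite pL hs0 /= (c01K (c01I s)).
have half s : 0 <= c01 s / 2 <= 1 /\ c01 s / 2 <= 1 / 2.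
  by have /andP[? ?] := c01I s; split; [apply/andP; split|]; lra.
have <- : L (1 / 2) = be 1.
  have := @path_lift_unique (fun s => L (1 / 2 * s + 0)) be _ cb _ _ 1.
  rewrite mulr0 mulr1 !addr0; apply => //; last by rewrite ler01 lexx.
    exact: (continuous_compose (claff _ _)).
  move=> s; have /andP[s0 s1] := c01I s.
  rewrite pL pb /= c01K; last by apply/andP; split; lra.
  rewrite /l ifT; last by lra.
  have -> : 2 * (1 / 2 * c01 s + 0) + 0 = c01 s by lra.
  by rewrite (c01K (c01I s)).
have := @path_lift_unique (fun s => L (- (1 / 2) * s + 1)) be' _ cb' _ _ 1.
have -> : - (1 / 2) * 1 + 1 = 1 / 2 :> R by lra.
rewrite mulr0 add0r; apply => //; last by rewrite ler01 lexx.
- exact: (continuous_compose (claff _ _)).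
- move=> s; have /andP[s0 s1] := c01I s.
  rewrite pL pb' /= c01K; last by apply/andP; split; lra.
  rewrite /l; case: ifP => [le|_].
    have s1' : c01 s = 1 by lra.
    rewrite s1'; have -> : 2 * (- (1 / 2) * 1 + 1) + 0 = 1 :> R by lra.
    by rewrite c1 a1.
  have -> : - 2 * (- (1 / 2) * c01 s + 1) + 2 = c01 s by lra.
  by rewrite (c01K (c01I s)).
- by rewrite L1 b0.
Qed.

Hypothesis locally_path : forall (a : M) (A : set M), nbhs a A ->
  \forall b \near a, exists g : R -> M, [/\ continuous g, g 0 = a, g 1 = b & forall s, A (g s)].

(** f a is the endpoint of the lift from [x1] of the projection of any path from [x0] to a;
    [lift_endpoint] makes it independent of the path. Near a it is p followed by the section through
    f a, because nearby points are joined to a by paths inside a sheet. *)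
Lemma exists_lift_map x0 x1 : p x0 = p x1 ->
  exists f : M -> M, [/\ continuous f, forall a, p (f a) = p a & f x0 = x1].
Proof.
move=> px.
have ex a : exists b, exists al be : R -> M, [/\ continuous al, continuous be,
    [/\ al 0 = x0, al 1 = a, be 0 = x1 & be 1 = b] &
        forall s, p (be (c01 s)) = p (al (c01 s))].
  have [al [ca a0 a1]] := path_connected_path x0 a pM.
  have [|be [cb b0 pb]] := @path_lift (p \o al) x1 (continuous_compose ca cp).
    by rewrite /= a0.
  exists (be 1), al, be; split => // s.
  by rewrite pb /= (c01K (c01I s)).
have [f fP] := choice ex.
have fE a b (al be : R -> M) : continuous al -> continuous be -> al 0 = x0 -> al 1 = a ->
    be 0 = x1 -> be 1 = b -> (forall s, p (be (c01 s)) = p (al (c01 s))) -> f a = b.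
  move=> ca cb a0 a1 b0 b1 pb; have [al' [be' [ca' cb' [a0' a1' b0' b1'] pb']]] := fP a.
  by rewrite -b1 -b1'; apply: (@lift_endpoint al' al) => //; rewrite ?a0' ?a1' ?b0'.
have pf a : p (f a) = p a.
  have [al [be [ca cb [a0 a1 b0 b1] pb]]] := fP a.
  by rewrite -b1 -a1; have := pb 1; rewrite c1.
exists f; split => //; last first.
  by apply: (@fE _ _ (fun=> x0) (fun=> x1)) => //; exact: continuous_const.
move=> a; have [U [s [Ua tU]]] := trivializing_at cov (p a).
have [oU s1 s2 s3 s4] := tU.
have Ufa : U (p (f a)) by rewrite pf.
have key : \forall b \near a, s (f a) (p b) = f b.
  have sh : nbhs a [set b | U (p b) /\ s a (p b) = b] := sheet_nbhs tU Ua.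
  apply: filterS (locally_path sh) => b [g [cg g0 g1 gA]].
  have [al [be [ca cb [a0 a1 b0 b1] pb]]] := fP a.
  have claff (c e : R) : continuous (fun s : R => c * s + e).
    move=> t; apply: cvgD; last exact: cvg_cst.
    by apply: cvgM; [exact: cvg_cst|exact: continuous_self].
  have csg : continuous (fun t => s (f a) (p (g t))).
    move=> t; apply: (continuous_comp (f := p \o g)); first exact: (continuous_compose cg cp).
    by have [] := s2 (f a) _ Ufa (gA t).1.
  pose cat (x y : R -> M) t := if t <= 1 / 2 then x (c01 (2 * t + 0)) else y (c01 (2 * t + -1)).
  have ccat (x y : R -> M) : continuous x -> continuous y -> x 1 = y 0 -> continuous (cat x y).
    move=> cx cy xy; apply: paste_continuous.
    - by apply: (continuous_compose _ cx); apply: (continuous_compose _ cc01).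
    - by apply: (continuous_compose _ cy); apply: (continuous_compose _ cc01).
    - exact: continuous_self.
    - move=> t ->; have -> : 2 * (1 / 2) + 0 = 1 :> R by lra.
      have -> : 2 * (1 / 2) + -1 = 0 :> R by lra.
  by rewrite c1 c0.
  have cat0 x y : cat x y 0 = x 0 by rewrite /cat divr_ge0 // mulr0 addr0 c0.
  have cat1 x y : cat x y 1 = y 1.
    rewrite /cat ifF; last by apply/negbTE; rewrite -ltNge; lra.
    have -> : 2 * 1 + -1 = 1 :> R by lra.
  by rewrite c1.
  apply/esym; apply: (@fE b _ (cat al g) (cat be (fun t => s (f a) (p (g t))))).
  - by apply: ccat => //; rewrite a1 g0.
  - by apply: ccat => //; rewrite b1 g0 -pf s1.
  - by rewrite cat0.
  - by rewrite cat1.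
  - by rewrite cat0.
  - by rewrite cat1 g1.
  - move=> t; rewrite /cat; case: ifP => _; first by rewrite pb.
    by have [-> _] := s2 (f a) _ Ufa (gA (c01 (2 * c01 t + -1))).1.
have cs : {for a, continuous (fun b => s (f a) (p b))}.
  by apply: (continuous_comp (@cp a)); have [] := s2 (f a) _ Ufa Ua.
move=> A nA; rewrite -(s1 _ Ufa) pf in nA.
have h : \forall b \near a, A (s (f a) (p b)) by exact: cs.
by apply: filterS2 key h => b /= ->.
Qed.

Lemma deck_transitive x0 x1 : p x0 = p x1 ->
  exists2 f : M -> M, deck_transformation p f & f x0 = x1.
Proof.
move=> px; have [f [cf pf fx]] := exists_lift_map px.
have [f' [cf' pf' fx']] := exists_lift_map (esym px).
have LM := locally_constant_path pM.
exists f => //; split => //; first by apply/funext => a; rewrite /= pf.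
exists f'; split => // a.
  apply: (@lift_unique _ _ _ cov _ (f' \o f) id x0) => //=.
  - exact: (continuous_compose cf cf').
  - exact: continuous_self.
  - by move=> b; rewrite pf' pf.
  - by rewrite fx fx'.
apply: (@lift_unique _ _ _ cov _ (f \o f') id x1) => //=.
- exact: (continuous_compose cf' cf).
- exact: continuous_self.
- by move=> b; rewrite pf pf'.
- by rewrite fx' fx.
Qed.

End DeckTransitivity.

(** * The universal cover of a closed manifold and its deck group *)

Section CoverOfManifold.
Context {R : realType} {d : nat} {M N : topologicalType}.
Variable p : M -> N.
Hypothesis N_manifold : closed_connected_manifold R d N.
Hypothesis uc : universal_cover R p.

Let pM : @path_connected R M. Proof. by case: uc => -[]. Qed.
Let cov : covering_map p. Proof. by case: uc. Qed.
Let cp : continuous p. Proof. by case: cov. Qed.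

Lemma chart_at (x : M) : exists (Q : set M) (W : set 'rV[R]_d)
    (psi : M -> 'rV[R]_d) (k : 'rV[R]_d -> M), [/\ open Q, Q x, open W,
    forall a, Q a -> [/\ W (psi a), k (psi a) = a & {for a, continuous psi}] &
    forall w, W w -> [/\ Q (k w), psi (k w) = w & {for w, continuous k}]].
Proof.
have [_ _ /(_ (p x))[U [W0 [f [g [[oU Ux oW0] [cf cg fU fg gf]]]]]] _ _] := N_manifold.
rewrite continuous_open_subspace // in cf; rewrite continuous_open_subspace // in cg.
have [U1 [s [U1x tU1]]] := trivializing_at cov (p x).
pose V := U1 `&` U; have oV : open V by apply: openI => //; case: tU1.
have tV : trivializing p V s by apply: trivializing_subset tU1 oV _ => // y [].
have [_ s1 s2 s3 s4] := tV; have Vx : V (p x) by [].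
have gU w : W0 w -> U (g w).
  by rewrite -fU => -[y Uy <-]; rewrite fg // inE.
exists (s x @` V), (W0 `&` g @^-1` V), (f \o p), (s x \o g); split.
- exact: s3.
- by exists (p x) => //; exact: s1.
- rewrite openE => w [Ww Vw]; apply: filterI; first exact: open_nbhs_nbhs.
  have cgw : {for w, continuous g} by apply: cg; rewrite inE.
  exact: (cgw _ (open_nbhs_nbhs (conj oV Vw))).
- move=> _ [y Vy <-]; have [psy _] := s2 x y Vx Vy; have Uy : U y by case: Vy.
  split.
  + split; first by rewrite -fU; exists y => //=; rewrite psy.
    by rewrite /= psy fg ?inE.
  + by rewrite /= psy fg ?inE.
  + apply: continuous_comp; first exact: cp.
    by rewrite psy; apply: cf; rewrite inE.
- move=> w [Ww Vw]; have [psw csw] := s2 x (g w) Vx Vw; split.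
  + by exists (g w).
  + by rewrite /= psw gf // inE.
  + by apply: continuous_comp => //; apply: cg; rewrite inE.
Qed.

Lemma cover_locally_path (a : M) (A : set M) : nbhs a A ->
  \forall b \near a, exists g : R -> M, [/\ continuous g, g 0 = a, g 1 = b & forall s, A (g s)].
Proof.
move=> nA; have [Q [W [psi [k [oQ Qa oW QP WP]]]]] := chart_at a.
have [Wa ka ca] := QP a Qa; have [_ _ ck] := WP _ Wa.
have nW : nbhs (psi a) (W `&` k @^-1` A).
  by apply: filterI; [exact: open_nbhs_nbhs|apply: ck; rewrite ka].
have /nbhs_mxP[r r0 rP] := nW.
have nb : \forall b \near a, `|psi a - psi b| < r.
  have nr : nbhs (psi a) [set w | `|psi a - w| < r] by apply/nbhs_mxP; exists r.
  exact: (ca _ nr).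
apply: filterS2 nb (open_nbhs_nbhs (conj oQ Qa)) => b br Qb.
have [Wb kb _] := QP b Qb.
pose l (s : R) := psi a + clamp 0 1 s *: (psi b - psi a).
have lr s : `|psi a - l s| < r.
  rewrite /l opprD addrA subrr add0r normrN normrZ distrC.
  have /andP[s0 s1] := clamp_itv s (ler01 : 0 <= 1 :> R).
  by rewrite (ger0_norm s0) (le_lt_trans _ br) // ler_piMl.
have cl : continuous l.
  move=> s; apply: cvgD; first exact: cvg_cst.
  by apply: cvgZ; [exact: clamp_continuous|exact: cvg_cst].
exists (k \o l); split.
- move=> s; apply: (continuous_comp (cl s)).
  by have [_ _] := WP (l s) (rP _ (lr s)).1.
- by rewrite /= /l clamp_id ?lexx ?ler01 // scale0r addr0.
- by rewrite /= /l clamp_id ?lexx ?ler01 // scale1r addrC subrK.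
- by move=> s; exact: (rP _ (lr s)).2.
Qed.

Lemma cover_hausdorff : hausdorff_space M.
Proof.
move=> x y cxy; have [hN _ _ _ _] := N_manifold.
have pxy : p x = p y.
  apply: hN => A B nA nB; have [z [zA zB]] := cxy _ _ (cp nA) (cp nB).
  by exists (p z).
have [U [s [Ux tU]]] := trivializing_at cov (p x).
have [oU s1 s2 s3 s4] := tU; have Uy : U (p y) by rewrite -pxy.
have [b [[Ub sx] [_ sy]]] := cxy _ _ (sheet_nbhs tU Ux) (sheet_nbhs tU Uy).
by rewrite -(s1 _ Ux) -(s1 _ Uy) -(s4 x _ _ Ux Ub Ux) sx -(s4 y _ _ Uy Ub Uy) sy pxy.
Qed.

Variables (G : groupType) (act : G -> M -> M).
Hypothesis deck : is_deck_group p act.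

Lemma deck_continuous g : continuous (act g).
Proof. by have [_ _ /(_ (act g))[_ h]] := deck; have [] := h (ex_intro _ g erefl). Qed.

Lemma deck_proj g x : p (act g x) = p x.
Proof.
have [_ _ /(_ (act g))[_ h]] := deck; have [_ + _] := h (ex_intro _ g erefl).
by move=> e; exact: (congr1 (fun f => f x) e).
Qed.

Lemma deck_orbit x y : p x = p y -> exists g, act g x = y.
Proof.
move=> pxy; have [f df fx] := deck_transitive uc cover_locally_path pxy.
have [_ _ /(_ f)[/(_ df)[g gf] _]] := deck.
by exists g; rewrite gf.
Qed.

Lemma deck_eq g h x : act g x = act h x -> g = h.
Proof.
move=> e; have [_ inj _] := deck; apply: inj; apply/funext.
apply: (@lift_unique _ _ _ cov _ (act g) (act h) x).
- exact: locally_constant_path pM.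
- exact: deck_continuous.
- exact: deck_continuous.
- by move=> y; rewrite !deck_proj.
- exact: e.
Qed.

(** Near (x, y), g x' = y' forces g x = y, which determines g: uniqueness of lifts allows to follow
    g back along a short path from x' to x. If p x and p y differ, disjoint neighbourhoods leave no
    g at all. *)
Lemma deck_locally_finite (x y : M) : exists l : seq G,
  nbhs (x, y) [set z : M * M | forall g, act g z.1 = z.2 -> g \in l].
Proof.
have [pxy|pxy] := pselect (p x = p y); last first.
  exists [::]; have [hN _ _ _ _] := N_manifold.
  apply: contrapT => nz; apply: pxy; apply: hN => A B nA nB.
  apply: contrapT => AB0; apply: nz; exists (p @^-1` A, p @^-1` B).
    by split; [exact: (cp nA)|exact: (cp nB)].
  move=> [x' y'] [/= Ax' By'] g gx; exfalso; apply: AB0; exists (p x'); split => //.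
  by rewrite -(deck_proj g) gx.
have [U [s [Ux tU]]] := trivializing_at cov (p x).
have [oU s1 s2 s3 s4] := tU; have Uy : U (p y) by rewrite -pxy.
have nx := sheet_nbhs tU Ux; have ny := sheet_nbhs tU Uy.
have key : nbhs (x, y) [set z : M * M | forall g, act g z.1 = z.2 -> act g x = y].
  exists ([set b | exists ga : R -> M, [/\ continuous ga, ga 0 = x, ga 1 = b &
     forall t, U (p (ga t))]], [set b | U (p b) /\ s y (p b) = b]).
    split; last exact: ny.
    apply: filterS (cover_locally_path nx) => b [ga [cg g0 g1 gU]].
    by exists ga; split => // t; have [] := gU t.
  move=> [x' y'] /= [[ga [cg g0 g1 gU]] [Uy' sy']] g gx.
  have csg : continuous (fun t => s y (p (ga t))).
    move=> t; apply: (continuous_comp (f := p \o ga)); first exact: (continuous_compose cg cp).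
    by have [] := s2 y _ Uy (gU t).
  have := @lift_unique _ _ _ cov _ (act g \o ga) (fun t => s y (p (ga t))) 1.
  move=> /(_ (@locally_constant_real R)) /(_ (continuous_compose cg (@deck_continuous g))).
  move=> /(_ csg) h; have := h _ _ 0; rewrite /= g0 pxy s1 //; apply.
    by move=> t; rewrite deck_proj; have [-> _] := s2 y _ Uy (gU t).
  by rewrite g1 gx -{1}sy' -gx deck_proj.
have [[g0 g0x]|ng] := pselect (exists g, act g x = y).
  exists [:: g0]; apply: filterS key => z h g /h gx.
  by rewrite inE; apply/eqP/(@deck_eq _ _ x); rewrite gx g0x.
by exists [::]; apply: filterS key => z h g /h gx; case: ng; exists g.
Qed.

Lemma deck_properly_discontinuous (K : set M) : compact K ->
  exists l : seq G, forall g x, K x -> K (act g x) -> g \in l.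
Proof.
move=> cK; have cKK := compact_setX cK cK.
have /compact_near_coveringP nc := cKK.
(* The filter of all sufficiently large lists: compactness in its near-covering form then merges the
   local lists into one. *)
pose F : set_system (seq G) := [set A | exists l0 : seq G, forall l : seq G, {subset l0 <= l} -> A l].
have FF : Filter F.
  split.
  - by exists [::].
  - move=> A B [l1 h1] [l2 h2]; exists (l1 ++ l2) => l sl; split.
      by apply: h1 => g gl; apply: sl; rewrite mem_cat gl.
    by apply: h2 => g gl; apply: sl; rewrite mem_cat gl orbT.
  - by move=> A B AB [l0 h]; exists l0 => l sl; apply: AB; exact: h.
have [|l0 h] := nc _ F (fun (l : seq G) z => forall g, act g z.1 = z.2 -> g \in l) FF.
  move=> [x y] _; have [l hl] := deck_locally_finite x y.
  exists ([set z | forall g, act g z.1 = z.2 -> g \in l], [set l' : seq G | {subset l <= l'}]).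
    by split => //=; exists l.
  by move=> [z l'] /= [hz ll'] g /hz; exact: ll'.
exists l0 => g x Kx Kgx.
by apply: (h l0 _ (x, act g x)) => //; split.
Qed.

(** Closed balls in charts of the cover have images that are neighbourhoods in N, and finitely many
    of them cover N. *)
Lemma deck_cocompact : exists2 K : set M, compact K & \bigcup_g (act g @` K) = setT.
Proof.
have [_ _ _ cN _] := N_manifold.
have /compact_near_coveringP nc := cN.
(* The same device, for sets that contain a sufficiently large compact set. *)
pose F : set_system (set M) := [set A | exists2 C, compact C & forall K, C `<=` K -> A K].
have FF : Filter F.
  split.
  - by exists set0 => //; exact: compact0.
  - move=> A B [C1 cC1 h1] [C2 cC2 h2]; exists (C1 `|` C2); first exact: compactU.
    by move=> K sK; split; [apply: h1|apply: h2] => x Cx; apply: sK; [left|right].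
  - by move=> A B AB [C cC h]; exists C => // K sK; apply: AB; exact: h.
have [y _|C cC h] := nc _ F (fun K y => exists2 k, K k & p k = y) FF.
  have [_ sp _] := cov.
  have [x _ px] : (range p) y by rewrite sp.
  have [Q [W [psi [k [oQ Qx oW QP WP]]]]] := chart_at x.
  have [Wx kx cx] := QP x Qx.
  have /nbhs_mxP[r r0 rP] : nbhs (psi x) W by exact: open_nbhs_nbhs.
  have r20 : 0 < r / 2 by rewrite divr_gt0.
  pose B := [set w : 'rV[R]_d | `|psi x - w| <= r / 2].
  have BW : B `<=` W.
    move=> w Bw; apply: rP; apply: (le_lt_trans Bw).
    by rewrite ltr_pdivrMr // ltr_pMr // ltr1n.
  have cB : compact B.
    apply: bounded_closed_compact_mx.
      exists (`|psi x| + r / 2) => w Bw; rewrite -[w](subrK (psi x)) addrC.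
      by rewrite (le_trans (ler_normD _ _)) // lerD2l distrC.
    apply: closed_fun_le => w; apply: (cvg_norm (F := nbhs w)).
    by apply: (cvgB (F := nbhs w)); [exact: cvg_cst|exact: continuous_self].
  have cKB : compact (k @` B).
    apply: continuous_compact => //; apply: continuous_in_subspaceT => w.
    by rewrite inE => /BW /WP[].
  exists ([set y' | exists2 b, (k @` B) b & p b = y'], [set K | k @` B `<=` K]).
    split; last by exists (k @` B).
    have [U [s [Ux tU]]] := trivializing_at cov (p x).
    have [oU s1 s2 s3 s4] := tU.
    have nQ : nbhs x [set b | Q b /\ `|psi x - psi b| < r / 2].
      apply: filterI; first exact: open_nbhs_nbhs.
      have nr : nbhs (psi x) [set w | `|psi x - w| < r / 2] by apply/nbhs_mxP; exists (r / 2).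
      exact: (cx _ nr).
    have [_ csx] := s2 x _ Ux Ux.
    rewrite -px /=; rewrite -(s1 _ Ux) in nQ.
    have h1 : \forall z \near p x, Q (s x z) /\ `|psi x - psi (s x z)| < r / 2.
      by have h := csx _ nQ; rewrite (s1 _ Ux) in h; exact: h.
    have h2 : \forall z \near p x, U z by exact: open_nbhs_nbhs.
    apply: filterS2 h1 h2 => z /= [Qz zr] Uz.
    exists (s x z); last by have [] := s2 x z Ux Uz.
    exists (psi (s x z)); last by have [] := QP _ Qz.
    exact: ltW.
  by move=> [y' K] /= [[b kb pb] sK]; exists b => //; exact: sK.
exists C => //; apply/seteqP; split => // x _.
have [k Ck pk] := h C (@subset_refl _ C) (p x) I.
by have [g gk] := deck_orbit pk; exists g => //; exists k.
Qed.

End CoverOfManifold.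

(** * Pencils and their sphere bundle *)

Section Projector.
Context {R : realType}.

(** The orthogonal projector onto the row space of X, for X with independent rows. *)
Definition row_projector d k (X : 'M[R]_(d, k)) : 'M[R]_k :=
  X^T *m invmx (X *m X^T) *m X.

Lemma row_free_injP d k (X : 'M[R]_(d, k)) :
  row_free X <-> forall w : 'rV_d, w *m X = 0 -> w = 0.
Proof.
split=> [fX w wX|H]; first by apply: (row_free_inj fX); rewrite mul0mx.
rewrite -kermx_eq0; apply/eqP/row_matrixP => i; rewrite row0; apply: H.
by apply/sub_kermxP; exact: row_sub.
Qed.

Lemma gram_unit d k (X : 'M[R]_(d, k)) : row_free X -> X *m X^T \in unitmx.
Proof.
move=> /row_free_injP fX; rewrite -row_free_unit; apply/row_free_injP => w wG; apply: fX.
have : nsq (w *m X)^T = 0 by rewrite -row_nsq trmx_mul mulmxA -[w *m X *m _]mulmxA wG mul0mx mxE.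
by move/eqP; rewrite nsq_eq0 => /eqP/(congr1 trmx); rewrite trmxK trmx0.
Qed.

Section Frame.
Variables (d k : nat) (X : 'M[R]_(d, k)).
Hypothesis fX : row_free X.

Lemma row_projector_tr : (row_projector X)^T = row_projector X.
Proof.
rewrite /row_projector !trmx_mul trmxK trmx_inv !trmx_mul trmxK mulmxA //.
Qed.

Lemma frame_row_projector : X *m row_projector X = X.
Proof. by rewrite /row_projector !mulmxA mulmxV ?gram_unit // mul1mx. Qed.

Lemma row_projector_idem : row_projector X *m row_projector X = row_projector X.
Proof. by rewrite {1}/row_projector -mulmxA frame_row_projector. Qed.

Lemma row_projectorP m (A : 'M[R]_(m, k)) : (A *m row_projector X == A) = (A <= X)%MS.
Proof.
apply/eqP/idP => [<-|/submxP[D ->]]; first by rewrite /row_projector mulmxA submxMl.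
by rewrite -mulmxA frame_row_projector.
Qed.

End Frame.

Lemma row_projector_eq d k (X Y : 'M[R]_(d, k)) : row_free X -> row_free Y ->
  (X <= Y)%MS -> row_projector X = row_projector Y.
Proof.
move=> fX fY sXY.
have sYX : (Y <= X)%MS.
  have := mxrank_leqif_eq sXY; rewrite (eqP (fX : _ == _)) (eqP (fY : _ == _)).
  by case=> _; rewrite eqxx => /esym/andP[].
have XY : row_projector X *m row_projector Y = row_projector X.
  apply/eqP; rewrite row_projectorP // (submx_trans _ sXY) //.
  by rewrite /row_projector submxMl.
have YX : row_projector Y *m row_projector X = row_projector Y.
  apply/eqP; rewrite row_projectorP // (submx_trans _ sYX) //.
  by rewrite /row_projector submxMl.
by rewrite -[LHS]row_projector_tr -XY trmx_mul !row_projector_tr YX.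
Qed.

End Projector.

Section GrProjector.
Context {R : realType} {d a b : nat}.
Implicit Types (U : Gr R d a b) (B : 'I_d -> 'M[R]_(a, b)).

Definition frame_mx B : 'M[R]_(d, a * b) := \matrix_i mxvec (B i).

Lemma frame_mx_mul B (w : 'rV[R]_d) : w *m frame_mx B = mxvec (\sum_i w 0 i *: B i).
Proof.
rewrite mulmx_sum_row linear_sum; apply: eq_bigr => i _.
by rewrite rowK linearZ.
Qed.

Lemma frame_mxP B q : reflect (exists w : 'rV[R]_d, q = \sum_i w 0 i *: B i)
  (mxvec q <= frame_mx B)%MS.
Proof.
apply: (iffP submxP) => -[w e]; exists w.
  by apply: (can_inj mxvecK); rewrite e frame_mx_mul.
by rewrite frame_mx_mul e.
Qed.

Lemma frame_span B q : (q \in <<[seq B i | i <- enum 'I_d]>>%VS) = (mxvec q <= frame_mx B)%MS.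
Proof.
apply/idP/frame_mxP => [|[w ->]]; last first.
  apply: memv_suml => i _; apply: memvZ; apply: memv_span.
  by rewrite map_f // mem_enum.
have -> : [seq B i | i <- enum 'I_d] = [tuple B i | i < d] :> seq _ by [].
move=> /coord_span qE; exists (\row_i coord [tuple B i | i < d] i q).
rewrite {1}qE; apply: eq_bigr => i _.
by rewrite mxE -tnth_nth tnth_mktuple.
Qed.

Lemma is_frame_free U B : is_frame B U -> row_free (frame_mx B).
Proof.
move=> fB; apply/row_free_injP => w; rewrite frame_mx_mul => /(congr1 vec_mx).
rewrite mxvecK linear0 => wB.
have fr : free [tuple B i | i < d].
  by rewrite /free -fB gr_dim size_tuple.
apply/rowP => i; rewrite mxE; move/freeP : fr => /(_ (fun i => w 0 i)); apply.
by rewrite -[RHS]wB; apply: eq_bigr => j _; rewrite -tnth_nth tnth_mktuple.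
Qed.

Definition canonical_frame U (i : 'I_d) : 'M[R]_(a, b) := nth 0 (vbasis (gr_val U)) i.

Lemma canonical_frameP U : is_frame (canonical_frame U) U.
Proof.
have sz : size (vbasis (gr_val U)) = d by rewrite size_tuple gr_dim.
rewrite /is_frame -[LHS](span_basis (vbasisP _)); congr (<< _ >>%VS).
apply: (@eq_from_nth _ 0) => [|i]; first by rewrite size_map size_enum_ord sz.
rewrite sz => id_.
by rewrite (nth_map (Ordinal id_)) ?size_enum_ord // /canonical_frame nth_enum_ord.
Qed.

(** A point of the Grassmannian is encoded by the orthogonal projector onto it, so that continuity
    and closedness become statements about matrices. *)
Definition gr_proj U : 'M[R]_(a * b) := row_projector (frame_mx (canonical_frame U)).

Lemma gr_projE U B : is_frame B U -> gr_proj U = row_projector (frame_mx B).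
Proof.
move=> fB; have fC := canonical_frameP U.
apply: row_projector_eq; [exact: is_frame_free fC|exact: is_frame_free fB|].
apply/row_subP => i; rewrite rowK -frame_span -fB fC.
by apply: memv_span; rewrite map_f // mem_enum.
Qed.

Lemma gr_proj_tr U : (gr_proj U)^T = gr_proj U.
Proof. exact: row_projector_tr. Qed.

Lemma gr_proj_idem U : gr_proj U *m gr_proj U = gr_proj U.
Proof. exact: row_projector_idem (is_frame_free (canonical_frameP U)). Qed.

Lemma gr_projP U q : reflect (mxvec q *m gr_proj U = mxvec q) (q \in gr_val U).
Proof.
apply: (iffP idP) => [qU|/eqP].
  apply/eqP; rewrite row_projectorP ?(is_frame_free (canonical_frameP U)) //.
  by rewrite -frame_span -canonical_frameP.
rewrite row_projectorP ?(is_frame_free (canonical_frameP U)) //.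
by rewrite -frame_span -canonical_frameP.
Qed.

(** The topology of [Gr] is a quotient of that of frames, so it is enough that the projector depends
    continuously on a frame. *)
Lemma gr_proj_continuous : continuous (gr_proj : Gr R d a b -> 'M[R]_(a * b)).
Proof.
apply/continuousP => A oA; change (gr_open (gr_proj @^-1` A)) => U B fB AU.
have cf : (fun B' : {ptws 'I_d -> 'M[R]_(a, b)} => frame_mx B') @ B --> frame_mx B.
  apply/(cvg_mxP (F := nbhs B)) => i j.
  have pc : (fun B' : {ptws 'I_d -> 'M[R]_(a, b)} => B' i) @ B --> B i.
    exact: (@proj_continuous _ (fun=> 'M[R]_(a, b)) i B).
  have h := (cvg_mxP (F := nbhs B) _ _).1 (cvg_mxvec (F := nbhs B) pc) 0 j.
  have E : (fun B' : {ptws 'I_d -> 'M[R]_(a, b)} => frame_mx B' i j) =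
      (fun B' => mxvec (B' i) 0 j) by apply/funext => B'; rewrite mxE.
  by rewrite E [frame_mx B i j]mxE; exact: h.
have cp : (fun B' : {ptws 'I_d -> 'M[R]_(a, b)} => row_projector (frame_mx B')) @ B -->
    row_projector (frame_mx B).
  have FF : Filter (nbhs B) by exact: nbhs_filter.
  have cT := cvg_trmx (FF := FF) cf.
  have cG := cvg_mulmx (FF := FF) cf cT.
  have cI := cvg_invmx (FF := FF) (gram_unit (is_frame_free fB)) cG.
  exact: (cvg_mulmx (FF := FF) (cvg_mulmx (FF := FF) cT cI) cf).
have nA : nbhs (row_projector (frame_mx B)) A.
  by rewrite -(gr_projE fB); exact: open_nbhs_nbhs.
have h : nbhs B [set B' : {ptws 'I_d -> 'M[R]_(a, b)} | A (row_projector (frame_mx B'))].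
  exact: cp.
apply: (@filterS _ (nbhs B) (nbhs_filter B) _ _ _ h) => B' AB' U' fB'.
by rewrite /= (gr_projE fB').
Qed.

End GrProjector.

Lemma form_act_linear (R : realType) m (g : 'M[R]_m) : linear (form_act g).
Proof.
by move=> a q q'; rewrite /form_act mulmxDr mulmxDl -scalemxAr -scalemxAl.
Qed.

HB.instance Definition _ (R : realType) m (g : 'M[R]_m) :=
  GRing.isLinear.Build R 'M[R]_m 'M[R]_m _ (form_act g) (form_act_linear g).

Lemma form_actM (R : realType) m (g h q : 'M[R]_m) : g \in unitmx -> h \in unitmx ->
  form_act (g *m h) q = form_act g (form_act h q).
Proof.
move=> ug uh; rewrite /form_act; have -> : invmx (g *m h) = invmx h *m invmx g.
  apply: (can_inj (mulKmx (_ : g *m h \in unitmx))); first by rewrite unitmx_mul ug.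
  by rewrite mulmxV ?unitmx_mul ?ug // mulmxA -(mulmxA g) mulmxV // mulmx1 mulmxV.
by rewrite trmx_mul !mulmxA.
Qed.

Lemma form_act1 (R : realType) m (q : 'M[R]_m) : form_act 1%:M q = q.
Proof. by rewrite /form_act invmx1 trmx1 mul1mx mulmx1. Qed.

(** * The sphere bundle through its unit representatives *)

Section SphereBundleTopology.
Context {R : realType} {d m : nat} {M : topologicalType}.
Variable u : M -> Gr R d m m.
Implicit Types s : sphere_bundle u.

Lemma sb_ray_rep s q : sb_ray s q ->
  [/\ q \in gr_val (u (sb_pt s)), q != 0 & sb_ray s = positive_ray q].
Proof.
case: (sb_rayP s) => q0 [q0u q00 ->] [c /= c0 <-]; split.
- exact: memvZ.
- by rewrite scaler_eq0 negb_or q00 gt_eqF.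
- apply/seteqP; split=> _ [e /= e0 <-].
    exists (e / c); first by rewrite /= divr_gt0.
    by rewrite scalerA divfK // gt_eqF.
  by exists (e * c); [rewrite /= mulr_gt0|rewrite scalerA].
Qed.

Definition sb_unit s : 'M[R]_m := xget 0 [set q | sb_ray s q /\ `|q| = 1].

Lemma sb_unitP s : sb_ray s (sb_unit s) /\ `|sb_unit s| = 1.
Proof.
apply: (@xgetPex _ 0 [set q | sb_ray s q /\ `|q| = 1]).
case: (sb_rayP s) => q [qu q0 qE]; have n0 : 0 < `|q| by rewrite normr_gt0.
exists (`|q|^-1 *: q); split; first by rewrite qE; exists `|q|^-1 => //=; rewrite invr_gt0.
by rewrite normrZ normfV normr_id mulVf // gt_eqF.
Qed.

Lemma sb_rayE s : sb_ray s = positive_ray (sb_unit s).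
Proof. by have [/sb_ray_rep[]] := sb_unitP s. Qed.

Lemma sb_unit_mem s : sb_unit s \in gr_val (u (sb_pt s)).
Proof. by have [/sb_ray_rep[]] := sb_unitP s. Qed.

Lemma sb_unit_ray s q : sb_ray s q -> sb_unit s = `|q|^-1 *: q.
Proof.
rewrite sb_rayE => -[c /= c0 <-]; have [_ n1] := sb_unitP s.
by rewrite normrZ n1 mulr1 gtr0_norm // scalerA mulVf ?scale1r // gt_eqF.
Qed.

Lemma sb_ray_pos s q : sb_ray s q -> exists2 c : R, 0 < c & q = c *: sb_unit s.
Proof. by rewrite sb_rayE => -[c /= c0 <-]; exists c. Qed.

Lemma sb_unit_in_ray s : sb_ray s (sb_unit s). Proof. by have [] := sb_unitP s. Qed.
Lemma sb_unit_norm s : `|sb_unit s| = 1. Proof. by have [] := sb_unitP s. Qed.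

Lemma sb_unit_neq0 s : sb_unit s != 0.
Proof. by rewrite -normr_gt0 sb_unit_norm ltr01. Qed.

Lemma sb_exists x q : q \in gr_val (u x) -> q != 0 ->
  exists2 s : sphere_bundle u, sb_pt s = x & sb_ray s = positive_ray q.
Proof.
move=> qu q0; have h : exists q', [/\ q' \in gr_val (u x), q' != 0 &
  positive_ray q = positive_ray q'] by exists q.
by exists (MkSphereBundle h).
Qed.

Lemma positive_ray_self (q : 'M[R]_m) : positive_ray q q.
Proof. by exists 1; rewrite /= ?ltr01 ?scale1r. Qed.

Lemma sb_nbhs s q (A : set (sphere_bundle u)) : sb_ray s q -> nbhs s A ->
  \forall z \near nbhs (sb_pt s, q), forall s', sb_pt s' = z.1 -> sb_ray s' z.2 -> A s'.
Proof.
rewrite nbhsE => sq -[B [oB Bs] BA]; have := (oB : sb_open B) s q sq Bs.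
by apply: filterS => z h s' e1 e2; apply: BA; exact: h.
Qed.

Lemma sb_pt_continuous : continuous (@sb_pt _ _ _ _ u).
Proof.
apply/continuousP => A oA; change (sb_open (@sb_pt _ _ _ _ u @^-1` A)) => s q sq As.
exists (A, setT) => /=; first by split; [exact: open_nbhs_nbhs|exact: filterT].
by move=> [x q'] [/= Ax _] s' /= e _; rewrite e.
Qed.

Lemma sb_unit_continuous : continuous sb_unit.
Proof.
apply/continuousP => A oA; change (sb_open (sb_unit @^-1` A)) => s q sq As.
have [_ q0 _] := sb_ray_rep sq.
have cn : {for q, continuous (fun q' : 'M[R]_m => `|q'|^-1 *: q')}.
  apply: (cvgZ (F := nbhs q)); last exact: continuous_self.
  by apply: (cvgV (F := nbhs q)); [rewrite normr_eq0|exact: norm_continuous].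
have nA : nbhs (`|q|^-1 *: q) A.
  by apply: open_nbhs_nbhs; split => //; rewrite -(sb_unit_ray sq).
exists (setT, [set q' | A (`|q'|^-1 *: q')]) => /=.
  by split; [exact: filterT|exact: cn].
by move=> [x q'] [/= _ Aq'] s' /= _ sq'; rewrite /= (sb_unit_ray sq').
Qed.

Hypothesis cu : continuous u.

(** The bundle is a quotient, so compactness is drawn from that of K times the unit sphere of
    matrices. A pair (x, q) with q outside the pencil of x has a neighbourhood without points of the
    bundle, because [gr_proj] is continuous along u. *)
Lemma sb_compact (K : set M) : compact K -> compact [set s : sphere_bundle u | K (sb_pt s)].
Proof.
move=> cK; apply/compact_near_coveringP => I F P FF cov.
have cS : compact [set q : 'M[R]_m | `|q| = 1].
  apply: bounded_closed_compact_mx; first by exists 1 => q /= ->.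
  by apply: closed_fun_eq; exact: norm_continuous.
have /compact_near_coveringP nc := compact_setX cK cS.
have h := nc I F (fun i (z : M * 'M[R]_m) => forall s : sphere_bundle u, sb_pt s = z.1 -> sb_ray s z.2 -> P i s) FF.
have {}h : \forall i \near F, [set z : M * 'M[R]_m | K z.1 /\ `|z.2| = 1] `<=`
    (fun z => forall s : sphere_bundle u, sb_pt s = z.1 -> sb_ray s z.2 -> P i s).
  apply: h => -[x q] [/= Kx q1].
  have [qu|nqu] := pselect (mxvec q *m gr_proj (u x) = mxvec q); last first.
    pose e (z : M * 'M[R]_m) := mxvec z.2 *m gr_proj (u z.1) - mxvec z.2.
    have ce : continuous e.
      have cv : continuous (fun z : M * 'M[R]_m => mxvec z.2).
        by move=> z; apply: (cvg_mxvec (F := nbhs z)); exact: continuous_snd.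
      have cp : continuous (fun z : M * 'M[R]_m => gr_proj (u z.1)).
        apply: continuous_compose (@gr_proj_continuous _ _ _ _).
        by apply: continuous_compose cu; exact: continuous_fst.
      move=> z; apply: (cvgB (F := nbhs z)); last exact: cv.
      exact: (continuous_mulmx cv cp).
    have oe : open [set z | e z != 0].
      have -> : [set z | e z != 0] = ~` [set z | e z = 0].
        by apply/seteqP; split=> z /= /eqP.
      by apply: closed_openC; exact: closed_fun_mx0.
    have ez : [set z | e z != 0] (x, q) by rewrite /= subr_eq0; apply/eqP.
    exists ([set z | e z != 0], setT) => /=.
      by split; [exact: open_nbhs_nbhs|exact: filterT].
    move=> [z i] [/= ezn _] s sz sq; exfalso; move/eqP : ezn; apply.
    have [qu _ _] := sb_ray_rep sq.
    by apply/eqP; rewrite /e subr_eq0 -sz; apply/eqP/gr_projP.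
  have q0 : q != 0 by rewrite -normr_gt0 q1 ltr01.
  have [s sx sr] := sb_exists (introT (gr_projP _ _) qu) q0.
  have sq : sb_ray s q by rewrite sr; exact: positive_ray_self.
  have Ks : K (sb_pt s) by rewrite sx.
  have [[A B] /= [nA nB] AB] := cov s Ks.
  have := sb_nbhs sq nA; rewrite sx => nz.
  exists ([set z : M * 'M[R]_m | forall s', sb_pt s' = z.1 -> sb_ray s' z.2 -> A s'], B) => //.
  by move=> [z i] [/= hz Bi] s' e1 e2; apply: (AB (s', i)); split => //; exact: hz.
apply: filterS h => i h s Ks; apply: (h (sb_pt s, sb_unit s)) => //=.
  by split => //; exact: sb_unit_norm.
exact: sb_unit_in_ray.
Qed.

End SphereBundleTopology.

Section Translates.
Context {R : realType} {d m : nat} {M : topologicalType} {G : groupType}.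
Variables (u : M -> Gr R d m m) (act : G -> M -> M) (rho : G -> 'M[R]_m).
Hypothesis u_equiv : equivariant_pencil_map u act rho.

Lemma pencil_act g x q : q \in gr_val (u x) ->
  form_act (rho g) q \in gr_val (u (act g x)).
Proof. by move=> qu; rewrite u_equiv -[form_act _ _]lfunE memv_img. Qed.

Lemma form_act_eq0 (g q : 'M[R]_m) : g \in unitmx -> form_act g q = 0 -> q = 0.
Proof.
move=> ug /(congr1 (fun X => g^T *m X *m g)).
rewrite /form_act mulmx0 mul0mx !mulmxA -trmx_mul mulVmx // trmx1 mul1mx.
by rewrite -mulmxA mulVmx // mulmx1.
Qed.

Lemma sb_translate_exists g (s : sphere_bundle u) : rho g \in unitmx ->
  exists s', sb_translate act rho g s s'.
Proof.
move=> ug; have qu := pencil_act g (sb_unit_mem s).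
have q0 : form_act (rho g) (sb_unit s) != 0.
  by apply: contraNneq (sb_unit_neq0 s) => /(form_act_eq0 ug) ->.
have [s' sx sr] := sb_exists qu q0; exists s'; split => //.
rewrite sr sb_rayE; apply/seteqP; split=> [_ [c c0 <-]|_ [_ [c c0 <-] <-]].
  exists (c *: sb_unit s); first by exists c.
  by rewrite linearZ.
by exists c => //; rewrite linearZ.
Qed.

End Translates.

(** * Growth along the flow *)

Section GrowthOfSequences.
Context {R : realType}.
Variables (Q a : nat -> R) (e : R).
Hypothesis e01 : 0 < e < 1.
Hypothesis Qstep : forall k, `|Q k| <= a k /\ e * a k <= Q k.+1 - Q k.

(** For the tails S of the sum of a, one has e S_j <= - Q_j <= a_j = S_j - S_(j+1), hence S_(j+1) <=
    (1 - e) S_j. *)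
Lemma sequence_contract k : Q k.+1 <= 0 -> a k <= (1 - e) ^+ k * (a 0 / e).
Proof.
have /andP[e0 e1] := e01.
move=> QK; pose S j := \sum_(j <= i < k.+1) a i.
have QS j : (j <= k.+1)%N -> e * S j <= - Q j.
  move=> jk; have -> : j = (k.+1 - (k.+1 - j))%N by rewrite subKn.
  elim: (k.+1 - j)%N (leq_subr j k.+1) => [|i IH] ik.
    by rewrite subn0 /S big_geq // mulr0 oppr_ge0.
  have := IH (ltnW ik); have -> : (k.+1 - i)%N = (k.+1 - i.+1).+1 by lia.
  set l := (k.+1 - i.+1)%N => h; rewrite /S big_ltn ?mulrDr; last by rewrite /l; lia.
  have [_ st] := Qstep l; rewrite -/(S l.+1); lra.
have aS j : (j <= k.+1)%N -> e * S j <= a j.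
  move=> jk; have [h _] := Qstep j; apply: le_trans (QS j jk) _.
  by apply: le_trans h; rewrite -normrN ler_norm.
have Sdec j : (j <= k)%N -> S j <= (1 - e) ^+ j * S 0.
  elim: j => [|j IH] jk; first by rewrite expr0 mul1r.
  rewrite exprS -mulrA (le_trans _ (_ : (1 - e) * S j <= _)) //; last first.
    by rewrite ler_wpM2l ?IH ?(ltnW jk) //; lra.
  have -> : S j = a j + S j.+1 by rewrite /S big_ltn //; lia.
  by have := aS j (leqW (ltnW jk)); rewrite /S big_ltn; [lra|lia].
have -> : a k = S k by rewrite /S big_nat1.
rewrite (le_trans (Sdec k _)) // ler_wpM2l ?exprn_ge0 //; first by lra.
by rewrite ler_pdivlMr // mulrC aS.
Qed.

(** Discrete Gronwall inequality for the partial sums T of a: e T_j <= Q_j <= a_j, hence T_(j+1) >=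
    (1 + e) T_j. *)
Lemma sequence_expand k : 0 <= Q 0 -> e * (1 + e) ^+ k * a 0 <= a k.+1.
Proof.
have /andP[e0 e1] := e01; move=> Q0.
pose T j := \sum_(0 <= i < j) a i.
have QT j : e * T j <= Q j.
  elim: j => [|j IH]; first by rewrite /T big_geq // mulr0.
  by rewrite /T big_nat_recr //= mulrDr -/(T j); have [_] := Qstep j; lra.
have aT j : e * T j <= a j.
  by have [h _] := Qstep j; apply: le_trans (QT j) (le_trans (ler_norm _) h).
have Tg j : (1 + e) ^+ j * a 0 <= T j.+1.
  elim: j => [|j IH]; first by rewrite expr0 mul1r /T big_nat1.
  rewrite exprS -mulrA (le_trans (_ : _ <= (1 + e) * T j.+1)) //.
    by rewrite ler_wpM2l //; lra.
  by rewrite /T [leRHS]big_nat_recr //= -/(T j.+1); have := aT j.+1; lra.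
by rewrite -mulrA (le_trans _ (aT k.+1)) // ler_wpM2l // ltW.
Qed.

End GrowthOfSequences.

Section SignatureFrames.
Context {R : realType} {n : nat}.

Lemma signature_frames (q : 'M[R]_(n + n)) : signature_nn q ->
  exists N P : 'M[R]_(n + n, n), [/\ forall w : 'cV_n, N *m w = 0 -> w = 0,
    forall w : 'cV_n, P *m w = 0 -> w = 0,
    forall w : 'cV_n, w != 0 -> form_eval q (N *m w) (N *m w) < 0 &
    forall w : 'cV_n, w != 0 -> 0 < form_eval q (P *m w) (P *m w)].
Proof.
move=> [X uX XqX]; exists (X *m col_mx 0 1%:M), (X *m col_mx 1%:M 0).
have inj (Y : 'M[R]_(n + n, n)) : (forall w : 'cV_n, Y *m w = 0 -> w = 0) ->
    forall w : 'cV_n, X *m Y *m w = 0 -> w = 0.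
  move=> Yi w; rewrite -mulmxA => /(congr1 (mulmx (invmx X))).
  by rewrite mulKmx // mulmx0; exact: Yi.
have bl (v w : 'cV[R]_n) : form_eval (block_mx 1%:M 0 0 (- 1%:M)) (col_mx v w) (col_mx v w) =
    nsq v - nsq w.
  rewrite /form_eval tr_col_mx mul_row_block !mulmx0 addr0 add0r !mulmx1 mulmxN mulmx1.
  by rewrite mul_row_col mulNmx /nsq mxE [X in _ + X]mxE.
split.
- by apply: inj => w; rewrite mul_col_mx mul0mx mul1mx -col_mx0 => /eq_col_mx[].
- by apply: inj => w; rewrite mul_col_mx mul0mx mul1mx -col_mx0 => /eq_col_mx[].
- move=> w w0; rewrite -mulmxA -form_eval_mul XqX mul_col_mx mul0mx mul1mx bl.
  by rewrite /nsq mulmx0 mxE sub0r oppr_lt0 -/(nsq w) nsq_gt0.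
- move=> w w0; rewrite -mulmxA -form_eval_mul XqX mul_col_mx mul0mx mul1mx bl.
  by rewrite [X in _ - X]/nsq mulmx0 mxE subr0 nsq_gt0.
Qed.

Lemma posdef_bound m (X : 'M[R]_m) : (forall v : 'cV_m, v != 0 -> 0 < form_eval X v v) ->
  exists2 e, 0 < e & forall v, e * nsq v <= form_eval X v v.
Proof.
move=> X0; pose S := [set v : 'cV[R]_m | nsq v = 1].
have cS : compact S.
  apply: bounded_closed_compact_mx.
    exists 1 => v v1; have := norm_nsq v; rewrite v1.
    by move=> h; rewrite -(@ler_pXn2r _ 2) ?nnegrE // expr1n.
  apply: closed_fun_eq; apply: continuous_entry; apply: continuous_mulmx.
    by apply: continuous_trmx; exact: continuous_self.
  exact: continuous_self.
have cX : {within S, continuous (fun v : 'cV[R]_m => form_eval X v v)}.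
  apply: continuous_subspaceT; apply: continuous_entry; apply: continuous_mulmx.
    apply: continuous_mulmx; last exact: continuous_const.
    by apply: continuous_trmx; exact: continuous_self.
  exact: continuous_self.
have [[v0 Sv0]|S0] := pselect (S !=set0); last first.
  exists 1 => // v; rewrite mul1r; have [->|v0] := eqVneq v 0.
    by rewrite /nsq /form_eval !mulmx0 !mxE.
  exfalso; apply: S0; exists ((Num.sqrt (nsq v))^-1 *: v); rewrite /S /= nsqZ.
  by rewrite exprVn sqr_sqrtr ?nsq_ge0 // mulVf // nsq_eq0.
have [v1 v1S vmin] := compact_EVT_min (ex_intro _ v0 Sv0) cS cX.
move: v1S; rewrite inE /S /= => n1.
have v1n0 : v1 != 0 by rewrite -nsq_gt0 n1.
exists (form_eval X v1 v1); first exact: X0.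
move=> v; have [->|v0'] := eqVneq v 0.
  by rewrite /nsq /form_eval !mulmx0 !mxE ?mulr0.
have nv : 0 < nsq v by rewrite nsq_gt0.
have Sv : (Num.sqrt (nsq v))^-1 *: v \in S.
  by rewrite inE /S /= nsqZ exprVn sqr_sqrtr ?nsq_ge0 // mulVf // nsq_eq0.
have := vmin _ Sv; rewrite form_evalvZ exprVn sqr_sqrtr ?nsq_ge0 //.
by rewrite mulrC ler_pdivlMr.
Qed.

End SignatureFrames.

(** * Chains of increasing forms *)

Section Chains.
Context {R : realType} {n : nat} {G : groupType}.
Local Notation m := (n + n)%N.
Variable rho : G -> 'M[R]_m.

Definition hnorm g (v : 'cV[R]_m) : R := nsq (invmx (rho g) *m v).

Lemma hnorm_ge0 g v : 0 <= hnorm g v.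
Proof. exact: nsq_ge0. Qed.

(* q k is a form on V which is comparable to c k times the euclidean structure
   transported by e k, and the forms increase along the chain. *)
Definition chain (D C0 C1 : R) (F : seq G) (e : nat -> G) (c : nat -> R) (q : nat -> 'M[R]_m) :=
  forall k, [/\ 0 < c k /\ signature_nn (q k),
    forall v, `|form_eval (q k) v v| <= C0 * (c k * hnorm (e k) v),
    forall v, D * (c k * hnorm (e k) v) <= form_eval (q k.+1) v v - form_eval (q k) v v,
    forall v, c k.+1 * hnorm (e k.+1) v <= C1 * (c k * hnorm (e k) v) &
    ((e k)^-1 * e k.+1)%g \in F].

Lemma chain_shift D C0 C1 F e c q i : chain D C0 C1 F e c q ->
  chain D C0 C1 F (fun k => e (i + k)%N) (fun k => c (i + k)%N) (fun k => q (i + k)%N).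
Proof. by move=> h k; have := h (i + k)%N; rewrite -addnS. Qed.

Section Growth.
Variables (D C0 C1 : R) (F : seq G) (e : nat -> G) (c : nat -> R) (q : nat -> 'M[R]_m).
Hypotheses (D0 : 0 < D) (DC : D < C0).
Hypothesis ch : chain D C0 C1 F e c q.
Let ep := D / C0.

Let C00 : 0 < C0. Proof. exact: lt_trans DC. Qed.
Let ep01 : 0 < ep < 1. Proof. by rewrite divr_gt0 //= ltr_pdivrMr // mul1r. Qed.

Let ah v k := C0 * (c k * hnorm (e k) v).

Let step v k : `|form_eval (q k) v v| <= ah v k /\
  ep * ah v k <= form_eval (q k.+1) v v - form_eval (q k) v v.
Proof.
have [_ h1 h2 _ _] := ch k; split; first exact: h1.
by rewrite /ep /ah mulrA divfK ?gt_eqF.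
Qed.

(** This is [sequence_contract] for the values of the forms at v, with a_k = C0 c_k |rho(e_k)^-1
    v|^2 and rate D/C0. *)
Lemma chain_contract v k : form_eval (q k.+1) v v <= 0 ->
  c k * hnorm (e k) v <= (1 - ep) ^+ k * (c 0%N * hnorm (e 0%N) v / ep).
Proof.
move=> h; have := sequence_contract ep01 (step v) h.
rewrite /ah => h'; rewrite -(ler_pM2l C00) (le_trans h') //.
by rewrite le_eqVlt; apply/orP; left; apply/eqP; ring.
Qed.

Lemma chain_expand v k : 0 <= form_eval (q 0%N) v v ->
  ep * (1 + ep) ^+ k * (c 0%N * hnorm (e 0%N) v) <= c k.+1 * hnorm (e k.+1) v.
Proof.
move=> h; have := sequence_expand ep01 (step v) k h.
by rewrite /ah mulrCA ler_pM2l // C00.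
Qed.

Lemma chain_mono v i j : (i <= j)%N -> form_eval (q i) v v <= form_eval (q j) v v.
Proof.
move=> ij; rewrite -(subnKC ij); elim: (j - i)%N => [|k IH]; first by rewrite addn0.
rewrite addnS (le_trans IH) // -subr_ge0; have [_ _ h _ _] := ch (i + k)%N.
apply: le_trans (h v); have [[c0 _] _ _ _ _] := ch (i + k)%N.
by rewrite !mulr_ge0 ?hnorm_ge0 ?(ltW D0) ?(ltW c0).
Qed.

End Growth.
End Chains.

Section FlowChains.
Context {R : realType} {d n : nat} {M : topologicalType} {G : groupType}.
Local Notation m := (n + n)%N.
Variables (act : G -> M -> M) (rho : G -> 'M[R]_m) (u : M -> Gr R d m m)
  (Phi : R -> sphere_bundle u -> sphere_bundle u).
Hypothesis act_act : is_action act.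
Hypothesis rho_unit : forall g, rho g \in unitmx.
Hypothesis rho_mul : forall g h, rho (g * h)%g = rho g *m rho h.

Lemma rho1 : rho 1%g = 1%:M.
Proof.
have := rho_mul 1 1; rewrite mulg1 => /(congr1 (mulmx (invmx (rho 1%g)))).
by rewrite mulKmx // mulVmx.
Qed.

Lemma rhoV g : rho g^-1%g = invmx (rho g).
Proof.
have := rho_mul g g^-1; rewrite mulgV rho1 => /(congr1 (mulmx (invmx (rho g)))).
by rewrite mulKmx // mulmx1.
Qed.

Lemma hnorm_mul g h v : hnorm rho (g * h) v = hnorm rho h (invmx (rho g) *m v).
Proof. by rewrite /hnorm -!rhoV invgM rho_mul mulmxA. Qed.

Lemma hnorm1 v : hnorm rho 1 v = nsq v.
Proof. by rewrite /hnorm -rhoV invg1 rho1 mul1mx. Qed.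

Lemma form_act_rho g h q : form_act (rho (g * h)%g) q = form_act (rho g) (form_act (rho h) q).
Proof. by rewrite rho_mul form_actM. Qed.

Lemma form_actK g q : form_act (rho g^-1%g) (form_act (rho g) q) = q.
Proof. by rewrite -form_act_rho mulVg rho1 form_act1. Qed.

Lemma form_act_norm (g q : 'M[R]_m) :
  `|form_act g q| <= m%:R ^+ 2 * `|invmx g| ^+ 2 * `|q|.
Proof.
rewrite /form_act (le_trans (mx_norm_mul _ _)) //.
apply: (@le_trans _ _ (m%:R * (m%:R * `|invmx g| * `|q|) * `|invmx g|)).
  rewrite ler_wpM2r // ler_wpM2l // (le_trans (mx_norm_mul _ _)) //.
  by rewrite mx_norm_tr.
by rewrite le_eqVlt; apply/orP; left; apply/eqP; ring.
Qed.

Hypothesis PD : forall K : set M, compact K ->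
  exists l : seq G, forall g x, K x -> K (act g x) -> g \in l.
Hypothesis cu : continuous u.
Hypothesis u_nn : forall x, pencil_nn (u x).
Hypothesis u_equiv : equivariant_pencil_map u act rho.
Hypothesis Phi_fitting : fitting_flow Phi.
Hypothesis Phi_equiv : equivariant_flow act rho Phi.

Lemma act1 x : act 1%g x = x. Proof. exact: act_act.1. Qed.
Lemma actM g h x : act (g * h)%g x = act g (act h x). Proof. exact: act_act.2. Qed.
Lemma actK g x : act g^-1%g (act g x) = x. Proof. by rewrite -actM mulVg act1. Qed.
Lemma sb_translateV g (s s' : sphere_bundle u) : sb_translate act rho g s s' ->
  sb_translate act rho g^-1%g s' s.
Proof.
move=> [e1 e2]; split; first by rewrite e1 actK.
rewrite e2; apply/seteqP; split=> [q sq|_ [_ [q sq <-] <-]].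
  by exists (form_act (rho g) q); [exists q|rewrite form_actK].
by rewrite form_actK.
Qed.

Lemma Phi_joint : continuous (fun z : R * sphere_bundle u => Phi z.1 z.2).
Proof. by case: Phi_fitting => -[]. Qed.

Lemma Phi_time t : continuous (Phi t).
Proof.
apply: (continuous_compose (f := fun s => (t, s)) _ Phi_joint).
by apply: continuous_pair; [exact: continuous_const|exact: continuous_self].
Qed.

Lemma Phi0 s : Phi 0 s = s. Proof. by case: Phi_fitting => -[h _ _]. Qed.
Lemma PhiD t1 t2 s : Phi (t1 + t2) s = Phi t1 (Phi t2 s).
Proof. by case: Phi_fitting => -[_ h _]. Qed.

Lemma fitting_step s t : 0 < t ->
  exists2 c, 0 < c & positive_form (c *: sb_unit (Phi t s) - sb_unit s).
Proof.
move=> t0; have [_ /(_ s t t0)[q [q' [/sb_ray_pos[a a0 ->] /sb_ray_pos[b b0 ->]]]]] := Phi_fitting.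
move=> [sq pq]; exists (b / a); first by rewrite divr_gt0.
have E : (b / a) *: sb_unit (Phi t s) - sb_unit s =
    a^-1 *: (b *: sb_unit (Phi t s) - a *: sb_unit s).
  by rewrite scalerBr !scalerA mulVf ?gt_eqF // scale1r mulrC.
rewrite E; split; first by rewrite /Defs.symmetric_form trmxZ; congr (_ *: _).
by move=> v v0; rewrite form_evalZ mulr_gt0 ?invr_gt0 ?pq.
Qed.

Variable K : set M.
Hypothesis cK : compact K.

Lemma uniform_step : exists D C : R, [/\ 0 < D, D <= 1, 0 < C &
  forall s : sphere_bundle u, K (sb_pt s) -> exists c, [/\ 0 < c, c <= C &
    forall v, D * nsq v <= form_eval (c *: sb_unit (Phi 1 s) - sb_unit s) v v]].
Proof.
have /compact_near_coveringP nc := sb_compact cu cK.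
(* A single integer bounds both the factor c and the inverse of the gap, so that compactness can be
   applied along [\oo]. *)
pose P (i : nat) (s : sphere_bundle u) := exists c, [/\ 0 < c, c <= i.+1%:R &
    forall v, i.+1%:R^-1 * nsq v <= form_eval (c *: sb_unit (Phi 1 s) - sb_unit s) v v].
have [|N _ NP] := nc nat \oo P eventually_filter.
  move=> s0 _; have [c c0 [_ pc]] := fitting_step s0 ltr01.
  have [e e0 eP] := posdef_bound pc.
  pose mm : R := m%:R ^+ 2 + 1.
  have mm0 : 0 < mm by rewrite ltr_wpDl // exprn_ge0.
  pose X s := c *: sb_unit (Phi 1 s) - sb_unit s.
  have cX : continuous X.
    have cU := @sb_unit_continuous R d m M u.
    move=> s; apply: (cvgB (F := nbhs s)); last exact: cU.
    apply: (cvgZ (F := nbhs s)); first exact: continuous_const.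
    exact: (continuous_compose (@Phi_time 1) cU).
  have r0 : 0 < e / 2 / mm by rewrite !divr_gt0.
  have nX : nbhs (X s0) [set q | `|X s0 - q| < e / 2 / mm] by apply/nbhs_mxP; exists (e / 2 / mm).
  have [k kP] : exists k : nat, c <= k.+1%:R /\ k.+1%:R^-1 <= e / 2.
    exists (Num.truncn (c + 2 / e)); have h : c + 2 / e < (Num.truncn (c + 2 / e)).+1%:R by exact: truncnS_gt.
    have e2 : 0 < 2 / e by rewrite divr_gt0.
    split; first by apply: ltW; apply: le_lt_trans h; rewrite lerDl ltW.
    rewrite -[leRHS]invrK lef_pV2 ?posrE ?invr_gt0 ?divr_gt0 //.
    by rewrite invf_div ltW // (le_lt_trans _ h) // lerDr ltW.
  exists ([set s | `|X s0 - X s| < e / 2 / mm], [set i | (k <= i)%N]).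
    by split => /=; [exact: (cX s0 _ nX)|exists k].
  move=> [s i] /= [Xs ki]; exists c; split => //.
    by rewrite (le_trans kP.1) // ler_nat ltnS.
  move=> v; have := form_eval_norm (X s0 - X s) v.
  rewrite form_evalB -/(X s) => h.
  have h2 : m%:R ^+ 2 * `|X s0 - X s| * nsq v <= e / 2 * nsq v.
    rewrite ler_wpM2r ?nsq_ge0 // (le_trans (_ : _ <= mm * `|X s0 - X s|)) //.
      by rewrite ler_wpM2r // lerDl.
    by rewrite mulrC -ler_pdivlMr // ltW.
  have h3 : i.+1%:R^-1 * nsq v <= e / 2 * nsq v.
    rewrite ler_wpM2r ?nsq_ge0 // (le_trans _ kP.2) // lef_pV2 ?posrE ?ltr0n //.
    by rewrite ler_nat ltnS.
  have aux (a b w z r : R) : r * w <= a -> a - b <= r / 2 * w -> z <= r / 2 * w -> z <= b by lra.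
  exact: (aux _ _ _ _ _ (eP v) (le_trans (ler_norm _) (le_trans h h2)) h3).
exists N.+1%:R^-1, N.+1%:R; split; [by rewrite invr_gt0| |by []|].
  by rewrite invf_le1 // ler1n.
by move=> s Ks; exact: (NP N (leqnn N) s Ks).
Qed.

Definition flow_path (s : sphere_bundle u) (ga : nat -> G) :=
  forall k, (act (ga k) @` K) (sb_pt (Phi k%:R s)).

Lemma compact_translates (K1 : set M) : compact K1 ->
  exists F : seq G, forall g x, K x -> K1 (act g x) -> g \in F.
Proof.
move=> cK1; have [F FP] := PD (compactU cK cK1).
by exists F => g x Kx K1x; apply: (FP g x); [left|right].
Qed.

(** At each integer time the point of the flow line is moved back into K by the inverse of [ga k];
    its unit form there is [nu k]. All constants come from K and from the finite set F of
    translations that occur between consecutive times. The constant m^2 + 1 is the bound of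
    [form_eval_norm] plus 1; for n > 0 it exceeds D. *)
Lemma flow_chain : exists (D C1 : R) (F : seq G), [/\ 0 < D, D <= 1, 0 < C1 &
  forall s ga, flow_path s ga -> exists (c : nat -> R) (nu : nat -> 'M[R]_m),
    [/\ chain rho D (m%:R ^+ 2 + 1) C1 F ga c (fun k => c k *: form_act (rho (ga k)) (nu k)),
        forall k, `|nu k| = 1 &
        forall k, sb_ray (Phi k%:R s) (c k *: form_act (rho (ga k)) (nu k))]].
Proof.
have [D [C [D0 D1 C0 stepP]]] := uniform_step.
have cK1 : compact ((fun s => sb_pt (Phi 1 s)) @` [set s : sphere_bundle u | K (sb_pt s)]).
  apply: continuous_compact; last exact: sb_compact.
  apply: continuous_subspaceT; apply: continuous_compose (@sb_pt_continuous _ _ _ _ _).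
  exact: Phi_time.
have [F FP] := compact_translates cK1.
pose kap : R := \sum_(f <- F) (m%:R ^+ 2 * `|invmx (rho f^-1%g)| ^+ 2).
pose C2 : R := \sum_(f <- F) opbound (invmx (rho f)).
have bigle (f0 : G) (h : G -> R) : (forall f, 0 <= h f) -> f0 \in F -> h f0 <= \sum_(f <- F) h f.
  by move=> h0 f0F; rewrite (big_rem f0) //= lerDl sumr_ge0.
have kap0 : 0 <= kap by rewrite sumr_ge0 // => f _; rewrite mulr_ge0 ?exprn_ge0.
have C20 : 0 <= C2 by rewrite sumr_ge0 // => f _; rewrite ltW ?opbound_gt0.
exists D, (C * kap * C2 + 1), F; split => //.
  by rewrite ltr_wpDl // !mulr_ge0 // ltW.
move=> s ga fp.
have rex k : exists r, sb_translate act rho (ga k) r (Phi k%:R s) /\ K (sb_pt r).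
  have [r rP] := sb_translate_exists u_equiv (Phi k%:R s) (rho_unit (ga k)^-1%g).
  exists r; have := sb_translateV rP; rewrite invgK => h; split => //.
  by case: rP => -> _; have [x Kx <-] := fp k; rewrite actK.
have [r rP] := choice rex.
have [c' c'P] := choice (fun k => stepP (r k) (rP k).2).
have t1 k : sb_translate act rho (ga k) (Phi 1 (r k)) (Phi k.+1%:R s).
  by have := Phi_equiv (rP k).1 1; rewrite -PhiD nat1r.
pose f k := ((ga k)^-1 * ga k.+1)%g.
have fF k : f k \in F.
  apply: (FP _ (sb_pt (r k.+1))); first exact: (rP k.+1).2.
  exists (r k); first exact: (rP k).2.
  have [h1 _] := t1 k; have [h2 _] := (rP k.+1).1.
  by rewrite /f actM -h2 h1 actK.
have muex k : exists mu, 0 < mu /\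
    sb_unit (Phi 1 (r k)) = mu *: form_act (rho (f k)) (sb_unit (r k.+1)).
  have h : sb_ray (Phi k.+1%:R s) (form_act (rho (ga k.+1)) (sb_unit (r k.+1))).
    by have [_ ->] := (rP k.+1).1; exists (sb_unit (r k.+1)) => //; exact: sb_unit_in_ray.
  have [_ e] := t1 k; rewrite e in h; case: h => q /sb_ray_pos[b b0 ->] qE.
  exists b^-1; split; first by rewrite invr_gt0.
  have := congr1 (form_act (rho (ga k)^-1%g)) qE.
  rewrite form_actK -form_act_rho -/(f k) => <-.
  by rewrite scalerA mulVf ?scale1r // gt_eqF.
have [mu muP] := choice muex.
(* [c' k] is the factor of the fitting condition over one unit of time, and [mu k] compares two
   normalisations of the same ray; with their product the consecutive forms of the chain satisfy the
   fitting inequality. *)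
pose c := fix c k := if k is k'.+1 then c k' * c' k' * mu k' else 1 : R.
have c0 k : 0 < c k.
  by elim: k => //= k IH; have [h _ _] := c'P k; have [h' _] := muP k; rewrite !mulr_gt0.
pose nu k := sb_unit (r k).
have nu1 k : `|nu k| = 1 by exact: sb_unit_norm.
(* Both forms have norm 1, so [mu k] is bounded through the finitely many possible [f k]. *)
have mule k : mu k <= kap.
  have [mu0 muE] := muP k.
  set w := `|form_act (rho (f k)) (nu k.+1)|.
  have e1 : mu k * w = 1 by rewrite -(gtr0_norm mu0) -normrZ -muE sb_unit_norm.
  have w0 : 0 < w.
    by rewrite lt_neqAle normr_ge0 andbT; apply/eqP => z; move: e1; rewrite -z mulr0 => /eqP; rewrite eq_sym oner_eq0.
  rewrite -(ler_pM2r w0) e1 -(nu1 k.+1) -{1}(form_actK (f k) (nu k.+1)).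
  rewrite (le_trans (form_act_norm _ _)) // ler_wpM2r //.
  by apply: (bigle (f k) (fun f => m%:R ^+ 2 * `|invmx (rho f^-1%g)| ^+ 2)) => // g; rewrite mulr_ge0 ?exprn_ge0.
exists c, nu; split => // k; last first.
  have [_ ->] := (rP k).1; exists (c k *: nu k); last by rewrite linearZ.
  by rewrite sb_rayE; exists (c k) => /=.
have Ev g q v : form_eval (form_act (rho g) q) v v = form_eval q (invmx (rho g) *m v) (invmx (rho g) *m v).
  exact: form_eval_act.
split.
- split => //.
  have nz : c k *: form_act (rho (ga k)) (nu k) != 0.
    rewrite scaler_eq0 negb_or gt_eqF //=.
    by apply: contraNneq (sb_unit_neq0 (r k)) => /(form_act_eq0 (rho_unit _)) h; rewrite -/(nu k) h.
  have mem : c k *: form_act (rho (ga k)) (nu k) \in gr_val (u (act (ga k) (sb_pt (r k)))).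
    by apply: memvZ; apply: (pencil_act u_equiv); exact: sb_unit_mem.
  by have [_ h] := u_nn mem; exact: h.
- move=> v; rewrite form_evalZ Ev normrM (gtr0_norm (c0 k)) mulrCA ler_pM2l //.
  rewrite (le_trans (form_eval_norm _ _)) // nu1 mulr1 ler_wpM2r ?nsq_ge0 //.
  by rewrite lerDl.
- move=> v; rewrite !form_evalZ.
  have [c'0 _ /(_ (invmx (rho (ga k)) *m v))] := c'P k.
  have [mu0 ->] := muP k; rewrite form_evalB !form_evalZ -Ev -Ev -form_act_rho /f mulVKg.
  rewrite -/(nu k.+1) -/(nu k) -(ler_pM2l (c0 k)) => h.
  rewrite mulrCA (le_trans h) // mulrBr /= lerB // le_eqVlt; apply/orP; left.
  apply/eqP; ring.
- move=> v; have -> : hnorm rho (ga k.+1) v = hnorm rho (f k) (invmx (rho (ga k)) *m v).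
    by rewrite -hnorm_mul /f mulVKg.
  have [c'0 c'C _] := c'P k; have [mu0 _] := muP k.
  have h1 : hnorm rho (f k) (invmx (rho (ga k)) *m v) <= C2 * hnorm rho (ga k) v.
    rewrite (le_trans (nsq_mul_le _ _)) // ler_wpM2r ?nsq_ge0 //.
    by apply: (bigle (f k) (fun f => opbound (invmx (rho f)))) => // g; rewrite ltW ?opbound_gt0.
  have hn := hnorm_ge0 rho (ga k) v.
  have h2 : c' k * mu k <= C * kap by rewrite ler_pM // ltW.
  have h3 : (c' k * mu k) * hnorm rho (f k) (invmx (rho (ga k)) *m v) <= (C * kap) * (C2 * hnorm rho (ga k) v).
    by rewrite ler_pM ?hnorm_ge0 // mulr_ge0 // ltW.
  have -> (z : R) : c k.+1 * z = c k * (c' k * mu k * z) by rewrite /=; ring.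
  by rewrite [leRHS]mulrCA ler_pM2l // (le_trans h3) //; lra.
- exact: fF.
Qed.

End FlowChains.

(** * Chains and flow lines leave bounded regions *)

Section Escape.
Context {R : realType} {n : nat} {G : groupType}.
Local Notation m := (n + n)%N.
Variable rho : G -> 'M[R]_m.
Hypothesis n_gt0 : (0 < n)%N.
Hypothesis rho_unit : forall g, rho g \in unitmx.
Hypothesis rho_mul : forall g h, rho (g * h)%g = rho g *m rho h.

Lemma signature_vectors (q : 'M[R]_m) : signature_nn q ->
  exists v w : 'cV[R]_m, [/\ v != 0, w != 0, form_eval q v v <= 0 & 0 <= form_eval q w w].
Proof.
move=> /signature_frames[N [P [Ni Pi Nq Pq]]].
pose x : 'cV[R]_n := const_mx 1.
have x0 : x != 0.
  by apply/eqP => /matrixP/(_ (Ordinal n_gt0) 0); rewrite !mxE => /eqP; rewrite oner_eq0.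
exists (N *m x), (P *m x); split.
- by apply/eqP => /Ni; exact/eqP.
- by apply/eqP => /Pi; exact/eqP.
- exact: ltW (Nq x x0).
- exact: ltW (Pq x x0).
Qed.

Lemma hnorm_bounds (F : seq G) : exists C : R, 0 < C /\
  forall g, g \in F -> forall v, hnorm rho g v <= C * nsq v /\ nsq v <= C * hnorm rho g v.
Proof.
pose b g := opbound (invmx (rho g)) + opbound (rho g).
have b0 g : 0 <= b g by rewrite addr_ge0 // ltW ?opbound_gt0.
exists (\sum_(g <- F) b g + 1); split; first by rewrite ltr_wpDl // sumr_ge0.
move=> g gF v; have bg : b g <= \sum_(g <- F) b g + 1.
  by rewrite (big_rem g) //= -addrA lerDl addr_ge0 ?sumr_ge0.
have n1 := nsq_mul_le (invmx (rho g)) v.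
have n2 := nsq_mul_le (rho g) (invmx (rho g) *m v).
rewrite mulKVmx // in n2.
split.
  apply: (le_trans n1); rewrite ler_wpM2r ?nsq_ge0 // (le_trans _ bg) // lerDl.
  by rewrite ltW ?opbound_gt0.
apply: (le_trans n2); rewrite ler_wpM2r ?nsq_ge0 // (le_trans _ bg) // lerDr.
by rewrite ltW ?opbound_gt0.
Qed.

Lemma bernoulli (x : R) k : 0 <= x -> 1 + k%:R * x <= (1 + x) ^+ k.
Proof.
move=> x0; elim: k => [|k IH]; first by rewrite expr0 mul0r addr0.
rewrite exprS (le_trans _ (_ : (1 + x) * (1 + k%:R * x) <= _)) //; last first.
  by rewrite ler_wpM2l // addr_ge0.
have : 0 <= x * (k%:R * x) by rewrite !mulr_ge0.
by rewrite -natr1; lra.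
Qed.

(** If the two ends differ by an element of F', the norms transported to the ends are comparable. A
    vector where the last form is nonpositive then bounds the last scalar by a multiple of the first
    one, and a vector where the first form is nonnegative bounds it below by an exponential in k; so
    k is bounded. *)
Lemma chain_escape D C0 C1 (F F' : seq G) : 0 < D -> D < C0 -> 0 < C1 ->
  exists T : nat, forall e c q, chain rho D C0 C1 F e c q ->
    forall i k, ((e i)^-1 * e (i + k)%N)%g \in F' -> (k <= T)%N.
Proof.
move=> D0 DC C10; have [B [B0 BP]] := hnorm_bounds F'.
pose ep := D / C0; have C00 : 0 < C0 by exact: lt_trans DC.
have /andP[ep0 ep1] : 0 < ep < 1 by rewrite divr_gt0 //= ltr_pdivrMr // mul1r.
pose L := B * (B * (C1 / ep)) / ep.
suff aux e c q : chain rho D C0 C1 F e c q -> forall k, ((e 0%N)^-1 * e k)%g \in F' ->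
    (k <= (Num.truncn (L / ep)).+1)%N.
  exists (Num.truncn (L / ep)).+1 => e c q ch i k h.
  by apply: (aux _ _ _ (chain_shift i ch)); rewrite addn0.
move=> ch k; case: k => [//|k] eF; rewrite ltnS.
have hE v : hnorm rho (e k.+1) v = hnorm rho ((e 0%N)^-1 * e k.+1)%g (invmx (rho (e 0%N)) *m v).
  by rewrite -hnorm_mul // mulVKg.
have [[c00 s0] _ _ _ _] := ch 0%N; have [[ck0 sk] _ _ _ _] := ch k.+1.
have [v [_ [v0 _ qv _]]] := signature_vectors sk.
have [_ [w [_ w0 _ qw]]] := signature_vectors s0.
have hpos x : x != 0 -> 0 < hnorm rho (e 0%N) x.
  move=> x0; rewrite /hnorm nsq_gt0; apply: contraNneq x0 => z.
  by rewrite -(mulKVmx (rho_unit (e 0%N)) x) z mulmx0.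
have hv0 := hpos _ v0; have hw0 := hpos _ w0.
have cr := chain_contract D0 DC ch qv; have ex := chain_expand D0 DC ch k qw.
rewrite -/ep in cr ex.
have [_ _ _ /(_ v) st _] := ch k.
have [_ b1] := BP _ eF (invmx (rho (e 0%N)) *m v).
have [b2 _] := BP _ eF (invmx (rho (e 0%N)) *m w).
rewrite -hE -/(hnorm rho (e 0%N) v) in b1; rewrite -hE -/(hnorm rho (e 0%N) w) in b2.
have le1 : (1 - ep) ^+ k <= 1 by rewrite exprn_ile1 //; lra.
have u1 : c k.+1 <= B * (C1 / ep) * c 0%N.
  rewrite -(ler_pM2r hv0).
  have h1 : c k.+1 * hnorm rho (e 0%N) v <= B * (c k.+1 * hnorm rho (e k.+1) v).
    by rewrite mulrCA ler_pM2l.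
  apply: (le_trans h1); rewrite -!mulrA ler_pM2l // (le_trans st) // ler_pM2l //.
  rewrite (le_trans cr) // [leRHS]mulrC.
  by rewrite ler_piMl // !mulr_ge0 ?invr_ge0 ?(ltW ep0) ?(ltW c00) ?hnorm_ge0.
have u2 : ep * (1 + ep) ^+ k * c 0%N <= B * c k.+1.
  rewrite -(ler_pM2r hw0); apply: (@le_trans _ _ (ep * (1 + ep) ^+ k * (c 0%N * hnorm rho (e 0%N) w))).
    by rewrite mulrA.
  rewrite (le_trans ex) //; have -> (z : R) : B * c k.+1 * z = c k.+1 * (B * z) by ring.
  by rewrite ler_wpM2l // ltW.
have u3 : (1 + ep) ^+ k <= L.
  rewrite /L ler_pdivlMr // -(ler_pM2r c00).
  rewrite [X in X * _ <= _]mulrC (le_trans u2) //.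
  by rewrite -[leRHS]mulrA ler_pM2l.
have := bernoulli k (ltW ep0) => u4.
have u5 : k%:R * ep <= L by lra.
have u6 : k%:R <= L / ep by rewrite ler_pdivlMr.
by rewrite -ltnS -(ltr_nat R) (le_lt_trans u6) // truncnS_gt.
Qed.

End Escape.

Section Properness.
Context {R : realType} {d n : nat} {M : topologicalType} {G : groupType}.
Local Notation m := (n + n)%N.
Variables (act : G -> M -> M) (rho : G -> 'M[R]_m) (u : M -> Gr R d m m)
  (Phi : R -> sphere_bundle u -> sphere_bundle u).
Hypothesis n_gt0 : (0 < n)%N.
Hypothesis act_act : is_action act.
Hypothesis rho_unit : forall g, rho g \in unitmx.
Hypothesis rho_mul : forall g h, rho (g * h)%g = rho g *m rho h.
Hypothesis PD : forall K : set M, compact K ->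
  exists l : seq G, forall g x, K x -> K (act g x) -> g \in l.
Hypothesis cu : continuous u.
Hypothesis u_nn : forall x, pencil_nn (u x).
Hypothesis u_equiv : equivariant_pencil_map u act rho.
Hypothesis Phi_fitting : fitting_flow Phi.
Hypothesis Phi_equiv : equivariant_flow act rho Phi.

Lemma flow_path_exists (K : set M) s : \bigcup_g act g @` K = setT ->
  K (sb_pt s) -> exists2 ga, ga 0%N = 1%g & flow_path act Phi K s ga.
Proof.
move=> Kc Ks; have ex k : exists g, (k = 0%N -> g = 1%g) /\ (act g @` K) (sb_pt (Phi k%:R s)).
  case: k => [|k].
    by exists 1%g; split => //; exists (sb_pt s) => //; rewrite (act1 act_act) (Phi0 Phi_fitting).
  have : [set: M] (sb_pt (Phi k.+1%:R s)) by [].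
  by rewrite -Kc => -[g _ h]; exists g.
have [ga gaP] := choice ex; exists ga; first exact: (gaP 0%N).1.
by move=> k; exact: (gaP k).2.
Qed.

Lemma time_slab_compact (C : set M) (a b : R) : compact C ->
  compact ((fun z : R * sphere_bundle u => sb_pt (Phi z.1 z.2)) @`
    (`[a, b]%classic `*` [set s | C (sb_pt s)])).
Proof.
move=> cC; apply: continuous_compact; last first.
  by apply: compact_setX; [exact: segment_compact|exact: sb_compact].
apply: continuous_subspaceT.
exact: (continuous_compose (Phi_joint Phi_fitting) (@sb_pt_continuous _ _ _ _ _)).
Qed.

Lemma flow_proper (K C : set M) (y : M) : compact K -> \bigcup_g act g @` K = setT ->
  compact C ->
  exists T : R, forall s, sb_pt s = y -> forall t, T <= t -> ~ C (sb_pt (Phi t s)).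
Proof.
(* With y in the compact set, the sequence of translates can start at the identity. *)
move=> cK Kc cC; pose K1 := K `|` [set y].
have cK1 : compact K1 by apply: compactU => //; exact: compact_set1.
have K1c : \bigcup_g act g @` K1 = setT.
  apply/seteqP; split => // x _; have : [set: M] x by [].
  by rewrite -Kc => -[g _ [z Kz <-]]; exists g => //; exists z => //; left.
have [D [C1 [F [D0 D1 C10 fc]]]] :=
  flow_chain act_act rho_unit rho_mul PD cu u_nn u_equiv Phi_fitting Phi_equiv cK1.
(* The time t is replaced by its integer part k, and k - t lies in [-1, 0]. *)
have cS := @time_slab_compact C (- 1) 0 cC.
have [F' F'P] := compact_translates PD cK1 cS.
have DC : D < m%:R ^+ 2 + 1.
  by rewrite (le_lt_trans D1) // ltrDr exprn_gt0 // ltr0n; lia.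
have [T TP] := chain_escape n_gt0 rho_unit rho_mul F F' D0 DC C10.
exists T.+2%:R => s sy t Tt Ct.
have K1s : K1 (sb_pt s) by right.
have [ga ga1 fp] := flow_path_exists K1c K1s.
have [c [nu [ch _ _]]] := fc s ga fp.
have t0 : 0 <= t by rewrite (le_trans _ Tt).
pose k := Num.truncn t; have /andP[k1 k2] := truncn_itv t0.
rewrite -/k in k1 k2.
have kT : (T < k)%N.
  by rewrite -ltnS -(ltr_nat R) (le_lt_trans _ k2) // (le_trans _ Tt) // ler_nat.
have := TP _ _ _ ch 0%N k; rewrite add0n ga1 invg1 mul1g.
suff gF : ga k \in F' by move=> /(_ gF); rewrite leqNgt kT.
have [x Kx xE] := fp k; apply: (F'P _ x Kx); rewrite xE.
exists (k%:R - t, Phi t s); last by rewrite /= -(PhiD Phi_fitting) subrK.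
split => //=; rewrite in_itv /=; apply/andP; split; last by rewrite subr_le0.
by move: k2; rewrite -natr1; lra.
Qed.

End Properness.

(** * The degree argument *)

Lemma continuous_near (X Y : topologicalType) (f g : X -> Y) x :
  (\forall y \near x, f y = g y) -> {for x, continuous g} -> {for x, continuous f}.
Proof.
move=> h cg A; rewrite /= (nbhs_singleton h) => nA.
have {}nA : \forall y \near x, A (g y) by exact: cg.
by apply: filterS2 h nA => y /= ->.
Qed.

Lemma continuous_at_max (R : realType) (X : topologicalType) (f g : X -> R) x :
  {for x, continuous f} -> {for x, continuous g} ->
  {for x, continuous (fun y => Num.max (f y) (g y))}.
Proof. by move=> cf cg; exact: (continuous_max (f := f) (g := g) cf cg). Qed.

(* The degree argument is carried out by deforming a map f into M together with
   a frame tau of the pulled back bundle and a section g of the dual bundle. *)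
Section Push.
Context {R : realType} {d k : nat} {M X : topologicalType}.
Hypothesis hM : hausdorff_space M.
Hypothesis charts : forall x : M, exists (Q : set M) (W : set 'rV[R]_d.+1)
    (psi : M -> 'rV[R]_d.+1) (k : 'rV[R]_d.+1 -> M), [/\ open Q, Q x, open W,
    forall a, Q a -> [/\ W (psi a), k (psi a) = a & {for a, continuous psi}] &
    forall w, W w -> [/\ Q (k w), psi (k w) = w & {for w, continuous k}]].
Variable P : M -> 'M[R]_k.
Hypothesis cP : continuous P.
Hypothesis Prep : forall x, exists2 F : 'M[R]_(d.+1, k), row_free F & P x = row_projector F.
Variables (y : M) (bd : set X) (f0 : X -> M) (tau0 : X -> 'M[R]_(d.+1, k)) (g0 : M -> 'rV[R]_k).
Local Notation Z := (f0 @` bd).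
Hypothesis cZ : closed Z.

(** The rows of [tau p] are a basis of the image of [P (f p)]. The row [g z] acts as a functional on
    the image of [P z], and [g z *m P z] is its restriction; over C it may vanish only at y, so once
    C avoids y the functional has no zeros. *)
Definition deformation (C : set M) (f : X -> M) (tau : X -> 'M[R]_(d.+1, k)) (g : M -> 'rV[R]_k) :=
  [/\ [/\ continuous f, continuous tau & continuous g],
      closed C /\ (forall p, C (f p)),
      forall p, tau p *m P (f p) = tau p /\ row_free (tau p),
      forall z, C z -> z <> y -> g z *m P z <> 0 &
      forall p, bd p -> [/\ f p = f0 p, tau p = tau0 p & g (f0 p) = g0 (f0 p)]].

Definition missed (x : M) := exists C f tau g, deformation C f tau g /\ ~ C x.

Lemma P_idem x : P x *m P x = P x.
Proof. by have [F fF ->] := Prep x; rewrite row_projector_idem. Qed.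

Lemma P_tr x : (P x)^T = P x.
Proof. by have [F fF ->] := Prep x; rewrite row_projector_tr. Qed.

Lemma P_rep x (F : 'M[R]_(d.+1, k)) : row_free F -> F *m P x = F -> P x = row_projector F.
Proof.
have [F1 fF1 PE] := Prep x; rewrite PE => fF /eqP; rewrite row_projectorP // => sF.
by apply/esym; apply: row_projector_eq.
Qed.

(** A chart is shrunk until it avoids Z and until the projections of a frame at [x0] remain frames,
    which is an open condition on a Gram determinant. *)
Lemma local_chart x0 : ~ Z x0 -> exists (rho : R) (Q : set M) (psi : M -> 'rV[R]_d.+1)
    (kk : 'rV[R]_d.+1 -> M) (F0 : 'M[R]_(d.+1, k)), [/\ 0 < rho, open Q, Q x0,
    forall a, Q a -> [/\ `|psi a - psi x0| < rho, kk (psi a) = a, {for a, continuous psi},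
        ~ Z a & row_free (F0 *m P a)] &
    forall w, `|w - psi x0| < rho -> [/\ Q (kk w), psi (kk w) = w & {for w, continuous kk}]].
Proof.
move=> nZ; have [Q [W [psi [kk [oQ Qx oW QP WP]]]]] := charts x0.
have [F0 fF0 PE] := Prep x0.
pose gd a := \det ((F0 *m P a) *m (F0 *m P a)^T).
have cgd : continuous gd.
  have cF : continuous (fun a => F0 *m P a) by apply: continuous_mulmx => //; exact: continuous_const.
  by move=> a; apply: cvg_det; exact: (@continuous_mulmx _ _ _ _ _ _ _ cF (continuous_trmx cF) a).
have rfP a : gd a != 0 -> row_free (F0 *m P a).
  move=> ga; apply/row_free_injP => w wF.
  have u : (F0 *m P a) *m (F0 *m P a)^T \in unitmx by rewrite unitmxE unitfE.
  have : w *m ((F0 *m P a) *m (F0 *m P a)^T) = 0 by rewrite mulmxA wF mul0mx.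
  by move=> /(congr1 (mulmx^~ (invmx ((F0 *m P a) *m (F0 *m P a)^T)))); rewrite mulmxK // mul0mx.
have gx0 : gd x0 != 0.
  rewrite /gd PE frame_row_projector // -unitfE -unitmxE; exact: gram_unit.
pose A := [set a | ~ Z a /\ gd a != 0].
have nA : nbhs x0 A.
  apply: filterI; first by apply: open_nbhs_nbhs; split => //; exact: closed_openC.
  exact: (cgd x0 _ (open_nbhs_nbhs (conj (@open_neq R 0) gx0))).
have [Wx kx cx] := QP x0 Qx; have [_ _ ck] := WP _ Wx.
have nW : nbhs (psi x0) (W `&` kk @^-1` A).
  by apply: filterI; [exact: open_nbhs_nbhs|apply: ck; rewrite kx].
have /nbhs_mxP[r r0 rP] := nW.
exists r, (Q `&` [set a | `|psi a - psi x0| < r]), psi, kk, F0; split => //.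
- rewrite openE => a [Qa ar]; apply: filterI; first exact: open_nbhs_nbhs.
  have [_ _ ca] := QP a Qa.
  suff nA' : nbhs (psi a) [set v : 'rV[R]_d.+1 | `|v - psi x0| < r] by exact: (ca _ nA').
  apply/nbhs_mxP; exists (r - `|psi a - psi x0|); first by rewrite subr_gt0.
  move=> z za /=; rewrite -(subrK (psi a) z) -addrA (le_lt_trans (ler_normD _ _)) //.
  by rewrite distrC -ltrBrDr.
- by split => //=; rewrite subrr normr0.
- move=> a [Qa ar]; have [Wa ka ca] := QP a Qa.
  have [_] := rP (psi a) ltac:(by rewrite distrC); rewrite /= ka => -[nZa ga].
  by split => //; exact: rfP.
- move=> w wr; have [Ww Aw] := rP w ltac:(by rewrite distrC).
  by have [Qk kw cw] := WP w Ww; split => //; split => //=; rewrite kw.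
Qed.

(** The image of f avoids x, so it can be pushed radially out of a ball that contains x and x'. The
    frame follows through the local trivialisation. The functional must have no zeros on the
    boundary sphere of the ball, which the pushed image may now meet: this is where the perturbation
    on spheres is used. *)
Lemma push_off x0 : ~ Z x0 -> exists2 U : set M, nbhs x0 U &
  forall x x', U x -> U x' -> missed x -> missed x'.
Proof.
move=> nZ; have [rho [Q [psi [kk [F0 [rho0 oQ Qx0 QP WP]]]]]] := local_chart nZ.
have [_ _ cpsi0 _ _] := QP _ Qx0.
exists (Q `&` [set a | `|psi a - psi x0| < rho / 4]).
  apply: filterI; first exact: open_nbhs_nbhs.
  suff nA' : nbhs (psi x0) [set v : 'rV[R]_d.+1 | `|v - psi x0| < rho / 4] by exact: (cpsi0 _ nA').
  apply/nbhs_mxP; exists (rho / 4); first by rewrite divr_gt0.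
  by move=> z; rewrite distrC.
move=> x x' [Qx xr] [Qx' xr'] [C [f [tau [g [[[cf ct cg] [cC fC] tauP gP bdP] nCx]]]]].
set w := psi x.
pose nv z := `|psi z - w|.
have wb v : `|v - w| < 3 / 4 * rho -> `|v - psi x0| < rho.
  move=> h; rewrite -(subrK w v) -addrA (le_lt_trans (ler_normD _ _)) //.
  by move: xr h => /=; rewrite -/w; lra.
pose dl := rho / 16; have dl0 : 0 < dl by rewrite divr_gt0.
(* The functional is modified on the annulus from r to r + dl; of two disjoint candidates, one
   avoids y, where the functional may vanish. *)
have [r [r1 r2 ry]] : exists r, [/\ rho / 2 <= r, r + dl <= 11 / 16 * rho & ~ (r <= nv y <= r + dl)].
  rewrite /dl; have [yr|yr] := pselect (rho / 2 <= nv y <= rho / 2 + rho / 16).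
    exists (5 / 8 * rho); split; [lra|lra|move=> /andP[h _]; case/andP: yr => _; lra].
  by exists (rho / 2); split => //; lra.
have r0 : 0 < r by rewrite (lt_le_trans _ r1) // divr_gt0.
pose F z := F0 *m P z; pose Gm z := invmx (F z *m (F z)^T).
have cF : continuous F by apply: continuous_mulmx => //; exact: continuous_const.
have uG z : Q z -> F z *m (F z)^T \in unitmx by move=> /QP[_ _ _ _ fF]; exact: gram_unit.
have cG z : Q z -> {for z, continuous Gm}.
  move=> Qz; have h : (fun t => F t *m (F t)^T) @ z --> F z *m (F z)^T.
    exact: (@continuous_mulmx _ _ _ _ _ _ _ cF (continuous_trmx cF) z).
  exact: (cvg_invmx (FF := nbhs_filter z) (uG _ Qz) h).
have FP z : F z *m P z = F z by rewrite /F -mulmxA P_idem.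
have PF z : Q z -> P z = row_projector (F z).
  by move=> Qz; have [_ _ _ _ fF] := QP z Qz; apply: P_rep.
pose ball s := [set v : 'rV[R]_d.+1 | `|v - w| <= s].
have cn : continuous (fun v : 'rV[R]_d.+1 => `|v - w|).
  move=> v; apply: (cvg_norm (F := nbhs v)); apply: (cvgB (F := nbhs v)); last exact: continuous_const.
  exact: continuous_self.
have cball s : compact (ball s).
  apply: bounded_closed_compact_mx; last exact: closed_fun_le.
  by exists (s + `|w|) => v /= vs; rewrite -(subrK w v) (le_trans (ler_normD _ _)) // lerD2r.
have ckk s : s < 3 / 4 * rho -> {within ball s, continuous kk}.
  move=> s34; apply: continuous_in_subspaceT => v /set_mem /= vs.
  by have [] := WP v (wb v (le_lt_trans vs s34)).
have kcl (B : set 'rV[R]_d.+1) s : s < 3 / 4 * rho -> closed B -> B `<=` ball s -> compact (kk @` B).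
  move=> s34 cB Bs; apply: continuous_compact; last exact: subclosed_compact cB (cball s) Bs.
  exact: continuous_subspaceW Bs (ckk s s34).
have kball s : s < 3 / 4 * rho -> closed (kk @` ball s).
  move=> s34; apply: compact_closed => //; apply: (kcl _ s) => //; exact: closed_fun_le.
have kballE s z : s < 3 / 4 * rho -> (kk @` ball s) z <-> Q z /\ nv z <= s.
  move=> s34; split=> [[v vs <-]|[Qz zs]].
    by have [Qk kv _] := WP v (wb v (le_lt_trans vs s34)); split => //; rewrite /nv kv.
  by exists (psi z) => //; have [] := QP z Qz.
have r34 : r < 3 / 4 * rho by lra.
have rd34 : r + dl < 3 / 4 * rho by lra.
have psi_inj z : Q z -> nv z = 0 -> z = x.
  move=> Qz /eqP; rewrite normr_eq0 subr_eq0 => /eqP zw.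
  by have [_ <- _ _ _] := QP z Qz; have [_ <- _ _ _] := QP x Qx; rewrite zw.
have cnv z : Q z -> {for z, continuous nv}.
  move=> Qz; have [_ _ cz _ _] := QP z Qz.
  exact: (continuous_comp cz (cn (psi z))).
(* sg is the retraction of M minus x that pushes the ball radially to its boundary. *)
pose mu z : R := Num.max 1 (r / nv z).
pose sg z := if pselect (Q z) then kk (w + mu z *: (psi z - w)) else z.
have mu1 z : r <= nv z -> mu z = 1.
  move=> h; rewrite /mu max_l // ler_pdivrMr ?mul1r // (lt_le_trans r0) //.
have muv z : 0 < nv z -> nv z <= r -> mu z * nv z = r.
  move=> z0 h; rewrite /mu max_r ?divfK ?gt_eqF //.
  by rewrite ler_pdivlMr // mul1r.
have sg_out z : ~ (Q z /\ nv z <= r) -> sg z = z.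
  rewrite /sg; case: pselect => // Qz h; rewrite mu1; last first.
    by rewrite leNgt; apply/negP => /ltW h'; apply: h.
  by rewrite scale1r addrC subrK; have [] := QP z Qz.
have sg_in z : Q z -> z <> x -> nv z <= r ->
    let v := w + mu z *: (psi z - w) in [/\ sg z = kk v, `|v - w| = r & `|v - psi x0| < rho].
  move=> Qz zx zr v; have z0 : 0 < nv z.
    by rewrite lt_neqAle normr_ge0 andbT eq_sym; apply/eqP => /(psi_inj z Qz).
  have vr : `|v - w| = r.
    rewrite /v addrAC subrr add0r normrZ ger0_norm; first exact: muv.
    by rewrite /mu le_max ler01.
  by split => //; [rewrite /sg; case: pselect|apply: wb; rewrite vr].
have sgQ z : z <> x -> Q z -> Q (sg z).
  move=> zx Qz; have [h|h] := leP (nv z) r.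
    by have [-> _ vr] := sg_in z Qz zx h; have [] := WP _ vr.
  by rewrite sg_out // => -[_]; rewrite leNgt h.
have csg z : z <> x -> {for z, continuous sg}.
  move=> zx; have [Qz|nQz] := pselect (Q z); last first.
    apply: (@continuous_near _ _ _ id) => //.
    have : nbhs z (~` (kk @` ball r)).
      apply: open_nbhs_nbhs; split; first exact/closed_openC/kball.
      by move=> /(kballE _ _ r34)[].
    by apply: filterS => z' nz'; apply: sg_out => h; apply: nz'; exact/(kballE _ _ r34).
  have [_ _ cz _ _] := QP z Qz.
  have z0 : nv z != 0 by apply/eqP => /(psi_inj z Qz).
  apply: (@continuous_near _ _ _ (kk \o (fun z => w + mu z *: (psi z - w)))).
    apply: filterS (open_nbhs_nbhs (conj oQ Qz)) => z' Qz'.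
    by rewrite /sg /=; case: pselect.
  apply: continuous_comp.
    apply: (cvgD (F := nbhs z)); first exact: continuous_const.
    have cmu : {for z, continuous mu}.
      apply: (continuous_at_max (f := fun=> 1) (g := fun z => r / nv z)).
        exact: continuous_const.
      apply: (cvgM (F := nbhs z)); first exact: continuous_const.
      by apply: (cvgV (F := nbhs z)) => //; exact: cnv.
    apply: (cvgZ (F := nbhs z) cmu).
    by apply: (cvgB (F := nbhs z)); [exact: cz|exact: continuous_const].
  suff h : `|w + mu z *: (psi z - w) - psi x0| < rho by have [] := WP _ h.
  have [h|h] := leP (nv z) r; first by have [] := sg_in z Qz zx h.
  by rewrite mu1 ?(ltW h) // scale1r [w + _]addrC subrK; have [] := QP z Qz.
have fx p : f p <> x by move=> E; apply: nCx; rewrite -E.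
pose f' p := sg (f p).
have cf' : continuous f' by move=> p; apply: (continuous_comp (cf p)); exact: csg.
(* The coordinates of [tau p] in the frame F; the new frame has the same coordinates at the pushed
   point. *)
pose Tm p := tau p *m (F (f p))^T *m Gm (f p).
have TF p : Q (f p) -> Tm p *m F (f p) = tau p.
  move=> Qp; have [tp _] := tauP p.
  by rewrite -[RHS]tp (PF _ Qp) /row_projector /Tm /Gm !mulmxA.
have uT p : Q (f p) -> forall v : 'rV_d.+1, v *m Tm p = 0 -> v = 0.
  move=> Qp v vT; have [_ /row_free_injP] := tauP p; apply.
  by rewrite -(TF p Qp) mulmxA vT mul0mx.
pose tau' p := if pselect (Q (f p)) then Tm p *m F (f' p) else tau p.
have tau'_out p : ~ (Q (f p) /\ nv (f p) <= r) -> tau' p = tau p.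
  by move=> h; rewrite /tau' /f'; case: pselect => // Qp; rewrite sg_out // TF.
have ctau' : continuous tau'.
  move=> p; have [Qp|nQp] := pselect (Q (f p)); last first.
    apply: (@continuous_near _ _ _ tau); last exact: ct.
    have nb : nbhs (f p) (~` (kk @` ball r)).
      apply: open_nbhs_nbhs; split; first exact/closed_openC/kball.
      by move=> /(kballE _ _ r34)[].
    have {}nb : \forall p' \near p, ~ (kk @` ball r) (f p') by exact: (cf p _ nb).
    by apply: filterS nb => p' nz'; apply: tau'_out => h; apply: nz'; exact/(kballE _ _ r34).
  apply: (@continuous_near _ _ _ (fun p => Tm p *m F (f' p))).
    have nb : \forall p' \near p, Q (f p') by exact: (cf p _ (open_nbhs_nbhs (conj oQ Qp))).
    by apply: filterS nb => p' Qp'; rewrite /tau'; case: pselect.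
  apply: (cvg_mulmx (F := nbhs p)); last exact: (continuous_comp (cf' p) (cF (f' p))).
  apply: (cvg_mulmx (F := nbhs p)); last exact: (continuous_comp (cf p) (cG _ Qp)).
  apply: (cvg_mulmx (F := nbhs p)); first exact: ct.
  exact: (@continuous_trmx _ _ _ _ _ (continuous_compose cf cF) p).
have tau'P p : tau' p *m P (f' p) = tau' p /\ row_free (tau' p).
  have [Qp|nQp] := pselect (Q (f p)); last first.
    have no : ~ (Q (f p) /\ nv (f p) <= r) by case.
    by rewrite tau'_out // /f' sg_out //; exact: tauP.
  have -> : tau' p = Tm p *m F (f' p) by rewrite /tau'; case: pselect.
  rewrite -mulmxA FP; split => //; apply/row_free_injP => v.
  rewrite mulmxA => vF; apply: (uT p Qp).
  have [_ _ _ _ /row_free_injP h] := QP _ (sgQ _ (fx p) Qp); exact: h.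
(* On this compact set the functional is bounded below by [mn], which leaves room for the
   perturbation. *)
pose C1 := C `&` (kk @` [set v | r <= `|v - w| <= r + dl]).
have cann : closed [set v : 'rV[R]_d.+1 | r <= `|v - w| <= r + dl].
  have -> : [set v : 'rV[R]_d.+1 | r <= `|v - w| <= r + dl] =
      [set v | - `|v - w| <= - r] `&` [set v | `|v - w| <= r + dl].
    by apply/seteqP; split=> v /=; rewrite lerN2 => /andP.
  apply: closedI; last exact: closed_fun_le.
  by apply: closed_fun_le => v; apply: (cvgN (F := nbhs v)); exact: cn.
have cC1 : compact C1.
  rewrite /C1 setIC; apply: compact_closedI => //; apply: (kcl _ (r + dl)) => //.
  by move=> v /= /andP[].
have C1y z : C1 z -> z <> y.
  move=> [_ [v vr kv]] zy; apply: ry; rewrite -zy -kv /nv.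
  by have [_ -> _] := WP v (wb v (le_lt_trans (andP vr).2 rd34)).
have [mn mn0 mnP] : exists2 mn, 0 < mn & forall z, C1 z -> mn <= `|g z *m P z|.
  have [[z0 C1z0]|no] := pselect (C1 !=set0); last first.
    by exists 1 => // z C1z; exfalso; apply: no; exists z.
  have cgP : {within C1, continuous (fun z => `|g z *m P z|)}.
    apply: continuous_subspaceT => z; apply: (cvg_norm (F := nbhs z)).
    exact: (@continuous_mulmx _ _ _ _ _ _ _ cg cP z).
  have [z1 /set_mem C1z1 zmin] := compact_EVT_min (ex_intro _ z0 C1z0) cC1 cgP.
  exists `|g z1 *m P z1|; last by move=> z /mem_set /zmin.
  by rewrite normr_gt0; apply/eqP; apply: gP; [case: C1z1|exact: C1y].
(* Any radius strictly between 22/32 rho, which bounds r + dl, and 24/32 rho. *)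
pose s1 := 23 / 32 * rho; have s134 : s1 < 3 / 4 * rho by rewrite /s1; lra.
have [b b0 bP] : exists2 b, 0 < b & forall z, Q z -> nv z <= s1 -> `|Gm z *m F z| <= b.
  have cK : compact (kk @` ball s1) by apply: (kcl _ s1) => //; exact: closed_fun_le.
  have cGF : {within kk @` ball s1, continuous (fun z => `|Gm z *m F z|)}.
    apply: continuous_in_subspaceT => z /set_mem/(kballE _ _ s134)[Qz _].
    apply: (cvg_norm (F := nbhs z)); apply: (cvg_mulmx (F := nbhs z)); first exact: cG.
    exact: cF.
  have Kx : (kk @` ball s1) x.
    apply/(kballE _ _ s134); split => //; rewrite /nv /w subrr normr0 /s1.
    by rewrite mulr_ge0 // ltW.
  have [z1 _ zmax] := compact_EVT_max (ex_intro _ x Kx) cK cGF.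
  exists (`|Gm z1 *m F z1| + 1); first by rewrite ltr_wpDl.
  move=> z Qz zs; rewrite (le_trans (zmax z _)) ?lerDl //.
  by apply/mem_set/(kballE _ _ s134).
(* The functional in the coordinates of the frame F: a map from a ball to the space of the same
   dimension, as [sphere_perturbation] requires. *)
pose h v := g (kk v) *m (F (kk v))^T.
have ch : {within ball s1, continuous h}.
  apply: continuous_in_subspaceT => v /set_mem /= vs.
  have [_ _ cv] := WP v (wb v (le_lt_trans vs s134)).
  apply: (cvg_mulmx (F := nbhs v)); first exact: (continuous_comp cv (cg (kk v))).
  exact: (continuous_comp cv (@continuous_trmx _ _ _ _ _ cF (kk v))).
(* Half of [mn], divided by the factor by which the passage from coordinates to functionals can
   enlarge norms. *)
pose e := mn / (2 * (d.+1%:R * b)).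
have e0 : 0 < e by rewrite divr_gt0 // !mulr_gt0 // ltr0n.
have [et [cet et1 et2]] := sphere_perturbation w (cball s1) ch r0 e0.
pose phi (s : R) := Num.max 0 (1 - `|s - r| / dl).
have cphi : continuous phi.
  move=> s; apply: (continuous_at_max (f := fun=> 0) (g := fun s => 1 - `|s - r| / dl)).
    exact: continuous_const.
  apply: (cvgB (F := nbhs s)); first exact: continuous_const.
  apply: (cvgM (F := nbhs s)); last exact: continuous_const.
  apply: (cvg_norm (F := nbhs s)); apply: (cvgB (F := nbhs s)); last exact: continuous_const.
  exact: continuous_self.
have phi01 s : 0 <= phi s <= 1.
  rewrite /phi le_max lexx /= ge_max ler01 /= gerBl divr_ge0 // ltW //.
have phi_out s : r + dl <= s -> phi s = 0.
  move=> sr; rewrite /phi max_l // subr_le0 ler_pdivlMr // mul1r.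
  by rewrite (le_trans _ (ler_norm _)) // lerBrDl.
have phi_r : phi r = 1 by rewrite /phi subrr normr0 mul0r subr0 max_r.
(* The functional with coordinates [et] in the frame F, times a cutoff that is 1 on the sphere and 0
   beyond the annulus. *)
pose tm z := phi (nv z) *: (et (psi z) *m (Gm z *m F z)).
pose g' z := g z + (if pselect (Q z) then tm z else 0).
have g'_out z : ~ (Q z /\ nv z <= r + dl) -> g' z = g z.
  rewrite /g'; case: pselect => [Qz h1|nQ nQr]; last by rewrite addr0.
  rewrite /tm phi_out ?scale0r ?addr0 //.
  by rewrite leNgt; apply/negP => /ltW h2; apply: h1.
have cg' : continuous g'.
  move=> z; have [[Qz zs]|no] := pselect (Q z /\ nv z < s1); last first.
    apply: (@continuous_near _ _ _ g); last exact: cg.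
    have : nbhs z (~` (kk @` ball (r + dl))).
      apply: open_nbhs_nbhs; split; first exact/closed_openC/kball.
      move=> /(kballE _ _ rd34)[Qz zr]; apply: no; split => //.
      by rewrite (le_lt_trans zr) // /s1; lra.
    by apply: filterS => z' nz'; apply: g'_out => h'; apply: nz'; exact/(kballE _ _ rd34).
  apply: (@continuous_near _ _ _ (fun z => g z + tm z)).
    apply: filterS (open_nbhs_nbhs (conj oQ Qz)) => z' Qz'.
    by rewrite /g' /=; case: pselect.
  apply: (cvgD (F := nbhs z)); first exact: cg.
  apply: (cvgZ (F := nbhs z)); first exact: (continuous_comp (cnv z Qz) (cphi (nv z))).
  apply: (cvg_mulmx (F := nbhs z)).
    have [_ _ cz _ _] := QP z Qz; apply: (continuous_comp cz).
    have ob : open [set v : 'rV[R]_d.+1 | `|v - w| < s1] by exact: open_fun_lt.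
    have cet' : {within [set v : 'rV[R]_d.+1 | `|v - w| < s1], continuous et}.
      by apply: continuous_subspaceW cet => v /= /ltW.
    by rewrite continuous_open_subspace // in cet'; apply: cet'; rewrite inE.
  by apply: (cvg_mulmx (F := nbhs z)); [exact: cG|exact: cF].
pose sph := [set v : 'rV[R]_d.+1 | `|v - w| = r].
pose C' := (C `&` ~` (Q `&` [set z | nv z < r])) `|` (kk @` sph).
have csph : closed (kk @` sph).
  apply: compact_closed => //; apply: (kcl _ r) => //; last by move=> v vr; rewrite /ball /= vr.
  exact: closed_fun_eq.
have oin : open (Q `&` [set z | nv z < r]).
  rewrite openE => z [Qz zr]; apply: filterI; first exact: open_nbhs_nbhs.
  exact: (cnv z Qz _ (open_nbhs_nbhs (conj (@open_lt R r) zr))).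
have nvx' : nv x' < r.
  rewrite (lt_le_trans _ r1) // /nv /w -(subrK (psi x0) (psi x')) -addrA.
  rewrite (le_lt_trans (ler_normD _ _)) // [`|psi x0 - _|]distrC.
  by move: xr xr' => /=; lra.
exists C', f', tau', g'; split; last first.
  case=> [[_ h1]|[v vr kv]]; first by apply: h1.
  move: nvx'.
  have vr' : `|v - w| < 3 / 4 * rho by rewrite vr.
  by rewrite -kv /nv; have [_ -> _] := WP v (wb v vr'); rewrite vr ltxx.
split => //.
- split.
    by apply: closedU => //; apply: closedI => //; exact: open_closedC.
  move=> p; have [[Qp pr]|no] := pselect (Q (f p) /\ nv (f p) <= r).
    by right; have [sgE vr _] := sg_in _ Qp (fx p) pr; rewrite /f' sgE; eexists; last reflexivity.
  left; rewrite /f' sg_out //; split => // -[Qp /ltW pr]; exact: no.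
- move=> z C'z zy.
  have sphP z' : (kk @` sph) z' -> g' z' *m P z' <> 0.
    move=> [v vr kv]; have vr' : `|v - w| < 3 / 4 * rho by rewrite vr.
    have [Qk kvv _] := WP v (wb v vr').
    have vs : `|v - w| <= s1 by rewrite vr /s1; lra.
    move=> /(congr1 (mulmx^~ (F z')^T)); rewrite mul0mx -mulmxA -{1}(P_tr z') -trmx_mul FP.
    rewrite /g' -kv; case: pselect => // Qk'; rewrite /tm /nv kvv vr phi_r scale1r.
    by rewrite mulmxDl -[_ *m (F _)^T in X in _ + X]mulmxA -[_ *m _ *m (F _)^T]mulmxA mulVmx ?uG // mulmx1; exact: et2.
  case: C'z => [[Cz nin]|]; last exact: sphP.
  have [[Qz zr]|no] := pselect (Q z /\ nv z <= r + dl); last by rewrite g'_out //; exact: gP.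
  have rz : r <= nv z by rewrite leNgt; apply/negP => h1; apply: nin.
  have C1z : C1 z.
    split => //; exists (psi z); first by rewrite /= -/(nv z) rz zr.
    by have [] := QP z Qz.
  rewrite /g'; case: pselect => // Qz' /eqP; rewrite mulmxDl addr_eq0 => /eqP E.
  have := mnP z C1z; rewrite E normrN /tm -scalemxAl -[_ *m P z]mulmxA -[Gm z *m F z *m P z]mulmxA FP.
  have zs : nv z <= s1 by rewrite (le_trans zr) // /s1; lra.
  rewrite normrZ; have /andP[p0 p1] := phi01 (nv z).
  rewrite (ger0_norm p0) leNgt => /negP; apply.
  have h1 := mx_norm_mul (et (psi z)) (Gm z *m F z).
  have h2 : d.+1%:R * `|et (psi z)| * `|Gm z *m F z| <= d.+1%:R * e * b.
    by rewrite ler_pM // ?mulr_ge0 ?bP // ler_wpM2l //; apply: et1.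
  have h3 : d.+1%:R * e * b = mn / 2.
    by rewrite /e; field; rewrite gt_eqF //= pnatr_eq0.
  apply: (@le_lt_trans _ _ `|et (psi z) *m (Gm z *m F z)|); first by rewrite ler_piMl.
  lra.
- move=> p bp; have [e1 e2 e3] := bdP p bp.
  have nQ : ~ Q (f0 p) by move=> /QP[_ _ _ nz _]; apply: nz; exists p.
  have no : ~ (Q (f p) /\ nv (f p) <= r) by rewrite e1 => -[].
  by rewrite /f' sg_out // tau'_out // g'_out // => -[].
Qed.

End Push.

(** * Frames and fields on the ball *)

Section RadialRetraction.
Context {R : realType} {d : nat}.

Definition radial_retraction (p : 'rV[R]_d) : 'rV[R]_d := (Num.max 1 `|p|)^-1 *: p.

Lemma radial_retraction_continuous : continuous radial_retraction.
Proof.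
move=> p; apply: (cvgZ (F := nbhs p)); last exact: continuous_self.
have cm : {for p, continuous (fun q : 'rV[R]_d => Num.max 1 `|q|)}.
  apply: (continuous_at_max (f := fun=> 1) (g := fun q : 'rV[R]_d => `|q|)).
    exact: continuous_const.
  exact: norm_continuous.
by apply: (cvgV (F := nbhs p)) => //; rewrite gt_eqF // lt_max ltr01.
Qed.

Lemma radial_retraction_le p : `|radial_retraction p| <= 1.
Proof.
have m0 : 0 < Num.max 1 `|p| by rewrite lt_max ltr01.
rewrite /radial_retraction normrZ ger0_norm ?invr_ge0 ?(ltW m0) //.
by rewrite ler_pdivrMl // mulr1 le_max lexx orbT.
Qed.

Lemma radial_retraction_id p : `|p| <= 1 -> radial_retraction p = p.
Proof. by move=> p1; rewrite /radial_retraction max_l // invr1 scale1r. Qed.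

Lemma radial_retraction_out p : 1 <= `|p| -> radial_retraction p = `|p|^-1 *: p.
Proof. by move=> p1; rewrite /radial_retraction max_r. Qed.

End RadialRetraction.

(** The frame is carried outwards along each radius by projecting it successively to nearby
    subspaces. The projection between close subspaces is injective, so independence is preserved. *)
Lemma frame_transport (R : realType) D k d (Q : 'rV[R]_D -> 'M[R]_k) (F0 : 'M[R]_(d, k)) :
  continuous Q -> (forall p, Q p *m Q p = Q p) ->
  (forall p, `|p| <= 1 / 2 -> Q p = Q 0) -> F0 *m Q 0 = F0 -> row_free F0 ->
  exists tau : 'rV[R]_D -> 'M[R]_(d, k), [/\ continuous tau,
    forall p, `|p| <= 1 -> tau p *m Q p = tau p /\ row_free (tau p) &
    forall p, `|p| <= 1 / 2 -> tau p = F0].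
Proof.
move=> cQ QQ Q0 FQ fF.
pose K := [set p : 'rV[R]_D | `|p| <= 1].
have cK : compact K.
  by apply: bounded_closed_compact_mx; [exists 1|exact/closed_fun_le/norm_continuous].
(* The bound [mx_norm_mul] costs a factor k, so a difference of projectors of norm below 1/(k+1)
   cannot fix a nonzero vector. *)
have e0 : 0 < (k.+1%:R : R)^-1 by rewrite invr_gt0 ltr0n.
have [r r0 rP] := within_compact_unif_continuous cK (continuous_subspaceT cQ) e0.
pose N := (Num.truncn r^-1).+1.
have N0 : 0 < N%:R :> R by rewrite ltr0n.
have Nr : N%:R^-1 < r by rewrite -[ltRHS]invrK ltf_pV2 ?posrE ?invr_gt0 // truncnS_gt.
pose s j : R := j%:R / N%:R.
pose T := fix T j (p : 'rV[R]_D) := if j is j'.+1 then T j' p *m Q (s j *: p) else F0.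
have s01 j : (j <= N)%N -> 0 <= s j <= 1.
  by move=> jN; rewrite divr_ge0 ?ler_pdivrMr ?mul1r ?ler_nat // ltW.
have sK j p : (j <= N)%N -> `|p| <= 1 -> K (s j *: p).
  move=> /s01/andP[a b] p1; rewrite /K /= normrZ ger0_norm //.
  by rewrite (le_trans _ p1) // ler_piMl.
have TP j p : (j <= N)%N -> `|p| <= 1 -> T j p *m Q (s j *: p) = T j p /\ row_free (T j p).
  move=> jN p1; elim: j jN => [|j IH] jN; first by rewrite /s mul0r scale0r.
  have [e1 e2] := IH (ltnW jN); rewrite /= -mulmxA QQ; split => //.
  apply/row_free_injP => w; rewrite mulmxA; set v := w *m T j p => v0.
  have vE : v = v *m (Q (s j *: p) - Q (s j.+1 *: p)) by rewrite mulmxBr v0 subr0 /v -mulmxA e1.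
  have close : `|Q (s j *: p) - Q (s j.+1 *: p)| < k.+1%:R^-1.
    apply: rP; [exact: sK (ltnW jN) p1|exact: sK|].
    rewrite -scalerBl normrZ (le_lt_trans _ Nr) //.
    have -> : s j - s j.+1 = - N%:R^-1 by rewrite /s -natr1; ring.
    by rewrite normrN ger0_norm ?invr_ge0 ?(ltW N0) // ler_piMr // invr_ge0 ltW.
  have : `|v| <= k%:R * `|v| * k.+1%:R^-1.
    rewrite {1}vE (le_trans (mx_norm_mul _ _)) // ler_wpM2l ?mulr_ge0 //.
    exact: ltW.
  rewrite ler_pdivlMr ?ltr0n // -natr1 => h.
  have /eqP : `|v| = 0 by apply/eqP; rewrite eq_le normr_ge0 andbT; lra.
  by rewrite normr_eq0 => /eqP; apply: (row_free_injP _).1.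
exists (T N); split.
- suff cT j : continuous (T j) by exact: cT.
  elim: j => [|j IH]; first exact: continuous_const.
  apply: continuous_mulmx => //; apply: (continuous_compose _ cQ) => p.
  by apply: (cvgZ (F := nbhs p)); [exact: continuous_const|exact: continuous_self].
- by move=> p p1; have := TP N p (leqnn _) p1; rewrite /s divff ?gt_eqF // scale1r.
- move=> p p2; have : forall j, (j <= N)%N -> T j p = F0.
    elim=> [//|j IH] jN; rewrite /= IH ?(ltnW jN) // Q0 //.
    have /andP[a b] := s01 _ jN; rewrite normrZ ger0_norm // (le_trans _ p2) //.
    by rewrite ler_piMl.
  by apply.
Qed.

(** Such fields would combine to one on the ball that has no zeros and points outwards on the
    boundary, against [poincare_miranda]: a rescaled on the inner third, next a homotopy from a to
    ka on the unit sphere, where the two pair positively, then ka from radius 1 back to radius 1/2,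
    where it is radial. *)
Lemma radial_field_extension (R : realType) d (a : 'rV[R]_d.+1 -> 'rV[R]_d.+1)
    (ka : 'rV[R]_d.+1 -> 'rV[R]_d.+1) :
  continuous a -> (forall p, p != 0 -> {for p, continuous ka}) ->
  (forall p, `|p| <= 1 -> a p <> 0) ->
  (forall p, 1 / 2 <= `|p| <= 1 -> ka p <> 0) ->
  (forall p, `|p| = 1 -> 0 < (ka p *m (a p)^T) 0 0) ->
  (forall p, `|p| = 1 / 2 -> exists2 c, 0 < c & ka p = c *: p) -> False.
Proof.
move=> ca ck a0 k0 ak kp.
(* [la] grows from 0 to 1 between the radii 1/3 and 2/3; [rh] falls from 1 to 1/2 between 2/3 and
   1. *)
pose la (s : R) := clamp 0 1 (3 * s - 1); pose rh (s : R) := 1 - clamp 0 1 (3 * s - 2) / 2.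
have c3 b : continuous (fun s : R => clamp 0 1 (3 * s - b)).
  apply: (continuous_compose (f := fun s : R => 3 * s - b) _ (@clamp_continuous R 0 1)) => s.
  apply: (cvgB (F := nbhs s)); last exact: continuous_const.
  by apply: (cvgM (F := nbhs s)); [exact: continuous_const|exact: continuous_self].
have cn : continuous (fun x : 'rV[R]_d.+1 => `|x|) by exact: norm_continuous.
pose H1 (x : 'rV[R]_d.+1) : 'rV[R]_d.+1 := (1 - la `|x|) *: a (radial_retraction (3 *: x)).
pose g (x : 'rV[R]_d.+1) : 'rV[R]_d.+1 := (rh `|x| / `|x|) *: x.
pose H2 (x : 'rV[R]_d.+1) : 'rV[R]_d.+1 := la `|x| *: ka (g x).
have rh12 s : 1 / 2 <= rh s <= 1 by have := clamp_itv (3 * s - 2) (ler01 : 0 <= 1 :> R); rewrite /rh; lra.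
have gn x : x != 0 -> `|g x| = rh `|x|.
  move=> x0; rewrite /g normrZ ger0_norm ?divfK ?normr_eq0 //.
  by have h := rh12 `|x|; rewrite divr_ge0 //; lra.
have cH1 : continuous H1.
  move=> x; apply: (cvgZ (F := nbhs x)).
    apply: (cvgB (F := nbhs x)); first exact: continuous_const.
    exact: (continuous_compose cn (c3 1)).
  have c3x : continuous (fun x : 'rV[R]_d.+1 => 3 *: x).
    by move=> y; apply: (cvgZ (F := nbhs y)); [exact: continuous_const|exact: continuous_self].
  exact: (continuous_compose (continuous_compose c3x (@radial_retraction_continuous R d.+1)) ca).
have cH2 : continuous H2.
  move=> x; have [->|x0] := eqVneq x 0.
    suff h0 : {for (0 : 'rV[R]_d.+1), continuous H2} by exact: h0.
    apply: (@continuous_near _ _ H2 (fun=> 0 : 'rV[R]_d.+1)); last exact: continuous_const.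
    apply/nbhs_mxP; exists (1 / 3); first by rewrite divr_gt0.
    by move=> z; rewrite sub0r normrN => z3; rewrite /H2 /la clamp_le ?scale0r //; lra.
  apply: (cvgZ (F := nbhs x)); first exact: (continuous_compose cn (c3 1)).
  have cg : {for x, continuous g}.
    apply: (cvgZ (F := nbhs x)); last exact: continuous_self.
    apply: (cvgM (F := nbhs x)); last by apply: (cvgV (F := nbhs x)); [rewrite normr_eq0|exact: cn].
    apply: (cvgB (F := nbhs x)); first exact: continuous_const.
    apply: (cvgM (F := nbhs x)); last exact: continuous_const.
    exact: (continuous_compose cn (c3 2)).
  have g0 : g x != 0 by rewrite -normr_eq0 gn // gt_eqF //; have h := rh12 `|x|; lra.
  exact: (continuous_comp cg (ck _ g0)).
have cH : {within [set x : 'rV[R]_d.+1 | `|x| <= 1], continuous (fun x => H1 x + H2 x)}.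
  by apply: continuous_subspaceT => x; apply: (cvgD (F := nbhs x)); [exact: cH1|exact: cH2].
have bd (x : 'rV[R]_d.+1) i : `|x| = 1 -> exists2 c, 0 < c & (H1 x + H2 x) 0 i = c * x 0 i.
  move=> x1; have x0 : x != 0 by rewrite -normr_eq0 x1 oner_eq0.
  have l1 : la `|x| = 1 by rewrite x1 /la clamp_ge //; lra.
  have r1 : rh `|x| = 1 / 2 by rewrite x1 /rh clamp_ge //; lra.
  have [c c0 kc] : exists2 c, 0 < c & ka (g x) = c *: g x by apply: kp; rewrite gn.
  rewrite /H1 /H2 l1 subrr scale0r add0r scale1r kc /g r1 x1 divr1 scalerA.
  by exists (c * (1 / 2)); [rewrite mulr_gt0 // divr_gt0|rewrite mxE].
have xn (x : 'rV[R]_d.+1) i : `|x| <= 1 -> `|x 0 i| = 1 -> `|x| = 1.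
  by move=> x1 xi; apply/eqP; rewrite eq_le x1 -xi mx_entry_norm.
have [x x1 Hx] : exists2 x : 'rV[R]_d.+1, `|x| <= 1 & H1 x + H2 x = 0.
  apply: poincare_miranda => // x i x1 xi.
    have [c c0 ->] := bd x i (xn x i x1 ltac:(by rewrite xi normr1)).
    by rewrite xi mulr1.
  have [c c0 ->] := bd x i (xn x i x1 ltac:(by rewrite xi normrN1)).
  by rewrite xi mulrN1 oppr_lt0.
have [x3|x3] := leP `|x| (1 / 3).
  move: Hx; rewrite /H1 /H2 /la clamp_le //; last by lra.
  rewrite scale0r addr0 subr0 scale1r; apply: a0; exact: radial_retraction_le.
have x0 : x != 0 by rewrite -normr_gt0 (lt_trans _ x3) // divr_gt0.
have x13 : 1 <= `|3 *: x| by rewrite normrZ ger0_norm //; lra.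
have rE : radial_retraction (3 *: x) = `|x|^-1 *: x.
  rewrite radial_retraction_out // normrZ ger0_norm // scalerA; congr (_ *: _).
  by field; rewrite normr_eq0.
have [x23|x23] := leP (2 / 3) `|x|.
  move: Hx; rewrite /H1 /H2 /la clamp_ge //; last by lra.
  rewrite subrr scale0r add0r scale1r; apply: k0; rewrite gn //.
have r1 : rh `|x| = 1 by rewrite /rh clamp_le ?mul0r ?subr0 //; lra.
have gE : g x = `|x|^-1 *: x by rewrite /g r1 mul1r.
set xh := `|x|^-1 *: x in rE gE.
have n1 : `|xh| = 1 by rewrite -gE gn.
have l01 : 0 < la `|x| < 1 by rewrite /la clamp_id; lra.
have kk0 : 0 < (ka xh *m (ka xh)^T) 0 0.
  have := nsq_gt0 (ka xh)^T; rewrite /nsq trmxK => ->.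
  by rewrite trmx_eq0; apply/eqP/k0; rewrite n1; lra.
have E : (ka xh *m (H1 x + H2 x)^T) 0 0 = 0 by rewrite Hx trmx0 mulmx0 mxE.
have entD (A B : 'M[R]_1) : (A + B) 0 0 = A 0 0 + B 0 0 by rewrite mxE.
have entZ (s : R) (A : 'M[R]_1) : (s *: A) 0 0 = s * A 0 0 by rewrite mxE.
move: E; rewrite /H1 /H2 rE gE [(_ + _)^T]linearD /= !trmxZ mulmxDr -!scalemxAr entD !entZ.
have h1 := ak xh n1; have /andP[l0 l1] := l01.
have p1 : 0 < (1 - la `|x|) * (ka xh *m (a xh)^T) 0 0 by rewrite mulr_gt0 // subr_gt0.
have p2 : 0 < la `|x| * (ka xh *m (ka xh)^T) 0 0 by rewrite mulr_gt0.
lra.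
Qed.

Lemma sb_continuous_at (R : realType) d m (M X : topologicalType) (u : M -> Gr R d m m)
    (f : X -> sphere_bundle u) x : {for x, continuous (fun x => sb_pt (f x))} ->
  {for x, continuous (fun x => sb_unit (f x))} -> {for x, continuous f}.
Proof.
move=> c1 c2 A nA; have nz := sb_nbhs (sb_unit_in_ray (f x)) nA.
have cp : (fun x' => (sb_pt (f x'), sb_unit (f x'))) @ x --> (sb_pt (f x), sb_unit (f x)).
  exact: (cvg_pair (F := nbhs x) (G := nbhs (sb_pt (f x))) (H := nbhs (sb_unit (f x))) c1 c2).
have h : \forall x' \near x, forall s', sb_pt s' = sb_pt (f x') ->
    sb_ray s' (sb_unit (f x')) -> A s' by exact: (cp _ nz).
by apply: filterS h => x'; apply => //; exact: sb_unit_in_ray.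
Qed.

(** * Any two points are joined by a flow line *)

Section Reach.
Context {R : realType} {d n : nat} {M : topologicalType}.
Local Notation m := (n + n)%N.
Variables (u : M -> Gr R d.+1 m m) (Phi : R -> sphere_bundle u -> sphere_bundle u).
Hypothesis n_gt0 : (0 < n)%N.
Hypothesis hM : hausdorff_space M.
Hypothesis pM : @path_connected R M.
Hypothesis charts : forall x : M, exists (Q : set M) (W : set 'rV[R]_d.+1)
    (psi : M -> 'rV[R]_d.+1) (k : 'rV[R]_d.+1 -> M), [/\ open Q, Q x, open W,
    forall a, Q a -> [/\ W (psi a), k (psi a) = a & {for a, continuous psi}] &
    forall w, W w -> [/\ Q (k w), psi (k w) = w & {for w, continuous k}]].
Hypothesis cu : continuous u.
Hypothesis u_nn : forall x, pencil_nn (u x).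
Hypothesis Phi_fitting : fitting_flow Phi.
Hypothesis proper : forall (y : M) (C : set M), compact C ->
  exists T : R, forall s, sb_pt s = y -> forall t, T <= t -> ~ C (sb_pt (Phi t s)).

Theorem flow_reaches (y z : M) :
  exists s t, [/\ sb_pt s = y, 0 <= t & sb_pt (Phi t s) = z].
Proof.
apply: contrapT => nR.
have {}nR s t : sb_pt s = y -> 0 <= t -> sb_pt (Phi t s) <> z.
  by move=> sy t0 tz; apply: nR; exists s, t.
have m0 : (0 < m)%N by rewrite addn_gt0 n_gt0.
pose P x := gr_proj (u x).
have cP : continuous P by apply: continuous_compose cu _; exact: gr_proj_continuous.
have Prep x : exists2 F : 'M[R]_(d.+1, m * m), row_free F & P x = row_projector F.
  by exists (frame_mx (canonical_frame (u x))) => //; exact: is_frame_free (canonical_frameP _).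
have [F0 fF0 PF0] := Prep y.
have F0P : F0 *m P y = F0 by rewrite PF0 frame_row_projector.
have [b [bs b0 bn bP]] : exists b : 'M[R]_m, [/\ b^T = b, forall v, 0 <= form_eval b v v,
    b != 0 & mxvec b *m P y = 0].
  apply: psd_orthogonal => //; [exact: gr_proj_tr|exact: gr_proj_idem|].
  move=> q /gr_projP qu; have [sq nq] := u_nn qu; split => // -[_ pq].
  have [q0|/nq/(signature_vectors n_gt0)[v [_ [v0 _ qv _]]]] := eqVneq q 0; last first.
    by have := pq v v0; rewrite ltNge qv.
  pose v : 'cV[R]_m := const_mx 1.
  have v0 : v != 0 by apply/eqP => /matrixP/(_ (Ordinal m0) 0); rewrite !mxE => /eqP; rewrite oner_eq0.
  by have := pq v v0; rewrite q0 /form_eval mulmx0 mul0mx mxE ltxx.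
have [ga [cga ga0 ga1]] := path_connected_path z y pM.
pose ga' s := ga (clamp 0 1 s).
have cga' : continuous ga' by apply: continuous_compose (@clamp_continuous R 0 1) cga.
have cgaK : compact (ga @` `[0, 1]%classic).
  by apply: continuous_compact; [exact: continuous_subspaceT|exact: segment_compact].
(* From this time on the flow lines from y are off the path from z to y, so [push_off] can be
   applied at every point of that path. *)
have [T0 T0P] := proper y cgaK.
pose T := Num.max T0 1; have T1 : 0 < T by rewrite lt_max ltr01 orbT.
have TP s : sb_pt s = y -> ~ (ga @` `[0, 1]%classic) (sb_pt (Phi T s)).
  by move=> sy; apply: T0P => //; rewrite le_max lexx.
have qmem (p : 'rV[R]_d.+1) : p != 0 ->
    vec_mx (p *m F0) \in gr_val (u y) /\ (vec_mx (p *m F0) : 'M[R]_m) != 0.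
  move=> p0; split; first by apply/gr_projP; rewrite vec_mxK -mulmxA F0P.
  apply: contraNneq p0 => /(congr1 mxvec); rewrite vec_mxK linear0.
  by move/(row_free_injP _).1 : fF0 => /[apply] ->.
have sex (p : 'rV[R]_d.+1) : exists s : sphere_bundle u, sb_pt s = y /\
    (p != 0 -> sb_ray s (vec_mx (p *m F0))).
  have [->|p0] := eqVneq p 0.
    have p1 : (const_mx 1 : 'rV[R]_d.+1) != 0.
      by apply/eqP => /matrixP/(_ 0 0); rewrite !mxE => /eqP; rewrite oner_eq0.
    by have [q1 q2] := qmem _ p1; have [s sy _] := sb_exists q1 q2; exists s.
  have [q1 q2] := qmem _ p0; have [s sy sr] := sb_exists q1 q2.
  by exists s; split => // _; rewrite sr; exact: positive_ray_self.
have [s sP] := choice sex.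
have cn : continuous (fun x : 'rV[R]_d.+1 => `|x|) by exact: norm_continuous.
(* The ball of radius 1/2 is sent to y at time 0, the direction p selecting the ray of the form with
   coordinates p in the frame [F0]; the flow time then grows to T on the unit sphere. *)
pose tt (p : 'rV[R]_d.+1) : R := T * clamp 0 1 (2 * `|p| - 1).
have ctt : continuous tt.
  have h : continuous (fun r : R => T * clamp 0 1 (2 * r - 1)).
    have h1 : continuous (fun r : R => 2 * r - 1).
      move=> r; apply: (cvgB (F := nbhs r)); last exact: continuous_const.
      by apply: (cvgM (F := nbhs r)); [exact: continuous_const|exact: continuous_self].
    move=> r; apply: (cvgM (F := nbhs r)); first exact: continuous_const.
    exact: (continuous_compose h1 (@clamp_continuous R 0 1)).
  exact: (continuous_compose cn h).
have tt0 p : 0 <= tt p.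
  by have /andP[h _] := clamp_itv (2 * `|p| - 1) (ler01 : 0 <= 1 :> R); rewrite mulr_ge0 // ltW.
have tt_in p : `|p| <= 1 / 2 -> tt p = 0.
  by move=> h; rewrite /tt clamp_le ?mulr0 //; lra.
have tt_out p : 1 <= `|p| -> tt p = T.
  by move=> h; rewrite /tt clamp_ge ?mulr1 //; lra.
pose sf p := Phi (tt p) (s p).
have csf p : p != 0 -> {for p, continuous sf}.
  move=> p0; have cs : {for p, continuous s}.
    apply: sb_continuous_at.
      apply: (@continuous_near _ _ _ (fun=> y)); last exact: continuous_const.
      by apply/nbhs_mxP; exists 1 => // p' _; exact: (sP p').1.
    pose qf (p' : 'rV[R]_d.+1) : 'M[R]_m := vec_mx (p' *m F0).
    have cq : continuous qf.
      move=> p'; apply: (cvg_vec_mx (F := nbhs p')).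
      apply: (cvg_mulmx (F := nbhs p')); [exact: continuous_self|exact: continuous_const].
    pose uf (p' : 'rV[R]_d.+1) : 'M[R]_m := `|qf p'|^-1 *: qf p'.
    apply: (@continuous_near _ _ _ uf).
      have nb : nbhs p [set p' : 'rV[R]_d.+1 | p' != 0].
        apply/nbhs_mxP; exists `|p|; first by rewrite normr_gt0.
        by move=> z' h; apply: contraTneq h => ->; rewrite subr0 ltxx.
      apply: (@filterS _ (nbhs p) (nbhs_filter p) _ _ _ nb) => p' p'0.
      by apply: sb_unit_ray; exact: (sP p').2.
    apply: (cvgZ (F := nbhs p)); last exact: cq.
    apply: (cvgV (F := nbhs p)); first by rewrite normr_eq0; exact: (qmem p p0).2.
    by apply: (cvg_norm (F := nbhs p)); exact: cq.
  have cp : {for p, continuous (fun p' => (tt p', s p'))}.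
    exact: (cvg_pair (F := nbhs p) (G := nbhs (tt p)) (H := nbhs (s p)) (ctt p) cs).
  have cJ : continuous (fun z : R * sphere_bundle u => Phi z.1 z.2) by exact: (Phi_joint Phi_fitting).
  exact: (continuous_comp cp (cJ (tt p, s p))).
pose f1 p := sb_pt (sf p).
have f1_in p : `|p| <= 1 / 2 -> f1 p = y.
  by move=> h; rewrite /f1 /sf tt_in // (Phi0 Phi_fitting) (sP p).1.
have cf1 : continuous f1.
  move=> p; have [->|p0] := eqVneq p 0; last exact: (continuous_comp (csf p p0) (@sb_pt_continuous _ _ _ _ u (sf p))).
  suff h0 : {for (0 : 'rV[R]_d.+1), continuous f1} by exact: h0.
  apply: (@continuous_near _ _ _ (fun=> y)); last exact: continuous_const.
  apply/nbhs_mxP; exists (1 / 2); first by rewrite divr_gt0.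
  by move=> p'; rewrite sub0r normrN => /ltW; exact: f1_in.
have bpos p : 0 < tt p -> 0 < mxdot b (sb_unit (sf p)).
  move=> tp; have [c c0 pc] := fitting_step Phi_fitting (s p) tp.
  have := mxdot_psd_pos bs b0 bn pc; rewrite mxdotDr -scaleN1r !mxdotZr.
  have -> : mxdot b (sb_unit (s p)) = 0.
    have := sb_unit_mem (s p); rewrite (sP p).1 => /gr_projP qP.
    by rewrite /mxdot -qP trmx_mul gr_proj_tr mulmxA bP mul0mx mxE.
  by rewrite mulr0 addr0 pmulr_rgt0.
have cPf : continuous (fun p => P (f1 p)) by exact: continuous_compose cf1 cP.
have [tau1 [ctau1 tau1P tau1_in]] : exists tau : 'rV[R]_d.+1 -> 'M[R]_(d.+1, m * m), [/\ continuous tau,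
    forall p, `|p| <= 1 -> tau p *m P (f1 p) = tau p /\ row_free (tau p) &
    forall p, `|p| <= 1 / 2 -> tau p = F0].
  have f10 : f1 0 = y by apply: f1_in; rewrite normr0 divr_ge0.
  apply: frame_transport => //.
  - by move=> p; exact: gr_proj_idem.
  - by move=> p h; rewrite f1_in // f10.
  - by rewrite f10.
pose rr := @radial_retraction R d.+1.
have crr : continuous rr by exact: radial_retraction_continuous.
have rr1 p : `|rr p| <= 1 by exact: radial_retraction_le.
pose f0 p := f1 (rr p); pose tau0 p := tau1 (rr p).
have cball : compact [set p : 'rV[R]_d.+1 | `|p| <= 1].
  by apply: bounded_closed_compact_mx; [exists 1|exact/closed_fun_le].
pose bd := [set p : 'rV[R]_d.+1 | `|p| = 1].
have cbd : compact bd.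
  by apply: bounded_closed_compact_mx; [exists 1 => p /= ->|exact/closed_fun_eq].
have cf0 : continuous f0 by exact: continuous_compose crr cf1.
have cZ : closed (f0 @` bd).
  by apply: compact_closed => //; apply: continuous_compact => //; exact: continuous_subspaceT.
have gaZ r : ~ (f0 @` bd) (ga' r).
  move=> [p p1 E]; apply: (TP (s p) (sP p).1).
  have -> : sb_pt (Phi T (s p)) = ga' r.
    by rewrite -E /f0 /rr radial_retraction_id ?p1 // /f1 /sf tt_out ?p1.
  exists (clamp 0 1 r) => //; rewrite /= in_itv /=; exact: clamp_itv.
(* The deformation starts with the constant functional b: it vanishes on the pencil over y, and over
   the other points reached it is positive on the form carried by the flow line. *)
have missz : missed P y bd f0 tau0 (fun=> mxvec b) z.
  exists (f1 @` [set p | `|p| <= 1]), f0, tau0, (fun=> mxvec b); split; last first.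
    by move=> [p p1 E]; exact: (nR (s p) (tt p) (sP p).1 (tt0 p) E).
  split => //.
  - split => //; first exact: continuous_compose crr ctau1.
    exact: continuous_const.
  - split; last by move=> p; exists (rr p); [exact: rr1|].
    by apply: compact_closed => //; apply: continuous_compact => //; exact: continuous_subspaceT.
  - by move=> p; exact: tau1P.
  - move=> _ [p p1 <-] zy bz.
    have tp : 0 < tt p.
      rewrite lt_neqAle tt0 andbT eq_sym; apply/eqP => t0; apply: zy.
      by rewrite /f1 /sf t0 (Phi0 Phi_fitting) (sP p).1.
    have := bpos p tp; have /gr_projP qP := sb_unit_mem (sf p).
    by rewrite /mxdot -qP trmx_mul gr_proj_tr mulmxA bz mul0mx mxE ltxx.
have missy : missed P y bd f0 tau0 (fun=> mxvec b) y.
  have := @locally_constant_real R (fun r => missed P y bd f0 tau0 (fun=> mxvec b) (ga' r)).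
  move=> /(_ _ 0 1); rewrite /ga' clamp_id ?lexx ?ler01 // clamp_id ?lexx ?ler01 // ga0 ga1; apply => //.
  move=> r; have [U nU UP] := push_off hM charts cP Prep y tau0 (fun=> mxvec b) cZ (gaZ r).
  have nb : \forall r' \near r, U (ga' r') by exact: (cga' r _ nU).
  apply: filterS nb => r' Ur'; have Ur := nbhs_singleton nU.
  by split; apply: UP.
have [C [f' [tau' [g' [[[cf' ct' cg'] [cC fC] tau'P gP bdP] nC]]]]] := missy.
have fy p : f' p <> y by move=> E; apply: nC; rewrite -E.
(* [a] and [ka] are the functional and the form of the flow line in the coordinates of the frames;
   on the unit sphere the two frames coincide, so the product of [a] and [ka] is the pairing with
   b. *)
pose a p := (tau' p *m (g' (f' p))^T)^T.
pose Gr p := tau0 p *m (tau0 p)^T.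
pose ka p := mxvec (sb_unit (sf p)) *m (tau0 p)^T *m invmx (Gr p).
have tau0P p : tau0 p *m P (f0 p) = tau0 p /\ row_free (tau0 p) by exact: tau1P.
have ctau0 : continuous tau0 by exact: continuous_compose crr ctau1.
have kaE p : `|p| <= 1 -> ka p *m tau0 p = mxvec (sb_unit (sf p)).
  move=> p1; have [t1 t2] := tau0P p.
  have E : P (f0 p) = row_projector (tau0 p) by exact: (P_rep Prep).
  have := sb_unit_mem (sf p) => /gr_projP; rewrite -/(f1 p) -/(P (f1 p)).
  have -> : f1 p = f0 p by rewrite /f0 /rr radial_retraction_id.
  by rewrite E /row_projector !mulmxA.
apply: (@radial_field_extension R d a ka).
- move=> p; apply: (cvg_trmx (F := nbhs p)); apply: (cvg_mulmx (F := nbhs p)); first exact: ct'.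
  by apply: (cvg_trmx (F := nbhs p)); exact: (continuous_compose cf' cg').
- move=> p p0; apply: (cvg_mulmx (F := nbhs p)).
    apply: (cvg_mulmx (F := nbhs p)); last exact: (@continuous_trmx _ _ _ _ _ ctau0 p).
    apply: (cvg_mxvec (F := nbhs p)).
    exact: (continuous_comp (csf p p0) (@sb_unit_continuous _ _ _ _ u (sf p))).
  have cG : (fun t => Gr t) @ p --> Gr p.
    exact: (@continuous_mulmx _ _ _ _ _ _ _ ctau0 (continuous_trmx ctau0) p).
  exact: (cvg_invmx (FF := nbhs_filter p) (gram_unit (tau0P p).2) cG).
- move=> p _ /(congr1 trmx); rewrite /a trmxK trmx0 => ag.
  have [t1 t2] := tau'P p; apply: (gP (f' p) (fC p) (fy p)).
  rewrite (P_rep Prep t2 t1) /row_projector !mulmxA.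
  have -> : g' (f' p) *m (tau' p)^T = 0 by rewrite -[LHS]trmxK trmx_mul trmxK ag trmx0.
  by rewrite !mul0mx.
- move=> p /andP[_ p1] k0; have := sb_unit_neq0 (sf p).
  have := kaE p p1; rewrite k0 mul0mx => /(congr1 vec_mx); rewrite mxvecK linear0 => <-.
  by rewrite eqxx.
- move=> p p1; have [e1 e2 e3] := bdP p p1.
  rewrite /a trmxK e1 e2 e3 mulmxA kaE ?p1 //.
  have tp : 0 < tt p by rewrite tt_out ?p1.
  by have := bpos p tp; rewrite mxdotC.
- move=> p p2; have p0 : p != 0 by rewrite -normr_eq0 p2 gt_eqF // divr_gt0.
  have p1 : `|p| <= 1 by rewrite p2; lra.
  have sE : sf p = s p by rewrite /sf tt_in ?p2 // (Phi0 Phi_fitting).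
  have tE : tau0 p = F0 by rewrite /tau0 /rr radial_retraction_id // tau1_in // p2.
  pose q : 'M[R]_m := vec_mx (p *m F0).
  have q0 : 0 < `|q| by rewrite normr_gt0; exact: (qmem p p0).2.
  exists `|q|^-1; first by rewrite invr_gt0.
  have := kaE p p1; rewrite sE tE (sb_unit_ray ((sP p).2 p0)) -/q linearZ /= vec_mxK scalemxAl.
  by move=> /(row_free_inj fF0).
Qed.

End Reach.

(** * Word metrics and the singular value gap *)

Section WordLength.
Context {G : groupType}.
Implicit Types (S : finite_generating_set G) (F : seq G).

Lemma is_word_forM (S : seq G) g h i j : is_word_for S g i -> is_word_for S h j ->
  is_word_for S (g * h)%g (i + j)%N.
Proof.
move=> [w [sw aw pw]] [w' [sw' aw' pw']]; exists (w ++ w'); split.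
- by rewrite size_cat sw sw'.
- by rewrite all_cat aw aw'.
- by rewrite big_cat /= pw pw'.
Qed.

Lemma is_word_forV (S : seq G) g i : is_word_for S g i -> is_word_for S g^-1%g i.
Proof.
move=> [w [sw aw pw]]; exists (rev [seq x^-1%g | x <- w]); split.
- by rewrite size_rev size_map.
- rewrite all_rev all_map; apply: sub_all aw => x /=.
  by rewrite invgK orbC.
- have h := @prodgV G _ w xpredT id.
  by rewrite -map_rev big_map prodgV revK pw.
Qed.

Lemma is_word_for1 (S : seq G) : is_word_for S 1%g 0.
Proof. by exists [::]; rewrite big_nil. Qed.

Lemma is_word_for_mem (S : seq G) g : g \in S -> is_word_for S g 1.
Proof. by move=> gS; exists [:: g]; rewrite big_seq1 /= gS. Qed.

Lemma word_length_word S g : is_word_for (fgs_seq S) g (word_length S g).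
Proof. by rewrite /word_length; case: ex_minnP => k /asboolP. Qed.

Lemma word_length_le S g k : is_word_for (fgs_seq S) g k -> (word_length S g <= k)%N.
Proof. by move=> h; rewrite /word_length; case: ex_minnP => i _; apply; exact/asboolP. Qed.

Lemma word_lengthM S g h : (word_length S (g * h)%g <= word_length S g + word_length S h)%N.
Proof. by apply/word_length_le/is_word_forM; exact: word_length_word. Qed.

Lemma word_lengthV S g : word_length S g^-1%g = word_length S g.
Proof.
apply/eqP; rewrite eqn_leq; apply/andP; split.
  by apply/word_length_le/is_word_forV/word_length_word.
by apply: word_length_le; rewrite -{1}(invgK g); apply/is_word_forV/word_length_word.
Qed.

Lemma word_length1 S : word_length S 1%g = 0%N.
Proof. by apply/eqP; rewrite -leqn0; apply/word_length_le/is_word_for1. Qed.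

Lemma word_length_bound S F : exists L, forall g, g \in F -> (word_length S g <= L)%N.
Proof.
exists (\max_(g <- F) word_length S g) => g gF.
by rewrite (big_rem g) //= leq_maxl.
Qed.

Lemma steps_length S F L (e : nat -> G) : (forall g, g \in F -> (word_length S g <= L)%N) ->
  (forall k, ((e k)^-1 * e k.+1)%g \in F) ->
  forall i j, (i <= j)%N -> (word_length S ((e i)^-1 * e j)%g <= L * (j - i))%N.
Proof.
move=> LP eF i j ij; rewrite -(subnKC ij) addKn; elim: (j - i)%N => [|k IH].
  by rewrite addn0 mulVg word_length1.
have -> : ((e i)^-1 * e (i + k.+1)%N)%g = ((e i)^-1 * e (i + k)%N * ((e (i + k)%N)^-1 * e (i + k).+1))%g.
  by rewrite addnS mulgA mulgK.
rewrite (leq_trans (word_lengthM _ _ _)) // mulnS addnC leq_add //.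
exact: LP.
Qed.

End WordLength.

Section SigmaPositive.
Context {R : realType} {n : nat}.
Hypothesis n_gt0 : (0 < n)%N.

Lemma sigma_gt0 (B : 'M[R]_(n + n)) : B \in unitmx -> 0 < sigma n.+1 B.
Proof.
move=> uB; have [P [U [_ _ PU Ui [h _ _]]]] := small_projector n_gt0 B.
pose x : 'cV[R]_n := const_mx 1.
have x0 : x != 0.
  by apply/eqP => /matrixP/(_ (Ordinal n_gt0) 0); rewrite !mxE => /eqP; rewrite oner_eq0.
have Ux : U *m x != 0 by apply/eqP => /Ui; exact/eqP.
have := h (U *m x); rewrite [P *m _]mulmxA PU => h1.
have [_ s0] := sigma_ge0 n_gt0 B.
rewrite lt_neqAle s0 andbT eq_sym; apply/eqP => z; move: h1.
rewrite z expr0n mul0r leNgt nsq_gt0; apply/negP/negPn.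
by apply: contraNneq Ux => /(congr1 (mulmx (invmx B))); rewrite mulKmx // mulmx0 => ->.
Qed.

End SigmaPositive.

(** * The singular value gap in terms of word length *)

Section AnosovBound.
Context {R : realType} {d n : nat} {M : topologicalType} {G : groupType}.
Local Notation m := (n + n)%N.
Variables (act : G -> M -> M) (rho : G -> 'M[R]_m) (u : M -> Gr R d m m)
  (Phi : R -> sphere_bundle u -> sphere_bundle u).
Hypothesis n_gt0 : (0 < n)%N.
Hypothesis act_act : is_action act.
Hypothesis rho_unit : forall g, rho g \in unitmx.
Hypothesis rho_mul : forall g h, rho (g * h)%g = rho g *m rho h.
Hypothesis PD : forall K : set M, compact K ->
  exists l : seq G, forall g x, K x -> K (act g x) -> g \in l.
Hypothesis cu : continuous u.
Hypothesis u_nn : forall x, pencil_nn (u x).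
Hypothesis u_equiv : equivariant_pencil_map u act rho.
Hypothesis Phi_fitting : fitting_flow Phi.
Hypothesis Phi_equiv : equivariant_flow act rho Phi.
Variables (K : set M) (y0 : M).
Hypotheses (cK : compact K) (Kc : \bigcup_g act g @` K = setT) (Ky0 : K y0).
Hypothesis reach : forall y z : M,
  exists s t, [/\ sb_pt s = y, 0 <= t & sb_pt (Phi t s) = z].

(** The chain follows a flow line from [y0] to [act g y0]. F' collects the errors at its end, due to
    the last step of the chain and to the fractional part of the flow time. *)
Lemma chains_to : exists (D C1 : R) (F F' : seq G), [/\ 0 < D, D < m%:R ^+ 2 + 1, 0 < C1 &
  forall g, exists (e : nat -> G) c q k, [/\ chain rho D (m%:R ^+ 2 + 1) C1 F e c q,
    e 0%N = 1%g & ((e k.+1)^-1 * g)%g \in F']].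
Proof.
have [D [C1 [F [D0 D1 C10 fc]]]] :=
  flow_chain act_act rho_unit rho_mul PD cu u_nn u_equiv Phi_fitting Phi_equiv cK.
have cS := @time_slab_compact R d n M u Phi cu Phi_fitting K 0 1 cK.
have [F1 F1P] := compact_translates PD cK cS.
exists D, C1, F, [seq (f^-1 * f')%g | f <- F, f' <- F1]; split => //.
  by rewrite (le_lt_trans D1) // ltrDr exprn_gt0 // ltr0n; lia.
move=> g; have [s [t [sy t0 tz]]] := reach y0 (act g y0).
have Ks : K (sb_pt s) by rewrite sy.
have [ga ga1 fp] := flow_path_exists act_act Phi_fitting Kc Ks.
have [c [nu [ch _ _]]] := fc s ga fp.
pose k := Num.truncn t; have /andP[k1 k2] := truncn_itv t0.
rewrite -/k in k1 k2.
exists ga, c, (fun k => c k *: form_act (rho (ga k)) (nu k)), k; split => //.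
have [_ _ _ _ stF] := ch k.
have -> : ((ga k.+1)^-1 * g)%g = (((ga k)^-1 * ga k.+1)^-1 * ((ga k)^-1 * g))%g.
  by rewrite invgM invgK mulgA mulgK.
apply/allpairsP; exists (((ga k)^-1 * ga k.+1), ((ga k)^-1 * g))%g; split => //=.
apply: (F1P _ y0) => //.
have [r rP] := sb_translate_exists u_equiv (Phi k%:R s) (rho_unit (ga k)^-1%g).
exists (t - k%:R, r).
  split => /=; first by rewrite in_itv /=; move: k2; rewrite -natr1 => k2; apply/andP; split; lra.
  by case: rP => -> _; have [x Kx <-] := fp k; rewrite actK.
have [e _] := Phi_equiv rP (t - k%:R).
by rewrite /= e -(PhiD Phi_fitting) subrK tz actM.
Qed.

Lemma finitely_generated : exists S : finite_generating_set G, True.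
Proof.
have [D [C1 [F [F' [_ _ _ h]]]]] := chains_to.
have gen g : exists k, `[< is_word_for (F ++ F') g k >].
  have [e [c [q [k [ch e0 eF]]]]] := h g.
  have ek j : is_word_for (F ++ F') (e j) j.
    elim: j => [|j IH]; first by rewrite e0; exact: is_word_for1.
    have fF : ((e j)^-1 * e j.+1)%g \in F ++ F' by rewrite mem_cat; have [_ _ _ _ ->] := ch j.
    by have := is_word_forM IH (is_word_for_mem fF); rewrite mulVKg addn1.
  exists (k.+1 + 1)%N; apply/asboolP; rewrite -[g](mulVKg (e k.+1)).
  by apply: is_word_forM => //; apply: is_word_for_mem; rewrite mem_cat eF orbT.
by exists (MkFGS gen).
Qed.

(** A chain to g^-1 is used because [hnorm] involves inverses. The negative n-plane of its last form
    bounds [sigma n.+1] above, the positive n-plane of its first form bounds [sigma n] below, and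
    the quotient of the scalars cancels in the ratio. *)
Lemma anosov_bound (S : finite_generating_set G) : exists A B : R, [/\ 0 < A, 0 < B &
  forall g, expR (A * (word_length S g)%:R - B) <= sigma n (rho g) / sigma n.+1 (rho g)].
Proof.
have [D [C1 [F [F' [D0 DC C10 h]]]]] := chains_to.
have C00 : 0 < m%:R ^+ 2 + 1 :> R by exact: lt_trans DC.
have [Bc [Bc0 BcP]] := hnorm_bounds rho_unit F'.
have [L LP] := word_length_bound S F; have [L' L'P] := word_length_bound S F'.
set C0 := m%:R ^+ 2 + 1 in DC C00 h; pose ep := D / C0.
have /andP[ep0 ep1] : 0 < ep < 1 by rewrite divr_gt0 //= ltr_pdivrMr // mul1r.
have ep10 : 0 < 1 - ep by lra.
have epS : 0 < 1 + ep by lra.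
(* The growth of the squared ratio of singular values per step of the chain. *)
pose r := (1 + ep) / (1 - ep); have r1 : 1 < r by rewrite ltr_pdivlMr // mul1r; lra.
have lr0 : 0 < ln r by rewrite ln_gt0.
pose cc := ep ^+ 2 / (C1 * Bc ^+ 2).
have cc0 : 0 < cc by rewrite divr_gt0 ?exprn_gt0 // mulr_gt0 // exprn_gt0.
have ratio g : exists2 k, (word_length S g <= L * k.+1 + L')%N &
    cc * r ^+ k <= (sigma n (rho g) / sigma n.+1 (rho g)) ^+ 2.
  have [e [c [q [k [ch e0 eF]]]]] := h g^-1%g; exists k.
    rewrite -word_lengthV -[g^-1%g](mulVKg (e k.+1)).
    rewrite (leq_trans (word_lengthM _ _ _)) // leq_add ?L'P //.
    have := @steps_length _ S F L e LP _ 0%N k.+1 isT; rewrite e0 invg1 mul1g subn0; apply.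
    by move=> j; have [_ _ _ _ ->] := ch j.
  set f := ((e k.+1)^-1 * g^-1)%g in eF.
  have nE v : nsq (rho g *m v) = hnorm rho f (invmx (rho (e k.+1)) *m v).
    rewrite -(hnorm_mul rho_unit rho_mul) /f mulVKg /hnorm -(rhoV rho_unit rho_mul) invgK //.
  have hE v : hnorm rho (e k.+1) v = nsq (invmx (rho (e k.+1)) *m v) by [].
  have h0 v : hnorm rho (e 0%N) v = nsq v by rewrite e0 hnorm1.
  have [[c00 s0] _ _ _ _] := ch 0%N; have [[ck0 sk] _ _ _ _] := ch k.+1.
  have [N [_ [Ni _ Nq _]]] := signature_frames sk.
  have [_ [P [_ Pi _ Pq]]] := signature_frames s0.
  pose X := c 0%N / c k.+1; have X0 : 0 < X by rewrite divr_gt0.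
  pose al := Bc * (C1 * ((1 - ep) ^+ k / ep) * X).
  pose be := Bc^-1 * (ep * (1 + ep) ^+ k * X).
  have al0 : 0 < al by rewrite !mulr_gt0 ?invr_gt0 // exprn_gt0.
  have be0 : 0 < be by rewrite !mulr_gt0 ?invr_gt0 // exprn_gt0.
  have u1 : sigma n.+1 (rho g) ^+ 2 <= al.
    apply: (sigma_minimax_le n_gt0 Ni) => w; set v := N *m w.
    have qv : form_eval (q k.+1) v v <= 0.
      have [z|w0] := eqVneq w 0; last exact: ltW (Nq w w0).
      by rewrite /v z /form_eval !mulmx0 mxE.
    have cr := chain_contract D0 DC ch qv; rewrite -/ep h0 in cr.
    have [_ _ _ /(_ v) st _] := ch k.
    rewrite nE (le_trans (BcP _ eF _).1) // /al -mulrA ler_pM2l // -hE.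
    rewrite -(ler_pM2l ck0) (le_trans st) //.
    have -> : c k.+1 * (C1 * ((1 - ep) ^+ k / ep) * X * nsq v) =
       C1 * ((1 - ep) ^+ k * (c 0%N * nsq v / ep)).
      by rewrite /X; field; rewrite !gt_eqF.
    by rewrite ler_pM2l.
  have u2 : be <= sigma n (rho g) ^+ 2.
    apply: (sigma_minimax_ge n_gt0 Pi) => w; set v := P *m w.
    have qv : 0 <= form_eval (q 0%N) v v.
      have [z|w0] := eqVneq w 0; last exact: ltW (Pq w w0).
      by rewrite /v z /form_eval !mulmx0 mxE.
    have ex := chain_expand D0 DC ch k qv; rewrite -/ep h0 in ex.
    have [_ b2] := BcP _ eF (invmx (rho (e k.+1)) *m v).
    have E : Bc * (be * nsq v) = ep * (1 + ep) ^+ k * X * nsq v.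
      by rewrite /be; field; rewrite gt_eqF.
    rewrite nE -(ler_pM2l Bc0) E (le_trans _ b2) // -hE.
    rewrite -(ler_pM2l ck0) (le_trans _ ex) // le_eqVlt; apply/orP; left; apply/eqP.
    by rewrite /X; field; rewrite !gt_eqF.
  have sg : 0 < sigma n.+1 (rho g) by exact: sigma_gt0.
  rewrite [(sigma _ _ / _) ^+ 2]expr_div_n ler_pdivlMr ?exprn_gt0 // (le_trans _ u2) //.
  rewrite (le_trans (_ : _ <= cc * r ^+ k * al)) //.
    by rewrite ler_pM2l // mulr_gt0 // exprn_gt0 // (lt_trans _ r1).
  rewrite le_eqVlt; apply/orP; left; apply/eqP.
  have rk : r ^+ k = (1 + ep) ^+ k / (1 - ep) ^+ k by rewrite /r expr_div_n.
  have b0 : 0 < (1 - ep) ^+ k by rewrite exprn_gt0.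
  rewrite /cc rk /al /be; field.
  by rewrite !gt_eqF.
(* Half of the logarithm of r, since r concerns squares, divided by the number of letters per step;
   [L.+1] avoids a division by zero. *)
pose A := ln r / (2 * L.+1%:R); have A0 : 0 < A by rewrite divr_gt0 // mulr_gt0 // ltr0n.
pose B := A * (L%:R + L'%:R) + `|ln cc| / 2 + 1.
have B0 : 0 < B by rewrite ltr_wpDl // addr_ge0 // ?mulr_ge0 ?addr_ge0 ?divr_ge0 // ltW.
exists A, B; split => // g; have [k kL kr] := ratio g.
have sg : 0 < sigma n.+1 (rho g) by exact: sigma_gt0.
have [sn _] := sigma_ge0 n_gt0 (rho g).
rewrite -(@ler_pXn2r _ 2) ?nnegrE ?expR_ge0 ?divr_ge0 ?(ltW sg) //.
rewrite (le_trans _ kr) // -expRM_natl.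
have -> : cc * r ^+ k = expR (ln cc + ln r *+ k).
  by rewrite expRD lnK ?posrE // -mulr_natl expRM_natl lnK ?posrE // (lt_trans _ r1).
rewrite ler_expR.
have h1 : (word_length S g)%:R <= L%:R * (k%:R + 1) + L'%:R :> R.
  by rewrite natr1 -natrM -natrD ler_nat.
have h2 : A * (word_length S g)%:R <= A * (L%:R * (k%:R + 1) + L'%:R) by rewrite ler_pM2l.
have h3 : 2 * A * L%:R <= ln r.
  have L1 : L.+1%:R != 0 :> R by rewrite pnatr_eq0.
  have -> : 2 * A * L%:R = ln r * (L%:R / L.+1%:R).
    by rewrite /A; move: (L.+1%:R) L1 => l1 L1; field.
  by rewrite ler_piMr ?(ltW lr0) // ler_pdivrMr ?ltr0n // mul1r ler_nat.
have h4 : 2 * A * L%:R * k%:R <= ln r * k%:R by rewrite ler_wpM2r.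
have h5 : - ln cc <= `|ln cc| by rewrite -normrN ler_norm.
rewrite -[ln r *+ k]mulr_natr /B mulrBr.
lra.
Qed.

End AnosovBound.

(** * The Morse lemma for chains *)

Section Geodesics.
Context {G : groupType}.
Variable S : finite_generating_set G.
Local Notation len := (word_length S).

Definition generators := fgs_seq S ++ [seq g^-1%g | g <- fgs_seq S].

Lemma generatorsP g : (g \in fgs_seq S) || (g^-1%g \in fgs_seq S) = (g \in generators).
Proof.
rewrite mem_cat; congr (_ || _); apply/idP/mapP => [h|[x xS ->]]; last by rewrite invgK.
by exists g^-1%g; rewrite ?invgK.
Qed.

Lemma generators_length g : g \in generators -> (len g <= 1)%N.
Proof.
by move=> gS; apply: word_length_le; exists [:: g]; rewrite big_seq1 /= generatorsP gS.
Qed.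

Lemma geodesic g : exists p : nat -> G, [/\ p 0%N = 1%g, p (len g) = g,
  forall j, (j < len g)%N -> ((p j)^-1 * p j.+1)%g \in generators &
  forall i j, (i <= j <= len g)%N -> (j - i <= len ((p i)^-1 * p j)%g)%N].
Proof.
have [w [sw aw pw]] := word_length_word S g.
pose p j := (\prod_(x <- take j w) x)%g.
have pS j : (j < len g)%N -> p j.+1 = (p j * nth 1%g w j)%g.
  by move=> jl; rewrite /p (take_nth 1%g) ?sw // big_rcons.
have wordW (w' : seq G) : {subset w' <= w} -> is_word_for (fgs_seq S) (\prod_(x <- w') x)%g (size w').
  by move=> w'w; exists w'; split => //; apply/allP => x /w'w; exact: (allP aw).
exists p; split.
- by rewrite /p take0 big_nil.
- by rewrite /p -sw take_size.
- move=> j jl; rewrite pS // mulKg -generatorsP.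
  by apply: (allP aw); rewrite mem_nth // sw.
- move=> i j /andP[ij jl].
  have h1 : (len (p i) <= i)%N.
    have := word_length_le (wordW (take i w) (mem_take (n0 := i) (s := w))).
    by move/leq_trans; apply; rewrite size_take sw; case: ltnP.
  have h2 : (len ((p j)^-1 * g)%g <= len g - j)%N.
    have := word_length_le (wordW (drop j w) (mem_drop (n0 := j) (s := w))).
    rewrite size_drop sw; have -> : (\prod_(x <- drop j w) x)%g = ((p j)^-1 * g)%g; last by [].
    by rewrite -[in RHS]pw -[in RHS](cat_take_drop j w) big_cat /= mulKg.
  have : (len g <= len (p i) + (len ((p i)^-1 * p j)%g + len ((p j)^-1 * g)%g))%N.
    rewrite -{1}[g](mulVKg (p i)); apply: (leq_trans (word_lengthM _ _ _)).
    rewrite leq_add2l; apply: leq_trans (word_lengthM _ _ _).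
    by rewrite -mulgA mulVKg.
  lia.
Qed.

Lemma finite_balls r : exists F : seq G, forall g, (len g <= r)%N -> g \in F.
Proof.
elim: r => [|r [F FP]].
  exists [:: 1%g] => g; rewrite leqn0 => /eqP g0.
  have [p [p0 pg _ _]] := geodesic g; by rewrite -pg g0 p0 inE.
exists (F ++ [seq (x * y)%g | x <- F, y <- generators]) => g gr.
rewrite mem_cat; apply/orP; case: (leqP (len g) r) => [/FP|gr']; first by left.
have gE : len g = r.+1 by apply/eqP; rewrite eqn_leq gr.
right; have [p [p0 pg pS pd]] := geodesic g.
apply/allpairsP; exists (p r, ((p r)^-1 * g)%g); rewrite /= mulVKg; split => //.
  apply: FP; have : (r <= len g)%N by rewrite gE.
  elim: r {gr gr' gE} => [|j IH] jl; first by rewrite p0 word_length1.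
  rewrite -[p j.+1](mulVKg (p j)) (leq_trans (word_lengthM _ _ _)) // -[leqRHS]addn1.
  by rewrite leq_add ?IH ?(ltnW jl) // generators_length // pS.
by have := pS r; rewrite -gE pg gE; apply.
Qed.

End Geodesics.

Lemma geometric_telescope (R : realType) m (f : nat -> 'M[R]_m) (C x : R) N :
  0 <= C -> 0 < x < 1 -> (forall j, (j < N)%N -> `|f j - f j.+1| <= C * x ^+ j) ->
  `|f 0%N - f N| <= C / (1 - x).
Proof.
move=> C0 /andP[x0 x1] fS; have x10 : 0 < 1 - x by rewrite subr_gt0.
suff : `|f 0%N - f N| <= C * (1 - x ^+ N) / (1 - x).
  move/le_trans; apply; rewrite ler_pM2r ?invr_gt0 // ler_piMr // gerBl.
  by rewrite exprn_ge0 // ltW.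
elim: N fS => [|N IH] fS; first by rewrite subrr normr0 expr0 subrr mulr0 mul0r.
rewrite -(subrK (f N) (f 0%N)) -addrA (le_trans (ler_normD _ _)) //.
have h1 := IH (fun j jN => fS j (ltnW jN)); have h2 := fS N (ltnSn N).
rewrite (le_trans (lerD h1 h2)) // le_eqVlt; apply/orP; left; apply/eqP.
by rewrite exprS; field; rewrite gt_eqF.
Qed.

Lemma form_eval_comb (R : realType) m (q : 'M[R]_m) v z (a b : R) :
  form_eval q (a *: v + b *: z) (a *: v + b *: z) =
  a ^+ 2 * form_eval q v v + a * b * (form_eval q v z + form_eval q z v) + b ^+ 2 * form_eval q z z.
Proof.
have entD (A B : 'M[R]_1) : (A + B) 0 0 = A 0 0 + B 0 0 by rewrite mxE.
have entZ (s : R) (A : 'M[R]_1) : (s *: A) 0 0 = s * A 0 0 by rewrite mxE.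
rewrite /form_eval [(_ + _)^T]linearD /= !trmxZ !(mulmxDl, mulmxDr) -!scalemxAl -!scalemxAr.
by rewrite !entD !entZ; ring.
Qed.

(** The cross term is bounded by evaluating q at t v - z and t v + z, the weight t making both
    summands comparable. *)
Lemma form_perturb (R : realType) m (q : 'M[R]_m) (C t : R) v z : 0 <= C -> 0 < t ->
  (forall v, `|form_eval q v v| <= C * nsq v) -> nsq z <= t ^+ 2 * nsq v ->
  form_eval q (v - z) (v - z) <= form_eval q v v + C * (2 * t + t ^+ 2) * nsq v.
Proof.
move=> C0 t0 qC zt.
have E : form_eval q (v - z) (v - z) =
    form_eval q v v - (form_eval q v z + form_eval q z v) + form_eval q z z.
  by have := form_eval_comb q v z 1 (-1); rewrite scale1r scaleN1r => ->; ring.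
have h1 := qC (t *: v + (-1) *: z); have h2 := qC (t *: v + 1 *: z).
rewrite -!form_eval1 !form_eval_comb !form_eval1 in h1 h2.
set b := form_eval q v z + _ in E h1 h2; set b1 := form_eval 1%:M v z + _ in h1 h2.
have h3 := le_trans (ler_norm _) h1.
have h4 := le_trans (ler_norm _) (eq_ind_r (fun x => x <= _) h2 (normrN _)).
have h5 := le_trans (ler_norm _) (qC z).
have h6 : C * nsq z <= C * (t ^+ 2 * nsq v) by rewrite ler_wpM2l.
rewrite E -(ler_pM2l t0); nra.
Qed.

Lemma nsq_mulmx_norm (R : realType) m (A : 'M[R]_m) (v : 'cV[R]_m) :
  nsq (A *m v) <= m%:R ^+ 3 * `|A| ^+ 2 * nsq v.
Proof.
rewrite (le_trans (nsq_norm _)) //.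
rewrite (@le_trans _ _ (m%:R * (m%:R * `|A| * `|v|) ^+ 2)) //.
  by rewrite ler_wpM2l // lerXn2r ?nnegrE ?mulr_ge0 // mx_norm_mul.
have -> : m%:R * (m%:R * `|A| * `|v|) ^+ 2 = m%:R ^+ 3 * `|A| ^+ 2 * `|v| ^+ 2 by ring.
by rewrite ler_wpM2l ?norm_nsq // mulr_ge0 // exprn_ge0.
Qed.

Lemma norm_of_nsq (R : realType) m (A : 'M[R]_m) (e : R) : 0 <= e ->
  (forall v, nsq (A *m v) <= e ^+ 2 * nsq v) -> `|A| <= e.
Proof.
move=> e0 Ae; apply: mx_norm_le => // i j.
have d1 : nsq (delta_mx j 0 : 'cV[R]_m) = 1.
  rewrite nsqE (bigD1 j) //= mxE !eqxx expr1n big1 ?addr0 // => k kj.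
  by rewrite mxE (negbTE kj) expr0n.
have := Ae (delta_mx j 0); rewrite d1 mulr1 -colE => h.
rewrite -(@ler_pXn2r _ 2) ?nnegrE // (le_trans _ h) //.
rewrite nsqE (bigD1 i) //= mxE real_normK ?num_real // lerDl sumr_ge0 // => k _.
exact: sqr_ge0.
Qed.

Lemma linear_bounds_exponential (R : realType) (ep C : R) : 0 < ep ->
  exists T : nat, forall k, (1 + ep) ^+ k <= C -> (k <= T)%N.
Proof.
move=> ep0; exists (Num.truncn (C / ep)) => k kC.
have h := bernoulli k (ltW ep0).
have h1 : k%:R * ep <= C by lra.
have h2 : k%:R <= C / ep by rewrite ler_pdivlMr.
by rewrite -ltnS -(ltr_nat R) (le_lt_trans h2) // truncnS_gt.
Qed.

Section Morse.
Context {R : realType} {n : nat} {G : groupType}.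
Local Notation m := (n + n)%N.
Variable rho : G -> 'M[R]_m.
Hypothesis n_gt0 : (0 < n)%N.
Hypothesis rho_unit : forall g, rho g \in unitmx.
Hypothesis rho_mul : forall g h, rho (g * h)%g = rho g *m rho h.
Variables (S : finite_generating_set G) (A B : R).
Hypothesis A0 : 0 < A.
Hypothesis gap : forall g,
  expR (A * (word_length S g)%:R - B) <= sigma n (rho g) / sigma n.+1 (rho g).
Local Notation len := (word_length S).

(* P g and U g: the projector on, and a frame of, the span of the right singular
   vectors of rho(g)^-1 for its n smallest singular values. *)
Lemma small_projectors : exists (P : G -> 'M[R]_m) (U : G -> 'M[R]_(m, n)) (s s' : G -> R),
  forall g, [/\ (P g)^T = P g, P g *m P g = P g, P g *m U g = U g,
     forall w : 'cV_n, U g *m w = 0 -> w = 0 &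
  [/\ forall v, hnorm rho g (P g *m v) <= s g * nsq (P g *m v),
     forall v, s' g * nsq (v - P g *m v) <= hnorm rho g v,
     forall v, nsq (P g *m v) <= nsq v,
     0 < s g /\ s g <= expR (2 * (B - A * (len g)%:R)) * s' g &
     forall (N : 'M[R]_(m, n)) a, (forall w : 'cV_n, N *m w = 0 -> w = 0) ->
       (forall w, hnorm rho g (N *m w) <= a * nsq (N *m w)) -> s g <= a]].
Proof.
have [P Pe] := choice (fun g => small_projector n_gt0 (invmx (rho g))).
have [U UP] := choice Pe.
exists P, U, (fun g => sigma n.+1 (invmx (rho g)) ^+ 2), (fun g => sigma n (invmx (rho g)) ^+ 2).
move=> g; have [h1 h2 h3 h4 [h5 h6 h7]] := UP g; split => //; split => //.
- by move=> v; rewrite (h7 v) lerDl nsq_ge0.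
- have sg : 0 < sigma n.+1 (invmx (rho g)) by apply: sigma_gt0 => //; rewrite unitmx_inv.
  split; first by rewrite exprn_gt0.
  have := gap g^-1%g; rewrite (rhoV rho_unit rho_mul) word_lengthV ler_pdivlMr // => h.
  have [sn _] := sigma_ge0 n_gt0 (invmx (rho g)).
  have e0 := expR_gt0 (A * (len g)%:R - B).
  have -> : expR (2 * (B - A * (len g)%:R)) = (expR (A * (len g)%:R - B))^-1 ^+ 2.
    by rewrite -expRN -expRM_natl opprB.
  by rewrite -exprMn lerXn2r ?nnegrE ?(ltW sg) ?mulr_ge0 ?invr_ge0 ?(ltW e0) // ler_pdivlMl.
- by move=> N a Ni Na; apply: (sigma_minimax_le n_gt0 Ni).
Qed.

Variables (P : G -> 'M[R]_m) (U : G -> 'M[R]_(m, n)) (s s' : G -> R).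
Hypothesis PU : forall g, [/\ (P g)^T = P g, P g *m P g = P g, P g *m U g = U g,
     forall w : 'cV_n, U g *m w = 0 -> w = 0 &
  [/\ forall v, hnorm rho g (P g *m v) <= s g * nsq (P g *m v),
     forall v, s' g * nsq (v - P g *m v) <= hnorm rho g v,
     forall v, nsq (P g *m v) <= nsq v,
     0 < s g /\ s g <= expR (2 * (B - A * (len g)%:R)) * s' g &
     forall (N : 'M[R]_(m, n)) a, (forall w : 'cV_n, N *m w = 0 -> w = 0) ->
       (forall w, hnorm rho g (N *m w) <= a * nsq (N *m w)) -> s g <= a]].

(** A vector in the image of [P h] is contracted by rho(h)^-1, hence almost as much by rho(g)^-1 for
    a neighbour g; its part orthogonal to the image of [P g] is less contracted by the factor of the
    gap, so that part is exponentially small. *)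
Lemma adjacent_projectors : exists2 C, 0 < C & forall g f, f \in generators S ->
  `|P g - P (g * f)%g| <= C * expR (- (A * (len g)%:R)).
Proof.
have [k [k0 kP]] := hnorm_bounds rho_unit (generators S).
have half g h : (forall v, hnorm rho h v <= k * hnorm rho g v /\ hnorm rho g v <= k * hnorm rho h v) ->
    `|P h - P g *m P h| <= k * expR (B - A * (len g)%:R).
  move=> gh; apply: norm_of_nsq => [|v]; first by rewrite mulr_ge0 ?expR_ge0 // ltW.
  have [g1 g2 g3 g4 [g5 g6 g7 [g8 g9] g10]] := PU g.
  have [h1 h2 h3 h4 [h5 h6 h7 [h8 h9] h10]] := PU h.
  have e0 := expR_gt0 (2 * (B - A * (len g)%:R)).
  have s'0 : 0 < s' g by rewrite -(pmulr_rgt0 _ e0) (lt_le_trans g8).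
  have sh : s h <= k * s g.
    apply: (h10 (U g)) => // w; rewrite (le_trans (gh _).1) // -mulrA ler_pM2l //.
    by have := g5 (U g *m w); rewrite mulmxA g3.
  rewrite mulmxBl -mulmxA -(ler_pM2l s'0) (le_trans (g6 _)) // (le_trans (gh _).2) //.
  have e1 : hnorm rho h (P h *m v) <= s h * nsq v.
    by rewrite (le_trans (h5 v)) // ler_pM2l.
  have e2 : s h * nsq v <= k * s g * nsq v by rewrite ler_wpM2r ?nsq_ge0.
  have e3 : k * s g * nsq v <= k * (expR (2 * (B - A * (len g)%:R)) * s' g) * nsq v.
    by rewrite ler_wpM2r ?nsq_ge0 // ler_pM2l.
  have -> : s' g * ((k * expR (B - A * (len g)%:R)) ^+ 2 * nsq v) =
      k * (k * (expR (2 * (B - A * (len g)%:R)) * s' g) * nsq v).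
    by rewrite expRM_natl; ring.
  by rewrite ler_pM2l // (le_trans e1) // (le_trans e2).
exists (k * expR B * (1 + expR A)).
  by rewrite !mulr_gt0 ?expR_gt0 // ltr_wpDl ?expR_ge0 // addr_gt0 ?expR_gt0.
move=> g f fS; set h := (g * f)%g.
have gh v : hnorm rho h v <= k * hnorm rho g v /\ hnorm rho g v <= k * hnorm rho h v.
  by rewrite /h (hnorm_mul rho_unit rho_mul); exact: kP.
have a1 := half g h gh.
have a2 : `|P g - P h *m P g| <= k * expR (B - A * (len h)%:R).
  by apply: half => v; have [] := gh v.
(* Symmetry of the projectors turns the two one-sided estimates into one for the difference. *)
have a3 : P g - P h = (P g - P h *m P g)^T - (P h - P g *m P h).
  have [tg _ _ _ _] := PU g; have [th _ _ _ _] := PU h.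
  by rewrite linearB /= trmx_mul tg th opprB addrA subrK.
have gl : (len g <= len h + 1)%N.
  have -> : g = (h * f^-1)%g by rewrite /h mulgK.
  by rewrite (leq_trans (word_lengthM _ _ _)) // leq_add2l word_lengthV generators_length.
have e1 : expR (B - A * (len h)%:R) <= expR B * expR A * expR (- (A * (len g)%:R)).
  rewrite -!expRD ler_expR.
  have : A * (len g)%:R <= A * ((len h)%:R + 1) by rewrite ler_pM2l // natr1 ler_nat -addn1.
  lra.
have e2 : expR (B - A * (len g)%:R) = expR B * expR (- (A * (len g)%:R)) by rewrite expRD.
rewrite a3 (le_trans (ler_normB _ _)) // mx_norm_tr.
rewrite (le_trans (lerD a2 a1)) // e2.
have e3 : k * expR (B - A * (len h)%:R) <= k * (expR B * expR A * expR (- (A * (len g)%:R))).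
  by rewrite ler_pM2l.
lra.
Qed.

(** Let [j0] be the index of a point of the path nearest to 1. The length of [p j] is at least r
    and, by geodesicity, at least half of |j - j0|; half of the exponent is spent on r, and the rest
    gives geometric series on both sides of [j0]. *)
Lemma path_projectors : exists2 C, 0 < C & forall (p : nat -> G) l r,
  (forall j, (j < l)%N -> ((p j)^-1 * p j.+1)%g \in generators S) ->
  (forall i j, (i <= j <= l)%N -> (j - i <= len ((p i)^-1 * p j)%g)%N) ->
  (forall j, (j <= l)%N -> (r <= len (p j))%N) ->
  `|P (p l) - P (p 0%N)| <= C * expR (- (A / 2 * r%:R)).
Proof.
have [C C0 CP] := adjacent_projectors.
pose x := expR (- (A / 4)); have x0 : 0 < x by exact: expR_gt0.
have x1 : x < 1 by rewrite /x -expR0 ltr_expR oppr_lt0 divr_gt0.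
have x10 : 0 < 1 - x by rewrite subr_gt0.
pose C2 := C * expR A / (1 - x).
have C20 : 0 < C2 by rewrite !mulr_gt0 ?invr_gt0 ?expR_gt0.
exists (2 * C2) => [|p l r pS pd pr]; first by rewrite mulr_gt0.
have [j0 j0l j0min] : exists2 j0, (j0 <= l)%N & forall j, (j <= l)%N -> (len (p j0) <= len (p j))%N.
  case: (arg_minnP (fun i : 'I_l.+1 => len (p i)) (isT : xpredT ord0)) => j0 _ j0min.
  exists j0 => [|j jl]; first by rewrite -ltnS.
  exact: (j0min (Ordinal (jl : (j < l.+1)%N))).
set e := expR (- (A / 2 * r%:R)).
have step j k : (j <= l)%N -> (k <= j - j0 + (j0 - j))%N -> expR (- (A * (len (p j))%:R)) <= e * x ^+ k.
  move=> jl kj; have d1 : (k <= len (p j0) + len (p j))%N.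
    apply: (leq_trans kj); case: (leqP j j0) => jj.
      have -> : (j - j0 = 0)%N by lia.
      rewrite add0n (leq_trans (pd j j0 _)) ?jj // addnC (leq_trans (word_lengthM _ _ _)) //.
      by rewrite word_lengthV.
    have -> : (j0 - j = 0)%N by lia.
    rewrite addn0 (leq_trans (pd j0 j _)) ?(ltnW jj) // (leq_trans (word_lengthM _ _ _)) //.
    by rewrite word_lengthV.
  have d2 := j0min j jl; have d3 := pr j jl.
  rewrite /e /x -expRM_natl -expRD ler_expR.
  have d4 : 2 * r%:R + k%:R <= 4 * (len (p j))%:R :> R by rewrite -!natrM -natrD ler_nat; lia.
  have d5 : A * (2 * r%:R + k%:R) <= A * (4 * (len (p j))%:R) by rewrite ler_pM2l.
  lra.
have e0 : 0 < e by exact: expR_gt0.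
have eA : 1 <= expR A by rewrite -expR0 ler_expR ltW.
have t1 : `|P (p j0) - P (p l)| <= C2 * e.
  have := @geometric_telescope R m (fun k => P (p (j0 + k)%N)) (C * expR A * e) x (l - j0).
  rewrite addn0 subnKC // => h; rewrite (le_trans (h _ _ _)) //.
  - by rewrite !mulr_ge0 ?expR_ge0 // ltW.
  - by rewrite x0 x1.
  - move=> k kl; have kl' : (j0 + k < l)%N by rewrite -ltn_subRL.
    rewrite addnS -[p (j0 + k).+1](mulVKg (p (j0 + k)%N)).
    rewrite (le_trans (CP _ _ (pS _ kl'))) // -!mulrA ler_pM2l //.
    have h1 : expR (- (A * (len (p (j0 + k)%N))%:R)) <= e * x ^+ k.
      by apply: step; [exact: ltnW|rewrite addKn leq_addr].
    by rewrite (le_trans h1) // ler_peMl // mulr_ge0 ?exprn_ge0 // ltW.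
  - by rewrite le_eqVlt; apply/orP; left; apply/eqP; rewrite /C2; ring.
have t2 : `|P (p j0) - P (p 0%N)| <= C2 * e.
  have := @geometric_telescope R m (fun k => P (p (j0 - k)%N)) (C * expR A * e) x j0.
  rewrite subn0 subnn => h; rewrite (le_trans (h _ _ _)) //.
  - by rewrite !mulr_ge0 ?expR_ge0 // ltW.
  - by rewrite x0 x1.
  - move=> k kl; set j := (j0 - k.+1)%N; have jE : (j0 - k)%N = j.+1 by rewrite /j subnSK.
    have jl : (j < l)%N by rewrite -jE (leq_trans (leq_subr _ _)).
    rewrite jE -[p j.+1](mulVKg (p j)) distrC.
    rewrite (le_trans (CP _ _ (pS _ jl))) // -!mulrA ler_pM2l //.
    have h1 : expR (- (A * (len (p j))%:R)) <= e * x ^+ k.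
      apply: step; first exact: ltnW.
      by rewrite /j subKn // (leq_trans (leqnSn k)) // leq_addl.
    by rewrite (le_trans h1) // ler_peMl // mulr_ge0 ?exprn_ge0 // ltW.
  - by rewrite le_eqVlt; apply/orP; left; apply/eqP; rewrite /C2; ring.
rewrite -(subrK (P (p j0)) (P (p l))) -addrA (le_trans (ler_normD _ _)) //.
rewrite distrC (le_trans (lerD t1 t2)) // le_eqVlt; apply/orP; left; apply/eqP; ring.
Qed.

Section Ends.
Variables (D C0 C1 : R) (F : seq G).
Hypotheses (D0 : 0 < D) (DC : D < C0) (C10 : 0 < C1).
Let ep := D / C0.
Let C00 : 0 < C0. Proof. exact: lt_trans DC. Qed.
Let ep0 : 0 < ep. Proof. by rewrite divr_gt0. Qed.
Let ep1 : ep < 1. Proof. by rewrite ltr_pdivrMr // mul1r. Qed.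
Let ep10 k : 0 <= (1 - ep) ^+ k <= 1.
Proof. by rewrite exprn_ge0 ?exprn_ile1 //; have := ep0; have := ep1; lra. Qed.

Lemma hnorm_translate x g v : hnorm rho (x^-1 * g)%g v = hnorm rho g (rho x *m v).
Proof.
have -> : hnorm rho g (rho x *m v) = hnorm rho (x * (x^-1 * g))%g (rho x *m v) by rewrite mulVKg.
by rewrite [RHS](hnorm_mul rho_unit rho_mul) mulKmx.
Qed.

Lemma hnorm_self x v : hnorm rho x (rho x *m v) = nsq v.
Proof. by rewrite /hnorm mulKmx. Qed.

Lemma frame_translate x (N : 'M[R]_(m, n)) : (forall w : 'cV_n, N *m w = 0 -> w = 0) ->
  forall w : 'cV_n, invmx (rho x) *m N *m w = 0 -> w = 0.
Proof.
move=> Ni w; rewrite -mulmxA => /(congr1 (mulmx (rho x))).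
by rewrite mulKVmx // mulmx0; exact: Ni.
Qed.

(** Otherwise one step of the chain makes the form positive at the vector, which is then expanded
    exponentially, whereas the contracted subspace of the later element contracts at least as well
    as the negative n-plane of the last form. *)
Lemma end_negative : exists T : nat, forall e c q i k, chain rho D C0 C1 F e c q -> (T < k)%N ->
  forall v, P ((e i)^-1 * e (i + k.+2)%N)%g *m v = v -> v != 0 ->
    form_eval (q i) (rho (e i) *m v) (rho (e i) *m v) < - (D / 2) * (c i * nsq v).
Proof.
have [T TP] := linear_bounds_exponential (2 * C0 * C1 / (ep ^+ 2 * D)) ep0.
exists T => e c q i k ch Tk v; set h := ((e i)^-1 * _)%g => Pv v0; set v' := rho (e i) *m v.
rewrite ltNge; apply/negP => qv; move: Tk; rewrite ltnNge => /negP; apply; apply: TP.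
have chi := chain_shift i ch; have chS := chain_shift i.+1 ch.
have [[ci0 _] _ st _ _] := ch i; have [[cK0 sK] _ _ _ _] := ch (i + k.+2)%N.
have nv : 0 < nsq v by rewrite nsq_gt0.
have [_ _ _ _ [h5 _ _ _ h10]] := PU h.
have [N [_ [Ni _ Nq _]]] := signature_frames sK.
have sh : s h <= C1 * ((1 - ep) ^+ k.+1 / ep) * (c i / c (i + k.+2)%N).
  apply: (h10 _ _ (frame_translate (x := e i) Ni)) => w.
  rewrite /h hnorm_translate -[invmx _ *m N *m w]mulmxA mulKVmx //.
  have qw : form_eval (q (i + k.+2)%N) (N *m w) (N *m w) <= 0.
    by have [->|w0] := eqVneq w 0; [rewrite /form_eval !mulmx0 mxE|exact: ltW (Nq w w0)].
  have := chain_contract D0 DC chi (v := N *m w) (k := k.+1); rewrite -/ep => /(_ qw) cr.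
  have [_ _ _ /(_ (N *m w)) st1 _] := ch (i + k.+1)%N; rewrite -addnS in st1.
  rewrite -(ler_pM2l cK0) (le_trans st1) //.
  have -> : c (i + k.+2)%N * (C1 * ((1 - ep) ^+ k.+1 / ep) * (c i / c (i + k.+2)%N) * nsq (invmx (rho (e i)) *m (N *m w)))
     = C1 * ((1 - ep) ^+ k.+1 * (c i * hnorm rho (e i) (N *m w) / ep)).
    by rewrite /hnorm; field; rewrite !gt_eqF.
  by rewrite ler_pM2l //; move: cr; rewrite addn0.
have aK : c (i + k.+2)%N * hnorm rho (e (i + k.+2)%N) v' <= C1 / ep * (c i * nsq v).
  rewrite -hnorm_translate -/h.
  have := h5 v; rewrite Pv => h5v.
  have h6 : hnorm rho h v <= C1 * ((1 - ep) ^+ k.+1 / ep) * (c i / c (i + k.+2)%N) * nsq v.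
    by rewrite (le_trans h5v) // ler_pM2r.
  rewrite -(ler_pM2l cK0) in h6; rewrite (le_trans h6) //.
  have -> : c (i + k.+2)%N * (C1 * ((1 - ep) ^+ k.+1 / ep) * (c i / c (i + k.+2)%N) * nsq v) =
     (1 - ep) ^+ k.+1 * (C1 / ep * (c i * nsq v)) by field; rewrite !gt_eqF.
  have /andP[_ h7] := ep10 k.+1.
  by rewrite ler_piMl // !mulr_ge0 ?invr_ge0 // ltW.
have qS : D / 2 * (c i * nsq v) <= form_eval (q i.+1) v' v'.
  by have := st v'; rewrite /v' hnorm_self -/v' => st1; move: qv; rewrite mulNr; lra.
have pos : 0 < D / 2 * (c i * nsq v) by rewrite !mulr_gt0 ?invr_gt0.
have qS0 : 0 <= form_eval (q (i.+1 + 0)%N) v' v' by rewrite addn0 (le_trans _ qS) // ltW.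
have := chain_expand D0 DC chS k qS0; rewrite -/ep !addn0 addSnnS => ex.
have [_ /(_ v') b1 _ _ _] := ch i.+1.
have b2 : D / 2 * (c i * nsq v) <= C0 * (c i.+1 * hnorm rho (e i.+1) v').
  by rewrite (le_trans qS) // (le_trans (ler_norm _)).
have p0 : 0 < (1 + ep) ^+ k by rewrite exprn_gt0 // addr_gt0.
have b3 : ep * (1 + ep) ^+ k * (D / 2 * (c i * nsq v)) <= C0 * (C1 / ep * (c i * nsq v)).
  rewrite (le_trans (_ : _ <= ep * (1 + ep) ^+ k * (C0 * (c i.+1 * hnorm rho (e i.+1) v')))) //.
    by rewrite ler_pM2l // mulr_gt0.
  by rewrite mulrCA ler_pM2l // (le_trans ex).
rewrite ler_pdivlMr; last by rewrite mulr_gt0 // exprn_gt0.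
have X0 : 0 < c i * nsq v by rewrite mulr_gt0.
rewrite -(ler_pM2r X0) -(@ler_pM2r _ (2 * ep)^-1); last by rewrite invr_gt0 mulr_gt0.
have -> : (1 + ep) ^+ k * (ep ^+ 2 * D) * (c i * nsq v) / (2 * ep) =
   ep * (1 + ep) ^+ k * (D / 2 * (c i * nsq v)) by field; rewrite gt_eqF.
rewrite (le_trans b3) // le_eqVlt; apply/orP; left; apply/eqP.
by field; rewrite gt_eqF.
Qed.

(** The mirror image for the beginning of the chain: seen from the end, the contracted subspace of
    [e 0] contracts at least as well as the positive n-plane of the first form, which is impossible
    at a vector where the last form is negative. *)
Lemma end_positive : exists T : nat, forall e c q k, chain rho D C0 C1 F e c q -> (T < k)%N ->
  forall v, P ((e k.+1)^-1 * e 0%N)%g *m v = v ->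
    0 <= form_eval (q k.+1) (rho (e k.+1) *m v) (rho (e k.+1) *m v).
Proof.
have [T TP] := linear_bounds_exponential (C1 / ep ^+ 2) ep0.
exists T => e c q k ch Tk v; set x := e k.+1; set h := (x^-1 * _)%g => Pv.
have [->|v0] := eqVneq v 0; first by rewrite mulmx0 /form_eval mulmx0 mxE.
set v' := rho x *m v.
rewrite leNgt; apply/negP => /ltW qv; move: Tk; rewrite ltnNge => /negP; apply; apply: TP.
have [[c00 s0] _ _ _ _] := ch 0%N; have [[cK0 _] _ _ _ _] := ch k.+1.
have nv : 0 < nsq v by rewrite nsq_gt0.
have [_ _ _ _ [h5 _ _ _ h10]] := PU h.
have [_ [N [_ Ni _ Nq]]] := signature_frames s0.
have p0 : 0 < (1 + ep) ^+ k by rewrite exprn_gt0 // addr_gt0.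
have sh : s h <= (ep * (1 + ep) ^+ k)^-1 * (c k.+1 / c 0%N).
  apply: (h10 _ _ (frame_translate (x := x) Ni)) => w.
  rewrite /h hnorm_translate -[invmx _ *m N *m w]mulmxA mulKVmx //.
  have qw : 0 <= form_eval (q 0%N) (N *m w) (N *m w).
    by have [->|w0] := eqVneq w 0; [rewrite /form_eval !mulmx0 mxE|exact: ltW (Nq w w0)].
  have := chain_expand D0 DC ch k qw; rewrite -/ep => ex.
  have pc : 0 < ep * (1 + ep) ^+ k * c 0%N by apply: mulr_gt0 => //; exact: mulr_gt0.
  rewrite -(ler_pM2l pc).
  have -> : ep * (1 + ep) ^+ k * c 0%N * ((ep * (1 + ep) ^+ k)^-1 * (c k.+1 / c 0%N) * nsq (invmx (rho x) *m (N *m w)))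
     = c k.+1 * hnorm rho (e k.+1) (N *m w).
    by rewrite /hnorm -/x; field; rewrite !gt_eqF.
  by apply: le_trans ex; rewrite le_eqVlt; apply/orP; left; apply/eqP; ring.
have h6 : hnorm rho (e 0%N) v' <= (ep * (1 + ep) ^+ k)^-1 * (c k.+1 / c 0%N) * nsq v.
  rewrite -hnorm_translate -/h; have := h5 v; rewrite Pv => h5v.
  by rewrite (le_trans h5v) // ler_pM2r.
have cr := chain_contract D0 DC ch qv; rewrite -/ep in cr.
have [_ _ _ /(_ v') st _] := ch k; rewrite -/x hnorm_self in st.
have /andP[r0 r1] := ep10 k.
have h7 : (1 - ep) ^+ k * (c 0%N * hnorm rho (e 0%N) v' / ep) <= c 0%N * hnorm rho (e 0%N) v' / ep.
  by rewrite ler_piMl // !mulr_ge0 ?invr_ge0 ?hnorm_ge0 // ltW.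
have h8 : c 0%N * hnorm rho (e 0%N) v' / ep <= c 0%N * ((ep * (1 + ep) ^+ k)^-1 * (c k.+1 / c 0%N) * nsq v) / ep.
  by rewrite ler_pM2r ?invr_gt0 // ler_pM2l.
have h9 : c k.+1 * nsq v <= C1 * (c 0%N * ((ep * (1 + ep) ^+ k)^-1 * (c k.+1 / c 0%N) * nsq v) / ep).
  by rewrite (le_trans st) // ler_pM2l // (le_trans cr) // (le_trans h7).
rewrite ler_pdivlMr ?exprn_gt0 //.
rewrite -(@ler_pM2r _ (c k.+1 * nsq v / (ep ^+ 2 * (1 + ep) ^+ k))); last first.
  by rewrite !mulr_gt0 // invr_gt0 mulr_gt0 // exprn_gt0.
have -> : (1 + ep) ^+ k * ep ^+ 2 * (c k.+1 * nsq v / (ep ^+ 2 * (1 + ep) ^+ k)) = c k.+1 * nsq v.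
  by field; rewrite !gt_eqF.
rewrite (le_trans h9) // le_eqVlt; apply/orP; left; apply/eqP.
by field; rewrite !gt_eqF.
Qed.

End Ends.
End Morse.

Lemma steps_upto_length (G : groupType) (S : finite_generating_set G) (p : nat -> G) l :
  (forall j, (j < l)%N -> ((p j)^-1 * p j.+1)%g \in generators S) ->
  forall i j, (i <= j)%N -> (j <= l)%N -> (word_length S ((p i)^-1 * p j)%g <= j - i)%N.
Proof.
move=> pS i j ij; rewrite -(subnKC ij) addKn; elim: (j - i)%N => [|k IH] kl.
  by rewrite addn0 mulVg word_length1.
have -> : ((p i)^-1 * p (i + k.+1)%N)%g = ((p i)^-1 * p (i + k)%N * ((p (i + k)%N)^-1 * p (i + k).+1))%g.
  by rewrite addnS mulgA mulgK.
have kl' : (i + k < l)%N by rewrite -addnS.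
rewrite (leq_trans (word_lengthM _ _ _)) // -[leqRHS]addn1 leq_add ?IH ?(ltnW kl') //.
by rewrite generators_length // pS.
Qed.

Lemma ltn_add2_sub T k : (T + 2 < k)%N -> k = (k - 2).+2 /\ (T < k - 2)%N.
Proof. lia. Qed.

Lemma ltn_add1_pred T k : (T + 1 < k)%N -> k = k.-1.+1 /\ (T < k.-1)%N.
Proof. lia. Qed.

Lemma leq_add_slack T T' k : (k <= T + 2)%N || (k <= T' + 1)%N -> (k <= T + T' + 4)%N.
Proof. lia. Qed.

Lemma detour_length l j r a b x y z w : (a <= x + y -> b <= z + w -> x <= j -> w <= l - j ->
  y <= r -> z <= r -> j <= l -> a + b <= l + (r + r))%N.
Proof. lia. Qed.

Section ChainMorse.
Context {R : realType} {n : nat} {G : groupType}.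
Local Notation m := (n + n)%N.
Variable rho : G -> 'M[R]_m.
Hypothesis n_gt0 : (0 < n)%N.
Hypothesis rho_unit : forall g, rho g \in unitmx.
Hypothesis rho_mul : forall g h, rho (g * h)%g = rho g *m rho h.
Variables (S : finite_generating_set G) (A B : R).
Hypothesis A0 : 0 < A.
Hypothesis gap : forall g,
  expR (A * (word_length S g)%:R - B) <= sigma n (rho g) / sigma n.+1 (rho g).
Local Notation len := (word_length S).
Variables (D C0 C1 : R) (F : seq G).
Hypotheses (D0 : 0 < D) (DC : D < C0) (C10 : 0 < C1).

(** If a geodesic avoids a large ball around [e i], the contracted subspaces of its two ends seen
    from [e i] are close by [path_projectors]; yet [q i] is negative with a margin on the one ahead
    and nonnegative on the one behind. When i or k is small, an endpoint of the geodesic is already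
    near [e i]. *)
Lemma chain_near_geodesic : exists r : nat, forall e c q i k, chain rho D C0 C1 F e c q ->
  forall p l, p 0%N = e 0%N -> p l = e (i + k)%N ->
  (forall j, (j < l)%N -> ((p j)^-1 * p j.+1)%g \in generators S) ->
  (forall j j', (j <= j' <= l)%N -> (j' - j <= len ((p j)^-1 * p j')%g)%N) ->
  exists2 j, (j <= l)%N & (len ((e i)^-1 * p j)%g <= r)%N.
Proof.
have [P [U [s [s' PU]]]] := small_projectors n_gt0 rho_unit rho_mul gap.
have [T1 T1P] := end_negative rho_unit rho_mul PU F D0 DC C10.
have [T2 T2P] := end_positive rho_unit rho_mul PU F D0 DC C10.
have [C CC CP] := path_projectors n_gt0 rho_unit rho_mul A0 PU.
have [L LP] := word_length_bound S F.
have C00 : 0 < C0 by exact: lt_trans DC.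
(* A relative displacement t changes the form by at most 3/8 D in the units of [c i], less than the
   margin D/2 of [end_negative]. *)
pose t := D / (8 * C0); have t0 : 0 < t by rewrite divr_gt0 // mulr_gt0.
have C08 : D < 8 * C0 by rewrite (lt_le_trans DC) // ler_peMl ?ler1n // ltW.
have t1 : t < 1 by rewrite /t ltr_pdivrMr ?mul1r // mulr_gt0.
pose r0 := (Num.truncn (m%:R ^+ 2 * C / t / (A / 2))).+1.
have A2 : 0 < A / 2 by rewrite divr_gt0.
have r0P : m%:R ^+ 2 * (C * expR (- (A / 2 * r0%:R))) <= t.
  have h : m%:R ^+ 2 * C / t / (A / 2) < r0%:R by exact: truncnS_gt.
  rewrite expRN mulrA ler_pdivrMr ?expR_gt0 // -ler_pdivrMl //.
  rewrite (le_trans _ (expR_ge1Dx _)) // ler_wpDl // ltW //.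
  by rewrite [ltLHS]mulrC [ltRHS]mulrC -ltr_pdivrMr.
pose r1 := (L * (T1 + T2 + 4))%N; exists (r0 + r1)%N => e c q i k ch p l p0 pl pS pd.
have estep j : ((e j)^-1 * e j.+1)%g \in F by have [_ _ _ _ h] := ch j.
have el := steps_length LP estep.
have [ks|kb] := leqP k (T1 + 2)%N.
  exists l => //; rewrite pl (leq_trans (el _ _ (leq_addr k i))) // addKn.
  by rewrite (leq_trans _ (leq_addl _ _)) // leq_mul2l leq_add_slack ?ks ?orbT.
have [is_|ib] := leqP i (T2 + 1)%N.
  exists 0%N => //; rewrite p0 -word_lengthV invgM invgK (leq_trans (el _ _ (leq0n i))) // subn0.
  by rewrite (leq_trans _ (leq_addl _ _)) // leq_mul2l leq_add_slack ?is_ ?orbT.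
apply: contrapT => no.
have far j : (j <= l)%N -> (r0 <= len ((e i)^-1 * p j)%g)%N.
  move=> jl; rewrite leqNgt; apply/negP => h; apply: no; exists j => //.
  by rewrite (leq_trans (ltnW h)) // leq_addr.
have := CP (fun j => (e i)^-1 * p j)%g l r0; rewrite pl p0 => cl.
have mulE j j' : (((e i)^-1 * p j)^-1 * ((e i)^-1 * p j'))%g = ((p j)^-1 * p j')%g.
  by rewrite invgM invgK -mulgA mulVKg.
have {}cl : `|P ((e i)^-1 * e (i + k)%N)%g - P ((e i)^-1 * e 0%N)%g| <= C * expR (- (A / 2 * r0%:R)).
  by apply: cl => [j jl|j j' jj'|//]; rewrite mulE; [exact: pS|exact: pd].
set hl := ((e i)^-1 * e (i + k)%N)%g in cl; set h0 := ((e i)^-1 * e 0%N)%g in cl.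
have [_ _ PUl Ui _] := PU hl; have [_ PP0 _ _ _] := PU h0.
pose v := U hl *m (const_mx 1 : 'cV[R]_n).
have v0 : v != 0.
  apply/eqP => /Ui /matrixP/(_ (Ordinal n_gt0) 0); rewrite !mxE => /eqP.
  by rewrite oner_eq0.
have Pv : P hl *m v = v by rewrite mulmxA PUl.
have nv : 0 < nsq v by rewrite nsq_gt0.
pose z := v - P h0 *m v.
have zE : z = (P hl - P h0) *m v by rewrite mulmxBl Pv.
have nz : nsq z <= t ^+ 2 * nsq v.
  rewrite zE (le_trans (nsq_mulmx_norm _ _)) // ler_wpM2r ?nsq_ge0 //.
  have m1 : 1 <= m%:R :> R by rewrite ler1n addn_gt0 n_gt0.
  rewrite (@le_trans _ _ ((m%:R ^+ 2 * (C * expR (- (A / 2 * r0%:R)))) ^+ 2)) //; last first.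
    by rewrite lerXn2r ?nnegrE ?(ltW t0) // !mulr_ge0 ?expR_ge0 ?exprn_ge0 // ltW.
  rewrite exprMn -exprM ler_pM ?exprn_ge0 //; last by rewrite lerXn2r ?nnegrE ?mulr_ge0 ?expR_ge0 // ltW.
  by rewrite ler_weXn2l.
have [[ci0 _] qb _ _ _] := ch i.
pose Q := (rho (e i))^T *m q i *m rho (e i).
have QE w : form_eval Q w w = form_eval (q i) (rho (e i) *m w) (rho (e i) *m w).
  exact: form_eval_mul.
have Qb w : `|form_eval Q w w| <= C0 * c i * nsq w.
  by rewrite QE (le_trans (qb _)) // (hnorm_self rho_unit) mulrA.
have C0c : 0 <= C0 * c i by rewrite mulr_ge0 // ltW.
have := form_perturb C0c t0 Qb nz; rewrite /z opprB addrC subrK => pert.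
have [kE kb'] := ltn_add2_sub kb; have [iE ib'] := ltn_add1_pred ib.
have neg : form_eval Q v v < - (D / 2) * (c i * nsq v).
  rewrite QE; apply: (T1P e c q i (k - 2)%N ch kb' v _ v0).
  by rewrite -kE.
have pos : 0 <= form_eval Q (P h0 *m v) (P h0 *m v).
  have := T2P e c q i.-1 ch; rewrite -iE QE => h; apply: h => //.
  by rewrite -/h0 mulmxA PP0.
have X0 : 0 < c i * nsq v by rewrite mulr_gt0.
have b1 : C0 * c i * (2 * t + t ^+ 2) * nsq v <= 3 / 8 * D * (c i * nsq v).
  have -> : C0 * c i * (2 * t + t ^+ 2) * nsq v = C0 * (2 * t + t ^+ 2) * (c i * nsq v) by ring.
  rewrite ler_pM2r //.
  have tE : C0 * t = D / 8 by rewrite /t; field; rewrite gt_eqF.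
  have -> : C0 * (2 * t + t ^+ 2) = (C0 * t) * (2 + t) by ring.
  rewrite tE; have := ltW t1; have : 0 <= D * (1 - t) by rewrite mulr_ge0 ?subr_ge0 // ltW.
  lra.
have DX : 0 < D * (c i * nsq v) by rewrite mulr_gt0.
lra.
Qed.

Lemma chain_morse : exists r : nat, forall e c q i k, chain rho D C0 C1 F e c q ->
  (len ((e 0%N)^-1 * e i)%g + len ((e i)^-1 * e (i + k)%N)%g <=
   len ((e 0%N)^-1 * e (i + k)%N)%g + r)%N.
Proof.
have [r rP] := chain_near_geodesic; exists (r + r)%N => e c q i k ch.
have [p0 [p00 p0l p0S p0d]] := geodesic S ((e 0%N)^-1 * e (i + k)%N)%g.
set l := len _ in p0l p0S p0d *; pose p j := (e 0%N * p0 j)%g.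
have pE j j' : ((p j)^-1 * p j')%g = ((p0 j)^-1 * p0 j')%g by rewrite /p invgM -mulgA mulKg.
have pS j : (j < l)%N -> ((p j)^-1 * p j.+1)%g \in generators S by rewrite pE; exact: p0S.
have ps : p 0%N = e 0%N by rewrite /p p00 mulg1.
have pl : p l = e (i + k)%N by rewrite /p p0l mulVKg.
have [j jl jr] : exists2 j, (j <= l)%N & (len ((e i)^-1 * p j)%g <= r)%N.
  apply: (rP e c q i k ch p l ps pl pS) => j j' jj'; rewrite pE; exact: p0d.
have up := steps_upto_length pS.
have h1 := up 0%N j (leq0n j) jl; have h2 := up j l jl (leqnn l).
rewrite ps subn0 in h1; rewrite pl in h2.
have t1 : (len ((e 0%N)^-1 * e i)%g <= len ((e 0%N)^-1 * p j)%g + len ((e i)^-1 * p j)%g)%N.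
  rewrite -[len ((e i)^-1 * _)%g]word_lengthV invgM invgK (leq_trans _ (word_lengthM _ _ _)) //.
  by rewrite mulgA mulgK.
have t2 : (len ((e i)^-1 * e (i + k)%N)%g <= len ((e i)^-1 * p j)%g + len ((p j)^-1 * e (i + k)%N)%g)%N.
  by rewrite (leq_trans _ (word_lengthM _ _ _)) // mulgA mulgK.
exact: (detour_length t1 t2 h1 h2 jr jr jl).
Qed.

End ChainMorse.

(** * Attracting subspaces *)

(** A subspace given by a growth condition becomes the row space of a matrix: one of maximal rank
    among those whose row space satisfies the condition. *)
Lemma linear_predicate_mx (F : fieldType) m (T : 'rV[F]_m -> Prop) : T 0 ->
  (forall a u v, T u -> T v -> T (a *: u + v)) ->
  exists X : 'M[F]_m, forall v, T v <-> (v <= X)%MS.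
Proof.
move=> T0 TD; pose Pr r := `[< exists2 X : 'M[F]_m, \rank X = r & forall v : 'rV_m, (v <= X)%MS -> T v >].
have ex : exists r, Pr r.
  exists 0%N; apply/asboolP; exists 0; first by rewrite mxrank0.
  by move=> v; rewrite submx0 => /eqP ->.
have ub r : Pr r -> (r <= m)%N by move=> /asboolP[X <- _]; exact: rank_leq_row.
case: (ex_maxnP ex ub) => r /asboolP[X rX XT] rmax; exists X => v; split; last exact: XT.
move=> Tv; have YT (w : 'rV_m) : (w <= X + v)%MS -> T w.
  move=> /sub_addsmxP[[x y] /= ->]; rewrite [y]mx11_scalar mul_scalar_mx addrC.
  by apply: TD => //; apply: XT; rewrite submxMl.
have := rmax (\rank (X + v)%MS) _; rewrite -rX => h.
have XY : (X <= X + v)%MS by exact: addsmxSl.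
have := mxrank_leqif_sup XY => /leqifP; case: ifP => [h2 _|_ h2].
  by rewrite (submx_trans _ h2) // addsmxSr.
by move: h2; rewrite ltnNge h //; apply/asboolP; exists (X + v)%MS.
Qed.

Section GrassmannianFrames.
Context {R : realType} {n m : nat}.

Lemma gr_cols (U : Gr R n m 1) : exists B : 'M[R]_(m, n),
  [/\ forall w : 'cV_n, B *m w = 0 -> w = 0,
      forall v, v \in gr_val U <-> exists w : 'cV_n, v = B *m w &
      is_frame (fun i => col i B) U].
Proof.
pose f := canonical_frame U; have fU := canonical_frameP U.
pose B : 'M[R]_(m, n) := \matrix_(a, i) f i a 0.
have cB i : col i B = f i by apply/matrixP => a b; rewrite !mxE ord1.
have BE (w : 'rV[R]_n) : B *m w^T = \sum_i w 0 i *: f i.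
  apply/matrixP => a b; rewrite ord1 mxE summxE; apply: eq_bigr => i _.
  by rewrite !mxE mulrC.
exists B; split.
- move=> w Bw; have /row_free_injP h := is_frame_free fU.
  apply: trmx_inj; rewrite trmx0; apply: h.
  by rewrite frame_mx_mul -BE trmxK Bw linear0.
- move=> v; rewrite fU frame_span; split.
    by move=> /frame_mxP[w ->]; exists w^T; rewrite BE.
  by move=> [w ->]; apply/frame_mxP; exists w^T; rewrite -BE trmxK.
- by rewrite /is_frame fU; congr (<<_>>%VS); apply: eq_map => i; rewrite cB.
Qed.

Lemma gr_of_cols (B : 'M[R]_(m, n)) : (forall w : 'cV_n, B *m w = 0 -> w = 0) ->
  exists U : Gr R n m 1, is_frame (fun i => col i B) U /\
    forall v, v \in gr_val U <-> exists w : 'cV_n, v = B *m w.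
Proof.
move=> Bi; pose f i : 'M[R]_(m, 1) := col i B.
have BE (w : 'rV[R]_n) : B *m w^T = \sum_i w 0 i *: f i.
  apply/matrixP => a b; rewrite ord1 mxE summxE; apply: eq_bigr => i _.
  by rewrite !mxE mulrC.
have fr : free [tuple f i | i < n].
  apply/freeP => k ks i.
  have := Bi (\row_j k j)^T; rewrite BE => h.
  have /h : \sum_j (\row_j k j) 0 j *: f j = 0.
    by rewrite -[RHS]ks; apply: eq_bigr => j _; rewrite mxE -tnth_nth tnth_mktuple.
  by move=> /matrixP/(_ i 0); rewrite !mxE.
have sE : [seq f i | i <- enum 'I_n] = [tuple f i | i < n] :> seq _ by [].
have dU : \dim <<[seq f i | i <- enum 'I_n]>> = n.
  by move: fr; rewrite /free sE size_tuple => /eqP.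
exists (MkGr dU); split => // v; rewrite /= frame_span; split.
  by move=> /frame_mxP[w ->]; exists w^T; rewrite BE.
by move=> [w ->]; apply/frame_mxP; exists w^T; rewrite -BE trmxK.
Qed.

Lemma nbhs_frame (B : 'M[R]_(m, n)) (U : Gr R n m 1) (W : set (Gr R n m 1)) :
  is_frame (fun i => col i B) U -> nbhs U W ->
  exists2 e : R, 0 < e & forall B' (U' : Gr R n m 1),
    `|B - B'| < e -> is_frame (fun i => col i B') U' -> W U'.
Proof.
move=> fU; rewrite nbhsE => -[V [oV VU] VW].
have h := (oV : gr_open V) U (fun i => col i B) fU VU.
have FF : Filter ((fun (B' : 'M[R]_(m, n)) (i : 'I_n) => col i B') @ nbhs B).
  exact: fmap_filter.
have ccol : {ptws, (fun (B' : 'M[R]_(m, n)) (i : 'I_n) => col i B') @ nbhs B --> (fun i => col i B)}.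
  apply/cvg_sup => i W1 [_ [[W' oW' <-] W'B] W1P].
  have cc : (fun B' : 'M[R]_(m, n) => col i B') @ B --> col i B.
    apply/(cvg_mxP (F := nbhs B)) => a b.
    under eq_fun do rewrite mxE; rewrite mxE.
    exact: (@continuous_entry _ _ _ _ (fun B' : 'M[R]_(m, n) => B') a i (@continuous_self _) B).
  have nW' : nbhs B [set B' | W' (col i B')] by exact: (cc _ (open_nbhs_nbhs (conj oW' W'B))).
  by apply: (@filterS _ (nbhs B) (nbhs_filter B) _ _ _ nW') => B' WB'; apply: W1P.
have /nbhs_mxP[e e0 eP] := ccol _ h.
by exists e => // B' U' BB' fU'; apply: VW; exact: eP fU'.
Qed.

End GrassmannianFrames.

(* The determinant of L (B + eps N), with L N = 1, is a monic polynomial in eps. *)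
Lemma generic_perturbation (R : realType) m n (T : 'cV[R]_m -> Prop) (B N : 'M[R]_(m, n)) (e : R) :
  T 0 -> (forall a u v, T u -> T v -> T (a *: u + v)) ->
  (forall w : 'cV_n, T (N *m w) -> w = 0) -> 0 < e ->
  exists2 ep, 0 < ep < e & forall w : 'cV_n, T ((B + ep *: N) *m w) -> w = 0.
Proof.
move=> T0 TD TN e0.
have [X XP] : exists X : 'M[R]_m, forall v : 'rV_m, T v^T <-> (v <= X)%MS.
  apply: (linear_predicate_mx (T := fun v => T v^T)); first by rewrite trmx0.
  by move=> a u v Tu Tv; rewrite linearD /= trmxZ; exact: TD.
pose Y := N^T *m cokermx X.
have fY : row_free Y.
  apply/row_free_injP => w wY; apply: trmx_inj; rewrite trmx0; apply: TN.
  rewrite -[N *m _]trmxK; apply/XP; rewrite trmx_mul trmxK submxE.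
  by rewrite -mulmxA wY.
(* The transpose of the map L: it kills T and is inverse to N. *)
pose K := cokermx X *m pinvmx Y.
have XK (v : 'rV[R]_m) : T v^T -> v *m K = 0.
  by move=> /XP; rewrite submxE => /eqP h; rewrite /K mulmxA h mul0mx.
have NK : N^T *m K = 1%:M by rewrite /K mulmxA mulmxVp.
pose A := - (B^T *m K).
have [ep ep0 epA] : exists2 ep, 0 < ep < e & ~~ eigenvalue A ep.
  (* The numbers e/(j+2) are infinitely many candidates below e, and only finitely many numbers are
     eigenvalues. *)
  apply: contrapT => no; pose r j : R := e / j.+2%:R.
  have j2 j : 0 < j.+2%:R :> R by rewrite ltr0n.
  have rP j : root (char_poly A) (r j).
    rewrite -eigenvalue_root_char; case: (boolP (eigenvalue A (r j))) => // h.
    exfalso; apply: no; exists (r j) => //.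
    by rewrite /r divr_gt0 //= ltr_pdivrMr // ltr_pMr // ltr1n.
  have p0 : char_poly A != 0 by rewrite monic_neq0 // char_poly_monic.
  have := @max_poly_roots _ _ [seq r j | j <- iota 0 (size (char_poly A))] p0.
  have en0 : e != 0 by rewrite gt_eqF.
  rewrite size_map size_iota ltnn => h; have // : false; apply: h.
    by apply/allP => _ /mapP[j _ ->].
  rewrite map_inj_uniq ?iota_uniq // => j k /(mulfI en0) /invr_inj /eqP.
  by rewrite eqr_nat => /eqP[].
exists ep => // w Tw; apply: trmx_inj; rewrite trmx0; apply/eqP.
apply: contraNT epA => w0; apply/eigenvalueP; exists w^T => //.
have := XK ((B + ep *: N) *m w)^T; rewrite trmxK => /(_ Tw).
rewrite trmx_mul linearD /= trmxZ mulmxDr mulmxDl -!mulmxA -scalemxAl NK -scalemxAr mulmx1.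
by move=> /eqP; rewrite addr_eq0 => /eqP E; rewrite /A mulmxN E opprK.
Qed.

Section Attracting.
Context {R : realType} {n : nat}.
Local Notation m := (n + n)%N.
Variables (A q : 'M[R]_m) (lam : R) (E : Gr R n m 1).
Hypothesis uA : A \in unitmx.
Hypothesis lam0 : 0 < lam.
Hypothesis qnn : signature_nn q.
Hypothesis qA : forall w : 'cV_m, w != 0 ->
  form_eval q (A *m w) (A *m w) < lam * form_eval q w w.
Hypothesis EA : gr_attracting A E.

(* A decreases the form q up to the factor lam: a vector with q > 0 along its
   whole forward orbit is contracted, while a nonzero vector with q <= 0 is expanded. *)
Lemma attracting_nonpositive v : v \in gr_val E -> form_eval q v v <= 0.
Proof.
have [d1 d10 d1P] : exists2 d, 0 < d & forall v, d * nsq v <= form_eval (lam *: q - A^T *m q *m A) v v.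
  apply: posdef_bound => w w0; rewrite form_evalB form_evalZ form_eval_mul subr_gt0.
  exact: qA.
pose C := m%:R ^+ 2 * `|q| + d1 / lam + 1.
have dl0 : 0 <= d1 / lam by apply: divr_ge0; exact: ltW.
have mq0 : 0 <= m%:R ^+ 2 * `|q| by rewrite mulr_ge0 // exprn_ge0.
have CP w : `|form_eval q w w| <= C * nsq w.
  rewrite (le_trans (form_eval_norm _ _)) // ler_wpM2r ?nsq_ge0 // /C -addrA lerDl.
  by rewrite addr_ge0.
have C0 : 0 < C by rewrite ltr_wpDl // addr_ge0.
pose e := d1 / (lam * C).
have e01 : 0 < e < 1.
  rewrite divr_gt0 ?mulr_gt0 //= ltr_pdivrMr ?mulr_gt0 // mul1r -ltr_pdivrMl // mulrC.
  by rewrite /C; lra.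
have /andP[e0 e1] := e01.
pose b w k := lam ^- k * nsq (A ^+ k *m w).
pose Q w k := lam ^- k * form_eval q (A ^+ k *m w) (A ^+ k *m w).
have lk k : 0 < lam ^- k by rewrite invr_gt0 exprn_gt0.
have AS k w : A ^+ k.+1 *m w = A *m (A ^+ k *m w) by rewrite exprS mulmxA.
have st w k : `|- Q w k| <= C * b w k /\ e * (C * b w k) <= - Q w k.+1 - - Q w k.
  split.
    by rewrite normrN /Q /b normrM (gtr0_norm (lk k)) mulrCA ler_pM2l.
  have := d1P (A ^+ k *m w); rewrite form_evalB form_evalZ form_eval_mul -AS => h.
  have -> : e * (C * b w k) = lam ^- k.+1 * (d1 * nsq (A ^+ k *m w)).
    by rewrite /e /b exprS invfM; field; rewrite !gt_eqF // exprn_gt0.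
  have -> : - Q w k.+1 - - Q w k = lam ^- k.+1 * (lam * form_eval q (A ^+ k *m w) (A ^+ k *m w) -
      form_eval q (A ^+ k.+1 *m w) (A ^+ k.+1 *m w)).
    by rewrite /Q exprS invfM; field; rewrite !gt_eqF // exprn_gt0.
  by rewrite ler_pM2l.
clearbody e.
(* T contains the vectors whose orbit, rescaled by [lam], decays. It is a subspace that meets the
   cone q <= 0 only in 0, and every vector outside T enters q < 0 at some time. *)
pose T w := exists c, forall k, b w k <= c * (1 - e) ^+ k.
have T0 : T 0 by exists 0 => k; rewrite mul0r /b mulmx0 /nsq mulmx0 mxE mulr0.
have TD a x y : T x -> T y -> T (a *: x + y).
  move=> [c cP] [c' c'P]; exists (2 * (a ^+ 2 * c) + 2 * c') => k.
  have h : b (a *: x + y) k <= 2 * (a ^+ 2 * b x k) + 2 * b y k.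
    rewrite /b mulmxDr -scalemxAr.
    have -> : 2 * (a ^+ 2 * (lam ^- k * nsq (A ^+ k *m x))) + 2 * (lam ^- k * nsq (A ^+ k *m y)) =
       lam ^- k * (2 * nsq (a *: (A ^+ k *m x)) + 2 * nsq (A ^+ k *m y)) by rewrite nsqZ; ring.
    by rewrite ler_pM2l // nsqD_le.
  have h1 : a ^+ 2 * b x k <= a ^+ 2 * (c * (1 - e) ^+ k) by rewrite ler_wpM2l // sqr_ge0.
  have h2 := c'P k; rewrite mulrDl -!mulrA; lra.
have Tneg w : T w -> form_eval q w w <= 0 -> w = 0.
  move=> [c cP] qw; apply/eqP; rewrite -nsq_eq0 eq_le nsq_ge0 andbT leNgt; apply/negP => w0.
  have Q0 : 0 <= - Q w 0%N by rewrite /Q expr0 invr1 mul1r mul1mx oppr_ge0.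
  have b0 : b w 0%N = nsq w by rewrite /b expr0 invr1 mul1r mul1mx.
  have c0 : 0 <= c by have := cP 0%N; rewrite expr0 mulr1 b0; apply: le_trans; exact: ltW.
  have [k kP] : exists k : nat, C * c < e * (k%:R * e) * (C * nsq w).
    have X0 : 0 < e * e * (C * nsq w) by rewrite !mulr_gt0.
    exists (Num.truncn (C * c / (e * e * (C * nsq w)))).+1; set z := _.+1%:R.
    have zP : C * c / (e * e * (C * nsq w)) < z by exact: truncnS_gt.
    have -> : e * (z * e) * (C * nsq w) = z * (e * e * (C * nsq w)) by ring.
    by rewrite -ltr_pdivrMr.
  have := sequence_expand e01 (st w) k Q0; rewrite b0 leNgt => /negP; apply.
  have h1 : C * b w k.+1 <= C * c.
    rewrite ler_pM2l // (le_trans (cP _)) // ler_piMr // exprn_ile1 //; lra.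
  have := bernoulli k (ltW e0) => h2; have := le_lt_trans h1 kP => h3.
  have h4 : e * (k%:R * e) * (C * nsq w) <= e * (1 + e) ^+ k * (C * nsq w).
    by rewrite ler_pM2r ?mulr_gt0 // ler_pM2l //; lra.
  exact: lt_le_trans h3 h4.
have nTneg w : w != 0 -> ~ T w -> exists k, form_eval q (A ^+ k *m w) (A ^+ k *m w) < 0.
  move=> w0 nT; apply: contrapT => no; apply: nT; exists (b w 0%N / e) => k.
  have Qk : - Q w k.+1 <= 0.
    by rewrite oppr_le0 /Q mulr_ge0 ?(ltW (lk _)) // leNgt; apply/negP => h; apply: no; exists k.+1.
  have h := sequence_contract e01 (st w) Qk.
  rewrite -(ler_pM2l C0) (le_trans h) // le_eqVlt; apply/orP; left; apply/eqP; ring.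
have negS w : form_eval q w w < 0 -> forall k, form_eval q (A ^+ k *m w) (A ^+ k *m w) < 0.
  move=> qw; elim=> [|k IH]; first by rewrite expr0 mul1mx.
  rewrite AS; set x := A ^+ k *m w in IH *.
  have x0 : x != 0 by apply: contraTneq IH => ->; rewrite /form_eval mulmx0 mxE ltxx.
  by rewrite (lt_trans (qA x0)) // pmulr_rlt0.
have [EAE [Om nO attr]] := EA; have [B [Bi BE fB]] := gr_cols E.
have [N [_ [Ni _ Nq _]]] := signature_frames qnn.
have TN w : T (N *m w) -> w = 0.
  move=> TNw; apply: Ni; apply: Tneg TNw _.
  by have [->|w0] := eqVneq w 0; [rewrite /form_eval !mulmx0 mxE|exact: ltW (Nq w w0)].
have [eta eta0 etaP] := nbhs_frame fB nO.
pose eta' := eta / (`|N| + 1); have N10 : 0 < `|N| + 1 by rewrite ltr_wpDl.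
(* A plane near E that meets T only in 0, obtained by tilting E towards a negative n-plane. *)
have [ep /andP[ep0 epe] epP] := generic_perturbation B T0 TD TN (divr_gt0 eta0 N10).
pose B' := B + ep *: N.
have T00 : T 0 by [].
have B'i (w : 'cV[R]_n) : B' *m w = 0 -> w = 0 by move=> h; apply: epP; rewrite -/B' h.
have [U [fU UE]] := gr_of_cols B'i.
have OU : Om U.
  apply: etaP fU; rewrite /B' opprD addrA subrr sub0r normrN normrZ (gtr0_norm ep0).
  rewrite (@le_lt_trans _ _ (ep * (`|N| + 1))) // -?ltr_pdivlMr //.
  by rewrite ler_pM2l // lerDl.
(* Once negative, a vector stays negative, so compactness of the unit sphere gives one time from
   which the image of the whole plane is nonpositive. *)
have [K KP] : exists K : nat, forall k, (K <= k)%N -> forall w : 'cV[R]_n,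
    form_eval q (A ^+ k *m (B' *m w)) (A ^+ k *m (B' *m w)) <= 0.
  pose Sph := [set w : 'cV[R]_n | `|w| = 1].
  have cS : compact Sph.
    apply: bounded_closed_compact_mx; first by exists 1 => w /= ->.
    by apply: closed_fun_eq; exact: norm_continuous.
  pose ng (k : nat) (w : 'cV[R]_n) := forall k', (k <= k')%N ->
    form_eval q (A ^+ k' *m (B' *m w)) (A ^+ k' *m (B' *m w)) < 0.
  have /compact_near_coveringP nc := cS.
  have [|K _ KP] := nc nat \oo ng eventually_filter.
    move=> w /= w1; have w0 : w != 0 by rewrite -normr_eq0 w1 oner_eq0.
    have Bw0 : B' *m w != 0 by apply: contraNneq w0 => /B'i ->.
    have [|k kP] := nTneg _ Bw0.
      by move=> /epP wz; move: w0; rewrite wz eqxx.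
    pose fk (x : 'cV[R]_n) := form_eval q (A ^+ k *m (B' *m x)) (A ^+ k *m (B' *m x)).
    have cfk : continuous fk.
      have cl : continuous (fun x : 'cV[R]_n => A ^+ k *m (B' *m x)).
        apply: continuous_mulmx; first exact: continuous_const.
        by apply: continuous_mulmx; [exact: continuous_const|exact: continuous_self].
      apply: continuous_entry; apply: continuous_mulmx => //.
      by apply: continuous_mulmx; [exact: continuous_trmx|exact: continuous_const].
    exists ([set x | fk x < 0], [set i | (k <= i)%N]).
      split => /=; last by exists k.
      exact: (cfk w _ (open_nbhs_nbhs (conj (@open_lt R 0) kP))).
    move=> [x i] /= [fx ki] k' ik'.
    have kk' : (k <= k')%N by exact: leq_trans ki ik'.
    have AE : A ^+ (k' - k) *m (A ^+ k *m (B' *m x)) = A ^+ k' *m (B' *m x).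
      by rewrite [LHS]mulmxA -[A ^+ (k' - k) *m A ^+ k]/(A ^+ (k' - k) * A ^+ k) -exprD subnK.
    by have := negS _ fx (k' - k)%N; rewrite AE.
  exists K => k Kk w; have [->|w0] := eqVneq w 0; first by rewrite !mulmx0 /form_eval mulmx0 mxE.
  have nw : `|w| != 0 by rewrite normr_eq0.
  have := KP K (leqnn K) (`|w|^-1 *: w) _ k Kk; rewrite -!scalemxAr form_evalvZ => h.
  apply: ltW; rewrite -(pmulr_rlt0 _ (_ : 0 < `|w|^-1 ^+ 2)) ?h //.
    by rewrite /= /Sph /= normrZ normfV normr_id mulVf.
  by rewrite exprn_gt0 // invr_gt0 lt_neqAle eq_sym nw normr_ge0.
move=> vE; rewrite leNgt; apply/negP => qv.
(* If q is positive at v, it stays positive at the projections of v to planes near E; but the image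
   planes converge to E and are nonpositive. *)
pose pr (U' : Gr R n m 1) : 'cV[R]_m := vec_mx (mxvec v *m gr_proj U').
have cpr : continuous (fun U' => form_eval q (pr U') (pr U')).
  have c1 : continuous pr.
    move=> U'; apply: (cvg_vec_mx (F := nbhs U')); apply: (cvg_mulmx (F := nbhs U')); first exact: continuous_const.
    exact: gr_proj_continuous.
  apply: continuous_entry; apply: continuous_mulmx => //.
  by apply: continuous_mulmx; [exact: continuous_trmx|exact: continuous_const].
have nW : nbhs E [set U' | 0 < form_eval q (pr U') (pr U')].
  have prE : pr E = v by rewrite /pr (gr_projP _ _ vE) mxvecK.
  have h : 0 < form_eval q (pr E) (pr E) by rewrite prE.
  exact: (cpr E _ (open_nbhs_nbhs (conj (@open_gt R 0) h))).
have [K' _ K'P] := attr _ nW.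
pose k := maxn K K'.
have uAk : A ^+ k \in unitmx.
  by elim: (k) => [|i IH]; [rewrite expr0 unitmx1|rewrite exprS unitmx_mul uA].
have B2i (w : 'cV[R]_n) : (A ^+ k *m B') *m w = 0 -> w = 0.
  move=> h; apply: B'i; rewrite -(mulKmx uAk (B' *m w)) [A ^+ k *m _]mulmxA h mulmx0 //.
have [U' [fU' U'E]] := gr_of_cols B2i.
have im : gr_image (mulmx (A ^+ k)) U U'.
  apply/vspaceP => x; apply/idP/memv_imgP => [/U'E[w ->]|[y yU ->]].
    exists (B' *m w); last by rewrite lfunE /= mulmxA.
    by apply/UE; exists w.
  by move/UE : yU => [w ->]; rewrite lfunE /=; apply/U'E; exists w; rewrite mulmxA.
have := K'P k (leq_maxr _ _) U U' OU im => /=.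
have : pr U' \in gr_val U' by apply/gr_projP; rewrite /pr vec_mxK -mulmxA gr_proj_idem.
move=> /U'E[w ->]; rewrite -mulmxA ltNge KP //; exact: leq_maxl.
Qed.

End Attracting.

(** * Periodic chains and the limit map *)

Lemma signature_act (R : realType) n (g q : 'M[R]_(n + n)) (a : R) : g \in unitmx -> 0 < a ->
  signature_nn q -> signature_nn (a *: form_act g q).
Proof.
move=> ug a0 [X uX XqX]; pose s := (Num.sqrt a)^-1.
have s0 : s != 0 by rewrite invr_neq0 // gt_eqF // sqrtr_gt0.
exists (s *: (g *m X)); first by rewrite unitmxZ ?unitfE // unitmx_mul ug.
have ss : s * s * a = 1.
  by rewrite /s -invfM -expr2 sqr_sqrtr ?(ltW a0) // mulVf // gt_eqF.
have sE (Y Z : 'M[R]_(n + n)) : (s *: Y)^T *m (a *: Z) *m (s *: Y) = (s * s * a) *: (Y^T *m Z *m Y).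
  by rewrite trmxZ -!scalemxAl -!scalemxAr -!scalemxAl !scalerA; congr (_ *: _); ring.
rewrite sE ss scale1r.
rewrite /form_act trmx_mul !mulmxA -(mulmxA X^T) -trmx_mul mulVmx // trmx1 mulmx1.
by rewrite mulmxKV // XqX.
Qed.

Section Periodic.
Context {R : realType} {n : nat} {G : groupType}.
Local Notation m := (n + n)%N.
Variable rho : G -> 'M[R]_m.
Hypothesis rho_unit : forall g, rho g \in unitmx.
Hypothesis rho_mul : forall g h, rho (g * h)%g = rho g *m rho h.
Variables (D C0 C1 : R) (F : seq G) (e : nat -> G) (c : nat -> R) (nu : nat -> 'M[R]_m).
Local Notation q := (fun k => c k *: form_act (rho (e k)) (nu k)).
Hypothesis D0 : 0 < D.
Hypothesis ch : chain rho D C0 C1 F e c q.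
Variables i j : nat.
Hypothesis ij : (i < j)%N.
Hypothesis nuij : m%:R ^+ 2 * `|nu i - nu j| * C1 <= D / 2.

Let g := (e j * (e i)^-1)%g.
Let lam := c j / c i.

Let cpos k : 0 < c k. Proof. by have [[]] := ch k. Qed.
Let lam0 : 0 < lam. Proof. by rewrite divr_gt0. Qed.
Let lamX k : 0 < lam ^+ k. Proof. by rewrite exprn_gt0. Qed.

(** The first component counts completed periods; the second runs up to j-1 and jumps back to i at
    the end of each period. The resulting path is [e] up to j-1, followed by the translates by
    powers of g of the segment from i to j-1. *)
Definition next_state (s : nat * nat) := if s.2.+1 == j then (s.1.+1, i) else (s.1, s.2.+1).
Definition state l := iter l next_state (0%N, 0%N).
Definition periodic_path l := (g ^+ (state l).1 * e (state l).2)%g.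
Definition periodic_scale l := lam ^+ (state l).1 * c (state l).2.
Definition periodic_form l := lam ^+ (state l).1 *: form_act (rho (g ^+ (state l).1)%g) (q (state l).2).

Lemma state_lt l : ((state l).2 < j)%N.
Proof.
elim: l => [|l IH]; first by rewrite /= (leq_ltn_trans _ ij).
rewrite /state iterS -/(state l) /next_state; case: eqP => //= /eqP h.
by rewrite ltn_neqAle h IH.
Qed.

Lemma state_small l : (l < j)%N -> state l = (0%N, l).
Proof.
elim: l => // l IH lj; rewrite /state iterS -/(state l) (IH (ltnW lj)) /next_state /=.
by rewrite ltn_eqF.
Qed.

Lemma state_period k : state (i + k * (j - i)) = (k, i).
Proof.
elim: k => [|k IH]; first by rewrite mul0n addn0 state_small.
have st s : (i + s < j)%N -> iter s next_state (k, i) = (k, (i + s)%N).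
  elim: s => [|s IHs] sj; first by rewrite addn0.
  rewrite iterS IHs; last by rewrite (ltn_trans _ sj) // addnS.
  by rewrite /next_state /= -addnS ltn_eqF.
have pS : (j - i = (j - i).-1.+1)%N by rewrite prednK // subn_gt0.
have iS : (i + (j - i).-1).+1 = j by rewrite -addnS -pS subnKC // ltnW.
rewrite mulSn addnCA /state iterD -/(state _) IH pS iterS st; last by rewrite iS.
by rewrite /next_state /= iS eqxx.
Qed.

Let gt_step t : (g ^+ t.+1 * e i)%g = (g ^+ t * e j)%g.
Proof. by rewrite expgSr -mulgA /g mulgVK. Qed.

Let path_step l : periodic_path l.+1 = (g ^+ (state l).1 * e (state l).2.+1)%g.
Proof.
rewrite /periodic_path /state iterS -/(state l) /next_state; case: eqP => //= h.
by rewrite gt_step h.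
Qed.

Let scale_step l : periodic_scale l.+1 = lam ^+ (state l).1 * c (state l).2.+1.
Proof.
rewrite /periodic_scale /state iterS -/(state l) /next_state; case: eqP => //= h.
by rewrite h exprSr -mulrA /lam divfK ?gt_eqF.
Qed.

Let formE t r v : form_eval (lam ^+ t *: form_act (rho (g ^+ t)%g) (q r)) v v =
  lam ^+ t * form_eval (q r) (invmx (rho (g ^+ t)%g) *m v) (invmx (rho (g ^+ t)%g) *m v).
Proof. by rewrite form_evalZ form_eval_act. Qed.

Let hE t r v : hnorm rho (g ^+ t * e r)%g v = hnorm rho (e r) (invmx (rho (g ^+ t)%g) *m v).
Proof. exact: hnorm_mul. Qed.

(** Only the junction needs an argument: as g e_i = e_j, the translate by [e j] of [nu j] is
    replaced there by that of [nu i], and by [nuij] the error costs at most half of the increase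
    D. *)
Lemma periodic_chain : chain rho (D / 2) C0 C1 F periodic_path periodic_scale periodic_form.
Proof.
move=> l; rewrite path_step scale_step.
have nx : periodic_form l.+1 = if (state l).2.+1 == j
    then lam ^+ (state l).1.+1 *: form_act (rho (g ^+ (state l).1.+1)%g) (q i)
    else lam ^+ (state l).1 *: form_act (rho (g ^+ (state l).1)%g) (q (state l).2.+1).
  by rewrite /periodic_form /state iterS -/(state l) /next_state; case: eqP.
rewrite nx /periodic_path /periodic_scale /periodic_form.
move: (state l) (state_lt l) => [t r] /= rj {nx}.
have [[c0 sr] b1 b2 b3 b4] := ch r.
split.
- by split; [rewrite mulr_gt0|exact: signature_act].
- move=> v; rewrite formE normrM (gtr0_norm (lamX t)) hE.
  have -> : C0 * (lam ^+ t * c r * hnorm rho (e r) (invmx (rho (g ^+ t)%g) *m v)) =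
    lam ^+ t * (C0 * (c r * hnorm rho (e r) (invmx (rho (g ^+ t)%g) *m v))) by ring.
  by rewrite ler_pM2l.
- move=> v; rewrite hE [X in _ <= _ - X]formE; set w := invmx (rho (g ^+ t)%g) *m v.
  have hn := hnorm_ge0 rho (e r) w.
  have X0 : 0 <= D * (c r * hnorm rho (e r) w) by rewrite !mulr_ge0 // ltW.
  have -> : D / 2 * (lam ^+ t * c r * hnorm rho (e r) w) =
    lam ^+ t * (D / 2 * (c r * hnorm rho (e r) w)) by ring.
  have := b2 w => b2w.
  case: eqP => [rE|_]; last first.
    by rewrite formE -mulrBr ler_pM2l // (le_trans _ b2w) //; lra.
  rewrite formE.
  have -> : form_eval (q i) (invmx (rho (g ^+ t.+1)%g) *m v) (invmx (rho (g ^+ t.+1)%g) *m v) =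
      c i * form_eval (nu i) (invmx (rho (e j)) *m w) (invmx (rho (e j)) *m w).
    rewrite form_evalZ form_eval_act; congr (_ * _).
    suff -> : invmx (rho (e i)) *m (invmx (rho (g ^+ t.+1)%g) *m v) = invmx (rho (e j)) *m w by [].
    rewrite /w -!(rhoV rho_unit rho_mul) !mulmxA -!rho_mul -!invgM gt_step //.
  have qj : form_eval (q r.+1) w w = c j * form_eval (nu j) (invmx (rho (e j)) *m w) (invmx (rho (e j)) *m w).
    by rewrite rE form_evalZ form_eval_act.
  have lc : lam * c i = c j by rewrite /lam divfK ?gt_eqF.
  have lt (z : R) : lam ^+ t.+1 * (c i * z) = lam ^+ t * (c j * z).
    by rewrite -lc exprSr; ring.
  rewrite lt.
  rewrite -mulrBr ler_pM2l //.
  set x := invmx (rho (e j)) *m w in qj *.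
  have hx : hnorm rho (e j) w = nsq x by [].
  have d1 := form_eval_norm (nu i - nu j) x; rewrite form_evalB in d1.
  have d2 := b3 w; rewrite rE hx in d2.
  have d3 : c j * `|form_eval (nu i) x x - form_eval (nu j) x x| <= D / 2 * (c r * hnorm rho (e r) w).
    have d4 : c j * `|form_eval (nu i) x x - form_eval (nu j) x x| <= m%:R ^+ 2 * `|nu i - nu j| * (c j * nsq x).
      by rewrite mulrCA ler_pM2l.
    have mn0 : 0 <= m%:R ^+ 2 * `|nu i - nu j| by rewrite mulr_ge0 // exprn_ge0.
    have d5 := ler_wpM2l mn0 d2.
    rewrite (le_trans d4) // (le_trans d5) // [leLHS]mulrA ler_wpM2r // mulr_ge0 // ltW //.
  have d6 : c j * form_eval (nu j) x x - c j * form_eval (nu i) x x <=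
      c j * `|form_eval (nu i) x x - form_eval (nu j) x x|.
    by rewrite -mulrBr ler_pM2l // distrC ler_norm.
  by rewrite qj in b2w; lra.
- move=> v; rewrite !hE.
  have -> : C1 * (lam ^+ t * c r * hnorm rho (e r) (invmx (rho (g ^+ t)%g) *m v)) =
    lam ^+ t * (C1 * (c r * hnorm rho (e r) (invmx (rho (g ^+ t)%g) *m v))) by ring.
  by rewrite -mulrA ler_pM2l.
- by rewrite invgM -mulgA mulKg.
Qed.

Lemma periodic_path_small l : (l < j)%N -> periodic_path l = e l.
Proof. by move=> lj; rewrite /periodic_path state_small //= expg0 mul1g. Qed.

Lemma periodic_path_period k : periodic_path (i + k * (j - i)) = (g ^+ k * e i)%g.
Proof. by rewrite /periodic_path state_period. Qed.

(** After one period the form is [lam] times the translate of [q i] by g, and the forms have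
    strictly increased along the chain. *)
Lemma period_decreases w : w != 0 ->
  form_eval (q i) (rho g *m w) (rho g *m w) < lam * form_eval (q i) w w.
Proof.
move=> w0; set v := rho g *m w.
have D20 : 0 < D / 2 by rewrite divr_gt0.
have pc := periodic_chain.
have f0 : periodic_form (i + 0 * (j - i)) = q i.
  by rewrite /periodic_form state_period /= expr0 scale1r expg0 rho1 // form_act1.
have f1 : form_eval (periodic_form (i + 1 * (j - i))) v v = lam * form_eval (q i) w w.
  by rewrite /periodic_form state_period formE expr1 expg1 /v mulKmx.
have lt : (i.+1 <= i + 1 * (j - i))%N by rewrite mul1n subnKC // ltnW.
have := chain_mono D20 pc v lt; rewrite f1.
have [[cc _] _ st _ _] := pc i; have := st v.
rewrite mul0n addn0 in f0; rewrite f0.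
have hv : 0 < periodic_scale i * hnorm rho (periodic_path i) v.
  rewrite mulr_gt0 // /hnorm nsq_gt0; apply: contraNneq w0 => h.
  have : v = 0 by rewrite -(mulKVmx (rho_unit (periodic_path i)) v) h mulmx0.
  by move=> /(congr1 (mulmx (invmx (rho g)))); rewrite /v mulKmx // mulmx0 => ->.
have : 0 < D / 2 * (periodic_scale i * hnorm rho (periodic_path i) v) by rewrite mulr_gt0.
lra.
Qed.

End Periodic.

Lemma gromov_product_arith (w wx wy x y d r : nat) :
  (w + wx <= x + r -> w + wy <= y + r -> d <= wx + wy -> w + w <= (x + y - d) + (r + r))%N.
Proof. lia. Qed.

Lemma base_change_arith (w w0 wx x0 x b r : nat) :
  (w <= b + w0 -> w0 + wx <= x0 + r -> x0 <= b + x -> w + wx <= x + (r + (b + b)))%N.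
Proof. lia. Qed.

Lemma mulr_arith (w wx wy x y f r : nat) :
  (w + wy <= y + r -> wx <= wy + f -> y <= x + f -> w + wx <= x + (r + (f + f)))%N.
Proof. lia. Qed.

(** * Gromov products and the attracting points of periodic chains *)

Section Alignment.
Context {G : groupType}.
Variable S : finite_generating_set G.
Local Notation len := (word_length S).

(* Up to r, a geodesic from 1 to x passes through w. *)
Definition aligned r (w x : G) := (len w + len (w^-1 * x)%g <= len x + r)%N.

Lemma aligned_le r r' w x : (r <= r')%N -> aligned r w x -> aligned r' w x.
Proof. by move=> rr h; rewrite /aligned (leq_trans h) // leq_add2l. Qed.

Lemma aligned_gromov_product r w x y : aligned r w x -> aligned r w y ->
  (len w + len w <= gromov_product2 S x y + (r + r))%N.
Proof.
move=> wx wy; apply: (gromov_product_arith wx wy).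
rewrite -[len (w^-1 * x)%g]word_lengthV invgM invgK (leq_trans _ (word_lengthM _ _ _)) //.
by rewrite mulgA mulgK.
Qed.

Lemma aligned_mulr r w x f : aligned r w (x * f)%g -> aligned (r + (len f + len f)) w x.
Proof.
rewrite /aligned => h.
have h1 : (len (w^-1 * x)%g <= len (w^-1 * (x * f))%g + len f)%N.
  by rewrite -[len f]word_lengthV (leq_trans _ (word_lengthM _ _ _)) // mulgA mulgK.
have h2 := word_lengthM S x f.
exact: (mulr_arith h h1 h2).
Qed.

Lemma aligned_equiv r (w : nat -> G) (s s' : nat -> G) :
  (forall R0, exists l, (R0 <= len (w l))%N) ->
  (forall l k, (l <= k)%N -> aligned r (w l) (s k)) ->
  (forall l k, (l <= k)%N -> aligned r (w l) (s' k)) -> gromov_equiv S s s'.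
Proof.
move=> wfar ws ws' R0; have [l lP] := wfar (R0 + r)%N; exists l => i j li lj.
have h := aligned_gromov_product (ws l i li) (ws' l j lj).
rewrite -(leq_add2r (r + r)) (leq_trans _ h) //.
by rewrite addnA (leq_trans _ (leq_add lP lP)) // addnA leq_add2r -addnA [(r + R0)%N]addnC addnA leq_add2r leq_addr.
Qed.

End Alignment.

Section AttractingShadow.
Context {R : realType} {n : nat} {G : groupType}.
Local Notation m := (n + n)%N.
Variable rho : G -> 'M[R]_m.
Hypothesis n_gt0 : (0 < n)%N.
Hypothesis rho_unit : forall g, rho g \in unitmx.
Hypothesis rho_mul : forall g h, rho (g * h)%g = rho g *m rho h.
Variables (S : finite_generating_set G) (A B : R).
Hypothesis A0 : 0 < A.
Hypothesis gap : forall g,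
  expR (A * (word_length S g)%:R - B) <= sigma n (rho g) / sigma n.+1 (rho g).
Local Notation len := (word_length S).
Variables (D C0 C1 : R) (F : seq G).
Hypotheses (D0 : 0 < D) (DC : D < C0) (C10 : 0 < C1).

Lemma chain_aligned : exists r, forall e c q, chain rho D C0 C1 F e c q -> forall l k,
  aligned S (r + (len (e 0%N) + len (e 0%N))) (e l) (e (l + k)%N).
Proof.
have [r rP] := chain_morse n_gt0 rho_unit rho_mul A0 gap F D0 DC C10.
exists r => e c q ch l k; have h := rP e c q l k ch.
have h1 : (len (e l) <= len (e 0%N) + len ((e 0%N)^-1 * e l)%g)%N.
  by rewrite (leq_trans _ (word_lengthM _ _ _)) // mulVKg.
have h2 : (len ((e 0%N)^-1 * e (l + k)%N)%g <= len (e 0%N) + len (e (l + k)%N))%N.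
  by rewrite (leq_trans (word_lengthM _ _ _)) // word_lengthV.
exact: (base_change_arith h1 h h2).
Qed.

Lemma chain_far R0 b : exists T, forall e c q, chain rho D C0 C1 F e c q ->
  (len (e 0%N) <= b)%N -> forall l, (T < l)%N -> (R0 <= len (e l))%N.
Proof.
have [F' F'P] := finite_balls S (b + R0).
have [T TP] := chain_escape n_gt0 rho_unit rho_mul F F' D0 DC C10.
exists T => e c q ch eb l Tl; rewrite leqNgt; apply/negP => lR.
move: Tl; rewrite ltnNge => /negP; apply.
have := TP e c q ch 0%N l; rewrite add0n; apply; apply: F'P.
by rewrite (leq_trans (word_lengthM _ _ _)) // word_lengthV leq_add // ltnW.
Qed.

End AttractingShadow.

Section PeriodicShadow.
Context {R : realType} {n : nat} {G : groupType}.
Local Notation m := (n + n)%N.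
Variable rho : G -> 'M[R]_m.
Hypothesis n_gt0 : (0 < n)%N.
Hypothesis rho_unit : forall g, rho g \in unitmx.
Hypothesis rho_mul : forall g h, rho (g * h)%g = rho g *m rho h.
Variables (S : finite_generating_set G) (A B : R).
Hypothesis A0 : 0 < A.
Hypothesis gap : forall g,
  expR (A * (word_length S g)%:R - B) <= sigma n (rho g) / sigma n.+1 (rho g).
Local Notation len := (word_length S).
Variables (D C0 C1 : R) (F : seq G).
Hypotheses (D0 : 0 < D) (DC : D < C0) (C10 : 0 < C1).

(** The periodic path coincides with [e] before j and later stays near the powers of g, so the
    sequences for zeta and eta both pass near [e i]; as [e i] is far from 1, the two boundary points
    are close. *)
Lemma attracting_shadow (R0 b : nat) : exists T, forall e c nu,
  chain rho D C0 C1 F e c (fun k => c k *: form_act (rho (e k)) (nu k)) -> (len (e 0%N) <= b)%N ->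
  forall i j, (T < i)%N -> (i < j)%N -> m%:R ^+ 2 * `|nu i - nu j| * C1 <= D / 2 ->
  exists2 eta : gromov_boundary S, bd_attracting (e j * (e i)^-1)%g eta &
    forall zeta, bd_seqs zeta e -> bd_shadow zeta R0 eta.
Proof.
have D20 : 0 < D / 2 by rewrite divr_gt0.
have D2D : D / 2 <= D by rewrite ler_pdivrMr // ler_pMr // ler1n.
have D2C : D / 2 < C0 by exact: le_lt_trans D2D DC.
have [r rP] := chain_aligned n_gt0 rho_unit rho_mul A0 gap F D20 D2C C10.
pose r2 := (r + (b + b))%N.
have far R1 := chain_far n_gt0 rho_unit rho_mul S F D20 D2C C10 R1 b.
have [T TP] := far (R0 + r2)%N.
exists T => e c nu ch eb i j Ti ij nuij.
(* The constant is halved so that the same alignment bound serves [e] and the periodic path. *)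
have ch2 : chain rho (D / 2) C0 C1 F e c (fun k => c k *: form_act (rho (e k)) (nu k)).
  move=> k; have [[k0 k1] k2 k3 k4 k5] := ch k; split => // v.
  by rewrite (le_trans _ (k3 v)) // ler_wpM2r // mulr_ge0 ?hnorm_ge0 // ltW.
have pch := periodic_chain rho_unit rho_mul D0 ch ij nuij.
set e' := periodic_path e i j in pch.
set g := (e j * (e i)^-1)%g.
have e'E l : (l < j)%N -> e' l = e l by exact: periodic_path_small.
have e'P k : e' (i + k * (j - i))%N = (g ^+ k * e i)%g by exact: periodic_path_period.
have e'0 : e' 0%N = e 0%N by rewrite e'E // (leq_ltn_trans _ ij).
have e'b : (len (e' 0%N) <= b)%N by rewrite e'0.
have al2 (p : nat -> G) c' q' : chain rho (D / 2) C0 C1 F p c' q' -> (len (p 0%N) <= b)%N ->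
    forall l l', (l <= l')%N -> aligned S r2 (p l) (p l').
  move=> pc pb l l' ll; rewrite -(subnKC ll); apply: (@aligned_le _ _ (r + (len (p 0%N) + len (p 0%N)))).
    by rewrite leq_add2l leq_add.
  exact: (rP _ _ _ pc).
(* The periodic path passes through [sb k], which is at a bounded distance from the power [sa k]. *)
pose sa k := (g ^+ k)%g; pose sb k := (g ^+ k * e i)%g.
have kl k : (k <= i + k * (j - i))%N.
  by rewrite (leq_trans _ (leq_addl _ _)) // leq_pmulr // subn_gt0.
have asb l k : (l <= k)%N -> aligned S r2 (e' l) (sb k).
  by move=> lk; rewrite /sb -e'P; apply: (al2 _ _ _ pch e'b); exact: leq_trans lk (kl k).
pose r3 := (r2 + (len (e i) + len (e i)))%N.
have asb3 l k : (l <= k)%N -> aligned S r3 (e' l) (sb k).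
  by move=> lk; apply: (@aligned_le _ _ r2); [exact: leq_addr|exact: asb].
have asa3 l k : (l <= k)%N -> aligned S r3 (e' l) (sa k).
  by move=> lk; apply: aligned_mulr; exact: asb.
have e'far R1 : exists l, (R1 <= len (e' l))%N.
  by have [T1 T1P] := far R1; exists T1.+1; exact: (T1P _ _ _ pch e'b).
have eqv (s1 s2 : nat -> G) : (forall l k, (l <= k)%N -> aligned S r3 (e' l) (s1 k)) ->
    (forall l k, (l <= k)%N -> aligned S r3 (e' l) (s2 k)) -> gromov_equiv S s1 s2.
  by exact: aligned_equiv.
have hb : exists2 s, converges_at_infinity S s &
    [set s' | converges_at_infinity S s' /\ gromov_equiv S sa s'] =
    [set s' | converges_at_infinity S s' /\ gromov_equiv S s s'].
  by exists sa => //; exact: eqv.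
exists (MkBoundary hb); first by split; exact: eqv.
move=> zeta ze; exists e, sb, i; split => //; first by split; exact: eqv.
move=> k l ik il.
have a1 : aligned S r2 (e i) (e k) by exact: (al2 _ _ _ ch2 eb).
have a2 : aligned S r2 (e i) (sb l).
  rewrite -(e'E i ij) /sb -e'P; apply: (al2 _ _ _ pch e'b); exact: leq_addr.
have h := aligned_gromov_product a1 a2.
have ei : (R0 + r2 <= len (e i))%N by exact: (TP _ _ _ ch2 eb).
rewrite -(leq_add2r (r2 + r2)) (leq_trans _ h) //.
rewrite (leq_trans _ (leq_add ei ei)) //.
by rewrite [leqRHS]addnACA leq_add2r leq_addr.
Qed.

End PeriodicShadow.

Lemma recurrence (R : realType) m (nu : nat -> 'M[R]_m) (e : R) T : 0 < e ->
  (forall k, `|nu k| = 1) ->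
  exists i j, [/\ (T < i)%N, (i < j)%N & `|nu i - nu j| < e].
Proof.
move=> e0 nu1.
have cS : compact [set q : 'M[R]_m | `|q| = 1].
  apply: bounded_closed_compact_mx; first by exists 1 => q /= ->.
  by apply: closed_fun_eq; exact: norm_continuous.
have [|x [_ clx]] := cS (nu @ \oo) _; first by exists 0%N => // k _; exact: nu1.
have e20 : 0 < e / 2 by rewrite divr_gt0.
have nB : nbhs x [set q | `|x - q| < e / 2] by apply/nbhs_mxP; exists (e / 2).
have pick N : exists2 k, (N < k)%N & `|x - nu k| < e / 2.
  have h : (nu @ \oo) (nu @` [set k | (N < k)%N]) by exists N.+1 => // k /= Nk; exists k.
  by have [_ [[k Nk <-] xk]] := clx _ _ h nB; exists k.
have [i Ti xi] := pick T; have [j ij xj] := pick i.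
exists i, j; split => //; rewrite -(subrK x (nu i)) -addrA (le_lt_trans (ler_normD _ _)) //.
by rewrite distrC; lra.
Qed.

Lemma chain_bounded_eq0 (R : realType) n (G : groupType) (rho : G -> 'M[R]_(n + n)) (D C0 C1 : R)
    F e c q (v : 'cV[R]_(n + n)) (C : R) : (forall g, rho g \in unitmx) -> 0 < D -> D < C0 ->
  chain rho D C0 C1 F e c q -> 0 <= form_eval (q 0%N) v v ->
  (forall k, c k * hnorm rho (e k) v <= C) -> v = 0.
Proof.
move=> rho_unit D0 DC ch qv bC; have C00 : 0 < C0 by exact: lt_trans DC.
have ex k := chain_expand D0 DC ch k qv.
have : 0 < D / C0 by rewrite divr_gt0.
move: (D / C0) ex => ep ex ep0.
apply/eqP; apply: contraT => v0.
have h0 : 0 < c 0%N * hnorm rho (e 0%N) v.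
  have [[c0 _] _ _ _ _] := ch 0%N; rewrite mulr_gt0 // /hnorm nsq_gt0.
  by apply: contraNneq v0 => z; rewrite -(mulKVmx (rho_unit (e 0%N)) v) z mulmx0.
have [T TP] := linear_bounds_exponential (C / (ep * (c 0%N * hnorm rho (e 0%N) v))) ep0.
have := TP T.+1; rewrite ltnn => h; have // : false; apply: h.
rewrite (ler_pdivlMr _ _ (mulr_gt0 ep0 h0)) (le_trans _ (bC T.+2)) // (le_trans _ (ex T.+1)) //.
by rewrite le_eqVlt; apply/orP; left; apply/eqP; ring.
Qed.

(** * The value of the limit map *)

Section LimitMapValue.
Context {R : realType} {d n : nat} {M : topologicalType} {G : groupType}.
Local Notation m := (n + n)%N.
Variables (act : G -> M -> M) (rho : G -> 'M[R]_m) (u : M -> Gr R d m m)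
  (Phi : R -> sphere_bundle u -> sphere_bundle u).
Hypothesis n_gt0 : (0 < n)%N.
Hypothesis act_act : is_action act.
Hypothesis rho_unit : forall g, rho g \in unitmx.
Hypothesis rho_mul : forall g h, rho (g * h)%g = rho g *m rho h.
Hypothesis PD : forall K : set M, compact K ->
  exists l : seq G, forall g x, K x -> K (act g x) -> g \in l.
Hypothesis cu : continuous u.
Hypothesis u_nn : forall x, pencil_nn (u x).
Hypothesis u_equiv : equivariant_pencil_map u act rho.
Hypothesis Phi_fitting : fitting_flow Phi.
Hypothesis Phi_equiv : equivariant_flow act rho Phi.
Variables (S : finite_generating_set G) (A B : R).
Hypothesis A0 : 0 < A.
Hypothesis gap : forall g,
  expR (A * (word_length S g)%:R - B) <= sigma n (rho g) / sigma n.+1 (rho g).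
Variable xi : gromov_boundary S -> Gr R n m 1.
Hypothesis xi_limit : is_limit_map rho xi.

(** If a form were positive at v, it would be so at the projections of v to xi eta for eta near
    zeta. For eta the attracting point of a period that begins after k, the form at the beginning of
    the period is at least as large, yet nonpositive on xi eta. *)
Lemma limit_map_nonpositive (D C0 C1 : R) F e c nu zeta : 0 < D -> D < C0 -> 0 < C1 ->
  chain rho D C0 C1 F e c (fun k => c k *: form_act (rho (e k)) (nu k)) ->
  (forall k, `|nu k| = 1) -> bd_seqs zeta e ->
  forall k v, v \in gr_val (xi zeta) -> form_eval (c k *: form_act (rho (e k)) (nu k)) v v <= 0.
Proof.
move=> D0 DC C10 ch nu1 ze k v vE; rewrite leNgt; apply/negP => qv.
set q := fun k => _ in ch; rewrite -/(q k) in qv.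
pose pr (U : Gr R n m 1) : 'cV[R]_m := vec_mx (mxvec v *m gr_proj U).
have cpr : continuous (fun U => form_eval (q k) (pr U) (pr U)).
  have c1 : continuous pr.
    move=> U; apply: (cvg_vec_mx (F := nbhs U)); apply: (cvg_mulmx (F := nbhs U)).
      exact: continuous_const.
    exact: gr_proj_continuous.
  apply: continuous_entry; apply: continuous_mulmx => //.
  by apply: continuous_mulmx; [exact: continuous_trmx|exact: continuous_const].
have nW : nbhs (xi zeta) [set U | 0 < form_eval (q k) (pr U) (pr U)].
  have prE : pr (xi zeta) = v by rewrite /pr (gr_projP _ _ vE) mxvecK.
  have h : 0 < form_eval (q k) (pr (xi zeta)) (pr (xi zeta)) by rewrite prE.
  exact: (cpr _ _ (open_nbhs_nbhs (conj (@open_gt R 0) h))).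
have [cxi _ _ dyn] := xi_limit.
have nz : nbhs zeta [set eta | 0 < form_eval (q k) (pr (xi eta)) (pr (xi eta))] by exact: (cxi zeta _ nW).
move: nz; rewrite nbhsE => -[V [oV Vz] VW].
have [r rV] := (oV : bd_open V) zeta Vz.
have [T TP] := attracting_shadow n_gt0 rho_unit rho_mul A0 gap F D0 DC C10 r (word_length S (e 0%N)).
have d0 : 0 < D / 2 / (m%:R ^+ 2 * C1 + 1).
  by rewrite !divr_gt0 // ltr_wpDl // mulr_ge0 ?exprn_ge0 // ltW.
have [i [j [Ti ij nuij]]] := recurrence (maxn T k) d0 nu1.
have mC : 0 < m%:R ^+ 2 * C1 + 1 by rewrite ltr_wpDl // mulr_ge0 ?exprn_ge0 // ltW.
have nuij' : m%:R ^+ 2 * `|nu i - nu j| * C1 <= D / 2.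
  rewrite (@le_trans _ _ ((m%:R ^+ 2 * C1 + 1) * `|nu i - nu j|)) //.
    by rewrite mulrAC ler_wpM2r // lerDl.
  by rewrite mulrC -ler_pdivlMr // ltW.
have Ti' : (T < i)%N by rewrite (leq_ltn_trans _ Ti) // leq_maxl.
have ki : (k <= i)%N by rewrite ltnW // (leq_ltn_trans _ Ti) // leq_maxr.
have [eta eA eS] := TP e c nu ch (leqnn _) i j Ti' ij nuij'.
have Weta := VW _ (rV _ (eS zeta ze)).
have att := dyn _ _ eA.
have [[ci _] _ _ _ _] := ch i; have [[cj _] _ _ _ _] := ch j.
have [[_ si] _ _ _ _] := ch i.
have prU : pr (xi eta) \in gr_val (xi eta) by apply/gr_projP; rewrite /pr vec_mxK -mulmxA gr_proj_idem.
have := attracting_nonpositive (rho_unit _) (divr_gt0 cj ci) si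
  (period_decreases rho_unit rho_mul D0 ch ij nuij') att prU.
by move: Weta => /= Weta; rewrite leNgt (lt_le_trans Weta) // (chain_mono D0 ch).
Qed.

Theorem limit_map_value s zeta : path_limit act (fun t : R => sb_pt (Phi t s)) zeta ->
  proj_subspace (xi zeta) =
    \bigcap_(t in [set t : R | 0 <= t]) nonpos_locus (sb_ray (Phi t s)).
Proof.
move=> [K [cK Kc lim]].
have [D [C1 [F [D0 D1 C10 fc]]]] :=
  flow_chain act_act rho_unit rho_mul PD cu u_nn u_equiv Phi_fitting Phi_equiv cK.
have DC : D < m%:R ^+ 2 + 1.
  by rewrite (le_lt_trans D1) // ltrDr exprn_gt0 // ltr0n addn_gt0 n_gt0.
have gex k : exists g, (act g @` K) (sb_pt (Phi k%:R s)).
  have : [set: M] (sb_pt (Phi k%:R s)) by [].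
  by rewrite -Kc => -[g _ h]; exists g.
have [e fp] := choice gex.
have [c [nu [ch nu1 ray]]] := fc s e fp.
have ze : bd_seqs zeta e by apply: (lim (fun k => k%:R) e) => //; exact: cvgr_idn.
set C0 := m%:R ^+ 2 + 1 in DC ch.
have C00 : 0 < C0 by exact: lt_trans DC.
pose q k := c k *: form_act (rho (e k)) (nu k).
have xiq k v : v \in gr_val (xi zeta) -> form_eval (q k) v v <= 0.
  exact: (limit_map_nonpositive D0 DC C10 ch nu1 ze).
have [ep [ep01 cr]] : exists ep : R, 0 < ep < 1 /\ forall v k, form_eval (q k.+1) v v <= 0 ->
    c k * hnorm rho (e k) v <= (1 - ep) ^+ k * (c 0%N * hnorm rho (e 0%N) v / ep).
  exists (D / C0); split; first by rewrite divr_gt0 //= ltr_pdivrMr // mul1r.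
  by move=> v k qv; exact: (chain_contract D0 DC ch qv).
have /andP[ep0 ep1] := ep01.
have ep10 k : 0 <= (1 - ep) ^+ k <= 1 by rewrite exprn_ge0 ?exprn_ile1 //; lra.
(* The vectors that stay bounded in the rescaled norms: a subspace containing every v at which all
   the forms are nonpositive, in particular xi zeta. *)
pose T (v : 'cV[R]_m) := exists C, forall k, c k * hnorm rho (e k) v <= C.
have cpos k : 0 < c k by have [[]] := ch k.
have T0 : T 0 by exists 0 => k; rewrite /hnorm mulmx0 /nsq mulmx0 mxE mulr0.
have TD a x y : T x -> T y -> T (a *: x + y).
  move=> [C CP] [C' C'P]; exists (2 * (a ^+ 2 * C) + 2 * C') => k.
  have h : c k * hnorm rho (e k) (a *: x + y) <=
      2 * (a ^+ 2 * (c k * hnorm rho (e k) x)) + 2 * (c k * hnorm rho (e k) y).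
    have -> : 2 * (a ^+ 2 * (c k * hnorm rho (e k) x)) + 2 * (c k * hnorm rho (e k) y) =
      c k * (2 * (a ^+ 2 * hnorm rho (e k) x) + 2 * hnorm rho (e k) y) by ring.
    by rewrite ler_pM2l // /hnorm -nsqZ mulmxDr -scalemxAr nsqD_le.
  have h1 : a ^+ 2 * (c k * hnorm rho (e k) x) <= a ^+ 2 * C by rewrite ler_wpM2l // sqr_ge0.
  by have h2 := C'P k; lra.
have negT v : (forall k, form_eval (q k) v v <= 0) -> T v.
  move=> qv; exists (c 0%N * hnorm rho (e 0%N) v / ep) => k; rewrite (le_trans (cr v k (qv k.+1))) //.
  have /andP[_ h] := ep10 k.
  by rewrite ler_piMl // divr_ge0 ?mulr_ge0 ?hnorm_ge0 // ltW.
have [X XP] : exists X : 'M[R]_m, forall v : 'rV_m, T v^T <-> (v <= X)%MS.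
  apply: (linear_predicate_mx (T := fun v => T v^T)); first by rewrite trmx0.
  by move=> a x y Tx Ty; rewrite linearD /= trmxZ; exact: TD.
have [N0 [P [_ Pi _ Pq]]] : exists N P : 'M[R]_(m, n), [/\ forall w : 'cV_n, N *m w = 0 -> w = 0,
    forall w : 'cV_n, P *m w = 0 -> w = 0,
    forall w : 'cV_n, w != 0 -> form_eval (q 0%N) (N *m w) (N *m w) < 0 &
    forall w : 'cV_n, w != 0 -> 0 < form_eval (q 0%N) (P *m w) (P *m w)].
  by apply: signature_frames; have [[]] := ch 0%N.
have rank_inj (Y : 'M[R]_(m, n)) : (forall w : 'cV_n, Y *m w = 0 -> w = 0) -> \rank Y^T = n.
  move=> Yi; apply/eqP; change (row_free Y^T); apply/row_free_injP => w wY.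
  by apply: trmx_inj; rewrite trmx0; apply: Yi; rewrite -[Y]trmxK -trmx_mul wY trmx0.
(* A nonzero bounded vector in the positive n-plane of the first form would be expanded; hence T has
   dimension at most n and is equal to xi zeta. *)
have XP0 : (X :&: P^T)%MS = 0.
  apply/eqP; rewrite -submx0; apply/rV_subP => v; rewrite sub_capmx => /andP[/XP Tv /submxP[w vE]].
  have vE' : v^T = P *m w^T by rewrite vE trmx_mul trmxK.
  have : v^T = 0.
    have [C CP] := Tv; apply: (chain_bounded_eq0 rho_unit D0 DC ch _ CP).
    rewrite vE'; have [->|w0] := eqVneq w^T 0; first by rewrite /form_eval !mulmx0 mxE.
    exact: ltW (Pq _ w0).
  by move=> /(congr1 trmx); rewrite trmxK trmx0 => ->; exact: sub0mx.
have rX : (\rank X <= n)%N.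
  have := mxrank_disjoint_sum XP0; rewrite (rank_inj P Pi) => h.
  by have := rank_leq_row (X + P^T)%MS; rewrite h leq_add2r.
have [Bx [Bi BE _]] := gr_cols (xi zeta).
have BX : (Bx^T <= X)%MS.
  apply/row_subP => i; apply/XP; apply: negT => k; apply: xiq; apply/BE.
  by exists (delta_mx i 0); rewrite -colE tr_row trmxK.
have XB : (X <= Bx^T)%MS.
  have := mxrank_leqif_sup BX => /leqifP; case: ifP => // _.
  by rewrite (rank_inj Bx Bi) ltnNge rX.
have Tmem v : T v -> v \in gr_val (xi zeta).
  move=> Tv; have /XP/submx_trans/(_ XB)/submxP[w wE] : T v^T^T by rewrite trmxK.
  by apply/BE; exists w^T; rewrite -[v]trmxK wE trmx_mul trmxK.
apply/seteqP; split=> l.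
- move=> lE t /= t0 q' v rq' vl.
  have vE : v \in gr_val (xi zeta) by exact: (subvP lE).
  (* The form at time t lies below a positive multiple of the form at the next integer time. *)
  pose k := (Num.truncn t).+1; have tk : 0 < k%:R - t by rewrite subr_gt0 truncnS_gt.
  have [a a0 [_ pa]] := fitting_step Phi_fitting (Phi t s) tk.
  rewrite -(PhiD Phi_fitting) subrK in pa.
  have [b b0 ->] := sb_ray_pos rq'; rewrite form_evalZ pmulr_rle0 //.
  have [b' b'0 qE] := sb_ray_pos (ray k).
  have := xiq k v vE; rewrite /q qE form_evalZ pmulr_rle0 // => h.
  have [->|v0] := eqVneq v 0; first by rewrite /form_eval mulmx0 mxE.
  have := pa v v0; rewrite form_evalB form_evalZ.
  have : a * form_eval (sb_unit (Phi k%:R s)) v v <= 0 by rewrite pmulr_rle0.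
  lra.
(* For this inclusion the conditions at integer times are enough. *)
- move=> lq; apply/subvP => v vl; apply: Tmem; apply: negT => k.
  exact: (lq k%:R (ler0n _ _) _ v (ray k) vl).
Qed.

End LimitMapValue.

(** This serves the case where the cover has at most one point: with A = B = 1 the gap required of
    the identity is exp(-1), and its ratio of singular values is at least 1. *)
Lemma anosov_trivial_group (R : realType) n (G : groupType) (rho : G -> 'M[R]_(n + n)) :
  (0 < n)%N -> rho 1%g = 1%:M -> (forall g : G, g = 1%g) -> anosov rho.
Proof.
move=> n_gt0 rho1 G1.
have gen g : exists k, `[< is_word_for ([::] : seq G) g k >].
  by exists 0%N; apply/asboolP; rewrite (G1 g); exact: is_word_for1.
exists (MkFGS gen), 1, 1; split => // g; rewrite (G1 g) word_length1 mulr0 sub0r rho1.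
pose N : 'M[R]_(n + n, n) := col_mx 1%:M 0.
have Ni (w : 'cV_n) : N *m w = 0 -> w = 0.
  by rewrite mul_col_mx mul0mx mul1mx -col_mx0 => /eq_col_mx[].
have h1 : sigma n.+1 (1%:M : 'M[R]_(n + n)) ^+ 2 <= 1.
  by apply: (sigma_minimax_le n_gt0 Ni) => w; rewrite !mul1mx mul1r.
have h2 : 1 <= sigma n (1%:M : 'M[R]_(n + n)) ^+ 2.
  by apply: (sigma_minimax_ge n_gt0 Ni) => w; rewrite !mul1mx mul1r.
have s0 : 0 < sigma n.+1 (1%:M : 'M[R]_(n + n)) by apply: sigma_gt0 => //; exact: unitmx1.
have [sn _] := sigma_ge0 n_gt0 (1%:M : 'M[R]_(n + n)).
rewrite ler_pdivlMr // (@le_trans _ _ 1) //.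
  have e1 : expR (- 1 : R) <= 1 by rewrite -[X in _ <= X]expR0 ler_expR lerN10.
  have s1 : sigma n.+1 (1%:M : 'M[R]_(n + n)) <= 1.
    by rewrite -(@ler_pXn2r _ 2) ?nnegrE ?(ltW s0) // expr1n.
  by rewrite (le_trans (ler_pM _ _ e1 s1)) ?mulr1 ?expR_ge0 ?(ltW s0).
by rewrite -(@ler_pXn2r _ 2) ?nnegrE // expr1n.
Qed.

Theorem theorem5p4 (R : realType) (n d : nat) (n_gt0 : (0 < n)%N)
    (N Ntilde : topologicalType) (p : Ntilde -> N)
    (N_manifold : closed_connected_manifold R d N)
    (p_cover : universal_cover R p)
    (Gamma : groupType) (act : Gamma -> Ntilde -> Ntilde)
    (Gamma_pi1 : is_deck_group p act)
    (rho : Gamma -> 'M[R]_(n + n)) (rho_SL : SL_representation rho)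
    (u : Ntilde -> Gr R d (n + n) (n + n))
    (u_nn : forall x, pencil_nn (u x))
    (u_continuous : continuous u)
    (u_equivariant : equivariant_pencil_map u act rho)
    (Phi : R -> sphere_bundle u -> sphere_bundle u)
    (Phi_fitting : fitting_flow Phi)
    (Phi_equivariant : equivariant_flow act rho Phi) :
  anosov rho /\
  forall (S : finite_generating_set Gamma)
      (xi : gromov_boundary S -> Gr R n (n + n) 1),
    is_limit_map rho xi ->
    forall (q : sphere_bundle u) (zeta : gromov_boundary S),
      path_limit act (fun t : R => sb_pt (Phi t q)) zeta ->
      proj_subspace (xi zeta) =
        \bigcap_(t in [set t : R | 0 <= t]) nonpos_locus (sb_ray (Phi t q)).
Proof.
have [act_act act_inj _] := Gamma_pi1; have [rho_det rho_mul] := rho_SL.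
have rho_unit g : rho g \in unitmx by rewrite unitmxE rho_det unitr1.
have [[pM _] _] := p_cover.
have trivial_case : (forall x y : Ntilde, x = y) -> anosov rho.
  move=> Nt1; apply: anosov_trivial_group => //; first exact: rho1.
  by move=> g; apply: act_inj; apply/funext => x; exact: Nt1.
case: d N_manifold u u_nn u_continuous u_equivariant Phi Phi_fitting Phi_equivariant =>
  [|d] N_manifold u u_nn u_continuous u_equivariant Phi Phi_fitting Phi_equivariant.
  (* In dimension 0 the pencils are zero, so the sphere bundle is empty, and the path connected
     cover has at most one point. *)
  split; last first.
    move=> S xi _ q; have [q0 [q0u q0n _]] := sb_rayP q; exfalso; move: q0u q0n.
    have /eqP := gr_dim (u (sb_pt q)); rewrite dimv_eq0 => /eqP ->.
    by rewrite memv0 => ->.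
  apply: trivial_case => x y; apply/esym.
  suff loc z : \forall z' \near z, (z' = x <-> z = x).
    exact: (@locally_constant_path R Ntilde pM (fun z => z = x) loc x y erefl).
  have [Q [W [psi [k [oQ Qz oW QP WP]]]]] := chart_at N_manifold p_cover z.
  apply: filterS (open_nbhs_nbhs (conj oQ Qz)) => z' Qz'.
  suff -> : z' = z by [].
  have [_ <- _] := QP z' Qz'; have [_ <- _] := QP z Qz.
  by congr k; apply/matrixP => i [].
have PD := deck_properly_discontinuous N_manifold p_cover Gamma_pi1.
have [K cK Kc] := deck_cocompact N_manifold p_cover Gamma_pi1.
have [[y _]|Nt0] := pselect (exists y : Ntilde, True); last first.
  (* An empty cover carries no q, and its group is trivial because the action is faithful. *)
  split; first by apply: trivial_case => x; exfalso; apply: Nt0; exists x.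
  by move=> S xi _ q; exfalso; apply: Nt0; exists (sb_pt q).
have [y0 Ky0] : exists y0, K y0.
  have : [set: Ntilde] y by [].
  by rewrite -Kc => -[g _ [y0 Ky0 _]]; exists y0.
have hM := cover_hausdorff N_manifold p_cover.
have charts := chart_at N_manifold p_cover.
have proper y1 C := flow_proper n_gt0 act_act rho_unit rho_mul PD u_continuous u_nn u_equivariant
  Phi_fitting Phi_equivariant y1 cK Kc (C := C).
have reach := flow_reaches n_gt0 hM pM charts u_continuous u_nn Phi_fitting proper.
have bound := anosov_bound n_gt0 act_act rho_unit rho_mul PD u_continuous u_nn u_equivariant
  Phi_fitting Phi_equivariant cK Kc Ky0 reach.
split.
  have [S _] := finitely_generated n_gt0 act_act rho_unit rho_mul PD u_continuous u_nn u_equivariant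
    Phi_fitting Phi_equivariant cK Kc Ky0 reach.
  by have [A [B [A0 B0 AB]]] := bound S; exists S, A, B.
move=> S xi xi_lim q zeta; have [A [B [A0 B0 AB]]] := bound S.
exact: (limit_map_value n_gt0 act_act rho_unit rho_mul PD u_continuous u_nn u_equivariant
  Phi_fitting Phi_equivariant A0 AB xi_lim).
Qed.
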